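(* In the work-depth model, given a binary sequence of length $n$ packed into $n/\log n$ words, the rank and select structures for the sequence can be constructed by a parallel algorithm with $O(n/\log n)$ work and $O(\log n)$ depth.
   Context: Model: the work-depth model for parallel algorithms. Work is the total number of operations performed; depth (parallel time) is the length of the longest critical path (chain of dependent operations) in the computation. As in the word RAM, a machine word holds $\Theta(\log n)$ bits, and reading, writing or operating on a word takes unit work. $\log$ is base 2. For a binary sequence $T$ of length $n$, $\mathrm{rank}_c(T,i)$ is the number of occurrences of $c$ in positions $0,\ldots,i$ and $\mathrm{select}_c(T,i)$ is the position of the $i$-th occurrence of $c$. The rank and select structures are auxiliary data structures of $o(n)$ bits that, together with $T$, answer these queries in $O(1)$ work for $c\in\{0,1\}$. Concretely they are the following. Rank structure (Jacobson). Only ranks of $0$ are stored, since ranks of $1$ can be derived from them. $T$ is divided into ranges of $\log^2 n$ bits, and the rank of the last bit of each range is stored. Each range is divided into sub-ranges of $\log n$ bits, and the rank of every $\log n$-th bit relative to the beginning of its range is stored, using $O(\log\log n)$ bits each, packed into words. A lookup table stores the answers to all rank queries on bitstrings of length up to $(\log n)/2$; a query inside a sub-range uses at most two table lookups. Select structure (Clark; uses $O(n/\log\log n)$ extra bits). Described for $1$ bits; the structure for $0$ bits is analogous. The location of every $(\log n\log\log n)$-th $1$ bit is stored; these define ranges. For a range of length $r$: if $r\ge \log^2 n(\log\log n)^2$, the answers to all select queries in the range are stored directly; otherwise the location (relative to the range) of every $(\log r\log\log n)$-th $1$ bit is stored, which defines sub-ranges. For a sub-range of length $r'$: if $r'\ge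 \log r'\log r(\log\log n)^2$, the answers are stored directly relative to the start of the sub-range using $O(\log\log n)$ bits each, packed into words; otherwise queries are answered by a lookup table storing all answers for bitstrings of length $O((\log\log n)^4)$. *)

(* Defs.v *)
From Stdlib Require Import Arith List Bool Lia.
Import ListNotations.

(* Base-2 logarithm, rounded up; at least 1, so that log n and log (log n) are
   usable as block sizes and divisors for every n. *)
Definition lg (x : nat) : nat := Nat.max 1 (Nat.log2_up x).

Definition ceil_div (x y : nat) : nat := (x + y - 1) / y.

(* The work-depth model is a nested-parallel language over a shared memory of
   w-bit words, which are represented by natural numbers below 2 ^ w. *)

Inductive binop : Type :=
| Add | Sub | Mul | Div | Mod | And | Or | Xor | Shl | Shr | Eq | Lt.

Inductive expr : Type :=
| Const (k : nat)
| Reg (x : nat)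
| Bin (o : binop) (e1 e2 : expr).

(* Registers (set by Assign, Read and ParFor) are local to a thread; a program
   uses constantly many of them.  [ParFor x e c] runs c for x = 0, ..., e - 1 in
   parallel, each instance on its own copy of the registers; the copies are
   discarded at the end. *)
Inductive cmd : Type :=
| Skip
| Assign (x : nat) (e : expr)
| Read (x : nat) (addr : expr)
| Write (addr e : expr)
| Seq (c1 c2 : cmd)
| If (e : expr) (c1 c2 : cmd)
| While (e : expr) (c : cmd)
| ParFor (x : nat) (e : expr) (c : cmd).

Definition env := nat -> nat.
Definition mem := nat -> nat.

Definition upd (f : nat -> nat) (x v : nat) : nat -> nat :=
  fun y => if y =? x then v else f y.

(* All operations are modulo 2 ^ w; Eq and Lt return 0 or 1. *)
Definition eval_binop (w : nat) (o : binop) (x y : nat) : nat :=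
  (match o with
   | Add => x + y
   | Sub => x + 2 ^ w - y
   | Mul => x * y
   | Div => x / y
   | Mod => x mod y
   | And => Nat.land x y
   | Or => Nat.lor x y
   | Xor => Nat.lxor x y
   | Shl => Nat.shiftl x y
   | Shr => Nat.shiftr x y
   | Eq => Nat.b2n (x =? y)
   | Lt => Nat.b2n (x <? y)
   end) mod 2 ^ w.

Fixpoint eval (w : nat) (rho : env) (e : expr) : nat :=
  match e with
  | Const k => k mod 2 ^ w
  | Reg x => rho x
  | Bin o e1 e2 => eval_binop w o (eval w rho e1) (eval w rho e2)
  end.

Fixpoint ecost (e : expr) : nat :=
  match e with
  | Const _ | Reg _ => 1
  | Bin _ e1 e2 => S (ecost e1 + ecost e2)
  end.

(* [exec w c rho m rho' m' R W wk dp]: from registers rho and memory m, c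
   terminates in rho' and m', reads exactly the addresses in R and writes
   exactly those in W, with work wk and depth dp.

   Concurrent reads are allowed, but the instances of a parallel loop must be
   race-free: no instance writes an address that another one reads or writes.
   So the outcome does not depend on the scheduling, and the final memory is
   obtained from the private results of the instances.  The work of a parallel
   loop is the sum over its instances (plus 1 for starting each of them), its
   depth is the maximum. *)
Inductive exec (w : nat) :
  cmd -> env -> mem -> env -> mem ->
  (nat -> Prop) -> (nat -> Prop) -> nat -> nat -> Prop :=
| exec_skip : forall rho m,
    exec w Skip rho m rho m (fun _ => False) (fun _ => False) 1 1
| exec_assign : forall x e rho m,
    exec w (Assign x e) rho m (upd rho x (eval w rho e)) m
      (fun _ => False) (fun _ => False) (S (ecost e)) (S (ecost e))
| exec_read : forall x e rho m,
    exec w (Read x e) rho m (upd rho x (m (eval w rho e))) m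
      (fun a => a = eval w rho e) (fun _ => False) (S (ecost e)) (S (ecost e))
| exec_write : forall e1 e2 rho m,
    exec w (Write e1 e2) rho m rho (upd m (eval w rho e1) (eval w rho e2))
      (fun _ => False) (fun a => a = eval w rho e1)
      (S (ecost e1 + ecost e2)) (S (ecost e1 + ecost e2))
| exec_seq : forall c1 c2 rho m rho1 m1 rho2 m2 R1 W1 R2 W2 wk1 wk2 dp1 dp2,
    exec w c1 rho m rho1 m1 R1 W1 wk1 dp1 ->
    exec w c2 rho1 m1 rho2 m2 R2 W2 wk2 dp2 ->
    exec w (Seq c1 c2) rho m rho2 m2
      (fun a => R1 a \/ R2 a) (fun a => W1 a \/ W2 a) (wk1 + wk2) (dp1 + dp2)
| exec_if : forall e c1 c2 rho m rho' m' R W wk dp,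
    exec w (if eval w rho e =? 0 then c2 else c1) rho m rho' m' R W wk dp ->
    exec w (If e c1 c2) rho m rho' m' R W (S (ecost e) + wk) (S (ecost e) + dp)
| exec_while_false : forall e c rho m,
    eval w rho e = 0 ->
    exec w (While e c) rho m rho m
      (fun _ => False) (fun _ => False) (S (ecost e)) (S (ecost e))
| exec_while_true :
    forall e c rho m rho1 m1 rho2 m2 R1 W1 R2 W2 wk1 wk2 dp1 dp2,
    eval w rho e <> 0 ->
    exec w c rho m rho1 m1 R1 W1 wk1 dp1 ->
    exec w (While e c) rho1 m1 rho2 m2 R2 W2 wk2 dp2 ->
    exec w (While e c) rho m rho2 m2
      (fun a => R1 a \/ R2 a) (fun a => W1 a \/ W2 a)
      (S (ecost e) + wk1 + wk2) (S (ecost e) + dp1 + dp2)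
| exec_parfor : forall x e c rho m m' k
    (rhos : nat -> env) (ms : nat -> mem) (Rs Ws : nat -> nat -> Prop)
    (wks dps : nat -> nat),
    k = eval w rho e ->
    (forall i, i < k ->
       exec w c (upd rho x i) m (rhos i) (ms i) (Rs i) (Ws i) (wks i) (dps i)) ->
    (forall i j a, i < k -> j < k -> i <> j -> Ws i a ->
       ~ Rs j a /\ ~ Ws j a) ->
    (forall i a, i < k -> Ws i a -> m' a = ms i a) ->
    (forall a, (forall i, i < k -> ~ Ws i a) -> m' a = m a) ->
    exec w (ParFor x e c) rho m rho m'
      (fun a => exists i, i < k /\ Rs i a) (fun a => exists i, i < k /\ Ws i a)
      (S (ecost e) + list_sum (map (fun i => S (wks i)) (seq 0 k)))
      (S (ecost e) + list_max (map (fun i => S (dps i)) (seq 0 k))).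

Definition runs (w : nat) (c : cmd) (rho : env) (m : mem)
  (rho' : env) (m' : mem) (work depth : nat) : Prop :=
  exists R W, exec w c rho m rho' m' R W work depth.

Definition count (c : bool) (T : list bool) : nat := count_occ bool_dec T c.

Definition rank (c : bool) (T : list bool) (i : nat) : nat :=
  count c (firstn (S i) T).

Definition occurrences (c : bool) (T : list bool) : list nat :=
  filter (fun p => eqb (nth p T (negb c)) c) (seq 0 (length T)).

(* Occurrences are numbered from 1; the value is [length T] when there is no
   i-th occurrence. *)
Definition select (c : bool) (T : list bool) (i : nat) : nat :=
  nth (i - 1) (occurrences c T) (length T).

(* The first bit of a bitstring is the least significant one. *)
Fixpoint bits_val (s : list bool) : nat :=
  match s with
  | [] => 0
  | b :: s' => Nat.b2n b + 2 * bits_val s'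
  end.

(* T packed into ceil (n / log n) words, from address 0. *)
Definition packed_input (m : mem) (T : list bool) : Prop :=
  let L := lg (length T) in
  forall k, k * L < length T -> m k = bits_val (firstn L (skipn (k * L) T)).

(* The words from address a on are read as one stream of bits, L bits per word;
   the b bits of this stream from offset o on hold the number v. *)
Definition field (m : mem) (L a o b v : nat) : Prop :=
  v < 2 ^ b /\
  forall i, i < b ->
    Nat.testbit (m (a + (o + i) / L)) ((o + i) mod L) = Nat.testbit v i.

(* Jacobson's structure: [ranges] and [table] are arrays of words, [subranges]
   is a bit stream.  A range consists of L sub-ranges of L bits.  A table entry
   is indexed by the value of the bitstring, so that one array indexed by the
   2 ^ h values serves all the lengths up to h. *)
Definition rank_structure (m : mem) (T : list bool)
  (ranges subranges table : nat) : Prop :=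
  let n := length T in
  let L := lg n in
  let LL := lg L in
  let h := ceil_div L 2 in
  (forall k, k * L ^ 2 < n ->
     m (ranges + k) = rank false T (Nat.min (S k * L ^ 2) n - 1)) /\
  (forall j, j * L < n ->
     let start := j / L * L ^ 2 in
     field m L subranges (j * (2 * LL + 1)) (2 * LL + 1)
       (rank false (skipn start T) (Nat.min (S j * L) n - 1 - start))) /\
  (forall s i, length s <= h -> i < length s ->
     m (table + bits_val s * h + i) = rank false s i).

(* Clark's structure for the bits equal to c.  Range k is responsible for the
   occurrences k * g, ..., (k + 1) * g - 1, where g = log n loglog n, and goes
   from [bnd (k * g)] to [bnd ((k + 1) * g)]; likewise for its sub-ranges, which
   are numbered by j.  The first range starts at position 0 and the last one ends
   at n.

   - [locations]: array of words, the boundaries of the ranges.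
   - [answers]: array of words.  The answers for a long range starting at p are
     at index ceil (p / (log n loglog n)).  There are log n loglog n of them
     and the range has at least (log n loglog n)^2 bits, so distinct ranges do
     not overlap and no pointers or allocation are needed.
   - [sublocations]: bit stream, two words for every range, log r bits for every
     sub-range (there are at most ceil (log n / log r) of them in a range).
   - [subanswers]: bit stream.  The answers for a long sub-range starting at p
     are at offset ceil (p / loglog n), with log r' bits each.  They take at
     most log r loglog n log r' <= r' / loglog n bits: again no overlap.
   - [table]: array of words, indexed as in [rank_structure].  Since
     log r' <= log r <= 4 loglog n in a short range, a short sub-range has
     fewer than 16 (loglog n)^4 bits. *)
Definition select_structure (c : bool) (m : mem) (T : list bool)
  (locations answers sublocations subanswers table : nat) : Prop :=
  let n := length T in
  let L := lg n in
  let LL := lg L in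
  let N := count c T in
  let g := L * LL in
  let bnd := fun i => if i =? 0 then 0 else select c T i in
  let l := 16 * LL ^ 4 in
  (forall k, k <= S (N / g) -> m (locations + k) = bnd (k * g)) /\
  (forall k, k <= N / g ->
     let p := bnd (k * g) in
     let r := bnd (S k * g) - p in
     (L ^ 2 * LL ^ 2 <= r ->
      forall i, k * g <= i < S k * g -> 1 <= i <= N ->
        m (answers + ceil_div p (L * LL) + (i - k * g)) = select c T i) /\
     (r < L ^ 2 * LL ^ 2 ->
      let g' := lg r * LL in
      forall j,
      let first := k * g + j * g' in
      let next := Nat.min (first + g') (S k * g) in
      let p' := bnd first in
      let r' := bnd next - p' in
      j * g' < g -> first <= N ->
      field m L sublocations (2 * k * L + j * lg r) (lg r) (p' - p) /\
      (lg r' * lg r * LL ^ 2 <= r' ->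
       forall i, first <= i < next -> 1 <= i <= N ->
         field m L subanswers (ceil_div p' LL + (i - first) * lg r') (lg r')
           (select c T i - p')))) /\
  (forall s i, length s <= l -> 1 <= i <= count c s ->
     m (table + bits_val s * l + (i - 1)) = select c s i).

(* Main.v *)
(** A chunk of [(log n) / 2] bits is an index into universal tables of [sqrt n
    * polylog n] entries, so it is processed in constant work, and there are
    [O(n / log n)] chunks. A parallel prefix sum of the numbers of occurrences
    gives the rank at every chunk boundary. The chunk in which the occurrence
    number [k * log n loglog n] lies finds it by a table and writes it down as
    the boundary of range [k], and the chunks that meet a long range write the
    answers for it.

    The bit streams of the structure are harder, since a word collects data
    from several chunks, which may not write it concurrently. Such a word is
    written as a sum, over the occurrences [i], of a weight [v_i * 2 ^ (o_i)],
    where [v_i] is the entry for [i] and [o_i] its offset. The fields are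
    disjoint, so the sum is the concatenation, and it is the difference of two
    prefix sums of the weights. The weights of the occurrences in a chunk are
    again summed with a constant number of table lookups, because a chunk
    meets at most two ranges, and of the sub-ranges of a range that it meets,
    all but the first and the last lie inside it. A machine word of [c0 * log
    n] bits, for a large constant [c0], holds these sums. *)

From Stdlib Require Import Arith List Bool Lia PeanoNat FunctionalExtensionality IndefiniteDescription ClassicalDescription FinFun.
Require Import Defs.
Import ListNotations.

(** * Expressions *)

(** Two obligations of [exec] shape the development: absence of races and an exact account of work.
    Both are settled for a single kind of parallel loop, the [phase]. It reads only below an
    address, evaluates expressions that write nothing, and writes through an injective address map
    into cells above that address. Injectivity excludes races, and by counting it also bounds the
    number of items written by the size of the target, which is the work bound for loops whose
    instances have unequal lengths. All regions have [MM n] words and fixed places, so no allocation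
    has to be computed.

    The answers of one sub-range take up to [16 * LL n ^ 3] bits. This can exceed [lg n] for small
    [n], but only by a constant factor. So the answers are grouped by the word in which they begin,
    and a word of the stream is the OR of a constant number of shifted groups.

    The constant [K0] makes [MM n = 2 ^ (K0 * lg n)] larger than every record, table and index. A
    word holds a product of eight such numbers, so crude bounds exclude overflow everywhere. *)

Ltac splits := repeat match goal with |- _ /\ _ => split end.

Definition rLIM := 9.
Definition rBND := 10.
(** Registers below [G] hold parameters. Those from [G] on form the evaluation stack, whose entries
    [G] and [G + 2] carry the two loop indices of [scatter]. *)
Definition G := 16.

(* Expressions with loads and bounded loops, evaluated without writing to memory.
   A load from an address not below register [rLIM] yields 0, and a loop [PFor]
   runs for the number of rounds held in register [rBND], whatever its inputs are.
   So the absence of races and the cost of a program follow from its syntax and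
   from these two registers, also for iterations whose value is irrelevant. *)
Inductive px : Type :=
| PK (k : nat)
| PV (x : nat)
| PB (o : binop) (a b : px)
| PL (a : px)
| PLet (a b : px)
| PIf (c a b : px)
| PFor (a b : px).

Fixpoint iter_up (k : nat) (f : nat -> nat -> nat) (v : nat) : nat :=
  match k with 0 => v | S k' => f k' (iter_up k' f v) end.

(** [d] is the height of the register stack. Intermediate results occupy the same registers as in
    [comp], so that a later subexpression sees them in the denotation as it does in the code. *)
Fixpoint pe (w : nat) (m : mem) (lim bnd : nat) (rho : env) (d : nat) (e : px) : nat :=
  match e with
  | PK k => k mod 2 ^ w
  | PV x => rho x
  | PB o a b =>
      let va := pe w m lim bnd rho d a in
      eval_binop w o va (pe w m lim bnd (upd rho d va) (S d) b)
  | PL a =>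
      let va := pe w m lim bnd rho d a in
      if va <? lim then m va else 0
  | PLet a b => pe w m lim bnd (upd rho d (pe w m lim bnd rho d a)) (S d) b
  | PIf c a b =>
      if pe w m lim bnd rho d c =? 0 then pe w m lim bnd rho d b
      else pe w m lim bnd rho d a
  | PFor a b =>
      iter_up bnd
        (fun i acc => pe w m lim bnd (upd (upd rho d acc) (S d) i) (S (S d)) b)
        (pe w m lim bnd rho d a)
  end.

(** Stack discipline: the value ends up in register [d], registers below [d] survive, and those
    above [d] are scratch. *)
Fixpoint comp (d : nat) (e : px) : cmd :=
  match e with
  | PK k => Assign d (Const k)
  | PV x => Assign d (Reg x)
  | PB o a b =>
      Seq (comp d a) (Seq (comp (S d) b) (Assign d (Bin o (Reg d) (Reg (S d)))))
  | PL a =>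
      Seq (comp d a)
        (If (Bin Lt (Reg d) (Reg rLIM)) (Read d (Reg d)) (Assign d (Const 0)))
  | PLet a b => Seq (comp d a) (Seq (comp (S d) b) (Assign d (Reg (S d))))
  | PIf c a b => Seq (comp d c) (If (Reg d) (comp d a) (comp d b))
  | PFor a b =>
      Seq (comp d a) (Seq (Assign (S d) (Const 0))
        (While (Bin Lt (Reg (S d)) (Reg rBND))
          (Seq (comp (S (S d)) b)
            (Seq (Assign d (Reg (S (S d))))
              (Assign (S d) (Bin Add (Reg (S d)) (Const 1)))))))
  end.

Fixpoint wf (d : nat) (e : px) : bool :=
  match e with
  | PK _ => true
  | PV x => x <? d
  | PB _ a b => wf d a && wf (S d) b
  | PL a => wf d a
  | PLet a b => wf d a && wf (S d) b
  | PIf c a b => wf d c && (wf d a && wf d b)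
  | PFor a b => wf d a && wf (S (S d)) b
  end.

(** Depends only on the syntax and the number [B] of rounds; both branches of a conditional are
    charged. *)
Fixpoint pcost (B : nat) (e : px) : nat :=
  match e with
  | PK _ | PV _ => 2
  | PB _ a b => pcost B a + pcost B b + 4
  | PL a => pcost B a + 6
  | PLet a b => pcost B a + pcost B b + 2
  | PIf c a b => pcost B c + 2 + pcost B a + pcost B b
  | PFor a b => pcost B a + 2 + (B + 1) * 4 + B * (pcost B b + 6)
  end.

Fixpoint loop_free (e : px) : bool :=
  match e with
  | PK _ | PV _ => true
  | PB _ a b | PLet a b => loop_free a && loop_free b
  | PL a => loop_free a
  | PIf c a b => loop_free c && (loop_free a && loop_free b)
  | PFor _ _ => false
  end.

(** Excludes loops inside loop bodies, so that the cost is linear in the number of rounds. *)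
Fixpoint flat (e : px) : bool :=
  match e with
  | PK _ | PV _ => true
  | PB _ a b | PLet a b => flat a && flat b
  | PL a => flat a
  | PIf c a b => flat c && (flat a && flat b)
  | PFor a b => flat a && loop_free b
  end.

Lemma pcost_loop_free (B : nat) (e : px) : loop_free e = true -> pcost B e = pcost 0 e.
Proof.
  induction e; simpl; rewrite ?andb_true_iff; intros H; try discriminate; intuition lia.
Qed.

Lemma pcost_flat (B : nat) (e : px) : flat e = true -> pcost B e <= (B + 1) * pcost 1 e.
Proof.
  induction e; simpl; rewrite ?andb_true_iff; intros H; try lia.
  - destruct H as [H1 H2]; specialize (IHe1 H1); specialize (IHe2 H2); nia.
  - specialize (IHe H); nia.
  - destruct H as [H1 H2]; specialize (IHe1 H1); specialize (IHe2 H2); nia.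
  - destruct H as [H1 [H2 H3]]; specialize (IHe1 H1); specialize (IHe2 H2); specialize (IHe3 H3). nia.
  - destruct H as [H1 H2]; specialize (IHe1 H1).
    rewrite (pcost_loop_free B _ H2), (pcost_loop_free 1 _ H2). nia.
Qed.

(** * Correctness and cost of compiled expressions *)

Lemma upd_same (f : env) x v : upd f x v x = v.
Proof. unfold upd; now rewrite Nat.eqb_refl. Qed.

Lemma upd_other (f : env) x v y : y <> x -> upd f x v y = f y.
Proof. intros H; unfold upd; now rewrite (proj2 (Nat.eqb_neq y x) H). Qed.

Lemma iter_up_ext (k : nat) f g v :
  (forall i acc, i < k -> f i acc = g i acc) -> iter_up k f v = iter_up k g v.
Proof.
  induction k; simpl; intros H; auto. rewrite IHk by auto. apply H; lia.
Qed.

Lemma pe_agree (w : nat) (m : mem) (lim bnd : nat) (e : px) : forall d rho rho',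
  wf d e = true -> (forall i, i < d -> rho i = rho' i) ->
  pe w m lim bnd rho d e = pe w m lim bnd rho' d e.
Proof.
  assert (U : forall (rho rho' : env) d v, (forall i, i < d -> rho i = rho' i) ->
    forall i, i < S d -> upd rho d v i = upd rho' d v i).
  { intros rho rho' d v H i Hi. unfold upd. destruct (i =? d) eqn:E; auto.
    apply Nat.eqb_neq in E. apply H. lia. }
  induction e; cbn [wf pe]; intros d rho rho' H HA; rewrite ?andb_true_iff in H; auto.
  - apply HA. now apply Nat.ltb_lt.
  - destruct H. rewrite (IHe1 d rho rho'); auto.
  - rewrite (IHe d rho rho'); auto.
  - destruct H. rewrite (IHe1 d rho rho'); auto.
  - destruct H as [? [? ?]].
    rewrite (IHe1 d rho rho'), (IHe2 d rho rho'), (IHe3 d rho rho'); auto.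
  - destruct H. rewrite (IHe1 d rho rho'); auto. apply iter_up_ext.
    intros. apply IHe2; auto.
Qed.

(** Without a parallel loop work and depth coincide, so one number [k] stands for both. *)
Definition pure (w : nat) (c : cmd) (rho : env) (m : mem) (rho' : env) (lim k : nat) : Prop :=
  exists R W, exec w c rho m rho' m R W k k /\ (forall a, R a -> a < lim) /\ (forall a, ~ W a).

Lemma pure_seq w c1 c2 rho m rho1 rho2 lim k1 k2 :
  pure w c1 rho m rho1 lim k1 -> pure w c2 rho1 m rho2 lim k2 ->
  pure w (Seq c1 c2) rho m rho2 lim (k1 + k2).
Proof.
  intros (R1 & W1 & E1 & HR1 & HW1) (R2 & W2 & E2 & HR2 & HW2).
  do 2 eexists; split; [econstructor; eassumption|]. firstorder.
Qed.

Lemma pure_assign w x e rho m lim :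
  pure w (Assign x e) rho m (upd rho x (eval w rho e)) lim (S (ecost e)).
Proof. do 2 eexists; split; [constructor|]. firstorder. Qed.

Lemma pure_read w x e rho m lim : eval w rho e < lim ->
  pure w (Read x e) rho m (upd rho x (m (eval w rho e))) lim (S (ecost e)).
Proof. intros; do 2 eexists; split; [constructor|]. split; firstorder. congruence. Qed.

Lemma pure_if w e c1 c2 rho m rho' lim k :
  pure w (if eval w rho e =? 0 then c2 else c1) rho m rho' lim k ->
  pure w (If e c1 c2) rho m rho' lim (S (ecost e) + k).
Proof.
  intros (R & W & E & H1 & H2). do 2 eexists; split; [constructor; eassumption|]. auto.
Qed.

Lemma pure_while_false w e c rho m lim : eval w rho e = 0 ->
  pure w (While e c) rho m rho lim (S (ecost e)).
Proof. intros; do 2 eexists; split; [now constructor|]. firstorder. Qed.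

Lemma pure_while_true w e c rho m rho1 rho2 lim k1 k2 : eval w rho e <> 0 ->
  pure w c rho m rho1 lim k1 -> pure w (While e c) rho1 m rho2 lim k2 ->
  pure w (While e c) rho m rho2 lim (S (ecost e) + k1 + k2).
Proof.
  intros H (R1 & W1 & E1 & HR1 & HW1) (R2 & W2 & E2 & HR2 & HW2).
  do 2 eexists; split; [eapply exec_while_true; eassumption|]. firstorder.
Qed.

Lemma pow2_pos w : 1 <= 2 ^ w.
Proof. pose proof (Nat.pow_nonzero 2 w). lia. Qed.

Lemma pow2_ge2 w : 1 <= w -> 2 <= 2 ^ w.
Proof. intros. change 2 with (2 ^ 1) at 1. apply Nat.pow_le_mono_r; lia. Qed.

Lemma b2n_mod w b : 1 <= w -> Nat.b2n b mod 2 ^ w = Nat.b2n b.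
Proof. intros. apply Nat.mod_small. pose proof (pow2_ge2 w). destruct b; simpl; lia. Qed.

Lemma comp_ok w m (Hw : 1 <= w) (e : px) : forall d rho,
  rLIM < d -> rBND < d -> wf d e = true -> rho rBND < 2 ^ w ->
  exists rho' k, pure w (comp d e) rho m rho' (rho rLIM) k /\
    rho' d = pe w m (rho rLIM) (rho rBND) rho d e /\
    (forall i, i < d -> rho' i = rho i) /\
    k <= pcost (rho rBND) e.
Proof.
  assert (P2 := pow2_ge2 w Hw).
  induction e; intros d rho HL HB Hwf Hb; cbn [comp wf] in *; rewrite ?andb_true_iff in Hwf.
  - do 2 eexists; split; [apply pure_assign|]. split; [apply upd_same|].
    split; [intros; apply upd_other; lia|]. simpl; lia.
  - do 2 eexists; split; [apply pure_assign|]. split; [apply upd_same|].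
    split; [intros; apply upd_other; lia|]. simpl; lia.
  - destruct Hwf as [W1 W2].
    destruct (IHe1 d rho HL HB W1 Hb) as (r1 & k1 & E1 & V1 & A1 & C1).
    destruct (IHe2 (S d) r1) as (r2 & k2 & E2 & V2 & A2 & C2); try lia; auto.
    { rewrite A1; auto. }
    assert (QL : r1 rLIM = rho rLIM) by (apply A1; assumption).
    assert (QB : r1 rBND = rho rBND) by (apply A1; assumption).
    rewrite QL in *; rewrite QB in *.
    do 2 eexists; split; [eapply pure_seq; [exact E1|]; eapply pure_seq; [exact E2|apply pure_assign]|].
    split; [|split].
    + rewrite upd_same. simpl. rewrite V2, A2, V1 by lia. f_equal.
      apply pe_agree; auto. intros i Hi. unfold upd. destruct (Nat.eqb_spec i d); [congruence|].
      apply A1. lia.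
    + intros. rewrite upd_other, A2, A1; lia.
    + simpl. lia.
  - destruct (IHe d rho HL HB Hwf Hb) as (r1 & k1 & E1 & V1 & A1 & C1).
    assert (Q : exists r2, pure w (If (Bin Lt (Reg d) (Reg rLIM)) (Read d (Reg d)) (Assign d (Const 0)))
              r1 m r2 (rho rLIM) 6 /\
       r2 d = pe w m (rho rLIM) (rho rBND) rho d (PL e) /\ (forall i, i < d -> r2 i = r1 i)).
    { cbn [pe]. rewrite <- V1. destruct (Nat.ltb_spec (r1 d) (rho rLIM)).
      - eexists. split.
        + change 6 with (S (ecost (Bin Lt (Reg d) (Reg rLIM))) + 2). apply pure_if.
          cbn [eval]; unfold eval_binop. rewrite (A1 rLIM), (proj2 (Nat.ltb_lt _ _) H) by auto. cbn [Nat.b2n].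
          rewrite (Nat.mod_small 1) by lia. apply (pure_read w d (Reg d)). simpl; auto.
        + split; [apply upd_same|]. intros; apply upd_other; lia.
      - eexists. split.
        + change 6 with (S (ecost (Bin Lt (Reg d) (Reg rLIM))) + 2). apply pure_if.
          cbn [eval]; unfold eval_binop. rewrite (A1 rLIM), (proj2 (Nat.ltb_ge _ _) H) by auto. cbn [Nat.b2n].
          rewrite (Nat.mod_small 0) by lia. apply pure_assign.
        + split; [rewrite upd_same; simpl; apply Nat.mod_small; lia|]. intros; apply upd_other; lia. }
    destruct Q as (r2 & E2 & V2 & A2).
    do 2 eexists; split; [eapply pure_seq; [exact E1|exact E2]|].
    split; auto. split; [intros; rewrite A2, A1; auto|]. simpl; lia.
  - destruct Hwf as [W1 W2].
    destruct (IHe1 d rho HL HB W1 Hb) as (r1 & k1 & E1 & V1 & A1 & C1).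
    destruct (IHe2 (S d) r1) as (r2 & k2 & E2 & V2 & A2 & C2); try lia; auto.
    { rewrite A1; auto. }
    assert (QL : r1 rLIM = rho rLIM) by (apply A1; assumption).
    assert (QB : r1 rBND = rho rBND) by (apply A1; assumption).
    rewrite QL in *; rewrite QB in *.
    do 2 eexists; split; [eapply pure_seq; [exact E1|]; eapply pure_seq; [exact E2|apply pure_assign]|].
    split; [|split].
    + rewrite upd_same. simpl. rewrite V2.
      apply pe_agree; auto. intros i Hi. unfold upd. destruct (Nat.eqb_spec i d); [congruence|].
      apply A1. lia.
    + intros. rewrite upd_other, A2, A1; lia.
    + simpl. lia.
  - destruct Hwf as [W1 [W2 W3]].
    destruct (IHe1 d rho HL HB W1 Hb) as (r1 & k1 & E1 & V1 & A1 & C1).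
    assert (AG : forall i, i < d -> r1 i = rho i) by auto.
    destruct (IHe2 d r1) as (r2 & k2 & E2 & V2 & A2 & C2); try lia; auto.
    { rewrite A1; auto. }
    destruct (IHe3 d r1) as (r3 & k3 & E3 & V3 & A3 & C3); try lia; auto.
    { rewrite A1; auto. }
    assert (QL : r1 rLIM = rho rLIM) by (apply A1; assumption).
    assert (QB : r1 rBND = rho rBND) by (apply A1; assumption).
    rewrite QL in *; rewrite QB in *.
    rewrite (pe_agree w m _ _ _ d r1 rho W2 AG) in V2.
    rewrite (pe_agree w m _ _ _ d r1 rho W3 AG) in V3.
    destruct (Nat.eqb_spec (r1 d) 0) as [Z|Z].
    + exists r3. eexists. split.
      * eapply pure_seq; [exact E1|]. apply pure_if. simpl. rewrite (proj2 (Nat.eqb_eq _ _) Z). exact E3.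
      * split; [|split].
        -- simpl. rewrite <- V1, (proj2 (Nat.eqb_eq _ _) Z). exact V3.
        -- intros; rewrite A3, A1; auto.
        -- simpl. lia.
    + exists r2. eexists. split.
      * eapply pure_seq; [exact E1|]. apply pure_if. simpl. rewrite (proj2 (Nat.eqb_neq _ _) Z). exact E2.
      * split; [|split].
        -- simpl. rewrite <- V1, (proj2 (Nat.eqb_neq _ _) Z). exact V2.
        -- intros; rewrite A2, A1; auto.
        -- simpl. lia.
  - destruct Hwf as [W1 W2].
    destruct (IHe1 d rho HL HB W1 Hb) as (r1 & k1 & E1 & V1 & A1 & C1).
    set (lim := rho rLIM) in *. set (bnd := rho rBND) in *.
    set (f := fun i acc => pe w m lim bnd (upd (upd rho d acc) (S d) i) (S (S d)) e2).
    set (body := Seq (comp (S (S d)) e2) (Seq (Assign d (Reg (S (S d))))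
                  (Assign (S d) (Bin Add (Reg (S d)) (Const 1))))).
    (* Loop invariant, by induction on the number [j] of rounds left: register [d] holds the
       accumulator after [i] rounds and register [S d] holds [i]. *)
    assert (LP : forall j i r, i + j = bnd -> r (S d) = i ->
              r d = iter_up i f (pe w m lim bnd rho d e1) -> (forall x, x < d -> r x = rho x) ->
              exists r' k, pure w (While (Bin Lt (Reg (S d)) (Reg rBND)) body) r m r' lim k /\
                r' d = iter_up bnd f (pe w m lim bnd rho d e1) /\
                (forall x, x < d -> r' x = rho x) /\ k <= 4 + j * (4 + (pcost bnd e2 + 6))).
    { induction j; intros i r Hij Hi Hd Hr.
      - assert (Hib : i = bnd) by lia. rewrite Hib in Hi, Hd. exists r, 4. splits; auto; try lia.
        apply (pure_while_false w (Bin Lt (Reg (S d)) (Reg rBND))). cbn [eval]; unfold eval_binop.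
        rewrite Hi, (Hr rBND HB). fold bnd. rewrite Nat.ltb_irrefl. apply Nat.mod_small; simpl; lia.
      - destruct (IHe2 (S (S d)) r) as (r2 & k2 & E2 & V2 & A2 & C2); try lia; auto.
        { rewrite Hr; auto. }
        assert (QL : r rLIM = rho rLIM) by (apply Hr; assumption).
        assert (QB : r rBND = rho rBND) by (apply Hr; assumption).
        rewrite QL in *; rewrite QB in *. fold lim in E2, V2. fold bnd in V2, C2.
        assert (V2' : r2 (S (S d)) = f i (iter_up i f (pe w m lim bnd rho d e1))).
        { rewrite V2. unfold f at 1. apply pe_agree; auto. intros x Hx. unfold upd.
          destruct (Nat.eqb_spec x (S d)); [congruence|]. destruct (Nat.eqb_spec x d); [congruence|].
          apply Hr. lia. }
        destruct (IHj (S i) (upd (upd r2 d (eval w r2 (Reg (S (S d))))) (S d)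
           (eval w (upd r2 d (eval w r2 (Reg (S (S d))))) (Bin Add (Reg (S d)) (Const 1)))))
          as (r3 & k3 & E3 & V3 & A3 & C3).
        + lia.
        + rewrite upd_same. cbn [eval]; unfold eval_binop. rewrite upd_other, A2, Hi by lia.
          rewrite (Nat.mod_small 1) by lia. rewrite Nat.mod_small; lia.
        + rewrite upd_other, upd_same by lia. simpl. rewrite V2'. reflexivity.
        + intros x Hx. rewrite upd_other, upd_other, A2 by lia. auto.
        + do 2 eexists. split.
          * eapply pure_while_true.
            -- cbn [eval]; unfold eval_binop. rewrite Hi, (Hr rBND) by auto. fold bnd.
               rewrite (proj2 (Nat.ltb_lt i bnd)) by lia.
               cbn [Nat.b2n]. rewrite Nat.mod_small; lia.
            -- unfold body. eapply pure_seq; [exact E2|]. eapply pure_seq; apply pure_assign.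
            -- exact E3.
          * splits; [exact V3|exact A3|]. simpl. lia. }
    destruct (LP bnd 0 (upd r1 (S d) 0)) as (r2 & k2 & E2 & V2 & A2 & C2); auto.
    { apply upd_same. }
    { rewrite upd_other by lia. exact V1. }
    { intros. rewrite upd_other by lia. auto. }
    do 2 eexists. split.
    + eapply pure_seq; [exact E1|]. eapply pure_seq; [|exact E2].
      assert (Z : eval w r1 (Const 0) = 0) by (apply Nat.mod_small; lia).
      rewrite <- Z at 2. apply pure_assign.
    + splits; [exact V2|exact A2|]. simpl. fold bnd. lia.
Qed.

(** * Race-free parallel loops *)

Fixpoint psum (f : nat -> nat) (n : nat) : nat :=
  match n with 0 => 0 | S k => psum f k + f k end.

Lemma psum_ext f g n : (forall i, i < n -> f i = g i) -> psum f n = psum g n.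
Proof. induction n; simpl; auto. intros H. rewrite IHn, H; auto. Qed.

Lemma psum_le f g n : (forall i, i < n -> f i <= g i) -> psum f n <= psum g n.
Proof.
  induction n; simpl; auto. intros H. specialize (IHn (fun i Hi => H i (Nat.lt_lt_succ_r _ _ Hi))).
  specialize (H n (Nat.lt_succ_diag_r n)). lia.
Qed.

Lemma psum_const c n : psum (fun _ => c) n = n * c.
Proof. induction n; simpl; lia. Qed.

Lemma psum_add f g n : psum (fun i => f i + g i) n = psum f n + psum g n.
Proof. induction n; simpl; lia. Qed.

Lemma psum_mul c f n : psum (fun i => c * f i) n = c * psum f n.
Proof. induction n; simpl; lia. Qed.

Lemma list_sum_seq f n : list_sum (map f (seq 0 n)) = psum f n.
Proof.
  induction n; auto. rewrite seq_S, map_app, list_sum_app, IHn. simpl. lia.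
Qed.

Lemma list_max_seq f n b : (forall i, i < n -> f i <= b) -> list_max (map f (seq 0 n)) <= b.
Proof.
  intros H. apply list_max_le, Forall_forall. intros x Hx.
  apply in_map_iff in Hx. destruct Hx as (i & <- & Hi). apply in_seq in Hi. apply H; lia.
Qed.

(** [exec_parfor] wants the outcomes of the instances as functions of the index, whereas each
    instance is only known to have some outcome. *)
Lemma bounded_choice {A} (P : nat -> A -> Prop) (k : nat) (a0 : A) :
  (forall i, i < k -> exists a, P i a) -> exists f, forall i, i < k -> P i (f i).
Proof.
  intros H. destruct (functional_choice (fun i a => i < k -> P i a)) as [f Hf].
  - intros i. destruct (lt_dec i k) as [L|L].
    + destruct (H i L) as [a Ha]. exists a; auto.
    + exists a0. intros; lia.
  - exists f. intros; auto.
Qed.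

Definition preserves (b : nat) (rho rho' : env) : Prop := forall i, i < b -> rho' i = rho i.

(** Reads stay below [lim] and writes do not, so no instance reads what another one writes; of race
    freedom only the disjointness of the write sets remains to be checked. *)
Lemma parfor_ok w x e c rho m m' lim k (Ws : nat -> nat -> Prop) (wb : nat -> nat) (db : nat) :
  eval w rho e = k ->
  (forall i, i < k -> exists rho' mi R W wk dp,
     exec w c (upd rho x i) m rho' mi R W wk dp /\ (forall a, R a -> a < lim) /\
     (forall a, W a <-> Ws i a) /\ (forall a, Ws i a -> mi a = m' a) /\ wk <= wb i /\ dp <= db) ->
  (forall i a, i < k -> Ws i a -> lim <= a) ->
  (forall i j a, i < k -> j < k -> i <> j -> Ws i a -> ~ Ws j a) ->
  (forall a, (forall i, i < k -> ~ Ws i a) -> m' a = m a) ->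
  exists R W wk dp, exec w (ParFor x e c) rho m rho m' R W wk dp /\
    (forall a, R a -> a < lim) /\ (forall a, W a <-> exists i, i < k /\ Ws i a) /\
    wk <= S (ecost e) + k + psum wb k /\ dp <= S (ecost e) + S db.
Proof.
  intros Hk HI HL HD HF.
  destruct (bounded_choice (fun i (z : env * mem * (nat -> Prop) * (nat -> Prop) * nat * nat) =>
    let '(rho', mi, R, W, wk, dp) := z in
    exec w c (upd rho x i) m rho' mi R W wk dp /\ (forall a, R a -> a < lim) /\
     (forall a, W a <-> Ws i a) /\ (forall a, Ws i a -> mi a = m' a) /\ wk <= wb i /\ dp <= db) k
     (rho, m, fun _ => True, fun _ => True, 0, 0)) as [f Hf].
  { intros i Hi. destruct (HI i Hi) as (rho' & mi & R & W & wk & dp & H).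
    exists (rho', mi, R, W, wk, dp). exact H. }
  set (f1 := fun i => let '(rho', mi, R, W, wk, dp) := f i in rho').
  set (f2 := fun i => let '(rho', mi, R, W, wk, dp) := f i in mi).
  set (f3 := fun i => let '(rho', mi, R, W, wk, dp) := f i in R).
  set (f4 := fun i => let '(rho', mi, R, W, wk, dp) := f i in W).
  set (f5 := fun i => let '(rho', mi, R, W, wk, dp) := f i in wk).
  set (f6 := fun i => let '(rho', mi, R, W, wk, dp) := f i in dp).
  assert (H : forall i, i < k -> exec w c (upd rho x i) m (f1 i) (f2 i) (f3 i) (f4 i) (f5 i) (f6 i)
     /\ (forall a, f3 i a -> a < lim) /\
     (forall a, f4 i a <-> Ws i a) /\ (forall a, Ws i a -> f2 i a = m' a) /\ f5 i <= wb i /\ f6 i <= db).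
  { intros i Hi. specialize (Hf i Hi). unfold f1, f2, f3, f4, f5, f6.
    destruct (f i) as [[[[[? ?] ?] ?] ?] ?]. exact Hf. }
  clearbody f1 f2 f3 f4 f5 f6. clear Hf f HI.
  do 4 eexists. splits.
  - apply exec_parfor with (k := k) (rhos := f1) (ms := f2) (Rs := f3) (Ws := f4) (wks := f5) (dps := f6).
    + auto.
    + intros i Hi. apply H; auto.
    + intros i j a Hi Hj Hij Ha. destruct (H i Hi) as (_ & _ & A & _). pose proof (proj1 (A a) Ha) as A1.
      destruct (H j Hj) as (_ & R & B & _). split.
      * intros X. apply R in X. specialize (HL i a Hi A1). lia.
      * intros X. apply B in X. exact (HD i j a Hi Hj Hij A1 X).
    + intros i a Hi Ha. destruct (H i Hi) as (_ & _ & A & A2 & _). symmetry. apply A2, A, Ha.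
    + intros a Ha. apply HF. intros i Hi Hw. apply (Ha i Hi).
      destruct (H i Hi) as (_ & _ & A & _). apply A, Hw.
  - intros a (i & Hi & Ha). destruct (H i Hi) as (_ & R & _). auto.
  - intros a. split; intros (i & Hi & Ha); exists i; split; auto;
      destruct (H i Hi) as (_ & _ & A & _); apply A; auto.
  - rewrite list_sum_seq. apply (Nat.le_trans _ (S (ecost e) + psum (fun i => 1 + wb i) k)).
    + apply Nat.add_le_mono_l, psum_le. intros i Hi. destruct (H i Hi) as (_ & _ & _ & _ & B & _). lia.
    + rewrite psum_add, psum_const. lia.
  - apply Nat.add_le_mono_l, list_max_seq. intros i Hi. destruct (H i Hi) as (_ & _ & _ & _ & _ & B). lia.
Qed.

(** The nested loops range over items [(u, t)], with [u] in register [G] and [t] in register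
    [G + 2]; the number of items may depend on [u]. *)
Definition scatter (cnt len addr val : px) : cmd :=
  Seq (comp G cnt)
    (ParFor G (Reg G)
      (Seq (comp (G + 1) len)
        (ParFor (G + 2) (Reg (G + 1))
          (Seq (comp (G + 3) addr)
            (Seq (comp (G + 4) val) (Write (Reg (G + 3)) (Reg (G + 4)))))))).

(** Pigeonhole: the items are mapped injectively into an interval of [size] addresses. The condition
    that excludes races thereby also bounds the total work. *)
Lemma psum_inj_le (cnt : nat) (len : nat -> nat) (f : nat -> nat -> nat) (lo size : nat) :
  (forall u t, u < cnt -> t < len u -> lo <= f u t < lo + size) ->
  (forall u t u' t', u < cnt -> t < len u -> u' < cnt -> t' < len u' -> f u t = f u' t' ->
     u = u' /\ t = t') ->
  psum len cnt <= size.
Proof.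
  intros HR HI.
  set (l := fun c => flat_map (fun u => map (fun t => (u, t)) (seq 0 (len u))) (seq 0 c)).
  assert (Hin : forall c p, In p (l c) <-> fst p < c /\ snd p < len (fst p)).
  { intros c [u t]. unfold l. rewrite in_flat_map. simpl. split.
    - intros (x & Hx & H). apply in_map_iff in H. destruct H as (y & E & Hy). inversion E; subst.
      apply in_seq in Hx, Hy. lia.
    - intros [A B]. exists u. split; [apply in_seq; lia|]. apply in_map. apply in_seq. lia. }
  assert (Hlen : forall c, length (l c) = psum len c).
  { induction c; auto. unfold l. rewrite seq_S, flat_map_app, length_app. fold (l c). rewrite IHc.
    simpl. rewrite app_nil_r, length_map, length_seq. lia. }
  assert (ND : forall c, NoDup (l c)).
  { induction c; [constructor|]. unfold l. rewrite seq_S, flat_map_app. fold (l c). apply NoDup_app; auto.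
    - simpl. rewrite app_nil_r. apply Injective_map_NoDup; [|apply seq_NoDup].
      intros a b E. congruence.
    - intros p Hp Hq. apply Hin in Hp. simpl in Hq. rewrite app_nil_r in Hq.
      apply in_map_iff in Hq. destruct Hq as (y & E & _). subst p. simpl in Hp. lia. }
  rewrite <- Hlen, <- (length_map (fun p => f (fst p) (snd p))).
  rewrite <- (length_seq size lo). apply NoDup_incl_length.
  - apply NoDup_map_NoDup_ForallPairs; [|apply ND].
    intros [u t] [u' t'] A B E. apply Hin in A, B. simpl in *.
    destruct (HI u t u' t') as [-> ->]; tauto.
  - intros a Ha. apply in_map_iff in Ha. destruct Ha as ([u t] & E & H). apply Hin in H. simpl in *.
    subst a. apply in_seq. apply HR; tauto.
Qed.

Definition phase_cost (cnt len addr val : px) : nat :=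
  pcost 1 cnt + pcost 1 len + pcost 1 addr + pcost 1 val + 20.

(** The value written is asserted only for items where [val] is known in every admissible
    environment. Cost and race freedom hold for the other items too, because [px] expressions are
    total. *)
Lemma scatter_ok w cnt len addr val rho m cntv (lenv : nat -> nat) (addrv : nat -> nat -> nat) lo size :
  1 <= w -> rho rBND < 2 ^ w ->
  wf G cnt = true -> wf (G + 1) len = true -> wf (G + 3) addr = true -> wf (G + 4) val = true ->
  flat cnt = true -> flat len = true -> flat addr = true -> flat val = true ->
  let ev := pe w m (rho rLIM) (rho rBND) in
  ev rho G cnt = cntv ->
  (forall u r, u < cntv -> preserves G rho r -> r G = u -> ev r (G + 1) len = lenv u) ->
  (forall u t r, u < cntv -> t < lenv u -> preserves G rho r -> r G = u -> r (G + 2) = t ->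
     ev r (G + 3) addr = addrv u t) ->
  rho rLIM <= lo ->
  (forall u t, u < cntv -> t < lenv u -> lo <= addrv u t < lo + size) ->
  (forall u t u' t', u < cntv -> t < lenv u -> u' < cntv -> t' < lenv u' ->
     addrv u t = addrv u' t' -> u = u' /\ t = t') ->
  exists rho' m' wk dp,
    runs w (scatter cnt len addr val) rho m rho' m' wk dp /\ preserves G rho rho' /\
    (forall u t v, u < cntv -> t < lenv u ->
       (forall r, preserves G rho r -> r G = u -> r (G + 2) = t -> ev r (G + 4) val = v) ->
       m' (addrv u t) = v) /\
    (forall a, (forall u t, u < cntv -> t < lenv u -> addrv u t <> a) -> m' a = m a) /\
    wk <= (rho rBND + 1) * phase_cost cnt len addr val * (cntv + size + 1) /\
    dp <= (rho rBND + 1) * phase_cost cnt len addr val.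
Proof.
  intros Hw Hb W1 W2 W3 W4 F1 F2 F3 F4 ev Hcnt Hlen Haddr Hlo Hrange Hinj.
  assert (GL : rLIM < G) by (unfold rLIM, G; lia). assert (GB : rBND < G) by (unfold rBND, G; lia).
  apply (pcost_flat (rho rBND)) in F1, F2, F3, F4.
  destruct (comp_ok w m Hw cnt G rho GL GB W1 Hb) as (r0 & k0 & (R0 & WW0 & E0 & HR0 & HW0) & V0 & A0 & C0).
  fold ev in V0. rewrite Hcnt in V0.
  assert (P0 : preserves G rho r0) by exact A0.
  (* The value in the register file that the code really sees, including the length in [G + 1] and
     the address in [G + 3]. *)
  set (valv := fun u t => ev (upd (upd (upd (upd r0 G u) (G + 1) (lenv u)) (G + 2) t) (G + 3) (addrv u t)) (G + 4) val).
  assert (M' : exists m', (forall u t, u < cntv -> t < lenv u -> m' (addrv u t) = valv u t) /\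
    (forall a, (forall u t, u < cntv -> t < lenv u -> addrv u t <> a) -> m' a = m a)).
  (* The final memory is chosen cell by cell; injectivity of [addrv] makes the value at a written
     cell unique. *)
  { destruct (functional_choice (fun a v =>
      (forall u t, u < cntv -> t < lenv u -> addrv u t = a -> v = valv u t) /\
      ((forall u t, u < cntv -> t < lenv u -> addrv u t <> a) -> v = m a))) as [m' Hm].
    - intros a. destruct (classic (exists u t, u < cntv /\ t < lenv u /\ addrv u t = a)) as [(u & t & Hu & Ht & E)|N].
      + exists (valv u t). split.
        * intros u' t' Hu' Ht' E'. destruct (Hinj u t u' t') as [-> ->]; congruence.
        * intros X. exfalso. eapply X; eauto.
      + exists (m a). split; auto. intros u t Hu Ht E. exfalso. eauto 6.
    - exists m'. split; intros.
      + destruct (Hm (addrv u t)) as [A _]. auto.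
      + destruct (Hm a) as [_ A]. auto. }
  destruct M' as (m' & Hm1 & Hm2).
  set (cA := pcost (rho rBND) addr + pcost (rho rBND) val + 3).
  set (cL := pcost (rho rBND) len).
  assert (OUT : exists R W wk dp, exec w (ParFor G (Reg G)
      (Seq (comp (G + 1) len)
        (ParFor (G + 2) (Reg (G + 1))
          (Seq (comp (G + 3) addr)
            (Seq (comp (G + 4) val) (Write (Reg (G + 3)) (Reg (G + 4)))))))) r0 m r0 m' R W wk dp /\
    (forall a, R a -> a < rho rLIM) /\
    (forall a, W a <-> exists u, u < cntv /\ (exists t, t < lenv u /\ addrv u t = a)) /\
    wk <= S (ecost (Reg G)) + cntv + psum (fun u => cL + 2 + lenv u * (cA + 1)) cntv /\
    dp <= S (ecost (Reg G)) + S (cL + 3 + cA)).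
  { apply (parfor_ok w G (Reg G) _ r0 m m' (rho rLIM) cntv (fun u a => exists t, t < lenv u /\ addrv u t = a)).
    - exact V0.
    - intros u Hu. set (ru := upd r0 G u).
      assert (Pu : preserves G rho ru). { intros i Hi. unfold ru. rewrite upd_other by lia. apply A0, Hi. }
      assert (Qu1 : ru rBND = rho rBND) by (apply Pu, GB).
      assert (Qu2 : ru rLIM = rho rLIM) by (apply Pu, GL).
      destruct (comp_ok w m Hw len (G + 1) ru) as (r1 & k1 & (R1 & WW1 & E1 & HR1 & HW1) & V1 & A1 & C1); try lia; auto.
      rewrite Qu1, ?Qu2 in *. fold (ev ru) in V1. fold ev in V1. rewrite (Hlen u) in V1; auto.
      assert (P1 : preserves G rho r1). { intros i Hi. rewrite A1 by lia. apply Pu, Hi. }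
      assert (U1 : r1 G = u). { rewrite A1 by lia. apply upd_same. }
      (* The private memory of instance [u]: final values at its own addresses, old values
         everywhere else. *)
      set (mu := fun a => if excluded_middle_informative (exists t, t < lenv u /\ addrv u t = a) then m' a else m a).
      assert (INN : exists R W wk dp, exec w (ParFor (G + 2) (Reg (G + 1))
          (Seq (comp (G + 3) addr)
            (Seq (comp (G + 4) val) (Write (Reg (G + 3)) (Reg (G + 4)))))) r1 m r1 mu R W wk dp /\
          (forall a, R a -> a < rho rLIM) /\
          (forall a, W a <-> exists t, t < lenv u /\ a = addrv u t) /\
          wk <= S (ecost (Reg (G + 1))) + lenv u + psum (fun _ => cA) (lenv u) /\
          dp <= S (ecost (Reg (G + 1))) + S cA).
      { apply (parfor_ok w (G + 2) (Reg (G + 1)) _ r1 m mu (rho rLIM) (lenv u) (fun t a => a = addrv u t)).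
        - exact V1.
        - intros t Ht. set (rt := upd r1 (G + 2) t).
          assert (Pt : preserves G rho rt). { intros i Hi. unfold rt. rewrite upd_other by lia. apply P1, Hi. }
          assert (Qt1 : rt rBND = rho rBND) by (apply Pt, GB).
          assert (Qt2 : rt rLIM = rho rLIM) by (apply Pt, GL).
          assert (Ut : rt G = u) by (unfold rt; rewrite upd_other; [exact U1|lia]).
          assert (Tt : rt (G + 2) = t) by apply upd_same.
          destruct (comp_ok w m Hw addr (G + 3) rt) as (r2 & k2 & (R2 & WW2 & E2 & HR2 & HW2) & V2 & A2 & C2); try lia; auto.
          rewrite Qt1, ?Qt2 in *. fold ev in V2. rewrite (Haddr u t) in V2; auto.
          assert (P2 : preserves G rho r2). { intros i Hi. rewrite A2 by lia. apply Pt, Hi. }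
          assert (Q21 : r2 rBND = rho rBND) by (apply P2, GB).
          assert (Q22 : r2 rLIM = rho rLIM) by (apply P2, GL).
          destruct (comp_ok w m Hw val (G + 4) r2) as (r3 & k3 & (R3 & WW3 & E3 & HR3 & HW3) & V3 & A3 & C3); try lia; auto.
          rewrite Q21, ?Q22 in *. fold ev in V3.
          assert (V3' : r3 (G + 4) = valv u t).
          { rewrite V3. unfold valv, ev. apply pe_agree; auto. intros i Hi.
            destruct (Nat.eq_dec i (G + 3)) as [->|N3]; [rewrite upd_same; exact V2|].
            rewrite upd_other, A2 by lia.
            destruct (Nat.eq_dec i (G + 2)) as [->|N2]; [rewrite upd_same; exact Tt|].
            unfold rt. rewrite !(upd_other _ (G + 2)) by lia.
            destruct (Nat.eq_dec i (G + 1)) as [->|N1]; [rewrite upd_same; exact V1|].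
            rewrite (upd_other _ (G + 1)) by lia. apply A1. lia. }
          do 6 eexists. splits.
          + eapply exec_seq; [exact E2|]. eapply exec_seq; [exact E3|]. apply exec_write.
          + intros a [X|[X|X]]; auto. destruct X.
          + intros a. cbn [eval]. rewrite A3, V2 by lia. split; [|tauto]. intros [X|[X|X]]; auto.
            * exfalso; exact (HW2 _ X).
            * exfalso; exact (HW3 _ X).
          + intros a ->. cbn [eval]. rewrite A3, V2, V3' by lia. rewrite upd_same.
            unfold mu. destruct excluded_middle_informative as [X|X].
            * symmetry. apply Hm1; auto.
            * exfalso. apply X. eauto.
          + cbn [ecost]. unfold cA. lia.
          + cbn [ecost]. unfold cA. lia.
        - intros t a Ht ->. specialize (Hrange u t Hu Ht). lia.
        - intros t t' a Ht Ht' Htt -> E. destruct (Hinj u t u t'); auto.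
        - intros a Ha. unfold mu. destruct excluded_middle_informative as [(t & Ht & E)|X]; auto.
          exfalso. apply (Ha t Ht). auto. }
      destruct INN as (R2 & W2' & wk2 & dp2 & E2 & HR2 & HW2 & B2 & D2).
      do 6 eexists. splits.
      + eapply exec_seq; [exact E1|exact E2].
      + intros a [X|X]; auto.
      + intros a. cbv beta. rewrite HW2. split.
        * intros [X|(t & Ht & E)]; [exfalso; eapply HW1; eauto|]. exists t. auto.
        * intros (t & Ht & E). right. exists t. auto.
      + intros a (t & Ht & E). unfold mu. destruct excluded_middle_informative as [X|X]; auto.
        exfalso. apply X. eauto.
      + rewrite psum_const in B2. cbn [ecost] in B2. unfold cL. nia.
      + cbn [ecost] in D2. unfold cL. lia.
    - intros u a Hu (t & Ht & <-). specialize (Hrange u t Hu Ht). lia.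
    - intros u u' a Hu Hu' Huu (t & Ht & E) (t' & Ht' & E'). destruct (Hinj u t u' t'); auto. congruence.
    - intros a Ha. apply Hm2. intros u t Hu Ht E. apply (Ha u Hu). eauto. }
  destruct OUT as (R & W & wk & dp & E & HR & HW' & B & D).
  assert (SL : psum lenv cntv <= size) by (apply (psum_inj_le _ _ addrv lo); auto).
  exists r0, m', (k0 + wk), (k0 + dp). splits.
  - exists (fun a => R0 a \/ R a), (fun a => WW0 a \/ W a). eapply exec_seq; [exact E0|exact E].
  - exact P0.
  - intros u t v Hu Ht Hv. rewrite Hm1 by auto. apply Hv.
    + intros i Hi. rewrite !upd_other by lia. apply P0, Hi.
    + rewrite !upd_other by lia. apply upd_same.
    + rewrite upd_other by lia. apply upd_same.
  - exact Hm2.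
  - cbn [ecost] in B.
    assert (S1 : psum (fun u => cL + 2 + lenv u * (cA + 1)) cntv <= cntv * (cL + 2) + size * (cA + 1)).
    { rewrite (psum_add (fun _ => cL + 2) (fun u => lenv u * (cA + 1))), psum_const.
      rewrite (psum_ext (fun u => lenv u * (cA + 1)) (fun u => (cA + 1) * lenv u)) by (intros; lia).
      rewrite psum_mul. nia. }
    unfold phase_cost, cA, cL in *. set (b := rho rBND + 1) in *. assert (1 <= b) by lia.
    assert (wk + k0 <= b * (pcost 1 cnt + pcost 1 len + pcost 1 addr + pcost 1 val + 20) + cntv *  (b * (pcost 1 cnt + pcost 1 len + pcost 1 addr + pcost 1 val + 20)) + size * (b * (pcost 1 cnt + pcost 1 len + pcost 1 addr + pcost 1 val + 20))); [|nia].
    set (p1 := pcost 1 cnt) in *; set (p2 := pcost 1 len) in *; set (p3 := pcost 1 addr) in *; set (p4 := pcost 1 val) in *.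
    rewrite !Nat.mul_add_distr_l. nia.
  - unfold phase_cost, cA, cL in *. cbn [ecost] in D. nia.
Qed.

(** * Building expressions *)

(** Higher-order syntax: a builder receives the stack height, so that [let_] and [for_] can pass
    registers to their bodies as named values. *)
Definition bld := nat -> px.
Definition kk (k : nat) : bld := fun _ => PK k.
Definition vv (x : nat) : bld := fun _ => PV x.
Definition bop (o : binop) (a b : bld) : bld := fun d => PB o (a d) (b (S d)).
Definition ld (a : bld) : bld := fun d => PL (a d).
Definition let_ (a : bld) (f : bld -> bld) : bld := fun d => PLet (a d) (f (vv d) (S d)).
Definition if_ (c a b : bld) : bld := fun d => PIf (c d) (a d) (b d).
Definition for_ (a : bld) (f : bld -> bld -> bld) : bld :=
  fun d => PFor (a d) (f (vv d) (vv (S d)) (S (S d))).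

Declare Scope px_scope.
Delimit Scope px_scope with px.
Bind Scope px_scope with bld.
Notation "a +' b" := (bop Add a b) (at level 50, left associativity) : px_scope.
Notation "a -' b" := (bop Sub a b) (at level 50, left associativity) : px_scope.
Notation "a *' b" := (bop Mul a b) (at level 40, left associativity) : px_scope.
Notation "a /' b" := (bop Div a b) (at level 40, left associativity) : px_scope.
Notation "a %' b" := (bop Mod a b) (at level 40, left associativity) : px_scope.
Notation "a <<' b" := (bop Shl a b) (at level 55, left associativity) : px_scope.
Notation "a >>' b" := (bop Shr a b) (at level 55, left associativity) : px_scope.
Notation "a <' b" := (bop Lt a b) (at level 70, no associativity) : px_scope.
Notation "a =' b" := (bop Eq a b) (at level 70, no associativity) : px_scope.
Notation "'LET' x ':=' a 'IN' b" := (let_ a (fun x => b))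
  (at level 200, x name, a at level 100, b at level 200) : px_scope.
Open Scope px_scope.

Section Ev.
Context (w : nat) (m : mem) (lim bnd : nat).
(* Kripke style: the value is stable under extension of the register stack, so
   that it remains available below later binders. *)
Definition evb (rho : env) (d : nat) (b : bld) (v : nat) : Prop :=
  forall rho' d', d <= d' -> preserves d rho rho' -> pe w m lim bnd rho' d' (b d') = v.

Definition ext (rho : env) (d : nat) (rho' : env) (d' : nat) : Prop :=
  d <= d' /\ preserves d rho rho'.

Lemma ext_refl rho d : ext rho d rho d.
Proof. split; auto. intros ? ?; auto. Qed.

Lemma ext_trans r d r1 d1 r2 d2 : ext r d r1 d1 -> ext r1 d1 r2 d2 -> ext r d r2 d2.
Proof. intros [P1 P2] [Q1 Q2]. split; [lia|]. intros i Hi. rewrite Q2 by lia. apply P2, Hi. Qed.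

Lemma evb_mono rho d rho' d' b v : ext rho d rho' d' -> evb rho d b v -> evb rho' d' b v.
Proof.
  intros [A B] H r e C D. apply H; [lia|]. intros i Hi. rewrite D by lia. apply B, Hi.
Qed.

Lemma evb_pe rho d b v : evb rho d b v -> pe w m lim bnd rho d (b d) = v.
Proof. intros H; apply H; auto. intros ? ?; auto. Qed.

Lemma ev_eq rho d b v v' : evb rho d b v' -> v' = v -> evb rho d b v.
Proof. now intros H <-. Qed.

Lemma ev_k rho d k : k < 2 ^ w -> evb rho d (kk k) k.
Proof. intros H r e _ _. simpl. now apply Nat.mod_small. Qed.

Lemma ev_v rho d x : x < d -> evb rho d (vv x) (rho x).
Proof. intros H r e _ P. simpl. now apply P. Qed.

Lemma ext_upd rho d rho' d' v : ext rho d rho' d' -> ext rho d (upd rho' d' v) (S d').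
Proof.
  intros [A B]. split; [lia|]. intros i Hi. rewrite upd_other by lia. apply B, Hi.
Qed.

Lemma ev_bin o rho d a b x y z : evb rho d a x -> evb rho d b y -> eval_binop w o x y = z ->
  evb rho d (bop o a b) z.
Proof.
  intros A B <- r e C D. unfold bop. cbn [pe]. rewrite (A r e) by assumption. f_equal.
  apply B; [lia|]. intros i Hi. rewrite upd_other by lia. apply D, Hi.
Qed.

Lemma ev_add rho d a b x y : evb rho d a x -> evb rho d b y -> x + y < 2 ^ w -> evb rho d (a +' b) (x + y).
Proof. intros A B C. eapply ev_bin; eauto. now apply Nat.mod_small. Qed.

Lemma ev_mul rho d a b x y : evb rho d a x -> evb rho d b y -> x * y < 2 ^ w -> evb rho d (a *' b) (x * y).
Proof. intros A B C. eapply ev_bin; eauto. now apply Nat.mod_small. Qed.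

Lemma ev_sub rho d a b x y : evb rho d a x -> evb rho d b y -> y <= x -> x < 2 ^ w -> evb rho d (a -' b) (x - y).
Proof.
  intros A B C D. eapply ev_bin; eauto. unfold eval_binop.
  replace (x + 2 ^ w - y) with (x - y + 1 * 2 ^ w) by lia.
  rewrite Nat.Div0.mod_add. apply Nat.mod_small. lia.
Qed.

Lemma ev_div rho d a b x y : evb rho d a x -> evb rho d b y -> x < 2 ^ w -> evb rho d (a /' b) (x / y).
Proof.
  intros A B C. eapply ev_bin; eauto. apply Nat.mod_small.
  destruct y; [simpl; lia|]. pose proof (Nat.Div0.div_le_upper_bound x (S y) x). nia.
Qed.

Lemma ev_mod rho d a b x y : evb rho d a x -> evb rho d b y -> x < 2 ^ w -> evb rho d (a %' b) (x mod y).
Proof.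
  intros A B C. eapply ev_bin; eauto. apply Nat.mod_small.
  pose proof (Nat.Div0.mod_le x y). lia.
Qed.

Lemma ev_shl rho d a b x y : evb rho d a x -> evb rho d b y -> x * 2 ^ y < 2 ^ w -> evb rho d (a <<' b) (x * 2 ^ y).
Proof. intros A B C. eapply ev_bin; eauto. unfold eval_binop. rewrite Nat.shiftl_mul_pow2. now apply Nat.mod_small. Qed.

Lemma ev_shr rho d a b x y : evb rho d a x -> evb rho d b y -> x < 2 ^ w -> evb rho d (a >>' b) (x / 2 ^ y).
Proof.
  intros A B C. eapply ev_bin; eauto. unfold eval_binop. rewrite Nat.shiftr_div_pow2. apply Nat.mod_small.
  pose proof (Nat.Div0.div_le_upper_bound x (2 ^ y) x). pose proof (pow2_pos y). nia.
Qed.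

Lemma lor_lt x y k : x < 2 ^ k -> y < 2 ^ k -> Nat.lor x y < 2 ^ k.
Proof.
  intros A B. rewrite <- (Nat.mod_small x (2 ^ k)), <- (Nat.mod_small y (2 ^ k)) by assumption.
  rewrite <- !Nat.land_ones, <- Nat.land_lor_distr_l, Nat.land_ones.
  apply Nat.mod_upper_bound. apply Nat.pow_nonzero. lia.
Qed.

Lemma ev_or rho d a b x y : evb rho d a x -> evb rho d b y -> x < 2 ^ w -> y < 2 ^ w ->
  evb rho d (bop Or a b) (Nat.lor x y).
Proof. intros A B C D. eapply ev_bin; eauto. apply Nat.mod_small. now apply lor_lt. Qed.

Lemma ev_let rho d a f va v :
  evb rho d a va ->
  (forall rho' d' x, ext rho d rho' d' -> evb rho' d' x va -> evb rho' d' (f x) v) ->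
  evb rho d (let_ a f) v.
Proof.
  intros A B r e C D. unfold let_. cbn [pe]. rewrite (A r e C D).
  apply evb_pe. apply B.
  - apply ext_upd. now split.
  - intros r' e' X Y. simpl. rewrite Y by lia. apply upd_same.
Qed.

Lemma ev_if rho d c a b vc v :
  evb rho d c vc -> (vc <> 0 -> evb rho d a v) -> (vc = 0 -> evb rho d b v) -> evb rho d (if_ c a b) v.
Proof.
  intros C A B r e X Y. unfold if_. cbn [pe]. rewrite (C r e X Y).
  destruct (Nat.eqb_spec vc 0); [apply B|apply A]; auto.
Qed.

Lemma ev_if_lt rho d x y a b vx vy va vb :
  1 <= w -> evb rho d x vx -> evb rho d y vy -> (vx < vy -> evb rho d a va) -> (vy <= vx -> evb rho d b vb) ->
  evb rho d (if_ (x <' y) a b) (if vx <? vy then va else vb).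
Proof.
  intros Hw X Y A B.
  assert (E : evb rho d (x <' y) (Nat.b2n (vx <? vy))) by (eapply ev_bin; eauto; now apply b2n_mod).
  eapply ev_if; [exact E| |]; destruct (Nat.ltb_spec vx vy); simpl; intros; auto; lia.
Qed.

Lemma ev_if_eq rho d x y a b vx vy va vb :
  1 <= w -> evb rho d x vx -> evb rho d y vy -> (vx = vy -> evb rho d a va) -> (vx <> vy -> evb rho d b vb) ->
  evb rho d (if_ (x =' y) a b) (if vx =? vy then va else vb).
Proof.
  intros Hw X Y A B.
  assert (E : evb rho d (x =' y) (Nat.b2n (vx =? vy))) by (eapply ev_bin; eauto; now apply b2n_mod).
  eapply ev_if; [exact E| |]; destruct (Nat.eqb_spec vx vy); simpl; intros; auto; lia.
Qed.

Lemma ev_ld rho d a x : evb rho d a x -> x < lim -> evb rho d (ld a) (m x).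
Proof.
  intros A B r e C D. unfold ld. cbn [pe]. rewrite (A r e C D).
  now rewrite (proj2 (Nat.ltb_lt _ _) B).
Qed.

(** The body is evaluated only at accumulators that the loop really reaches, so a bound on
    [iter_up vi F va] may be used to exclude overflow in it. *)
Lemma ev_for rho d a f va (F : nat -> nat -> nat) :
  evb rho d a va ->
  (forall rho' d' acc i vi, ext rho d rho' d' -> vi < bnd ->
     evb rho' d' acc (iter_up vi F va) -> evb rho' d' i vi ->
     evb rho' d' (f acc i) (F vi (iter_up vi F va))) ->
  evb rho d (for_ a f) (iter_up bnd F va).
Proof.
  intros A B r e C D. unfold for_. cbn [pe]. rewrite (A r e C D).
  assert (H : forall k, k <= bnd -> iter_up k (fun i acc =>
    pe w m lim bnd (upd (upd r e acc) (S e) i) (S (S e)) (f (vv e) (vv (S e)) (S (S e)))) va = iter_up k F va).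
  { induction k; simpl; auto. intros Hk. rewrite IHk by lia. apply evb_pe. apply B.
    - apply ext_upd. apply ext_upd. now split.
    - lia.
    - intros r' e' X Y. simpl. rewrite Y by lia. rewrite upd_other by lia. apply upd_same.
    - intros r' e' X Y. simpl. rewrite Y by lia. apply upd_same. }
  now apply H.
Qed.
End Ev.

(** * Parameters *)

Lemma lg_pos x : 1 <= lg x.
Proof. unfold lg. lia. Qed.

Lemma lg_up x : x <= 2 ^ lg x.
Proof.
  unfold lg. apply (Nat.le_trans _ (2 ^ Nat.log2_up x)); [|apply Nat.pow_le_mono_r; lia].
  destruct (Nat.le_gt_cases x 0); [pose proof (pow2_pos (Nat.log2_up x)); lia|].
  now apply Nat.log2_log2_up_spec.
Qed.

Lemma lg_low x : 1 <= x -> 2 ^ lg x <= 2 * x.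
Proof.
  intros H. unfold lg. destruct (Nat.eq_dec x 1) as [->|N]; [simpl; lia|].
  pose proof (Nat.log2_up_spec x ltac:(lia)) as [A _].
  assert (1 <= Nat.log2_up x) by (apply (Nat.log2_up_le_mono 2 x); lia).
  rewrite Nat.max_r by lia. replace (Nat.log2_up x) with (S (pred (Nat.log2_up x))) at 1 by lia.
  simpl. lia.
Qed.

Lemma lg_mono x y : x <= y -> lg x <= lg y.
Proof. intros H. unfold lg. apply Nat.log2_up_le_mono in H. lia. Qed.

Lemma lg_le_pow x k : 1 <= k -> x <= 2 ^ k -> lg x <= k.
Proof.
  intros K H. unfold lg. apply Nat.log2_up_le_mono in H. rewrite Nat.log2_up_pow2 in H; lia.
Qed.

Lemma le_pow2 x : x < 2 ^ x.
Proof. apply Nat.pow_gt_lin_r. lia. Qed.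

Lemma lg_le x : 1 <= x -> lg x <= x.
Proof. intros H. apply lg_le_pow; auto. pose proof (le_pow2 x). lia. Qed.

Lemma pow4_pow2 k : k ^ 4 <= 32 * 2 ^ k.
Proof.
  destruct (Nat.le_gt_cases k 6) as [H|H].
  - assert (C : k = 0 \/ k = 1 \/ k = 2 \/ k = 3 \/ k = 4 \/ k = 5 \/ k = 6) by lia.
    repeat (destruct C as [->|C]; [apply Nat.leb_le; vm_compute; reflexivity|]).
    subst k. apply Nat.leb_le; vm_compute; reflexivity.
  - replace k with (6 + (k - 6)) by lia. generalize (k - 6) as j. clear H.
    induction j.
    + apply Nat.leb_le; vm_compute; reflexivity.
    + replace (6 + S j) with (S (6 + j)) by lia. rewrite (Nat.pow_succ_r' 2).
      (* From 6 on, the left side grows by a factor of at most [(7 / 6) ^ 4 < 2]. *)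
      assert (S (6 + j) ^ 4 <= 2 * (6 + j) ^ 4); [|lia].
      clear IHj. simpl. nia.
Qed.

Lemma lg_pow4 L : 1 <= L -> lg L ^ 4 <= 64 * L.
Proof. intros H. pose proof (pow4_pow2 (lg L)). pose proof (lg_low L H). lia. Qed.

(** The constant is used only through this inequality and its value stays opaque. The term [100 * L]
    covers indices and the tables over chunks; the term [300 * lg L ^ 4] covers packed sub-range
    answers and the table over bitstrings of [ll n] bits. *)
Lemma K0_exists : { K : nat | forall L, 1 <= L -> 300 * lg L ^ 4 + 100 * L <= K * L }.
Proof. exists (300 * 64 + 100). intros L H. pose proof (lg_pow4 L H). nia. Qed.

Definition K0 : nat := proj1_sig K0_exists.

Lemma K0_ok L : 1 <= L -> 300 * lg L ^ 4 + 100 * L <= K0 * L.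
Proof. apply (proj2_sig K0_exists). Qed.

Definition LL (n : nat) : nat := lg (lg n).
(** Chunk length: half a logarithm, so that a table indexed by chunk contents has about [sqrt n]
    rows. *)
Definition hh (n : nat) : nat := ceil_div (lg n) 2.
Definition gg (n : nat) : nat := lg n * LL n.
(** Radix of the indices of the packed tables; it exceeds each of the components that follow the
    chunk contents. *)
Definition DD (n : nat) : nat := 8 * lg n * lg n.
Definition MM (n : nat) : nat := 2 ^ (K0 * lg n).
(** Height of the summation tree. Its [NC n] leaves include the chunk of position [n] itself, so
    that ranks at the end of the sequence need no special case. *)
Definition HH (n : nat) : nat := Nat.log2_up (n / hh n + 1).
Definition NC (n : nat) : nat := 2 ^ HH n.
(** The length from which a range is long; it equals [gg n * gg n]. *)
Definition thr (n : nat) : nat := lg n ^ 2 * LL n ^ 2.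
Definition ll (n : nat) : nat := 16 * LL n ^ 4.

(* The round counter of a scan. *)
Definition rT := 11.

(** Registers 0 to 8, 12 and 13 stay fixed after the initialization, while [rLIM], [rBND] and [rT]
    change between phases. The bound on [rBND] is what the compiled loops need to terminate. *)
Record globs (n w : nat) (rho : env) : Prop := {
  g_n : rho 0 = n; g_L : rho 1 = lg n; g_LL : rho 2 = LL n; g_h : rho 3 = hh n;
  g_g : rho 4 = gg n; g_D : rho 5 = DD n; g_M : rho 6 = MM n; g_H : rho 7 = HH n;
  g_NC : rho 8 = NC n; g_thr : rho 12 = thr n; g_l : rho 13 = ll n;
  g_bnd : rho rBND < 2 ^ w }.

(** The factor 8 lets a word hold the product of eight numbers of size [MM n]. *)
Definition inst (n : nat) (T : list bool) (w : nat) : Prop :=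
  1 <= n /\ length T = n /\ 8 * K0 * lg n <= w.

Section Bounds.
Context (n : nat).

Lemma L_pos : 1 <= lg n. Proof. apply lg_pos. Qed.
Lemma LL_pos : 1 <= LL n. Proof. apply lg_pos. Qed.
Lemma LL_le_L : LL n <= lg n. Proof. apply lg_le, lg_pos. Qed.
Lemma hh_bounds : 1 <= hh n /\ hh n <= lg n /\ lg n <= 2 * hh n /\ 2 * hh n <= lg n + 1.
Proof.
  pose proof L_pos. unfold hh, ceil_div. set (x := lg n) in *.
  pose proof (Nat.div_mod_eq (x + 2 - 1) 2). pose proof (Nat.mod_upper_bound (x + 2 - 1) 2). lia.
Qed.
Lemma K0_pos : 100 <= K0.
Proof. pose proof (K0_ok 1 (le_n 1)). lia. Qed.
Lemma pow_le_M a : a <= K0 * lg n -> 2 ^ a <= MM n.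
Proof. intros. apply Nat.pow_le_mono_r; lia. Qed.
Lemma n_le : n <= 2 ^ lg n. Proof. apply lg_up. Qed.
Lemma pow_L_le : 1 <= n -> 2 ^ lg n <= 2 * n. Proof. apply lg_low. Qed.
Lemma NC_low : n / hh n + 1 <= NC n.
Proof. unfold NC, HH. apply (Nat.log2_log2_up_spec (n / hh n + 1)). lia. Qed.
Lemma NC_up : NC n <= 2 * (n / hh n + 1).
Proof.
  unfold NC, HH. set (x := n / hh n + 1). assert (1 <= x) by lia. clearbody x.
  destruct (Nat.eq_dec x 1) as [->|N]; [simpl; lia|].
  pose proof (Nat.log2_up_spec x ltac:(lia)) as [A _].
  assert (1 <= Nat.log2_up x) by (apply (Nat.log2_up_le_mono 2 x); lia).
  replace (Nat.log2_up x) with (S (pred (Nat.log2_up x))) at 1 by lia. simpl. lia.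
Qed.
Lemma HH_le : HH n <= lg n + 1.
Proof.
  unfold HH. destruct hh_bounds as (A & _).
  assert (n / hh n + 1 <= 2 ^ (lg n + 1)).
  { pose proof n_le. assert (n / hh n <= n) by (apply Nat.Div0.div_le_upper_bound; nia).
    pose proof (pow2_pos (lg n)). rewrite Nat.pow_add_r. change (2 ^ 1) with 2. lia. }
  apply Nat.log2_up_le_mono in H. rewrite Nat.log2_up_pow2 in H; lia.
Qed.
End Bounds.

Lemma M_sq w n T : inst n T w -> 2 ^ w >= MM n * MM n * MM n * MM n * MM n * MM n * MM n * MM n.
Proof.
  intros (_ & _ & H). unfold MM. rewrite <- !Nat.pow_add_r. apply Nat.pow_le_mono_r; lia.
Qed.

Lemma x_le_MM n x : x <= 100 * lg n -> 2 ^ x <= MM n.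
Proof. intros. apply pow_le_M. apply (Nat.le_trans _ (100 * lg n)); auto. apply Nat.mul_le_mono_r, K0_pos. Qed.

Lemma ll_M n : 2 ^ (18 * ll n) <= MM n.
Proof. apply pow_le_M. pose proof (K0_ok (lg n) (lg_pos n)). unfold ll, LL in *. lia. Qed.

(** With [y = x / (k * a)] one has [x <= k * a * 2 ^ y]; raise this to the power [a]. *)
Lemma poly_exp a k : 1 <= k -> exists C, forall x, x ^ a <= C * 2 ^ (x / k).
Proof.
  intros Hk. destruct (Nat.eq_dec a 0) as [->|Ha].
  { exists 1. intros x. simpl. pose proof (pow2_pos (x / k)). lia. }
  exists ((k * a) ^ a). intros x. set (y := x / (k * a)).
  assert (ka : k * a <> 0) by nia.
  pose proof (Nat.div_mod_eq x (k * a)) as E. fold y in E.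
  pose proof (Nat.mod_upper_bound x (k * a) ka).
  assert (x <= k * a * 2 ^ y). { pose proof (le_pow2 y). nia. }
  apply (Nat.le_trans _ ((k * a * 2 ^ y) ^ a)); [now apply Nat.pow_le_mono_l|].
  rewrite Nat.pow_mul_l, <- Nat.pow_mul_r. apply Nat.mul_le_mono_l, Nat.pow_le_mono_r; [lia|].
  apply Nat.div_le_lower_bound; [lia|]. nia.
Qed.

(** * Phases *)

Definition setr (x : nat) (e : bld) : cmd := Seq (comp G (e G)) (Assign x (Reg G)).

Lemma setr_ok w m rho x (e : bld) v : 1 <= w -> x < G -> wf G (e G) = true -> loop_free (e G) = true ->
  rho rBND < 2 ^ w -> evb w m (rho rLIM) (rho rBND) rho G e v ->
  exists rho' R W k, exec w (setr x e) rho m rho' m R W k k /\ rho' x = v /\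
    (forall i, i < G -> i <> x -> rho' i = rho i) /\ k <= pcost 0 (e G) + 2.
Proof.
  intros Hw Hx W F Hb E.
  destruct (comp_ok w m Hw (e G) G rho) as (r & k & (R & W' & E1 & _) & V & A & C);
    auto; try (unfold rLIM, rBND, G; lia).
  apply evb_pe in E. rewrite E in V. rewrite pcost_loop_free in C by assumption.
  do 4 eexists. split; [eapply exec_seq; [exact E1|apply exec_assign]|].
  split; [rewrite upd_same; exact V|]. split; [|simpl; lia].
  intros i Hi Hix. rewrite upd_other by assumption. apply A, Hi.
Qed.

Definition phase (lim bnd cnt len addr val : bld) : cmd :=
  Seq (setr rLIM lim) (Seq (setr rBND bnd)
    (scatter (cnt G) (len (G + 1)) (addr (G + 3)) (val (G + 4)))).

Definition phase_wf (lim bnd cnt len addr val : bld) : bool :=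
  forallb (fun x => x)
    [wf G (lim G); loop_free (lim G); wf G (bnd G); loop_free (bnd G);
     wf G (cnt G); flat (cnt G); wf (G + 1) (len (G + 1)); flat (len (G + 1));
     wf (G + 3) (addr (G + 3)); flat (addr (G + 3)); wf (G + 4) (val (G + 4)); flat (val (G + 4))].

Definition phase_k (lim bnd cnt len addr val : bld) : nat :=
  phase_cost (cnt G) (len (G + 1)) (addr (G + 3)) (val (G + 4)) +
  pcost 0 (lim G) + pcost 0 (bnd G) + 4.

Definition like (n w t : nat) (rho : env) : Prop := globs n w rho /\ rho rT = t.

Lemma like_preserves n w t rho rho' :
  (forall i, i < G -> i <> rLIM -> i <> rBND -> rho' i = rho i) -> rho' rBND < 2 ^ w ->
  like n w t rho -> like n w t rho'.
Proof.
  intros P B [[] E]. split; [constructor|]; try (rewrite P; unfold G, rLIM, rBND, rT in *; auto; lia).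
  exact B.
Qed.

Lemma phase_ok n w tau lim bnd cnt len addr val limv bndv cntv lenv addrv lo size rho m :
  1 <= w -> like n w tau rho -> phase_wf lim bnd cnt len addr val = true ->
  (forall r l b, like n w tau r -> evb w m l b r G lim limv) ->
  (forall r l b, like n w tau r -> evb w m l b r G bnd bndv) ->
  bndv < 2 ^ w ->
  (forall r, like n w tau r -> evb w m limv bndv r G cnt cntv) ->
  (forall u r, u < cntv -> like n w tau r -> r G = u -> evb w m limv bndv r (G + 1) len (lenv u)) ->
  (forall u t r, u < cntv -> t < lenv u -> like n w tau r -> r G = u -> r (G + 2) = t ->
     evb w m limv bndv r (G + 3) addr (addrv u t)) ->
  limv <= lo ->
  (forall u t, u < cntv -> t < lenv u -> lo <= addrv u t < lo + size) ->
  (forall u t u' t', u < cntv -> t < lenv u -> u' < cntv -> t' < lenv u' ->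
     addrv u t = addrv u' t' -> u = u' /\ t = t') ->
  exists rho' m' wk dp,
    runs w (phase lim bnd cnt len addr val) rho m rho' m' wk dp /\
    like n w tau rho' /\
    (forall u t v, u < cntv -> t < lenv u ->
       (forall r, like n w tau r -> r G = u -> r (G + 2) = t -> evb w m limv bndv r (G + 4) val v) ->
       m' (addrv u t) = v) /\
    (forall a, (forall u t, u < cntv -> t < lenv u -> addrv u t <> a) -> m' a = m a) /\
    wk <= phase_k lim bnd cnt len addr val * ((cntv + size + 1) * (bndv + 1)) /\
    dp <= phase_k lim bnd cnt len addr val * (bndv + 1).
Proof.
  intros Hw HL HWF Hlim Hbnd Hb Hcnt Hlen Haddr Hlo Hrange Hinj.
  unfold phase_wf in HWF. cbn [forallb] in HWF. rewrite !andb_true_iff in HWF.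
  destruct HWF as (W1 & L1 & W2 & L2 & W3 & F3 & W4 & F4 & W5 & F5 & W6 & F6 & _).
  destruct (setr_ok w m rho rLIM lim limv Hw) as (r1 & R1 & WW1 & k1 & E1 & V1 & P1 & C1); auto.
  { unfold rLIM, G; lia. } { apply HL. }
  assert (L1' : like n w tau r1).
  { apply (like_preserves n w tau rho); auto. rewrite P1; [apply HL| |]; unfold rLIM, rBND, G; lia. }
  destruct (setr_ok w m r1 rBND bnd bndv Hw) as (r2 & R2 & WW2 & k2 & E2 & V2 & P2 & C2); auto.
  { unfold rBND, G; lia. } { apply L1'. }
  assert (L2' : like n w tau r2).
  { apply (like_preserves n w tau r1); auto. rewrite V2; auto. }
  assert (Q : r2 rLIM = limv). { rewrite P2; auto; unfold rLIM, rBND, G; lia. }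
  assert (LP : forall r, preserves G r2 r -> like n w tau r).
  { intros r Hr. apply (like_preserves n w tau r2); auto.
    rewrite Hr by (unfold rBND, G; lia). rewrite V2. exact Hb. }
  destruct (scatter_ok w (cnt G) (len (G + 1)) (addr (G + 3)) (val (G + 4)) r2 m cntv lenv addrv lo size)
    as (r3 & m' & wk & dp & (R3 & WW3 & E3) & P3 & A3 & F & B & D); auto; rewrite ?V2, ?Q; auto.
  - apply evb_pe, Hcnt, L2'.
  - intros u r Hu Hr Hru. apply evb_pe, Hlen; auto.
  - intros u t r Hu Ht Hr Hru Hrt. apply evb_pe, Haddr; auto.
  - exists r3, m', (k1 + (k2 + wk)), (k1 + (k2 + dp)). rewrite V2, Q in *. splits; auto.
    + do 2 eexists. eapply exec_seq; [exact E1|]. eapply exec_seq; [exact E2|exact E3].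
    + intros u t v Hu Ht Hv. apply A3; auto. intros r Hr Hru Hrt. apply evb_pe, Hv; auto.
    + unfold phase_k. set (pc := phase_cost _ _ _ _) in *. nia.
    + unfold phase_k. set (pc := phase_cost _ _ _ _) in *. nia.
Qed.

(** * Triples with cost bounds, and invariants on memory regions *)

Definition asrt := nat -> list bool -> nat -> env -> mem -> Prop.

(** Total correctness with the two cost bounds of the theorem built in. The constant [C] comes
    before the input, so sequential composition just adds constants; the work bound is multiplied
    out to avoid a division. *)
Definition Tri (P : asrt) (c : cmd) (Q : asrt) : Prop :=
  exists C, forall n T w rho m, P n T w rho m ->
    exists rho' m' wk dp, runs w c rho m rho' m' wk dp /\ Q n T w rho' m' /\
      wk * lg n <= C * n /\ dp <= C * lg n.

Lemma Tri_seq P Q S c1 c2 : Tri P c1 Q -> Tri Q c2 S -> Tri P (Seq c1 c2) S.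
Proof.
  intros [C1 H1] [C2 H2]. exists (C1 + C2). intros n T w rho m HP.
  destruct (H1 n T w rho m HP) as (r1 & m1 & wk1 & dp1 & (R1 & W1 & E1) & HQ & A1 & B1).
  destruct (H2 n T w r1 m1 HQ) as (r2 & m2 & wk2 & dp2 & (R2 & W2 & E2) & HS & A2 & B2).
  exists r2, m2, (wk1 + wk2), (dp1 + dp2). splits; auto; try lia.
  do 2 eexists. eapply exec_seq; eauto.
Qed.

Lemma Tri_conseq (P P' Q Q' : asrt) c : Tri P c Q ->
  (forall n T w rho m, P' n T w rho m -> P n T w rho m) ->
  (forall n T w rho m, Q n T w rho m -> Q' n T w rho m) -> Tri P' c Q'.
Proof.
  intros [C H] A B. exists C. intros n T w rho m HP. 
  destruct (H n T w rho m (A _ _ _ _ _ HP)) as (r & m' & wk & dp & E & HQ & X & Y).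
  exists r, m', wk, dp. auto 6.
Qed.

(* The memory is cut into regions of [MM n] words, far more than any table needs;
   region [t] is written by one phase only, which reads the regions before it. *)
Definition rg (n : nat) (m : mem) (t : nat) : nat -> nat :=
  fun i => if i <? MM n then m (t * MM n + i) else 0.

Lemma rg_at n m t i : i < MM n -> rg n m t i = m (t * MM n + i).
Proof. intros H. unfold rg. now rewrite (proj2 (Nat.ltb_lt _ _) H). Qed.

(** Since [rg] is cut off to 0 outside the region, a frame condition on cells becomes an equality of
    functions and transports any specification. *)
Lemma rg_ext n m m' t b : (forall a, a < b * MM n -> m' a = m a) -> t < b -> rg n m' t = rg n m t.
Proof.
  intros H Ht. apply functional_extensionality. intros i. unfold rg.
  destruct (Nat.ltb_spec i (MM n)); auto. apply H. nia.
Qed.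

Definition specs := nat -> list bool -> nat -> (nat -> nat) -> Prop.

Definition known (spec : specs) (t n : nat) (T : list bool) (m : mem) : Prop :=
  forall t', t' < t -> spec n T t' (rg n m t').

Definition Inv (spec : specs) (t : nat) : asrt := fun n T w rho m =>
  inst n T w /\ globs n w rho /\ known spec t n T m.

Definition gN := vv 0. Definition gL := vv 1. Definition gLL := vv 2. Definition gh := vv 3.
Definition gg_ := vv 4. Definition gD := vv 5. Definition gM := vv 6. Definition gH := vv 7.
Definition gNC := vv 8. Definition gT := vv 11. Definition gthr := vv 12. Definition gl := vv 13.
Definition uV := vv G. Definition tV := vv (G + 2).

Lemma inst_w n T w : inst n T w -> 1 <= w.
Proof. intros (H & _ & E). pose proof K0_pos. pose proof (lg_pos n). nia. Qed.

Lemma MM_pos n : 2 ^ 100 <= MM n.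
Proof. apply x_le_MM. pose proof (lg_pos n). lia. Qed.

(** The forms in which the word size is used: linear arithmetic treats the products of [MM n] as
    atoms. *)
Lemma sizes n T w : inst n T w -> 2 ^ w >= 64 * (MM n * MM n * MM n) /\ 2 ^ w >= 64 * (MM n * MM n)
   /\ 2 ^ w >= 64 * MM n /\ 64 <= MM n.
Proof.
  intros H. pose proof (M_sq w n T H) as E. pose proof (MM_pos n) as B.
  assert (64 <= MM n).
  { apply (Nat.le_trans _ (2 ^ 100)); auto. change 64 with (2 ^ 6). apply Nat.pow_le_mono_r; lia. }
  clear B. set (x := MM n) in *.
  assert (A2 : x * 1 <= x * x) by (apply Nat.mul_le_mono_l; lia).
  assert (A3 : x * x * 1 <= x * x * x) by (apply Nat.mul_le_mono_l; lia).
  assert (A4 : x * x * x * 64 <= x * x * x * x) by (apply Nat.mul_le_mono_l; lia).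
  assert (A8 : x * x * x * x * 1 <= x * x * x * x * (x * x * x * x)) by (apply Nat.mul_le_mono_l; nia).
  rewrite !Nat.mul_assoc in A8.
  splits; lia.
Qed.

Lemma globs_like n w rho : globs n w rho -> like n w (rho rT) rho.
Proof. intros; split; auto. Qed.

Lemma lg_lin : forall n, 1 <= n -> lg n * lg n <= 8 * n.
Proof.
  intros n Hn. pose proof (lg_low n Hn). set (x := lg n) in *.
  assert (x * x <= 4 * 2 ^ x); [|lia]. clearbody x. clear.
  destruct (Nat.le_gt_cases x 4) as [H|H].
  - assert (C : x = 0 \/ x = 1 \/ x = 2 \/ x = 3 \/ x = 4) by lia.
    repeat (destruct C as [->|C]; [simpl; lia|]). subst; simpl; lia.
  - replace x with (4 + (x - 4)) by lia. generalize (x - 4) as j. clear.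
    induction j; [simpl; lia|]. replace (4 + S j) with (S (4 + j)) by lia.
    rewrite (Nat.pow_succ_r' 2). nia.
Qed.

(** In the last premise the new region is an arbitrary function [a] of which only the written
    offsets are known, so a phase is verified without mention of the resulting memory. *)
Lemma scat_tri (spec : specs) (t : nat) (bnd cnt len off val : bld) (bndf cntf sizef : nat -> nat) :
  phase_wf (kk t *' gM) bnd cnt len (kk t *' gM +' off) val = true -> 1 <= t -> t < 64 ->
  (exists C, forall n, 1 <= n -> (cntf n + sizef n) * (bndf n + 1) * lg n <= C * n) ->
  (exists C, forall n, 1 <= n -> bndf n + 1 <= C * lg n) ->
  (forall n T w, inst n T w -> sizef n <= MM n /\ bndf n < 2 ^ w) ->
  (forall n T w m l b tau r, inst n T w -> like n w tau r ->
     evb w m l b r G bnd (bndf n) /\ evb w m l b r G cnt (cntf n)) ->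
  (forall n T w m, inst n T w -> known spec t n T m ->
     exists lenv offv,
     (forall u r, u < cntf n -> globs n w r -> r G = u ->
        evb w m (t * MM n) (bndf n) r (G + 1) len (lenv u)) /\
     (forall u v r, u < cntf n -> v < lenv u -> globs n w r -> r G = u -> r (G + 2) = v ->
        evb w m (t * MM n) (bndf n) r (G + 3) off (offv u v)) /\
     (forall u v, u < cntf n -> v < lenv u -> offv u v < sizef n) /\
     (forall u v u' v', u < cntf n -> v < lenv u -> u' < cntf n -> v' < lenv u' ->
       offv u v = offv u' v' -> u = u' /\ v = v') /\
     (forall a, (forall u v z, u < cntf n -> v < lenv u ->
        (forall r, globs n w r -> r G = u -> r (G + 2) = v ->
           evb w m (t * MM n) (bndf n) r (G + 4) val z) -> a (offv u v) = z) -> spec n T t a)) ->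
  Tri (Inv spec t) (phase (kk t *' gM) bnd cnt len (kk t *' gM +' off) val) (Inv spec (S t)).
Proof.
  intros HWF Ht1 Ht2 [C1 HC1] [C2 HC2] Hsz Hbc Hmain.
  set (K := phase_k (kk t *' gM) bnd cnt len (kk t *' gM +' off) val).
  exists (K * (C1 + 8 * C2)  + K * C2). intros n T w rho m (HI & HG & HK).
  pose proof (inst_w _ _ _ HI) as Hw. destruct (sizes _ _ _ HI) as (_ & Z2 & Z1 & _).
  destruct (Hsz n T w HI) as [Hs Hb].
  destruct (Hmain n T w m HI HK) as (lenv & offv & M1 & M2 & M3 & M4 & M5).
  pose proof (globs_like _ _ _ HG) as HL.
  assert (LM : forall r d l b tau, like n w tau r -> G <= d -> evb w m l b r d (kk t *' gM) (t * MM n)).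
  { intros r d l b tau [Hr _] Hd. assert (1 <= MM n) by apply pow2_pos. apply ev_mul.
    - apply ev_k. lia.
    - rewrite <- (g_M _ _ _ Hr). apply ev_v. unfold G in *. lia.
    - nia. }
  destruct (phase_ok n w (rho rT) (kk t *' gM) bnd cnt len (kk t *' gM +' off) val
    (t * MM n) (bndf n) (cntf n) lenv (fun u v => t * MM n + offv u v) (t * MM n) (sizef n) rho m)
    as (rho' & m' & wk & dp & E & HL' & A & F & B & D); auto.
  - intros r l b Hr. eapply LM; eauto.
  - intros r l b Hr. eapply Hbc; eauto.
  - intros r Hr. eapply Hbc; eauto.
  - intros u r Hu Hr Hru. apply M1; auto. apply Hr.
  - intros u v r Hu Hv Hr Hru Hrv. apply ev_add.
    + eapply LM; eauto. unfold G; lia.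
    + apply M2; auto. apply Hr.
    + specialize (M3 u v Hu Hv). nia.
  - intros u v Hu Hv. specialize (M3 u v Hu Hv). lia.
  - intros u v u' v' Hu Hv Hu' Hv' Huv. apply M4; auto. lia.
  - exists rho', m', wk, dp. splits; auto.
    + split; [auto|]. split; [apply HL'|]. intros t' Ht'.
      destruct (Nat.eq_dec t' t) as [->|Hne].
      * apply M5. intros u v z Hu Hv Hz. specialize (M3 u v Hu Hv). rewrite rg_at by lia.
        apply A; auto. intros r Hr. apply Hz. apply Hr.
      * rewrite (rg_ext n m m' t' t); [apply HK; lia| |lia].
        intros a Ha. apply F. intros; lia.
    + destruct HI as (Hn & _). specialize (HC1 n Hn). specialize (HC2 n Hn). fold K in B.
      (* The constant overhead of a phase, multiplied by its rounds, is [O(lg n)], and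
         [lg n * lg n <= 8 * n] makes it [O(n / lg n)]. *)
      pose proof (lg_lin n Hn). 
      assert (X : (cntf n + sizef n + 1) * (bndf n + 1) * lg n <= (C1 + 8 * C2) * n) by nia.
      apply (Nat.le_trans _ (K * ((cntf n + sizef n + 1) * (bndf n + 1)) * lg n)); [nia|].
      apply (Nat.le_trans _ (K * ((C1 + 8 * C2) * n))); [|nia].
      rewrite <- !Nat.mul_assoc. apply Nat.mul_le_mono_l. rewrite !Nat.mul_assoc in *. lia.
    + destruct HI as (Hn & _). specialize (HC2 n Hn). fold K in D. nia.
Qed.

Definition mapphase (t : nat) (bnd cnt val : bld) : cmd :=
  phase (kk t *' gM) bnd cnt (kk 1) (kk t *' gM +' uV) val.

Lemma map_tri (spec : specs) (t : nat) (bnd cnt val : bld) (bndf cntf : nat -> nat) :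
  phase_wf (kk t *' gM) bnd cnt (kk 1) (kk t *' gM +' uV) val = true -> 1 <= t -> t < 64 ->
  (exists C, forall n, 1 <= n -> cntf n * (bndf n + 1) * lg n <= C * n) ->
  (exists C, forall n, 1 <= n -> bndf n + 1 <= C * lg n) ->
  (forall n T w, inst n T w -> cntf n <= MM n /\ bndf n < 2 ^ w) ->
  (forall n T w m l b tau r, inst n T w -> like n w tau r ->
     evb w m l b r G bnd (bndf n) /\ evb w m l b r G cnt (cntf n)) ->
  (forall n T w m a, inst n T w -> known spec t n T m ->
     (forall u z, u < cntf n ->
        (forall r, globs n w r -> r G = u ->
           evb w m (t * MM n) (bndf n) r (G + 4) val z) -> a u = z) -> spec n T t a) ->
  Tri (Inv spec t) (mapphase t bnd cnt val) (Inv spec (S t)).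
Proof.
  intros HWF Ht1 Ht2 [C1 HC1] HC2 Hsz Hbc Hmain.
  apply scat_tri with (bndf := bndf) (cntf := cntf) (sizef := cntf); auto.
  { exists (2 * C1). intros n Hn. specialize (HC1 n Hn). nia. }
  intros n T w m HI HK. pose proof (inst_w _ _ _ HI) as Hw. pose proof (pow2_ge2 w Hw).
  exists (fun _ => 1), (fun u _ => u). splits.
  - intros. apply ev_k. lia.
  - intros u v r Hu Hv Hr Hru Hrv. rewrite <- Hru. apply ev_v. lia.
  - auto.
  - lia.
  - intros a Ha. apply (Hmain n T w m a); auto. intros u z Hu Hz. apply (Ha u 0); auto.
Qed.

(** * Bits, occurrences, bit fields *)

Definition cntb (f : nat -> bool) (n : nat) : nat := psum (fun i => Nat.b2n (f i)) n.

(* [s] counts from 1; the value is 0 if [f] has fewer than [s] true values below [b]. *)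
Fixpoint fsel (f : nat -> bool) (b s : nat) : nat :=
  match b with
  | 0 => 0
  | S b' => if f b' && (s =? S (cntb f b')) then b' else fsel f b' s
  end.

Lemma cntb_S f n : cntb f (S n) = cntb f n + Nat.b2n (f n).
Proof. reflexivity. Qed.

Lemma cntb_ext f g n : (forall i, i < n -> f i = g i) -> cntb f n = cntb g n.
Proof. intros H. apply psum_ext. intros i Hi. now rewrite H. Qed.

Lemma cntb_le f n : cntb f n <= n.
Proof. induction n; [auto|]. rewrite cntb_S. destruct (f n); simpl; lia. Qed.

Lemma cntb_mono f a b : a <= b -> cntb f a <= cntb f b.
Proof. induction 1; auto. rewrite cntb_S. lia. Qed.

Lemma psum_split f a b : psum f (a + b) = psum f a + psum (fun i => f (a + i)) b.
Proof. induction b; [rewrite Nat.add_0_r; simpl; lia|]. rewrite Nat.add_succ_r. simpl. lia. Qed.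

Lemma cntb_split f a b : cntb f (a + b) = cntb f a + cntb (fun i => f (a + i)) b.
Proof. unfold cntb. now rewrite psum_split. Qed.

Lemma cntb_lt f a b : f a = true -> a < b -> cntb f a < cntb f b.
Proof.
  intros Ha H. apply (Nat.lt_le_trans _ (cntb f (S a))); [rewrite cntb_S, Ha; simpl; lia|].
  now apply cntb_mono.
Qed.

Lemma cntb_inj f a b : f a = true -> f b = true -> cntb f a = cntb f b -> a = b.
Proof.
  intros A B E. destruct (Nat.lt_trichotomy a b) as [H|[H|H]]; auto.
  - pose proof (cntb_lt f a b A H). lia.
  - pose proof (cntb_lt f b a B H). lia.
Qed.

Lemma fsel_spec f b s : 1 <= s <= cntb f b ->
  fsel f b s < b /\ f (fsel f b s) = true /\ cntb f (fsel f b s) = s - 1.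
Proof.
  induction b; [unfold cntb; simpl; lia|]. rewrite cntb_S. intros H. cbn [fsel].
  destruct (f b) eqn:E; cbn [Nat.b2n andb] in *.
  - destruct (Nat.eqb_spec s (S (cntb f b))).
    + subst s. splits; auto; lia.
    + destruct IHb as (X & Y & Z); [lia|]. splits; auto; lia.
  - destruct IHb as (X & Y & Z); [lia|]. splits; auto; lia.
Qed.

Lemma fsel_unique f b s p : f p = true -> p < b -> cntb f p = s - 1 -> 1 <= s -> fsel f b s = p.
Proof.
  intros A B C D. pose proof (cntb_lt f p b A B).
  destruct (fsel_spec f b s) as (X & Y & Z); [lia|]. apply (cntb_inj f); auto; lia.
Qed.

Lemma fsel_lt f b s s' : 1 <= s -> s < s' -> s' <= cntb f b -> fsel f b s < fsel f b s'.
Proof.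
  intros A B C. destruct (fsel_spec f b s) as (X & Y & Z); [lia|].
  destruct (fsel_spec f b s') as (X' & Y' & Z'); [lia|].
  destruct (Nat.lt_ge_cases (fsel f b s) (fsel f b s')) as [|H]; auto.
  apply (cntb_mono f) in H. lia.
Qed.

(** The default [negb c] makes every position past the end of [T] a non-occurrence, for both
    bits. *)
Definition Bf (c : bool) (T : list bool) (p : nat) : bool := eqb (nth p T (negb c)) c.
Definition rk (c : bool) (T : list bool) (p : nat) : nat := cntb (Bf c T) p.
Definition bnd (c : bool) (T : list bool) (i : nat) : nat := if i =? 0 then 0 else select c T i.

Lemma Bf_out c T p : length T <= p -> Bf c T p = false.
Proof. intros H. unfold Bf. rewrite nth_overflow by auto. destruct c; auto. Qed.

Lemma Bf_neg c T p : p < length T -> Bf c T p = negb (Bf (negb c) T p).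
Proof.
  intros H. unfold Bf. rewrite negb_involutive, (nth_indep T (negb c) c H).
  destruct (nth p T c), c; reflexivity.
Qed.

Lemma psum_shift f n : psum f (S n) = f 0 + psum (fun i => f (S i)) n.
Proof. induction n; [simpl; lia|]. change (psum f (S n) + f (S n) = f 0 + (psum (fun i => f (S i)) n + f (S n))). lia. Qed.

Lemma count_cntb c T : count c T = cntb (Bf c T) (length T).
Proof.
  unfold count. induction T as [|x T IH]; auto.
  simpl length. unfold cntb. rewrite psum_shift. fold (cntb (fun i => Bf c (x :: T) (S i)) (length T)).
  change (cntb (fun i => Bf c (x :: T) (S i)) (length T)) with (cntb (Bf c T) (length T)).
  rewrite <- IH. unfold Bf. simpl. destruct (bool_dec x c); destruct x, c; simpl; auto; congruence.
Qed.

Lemma cntb_min c T p : cntb (Bf c T) p = cntb (Bf c T) (Nat.min p (length T)).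
Proof.
  destruct (Nat.le_gt_cases p (length T)); [now rewrite Nat.min_l|].
  rewrite Nat.min_r by lia. replace p with (length T + (p - length T)) by lia.
  rewrite cntb_split. replace (cntb (fun i => Bf c T (length T + i)) (p - length T)) with 0; [lia|].
  generalize (p - length T) as k. induction k; auto. rewrite cntb_S, <- IHk, Bf_out by lia. reflexivity.
Qed.

Lemma rank_rk c T i : rank c T i = rk c T (S i).
Proof.
  unfold rank, rk. rewrite count_cntb, length_firstn.
  rewrite (cntb_min c T (S i)). apply cntb_ext. intros p Hp. unfold Bf.
  rewrite nth_firstn. now rewrite (proj2 (Nat.ltb_lt _ _)) by lia.
Qed.

Lemma rank_skipn c T s i : rank c (skipn s T) i = rk c T (s + S i) - rk c T s.
Proof.
  rewrite rank_rk. unfold rk. rewrite cntb_split.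
  rewrite (cntb_ext (Bf c (skipn s T)) (fun i => Bf c T (s + i))); [lia|].
  intros p _. unfold Bf. now rewrite nth_skipn.
Qed.

Lemma filter_length f n : length (filter f (seq 0 n)) = cntb f n.
Proof.
  induction n; auto. rewrite seq_S, filter_app, length_app, IHn, cntb_S. simpl. destruct (f n); auto.
Qed.

Lemma filter_nth f n d k : k < cntb f n -> nth k (filter f (seq 0 n)) d = fsel f n (S k).
Proof.
  induction n; [unfold cntb; simpl; lia|]. rewrite cntb_S. intros H. rewrite seq_S, filter_app. simpl.
  destruct (Nat.eq_dec k (cntb f n)) as [E|E].
  - destruct (f n) eqn:F; [|simpl in H; lia]. rewrite app_nth2; rewrite filter_length; [|lia].
    rewrite E, Nat.sub_diag, Nat.eqb_refl. reflexivity.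
  - assert (k < cntb f n) by (destruct (f n); simpl in H; lia).
    rewrite app_nth1 by now rewrite filter_length.
    rewrite IHn by auto. rewrite (proj2 (Nat.eqb_neq k (cntb f n)) E), andb_false_r. reflexivity.
Qed.

Lemma select_fsel c T i : 1 <= i <= count c T -> select c T i = fsel (Bf c T) (length T) i.
Proof.
  intros H. rewrite count_cntb in H. unfold select, occurrences. fold (Bf c T).
  change (fun p => eqb (nth p T (negb c)) c) with (Bf c T).
  rewrite filter_nth by lia. f_equal. lia.
Qed.

Lemma select_out c T i : count c T < i -> select c T i = length T.
Proof.
  intros H. rewrite count_cntb in H. unfold select, occurrences. apply nth_overflow.
  change (fun p => eqb (nth p T (negb c)) c) with (Bf c T). rewrite filter_length. lia.
Qed.

Lemma testbit_bits s i : Nat.testbit (bits_val s) i = nth i s false.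
Proof.
  revert i. induction s as [|b s IH]; intros i; [destruct i; simpl; auto; apply Nat.bits_0|].
  simpl bits_val. destruct i.
  - simpl nth. rewrite Nat.add_comm. destruct b; simpl Nat.b2n.
    + apply Nat.testbit_odd_0.
    + rewrite Nat.add_0_r. apply Nat.testbit_even_0.
  - simpl nth. rewrite <- IH, Nat.add_comm. destruct b; simpl Nat.b2n.
    + apply Nat.testbit_odd_succ. lia.
    + rewrite Nat.add_0_r. apply Nat.testbit_even_succ. lia.
Qed.

Lemma bits_lt s : bits_val s < 2 ^ length s.
Proof. induction s as [|b s IH]; simpl; [lia|]. destruct b; simpl; lia. Qed.

Lemma testbit_high x k i : x < 2 ^ k -> k <= i -> Nat.testbit x i = false.
Proof.
  intros H K. destruct (Nat.eq_dec x 0) as [->|N]; [apply Nat.bits_0|].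
  apply Nat.bits_above_log2. apply Nat.log2_lt_pow2 in H; lia.
Qed.

Lemma bits_eq x y k : x < 2 ^ k -> y < 2 ^ k -> (forall i, i < k -> Nat.testbit x i = Nat.testbit y i) -> x = y.
Proof.
  intros A B H. apply Nat.bits_inj. intros i. destruct (Nat.lt_ge_cases i k); auto.
  now rewrite !(testbit_high _ k).
Qed.

Lemma testbit_glue lo hi o y : lo < 2 ^ o ->
  Nat.testbit (lo + hi * 2 ^ o) y = if y <? o then Nat.testbit lo y else Nat.testbit hi (y - o).
Proof.
  intros H. assert (2 ^ o <> 0) by (apply Nat.pow_nonzero; lia).
  destruct (Nat.ltb_spec y o).
  - rewrite <- (Nat.mod_pow2_bits_low _ o) by auto. rewrite Nat.Div0.mod_add, Nat.mod_small; auto.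
  - replace y with ((y - o) + o) at 1 by lia. rewrite <- Nat.div_pow2_bits, Nat.div_add by auto.
    now rewrite Nat.div_small.
Qed.

Definition isum (f : nat -> nat) (a b : nat) : nat := psum (fun t => f (a + t)) (b - a).

Lemma isum_nil f a b : b <= a -> isum f a b = 0.
Proof. intros H. unfold isum. now replace (b - a) with 0 by lia. Qed.

Lemma isum_split f a b c : a <= b -> b <= c -> isum f a c = isum f a b + isum f b c.
Proof.
  intros A B. unfold isum. replace (c - a) with ((b - a) + (c - b)) by lia. rewrite psum_split.
  f_equal. apply psum_ext. intros i _. f_equal. lia.
Qed.

Lemma isum_ext f g a b : (forall i, a <= i < b -> f i = g i) -> isum f a b = isum g a b.
Proof. intros H. apply psum_ext. intros i Hi. apply H. lia. Qed.

Lemma isum_S f a b : a <= b -> isum f a (S b) = isum f a b + f b.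
Proof.
  intros H. unfold isum. replace (S b - a) with (S (b - a)) by lia. simpl. f_equal. f_equal. lia.
Qed.

Lemma isum_zero f a b : (forall i, a <= i < b -> f i = 0) -> isum f a b = 0.
Proof.
  intros H. rewrite (isum_ext f (fun _ => 0)) by auto. unfold isum. now rewrite psum_const, Nat.mul_0_r.
Qed.

Lemma isum_bound f a b M : (forall i, a <= i < b -> f i <= M) -> isum f a b <= (b - a) * M.
Proof. intros H. unfold isum. rewrite <- psum_const. apply psum_le. intros i Hi. apply H. lia. Qed.

(* Disjoint bit fields never produce carries: a sum of fields in increasing order
   is their concatenation. *)
Lemma fields_sum (act : nat -> bool) (o wd v : nat -> nat) (a b : nat) :
  let f := fun i => if act i then v i * 2 ^ o i else 0 in
  (forall i, a <= i < b -> act i = true -> v i < 2 ^ wd i) ->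
  (forall i j, a <= i -> i < j -> j < b -> act i = true -> act j = true -> o i + wd i <= o j) ->
  (forall i t, a <= i < b -> act i = true -> t < wd i ->
     Nat.testbit (isum f a b) (o i + t) = Nat.testbit (v i) t) /\
  (forall y, Nat.testbit (isum f a b) y = true ->
     exists i, a <= i < b /\ act i = true /\ o i <= y < o i + wd i) /\
  (forall E, (forall i, a <= i < b -> act i = true -> o i + wd i <= E) -> isum f a b < 2 ^ E).
Proof.
  intros f. destruct (Nat.le_gt_cases b a) as [H|H].
  { rewrite isum_nil by lia. intros _ _. splits.
    - intros; lia.
    - intros y. rewrite Nat.bits_0. discriminate.
    - intros E _. pose proof (pow2_pos E). lia. }
  replace b with (a + (b - a)) by lia. generalize (b - a) as k. clear H b.
  induction k; intros Hv Ho.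
  { rewrite isum_nil by lia. splits.
    - intros; lia.
    - intros y. rewrite Nat.bits_0. discriminate.
    - intros E _. pose proof (pow2_pos E). lia. }
  destruct IHk as (I1 & I2 & I3).
  { intros; apply Hv; auto; lia. } { intros; apply Ho; auto; lia. }
  replace (a + S k) with (S (a + k)) in * by lia. rewrite isum_S by lia.
  set (S0 := isum f a (a + k)) in *. unfold f at 1 2 3. destruct (act (a + k)) eqn:E.
  (* The third claim of the induction hypothesis, with the offset of the new field as [E]: it is
     what makes the addition free of carries. *)
  - assert (L : S0 < 2 ^ o (a + k)) by (apply I3; intros; apply Ho; auto; lia).
    splits.
    + intros i t Hi Ai Ht. rewrite testbit_glue by auto.
      destruct (Nat.eq_dec i (a + k)) as [->|N].
      * rewrite (proj2 (Nat.ltb_ge _ _)) by lia. f_equal. lia.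
      * specialize (Ho i (a + k) ltac:(lia) ltac:(lia) ltac:(lia) Ai E).
        rewrite (proj2 (Nat.ltb_lt _ _)) by lia. apply I1; auto; lia.
    + intros y. rewrite testbit_glue by auto. destruct (Nat.ltb_spec y (o (a + k))).
      * intros B. destruct (I2 y B) as (i & Hi & X). exists i. split; auto; lia.
      * intros B. exists (a + k). splits; auto; try lia.
        destruct (Nat.lt_ge_cases (y - o (a + k)) (wd (a + k))); [lia|].
        rewrite (testbit_high _ (wd (a + k))) in B; auto; [discriminate|]. apply Hv; auto; lia.
    + intros E' HE. specialize (HE (a + k) ltac:(lia) E).
      specialize (Hv (a + k) ltac:(lia) E).
      apply (Nat.lt_le_trans _ (2 ^ (o (a + k) + wd (a + k)))); [|apply Nat.pow_le_mono_r; lia].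
      rewrite Nat.pow_add_r. nia.
  - rewrite Nat.add_0_r. splits.
    + intros i t Hi Ai Ht. apply I1; auto. assert (i <> a + k) by congruence. lia.
    + intros y B. destruct (I2 y B) as (i & Hi & X). exists i. split; auto; lia.
    + intros E' HE. apply I3. intros; apply HE; auto; lia.
Qed.

(** * Contents of the memory regions *)

Definition arr_spec := (nat -> nat) -> Prop.

Definition s_input (n : nat) (T : list bool) : arr_spec := fun a =>
  forall k, k * lg n < n -> a k = bits_val (firstn (lg n) (skipn (k * lg n) T)).
(** Ranks of 0, obtained from the number of ones. The same region is the lookup table of the final
    rank structure. *)
Definition s_rank (n : nat) : arr_spec := fun a =>
  forall x i, x < 2 ^ hh n -> i < hh n -> a (x * hh n + i) = i + 1 - cntb (Nat.testbit x) (i + 1).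
Definition s_sel (n : nat) : arr_spec := fun a =>
  forall x s, x < 2 ^ hh n -> 1 <= s <= cntb (Nat.testbit x) (hh n) ->
    a (x * hh n + (s - 1)) = fsel (Nat.testbit x) (hh n) s.
Definition pack_idx (D x s d mm b : nat) : nat := (((x * D + s) * D + d) * D + mm) * D + b.
(** Positions of occurrences in arithmetic progression, packed into fields of [b] bits. A step [d]
    equal to the sub-range size serves the sub-range locations, the step 1 serves the sub-range
    answers. *)
Definition s_pack (n : nat) : arr_spec := fun a =>
  let D := DD n in
  forall x s d mm b, x < 2 ^ hh n -> s < D -> d < D -> mm < D -> b < D ->
    1 <= s -> 1 <= mm <= hh n -> s + (mm - 1) * d <= cntb (Nat.testbit x) (hh n) ->
    2 ^ (mm * b) <= MM n ->
    a (pack_idx D x s d mm b) = psum (fun t => fsel (Nat.testbit x) (hh n) (s + t * d) * 2 ^ (t * b)) mm.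
Definition s_lg (n : nat) : arr_spec := fun a => forall r, r < thr n -> a r = lg r.
(** The weight [wt4] of occurrence [s + e] of a chunk with contents [x], for sub-ranges that begin
    at occurrence [s] and lie inside the chunk. The position of the chunk matters only through its
    residue [cc] modulo [lg n * LL n], because offsets are counted within a word; this keeps the
    table small. *)
Definition sub_term (n x s br cc e : nat) : nat :=
  let g' := br * LL n in
  let f := Nat.testbit x in
  let p0 := fsel f (hh n) (s + e / g' * g') in
  let p1 := fsel f (hh n) (s + (e / g' + 1) * g') in
  let b' := lg (p1 - p0) in
  if b' * br * LL n ^ 2 <=? p1 - p0 then
    (fsel f (hh n) (s + e) - p0) *
    2 ^ (ceil_div (cc + p0) (LL n) mod lg n + e mod g' * b')
  else 0.
Definition s_sub (n : nat) : arr_spec := fun a =>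
  let D := DD n in
  forall x s mj br cc, x < 2 ^ hh n -> s < D -> mj < D -> br < D -> cc < D ->
    1 <= s -> 1 <= br -> s + mj * (br * LL n) <= cntb (Nat.testbit x) (hh n) ->
    a (pack_idx D x s mj br cc) = psum (sub_term n x s br cc) (mj * (br * LL n)).

Section Weights.
Context (c : bool) (T : list bool).
Let n := length T.

Definition rlen (k : nat) : nat := bnd c T (S k * gg n) - bnd c T (k * gg n).
Definition short (k : nat) : bool := rlen k <? thr n.
Definition lgr (k : nat) : nat := lg (rlen k).
Definition gp (k : nat) : nat := lgr k * LL n.
(* The word of sub-range locations of a range is the sum over its occurrences of
   [wt1]: the first occurrence of each sub-range contributes its field. *)
Definition wt1 (i : nat) : nat :=
  let k := i / gg n in
  if short k && ((i - k * gg n) mod gp k =? 0) then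
    (bnd c T i - bnd c T (k * gg n)) * 2 ^ ((i - k * gg n) / gp k * lgr k)
  else 0.
(* The sub-range of occurrence [i] consists of the occurrences [sidx i], ..., [nidx i - 1]. *)
Definition sidx (i : nat) : nat :=
  let k := i / gg n in
  if short k then k * gg n + (i - k * gg n) / gp k * gp k else k * gg n.
Definition nidx (i : nat) : nat :=
  let k := i / gg n in
  if short k then Nat.min (sidx i + gp k) (S k * gg n) else S k * gg n.
Definition slen (i : nat) : nat := bnd c T (nidx i) - bnd c T (sidx i).
(** Only occurrences in a long sub-range of a short range contribute to the stream of sub-range
    answers. *)
Definition act4 (i : nat) : bool :=
  short (i / gg n) && (lg (slen i) * lgr (i / gg n) * LL n ^ 2 <=? slen i).
Definition off4 (i : nat) : nat :=
  ceil_div (bnd c T (sidx i)) (LL n) mod lg n + (i - sidx i) * lg (slen i).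
(* The contribution of occurrence [i] to the stream of sub-range answers, relative
   to the word in which the answers of its sub-range begin. *)
Definition wt4 (i : nat) : nat :=
  if act4 i then (bnd c T i - bnd c T (sidx i)) * 2 ^ off4 i else 0.

(** The summation runs from [k * gg n] to [S k * gg n - 1], cut down to the occurrence numbers that
    exist; [rk_bnd] shows that the ranks perform this cut. *)
Definition rec1 (k : nat) : nat :=
  isum wt1 (rk c T (bnd c T (k * gg n)) + 1) (rk c T (bnd c T (S k * gg n)) + 1).
(* The occurrences of the sub-ranges whose answers begin in word [o] are those at
   the positions from [pbw o] to [pbw (S o) - 1].  Their answers, [rec4 o], extend
   over at most [spill n] words; [sword o] collects the parts that fall in word [o]. *)
Definition pbw (o : nat) : nat :=
  if o =? 0 then 0 else bnd c T (nidx (rk c T (Nat.min n (LL n * (o * lg n - 1) + 1)))).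
Definition rec4 (o : nat) : nat := isum wt4 (rk c T (pbw o) + 1) (rk c T (pbw (S o)) + 1).
Definition spill (m : nat) : nat := 16 * LL m ^ 3 / lg m + 2.
Definition sword (o : nat) : nat :=
  iter_up (spill n) (fun z acc => Nat.lor acc (if o <? z then 0 else rec4 (o - z) / 2 ^ (z * lg n))) 0.
End Weights.

(** A chunk may inquire about range [n / gg n + 1], whose right boundary has index
    [n / gg n + 2]. *)
Definition nk (n : nat) : nat := n / gg n + 3.
Definition nom (n : nat) : nat := n / gg n + 3.

Section Specs.
Context (c : bool) (n : nat) (T : list bool).

Definition s_chunk : arr_spec := fun a => forall v, v < NC n ->
  a v < 2 ^ hh n /\ forall t, t < hh n -> Nat.testbit (a v) t = Bf c T (v * hh n + t).
Definition s_leaf0 : arr_spec := fun a => forall v, v < NC n ->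
  a v = rk c T (S v * hh n) - rk c T (v * hh n).
Definition s_cnt : arr_spec := fun a => forall v, v < NC n -> a v = rk c T (v * hh n).
Definition s_raw : arr_spec := fun a => forall k, 1 <= k -> k * gg n <= count c T ->
  a k = select c T (k * gg n).
Definition s_loc : arr_spec := fun a => forall k, k < nk n -> a k = bnd c T (k * gg n).
Definition s_ans : arr_spec := fun a => forall k i, k <= count c T / gg n -> thr n <= rlen c T k ->
  k * gg n <= i < S k * gg n -> 1 <= i <= count c T ->
  a (ceil_div (bnd c T (k * gg n)) (gg n) + (i - k * gg n)) = select c T i.
Definition s_leaf (wt : nat -> nat) : arr_spec := fun a => forall v, v < NC n ->
  a v = isum wt (rk c T (v * hh n) + 1) (rk c T (S v * hh n) + 1).
Definition s_scan (wt : nat -> nat) : arr_spec := fun a => forall v, v < NC n ->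
  a v = isum wt 1 (rk c T (v * hh n) + 1).
Definition s_rec : arr_spec := fun a => forall k, S k < nk n -> a k = rec1 c T k.
Definition s_subloc : arr_spec := fun a => forall k, S k < nk n ->
  a (2 * k) = rec1 c T k /\ a (2 * k + 1) = rec1 c T k / 2 ^ lg n.
Definition s_pb : arr_spec := fun a => forall o, o < S (nom n) -> a o = pbw c T o.
Definition s_w4p : arr_spec := fun a => forall o, o < S (nom n) ->
  a o = isum (wt4 c T) 1 (rk c T (pbw c T o) + 1).
Definition s_rec4 : arr_spec := fun a => forall o, o < nom n -> a o = rec4 c T o.
Definition s_subans : arr_spec := fun a => forall o, o < nom n -> a o = sword c T o.
Definition s_seltab : arr_spec := fun a => forall s i, length s <= ll n -> 1 <= i <= count c s ->
  a (bits_val s * ll n + (i - 1)) = select c s i.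

(** For the scratch regions of a scan, about which nothing is promised afterwards. *)
Definition s_any : arr_spec := fun _ => True.
Definition per_bit : list arr_spec :=
  [s_chunk; s_leaf0; s_any; s_any; s_cnt; s_raw; s_loc; s_ans;
   s_leaf (wt1 c T); s_any; s_any; s_scan (wt1 c T); s_rec; s_subloc;
   s_leaf (wt4 c T); s_any; s_any; s_scan (wt4 c T); s_pb; s_w4p; s_rec4; s_subans; s_seltab].

Definition s_ranges : arr_spec := fun a => forall k, k * lg n ^ 2 < n ->
  a k = rank false T (Nat.min (S k * lg n ^ 2) n - 1).
Definition rfield (j : nat) : nat :=
  rk false T (Nat.min (S j * lg n) n) - rk false T (j / lg n * lg n ^ 2).
Definition rb : nat := 2 * LL n + 1.
Definition s_subranges : arr_spec := fun a => forall j i, j * lg n < n -> i < rb ->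
  Nat.testbit (a ((j * rb + i) / lg n)) ((j * rb + i) mod lg n) = Nat.testbit (rfield j) i.
End Specs.

(* The contents of the regions, in the order in which they are computed. *)
Definition spec : specs := fun n T t =>
  nth t ([s_input n T; s_rank n; s_sel n; s_pack n; s_lg n; s_sub n]
         ++ per_bit true n T ++ per_bit false n T ++ [s_ranges n T; s_subranges n T]) s_any.

(** Six common regions precede the 23 regions of each bit. *)
Definition off (c : bool) : nat := if c then 6 else 29.

Lemma spec_off c n T j : j < 23 -> spec n T (off c + j) = nth j (per_bit c n T) s_any.
Proof. intros H. unfold spec, off. destruct c; do 23 (destruct j as [|j]; [reflexivity|]); lia. Qed.

(** * Lookup tables *)

Definition Wd (n w : nat) (r : env) (d : nat) : Prop := globs n w r /\ G <= d.

Lemma Wd_ext n w r d r' d' : ext r d r' d' -> Wd n w r d -> Wd n w r' d'.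
Proof.
  intros [A B] [H D]. split; [|lia]. destruct H.
  constructor; rewrite B; auto; unfold G, rBND in *; lia.
Qed.

Section Globs.
Context (n w : nat) (m : mem) (lim bnd : nat) (r : env) (d : nat).
Hypothesis H : Wd n w r d.
Lemma ev_glob x v : r x = v -> x < G -> evb w m lim bnd r d (vv x) v.
Proof. intros <- Hx. apply ev_v. destruct H as [_ Hd]. lia. Qed.
Lemma ev_gN : evb w m lim bnd r d gN n. Proof. apply ev_glob; [apply H|unfold G; lia]. Qed.
Lemma ev_gL : evb w m lim bnd r d gL (lg n). Proof. apply ev_glob; [apply H|unfold G; lia]. Qed.
Lemma ev_gLL : evb w m lim bnd r d gLL (LL n). Proof. apply ev_glob; [apply H|unfold G; lia]. Qed.
Lemma ev_gh : evb w m lim bnd r d gh (hh n). Proof. apply ev_glob; [apply H|unfold G; lia]. Qed.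
Lemma ev_gg : evb w m lim bnd r d gg_ (gg n). Proof. apply ev_glob; [apply H|unfold G; lia]. Qed.
Lemma ev_gD : evb w m lim bnd r d gD (DD n). Proof. apply ev_glob; [apply H|unfold G; lia]. Qed.
Lemma ev_gM : evb w m lim bnd r d gM (MM n). Proof. apply ev_glob; [apply H|unfold G; lia]. Qed.
Lemma ev_gH : evb w m lim bnd r d gH (HH n). Proof. apply ev_glob; [apply H|unfold G; lia]. Qed.
Lemma ev_gNC : evb w m lim bnd r d gNC (NC n). Proof. apply ev_glob; [apply H|unfold G; lia]. Qed.
Lemma ev_gthr : evb w m lim bnd r d gthr (thr n). Proof. apply ev_glob; [apply H|unfold G; lia]. Qed.
Lemma ev_gl : evb w m lim bnd r d gl (ll n). Proof. apply ev_glob; [apply H|unfold G; lia]. Qed.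
End Globs.

(** Transports all evaluation facts along the extension [He] and then forgets it, so that after each
    binder a single environment is in play. *)
Ltac lift He :=
  repeat match type of He with ext ?r ?d ?r' ?d' =>
    match goal with
    | H : evb _ _ _ _ r d _ _ |- _ => apply (evb_mono _ _ _ _ _ _ _ _ _ _ He) in H
    | H : Wd _ _ r d |- _ => apply (Wd_ext _ _ _ _ _ _ He) in H
    end end; clear He.

Definition arr (t : nat) (a : bld) : bld := ld (kk t *' gM +' a).

Lemma ev_arr n T w m lim bnd r d t a i : inst n T w -> Wd n w r d ->
  evb w m lim bnd r d a i -> i < MM n -> S t * MM n <= lim -> t < 64 ->
  evb w m lim bnd r d (arr t a) (rg n m t i).
Proof.
  intros HI HW Ha Hi Hlim Ht. pose proof (sizes _ _ _ HI) as (_ & Z2 & Z1 & Z0).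
  rewrite rg_at by auto. apply ev_ld; [|lia]. apply ev_add; [|exact Ha|nia].
  apply ev_mul; [apply ev_k; lia|apply ev_gM with (1 := HW)|nia].
Qed.

Lemma ev_varG w m lim bnd r x v d : r x = v -> x < d -> evb w m lim bnd r d (vv x) v.
Proof. intros <- H. now apply ev_v. Qed.

Definition bitm (x t : bld) : bld := (x >>' t) %' kk 2.

Lemma ev_bit w m lim bnd r d x t vx vt : evb w m lim bnd r d x vx -> evb w m lim bnd r d t vt ->
  vx < 2 ^ w -> 2 < 2 ^ w -> evb w m lim bnd r d (bitm x t) (Nat.b2n (Nat.testbit vx vt)).
Proof.
  intros X T A B. eapply ev_eq.
  - eapply ev_mod; [eapply ev_shr; eauto|apply ev_k; auto|].
    pose proof (Nat.Div0.div_le_upper_bound vx (2 ^ vt) vx). pose proof (pow2_pos vt). nia.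
  - symmetry. apply Nat.testbit_spec'.
Qed.

(** Chooses the rule by the head of the expression; the conditions that exclude overflow are left
    over for linear arithmetic. *)
Ltac ev1 :=
  lazymatch goal with
  | |- _ -> evb _ _ _ _ _ _ _ _ => intro
  | |- evb _ _ _ _ _ _ ?e _ =>
    lazymatch e with
    | bop Add _ _ => eapply ev_add
    | bop Sub _ _ => eapply ev_sub
    | bop Mul _ _ => eapply ev_mul
    | bop Div _ _ => eapply ev_div
    | bop Mod _ _ => eapply ev_mod
    | bop Shl _ _ => eapply ev_shl
    | bop Shr _ _ => eapply ev_shr
    | bop Or _ _ => eapply ev_or
    | bitm _ _ => eapply ev_bit
    | kk _ => eapply ev_k
    | gN => eapply ev_gN; eassumption
    | gL => eapply ev_gL; eassumption
    | gLL => eapply ev_gLL; eassumption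
    | gh => eapply ev_gh; eassumption
    | gg_ => eapply ev_gg; eassumption
    | gD => eapply ev_gD; eassumption
    | gM => eapply ev_gM; eassumption
    | gH => eapply ev_gH; eassumption
    | gNC => eapply ev_gNC; eassumption
    | gthr => eapply ev_gthr; eassumption
    | gl => eapply ev_gl; eassumption
    | if_ (bop Lt _ _) _ _ => eapply ev_if_lt; [assumption| | | |]
    | if_ (bop Eq _ _) _ _ => eapply ev_if_eq; [assumption| | | |]
    | arr _ _ => eapply ev_arr; [eassumption|eassumption| | | |]
    | _ => eassumption
    end
  end.

Lemma iter_inv k F v (P : nat -> nat -> Prop) : P 0 v ->
  (forall i acc, i < k -> P i acc -> P (S i) (F i acc)) -> P k (iter_up k F v).
Proof.
  intros H0 HS. assert (H : forall j, j <= k -> P j (iter_up j F v)).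
  { induction j; simpl; intros; auto. apply HS; [lia|]. apply IHj. lia. }
  apply H. auto.
Qed.

Lemma iter_psum k g mm : mm <= k ->
  iter_up k (fun t acc => if t <? mm then acc + g t else acc) 0 = psum g mm.
Proof.
  intros H. assert (A : forall j, iter_up j (fun t acc => if t <? mm then acc + g t else acc) 0 = psum g (Nat.min j mm)).
  { induction j; auto. simpl iter_up. rewrite IHj. destruct (Nat.ltb_spec j mm).
    - rewrite !Nat.min_l by lia. reflexivity.
    - now rewrite !Nat.min_r by lia. }
  rewrite A. now rewrite Nat.min_r.
Qed.

(** The exponent [hh n] is about half of [lg n], which leaves room for a factor [2 ^ (lg n / 3)]; it
    absorbs the polylogarithmic factor by [poly_exp]. *)
Lemma table_cost a : exists C, forall n, 1 <= n -> 2 ^ hh n * lg n ^ a <= C * n.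
Proof.
  destruct (poly_exp a 3 ltac:(lia)) as [C HC]. exists (4 * C). intros n Hn.
  pose proof (hh_bounds n) as (A & B & E & F). pose proof (pow_L_le n Hn).
  specialize (HC (lg n)). assert (hh n + lg n / 3 <= S (lg n)).
  { pose proof (Nat.div_mod_eq (lg n) 3). lia. }
  assert (2 ^ hh n * 2 ^ (lg n / 3) <= 2 * 2 ^ lg n).
  { rewrite <- Nat.pow_add_r, <- Nat.pow_succ_r'. apply Nat.pow_le_mono_r; lia. }
  set (X := lg n ^ a) in *. set (Y := 2 ^ (lg n / 3)) in *. set (Z := 2 ^ hh n) in *.
  apply (Nat.le_trans _ (Z * (C * Y))); [apply Nat.mul_le_mono_l; auto|]. nia.
Qed.

Lemma small_facts n : 2 ^ hh n <= MM n /\ lg n <= MM n /\ hh n <= MM n /\ DD n <= MM n /\ 2 ^ hh n * DD n ^ 4 <= MM n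
  /\ thr n <= MM n /\ 2 ^ lg n <= MM n /\ 4 * LL n * LL n < DD n /\ hh n < DD n /\ 4 * LL n < DD n
  /\ lg n * LL n < DD n /\ thr n <= 2 ^ (4 * LL n).
Proof.
  pose proof (hh_bounds n) as (A & B & E & F). pose proof (LL_pos n). pose proof (LL_le_L n).
  pose proof (le_pow2 (lg n)).
  assert (HD : DD n <= 2 ^ (3 + 2 * lg n)).
  { unfold DD. rewrite Nat.pow_add_r. replace (2 * lg n) with (lg n + lg n) by lia. rewrite Nat.pow_add_r.
    change (2 ^ 3) with 8. rewrite Nat.mul_assoc. nia. }
  assert (T1 : thr n <= 2 ^ (4 * LL n)).
  { unfold thr. replace (4 * LL n) with (LL n * 2 + LL n * 2) by lia.
    rewrite Nat.pow_add_r, !Nat.pow_mul_r. pose proof (lg_up (lg n)). fold (LL n) in *.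
    pose proof (le_pow2 (LL n)). apply Nat.mul_le_mono; apply Nat.pow_le_mono_l; lia. }
  assert (L1 : 1 <= lg n) by apply lg_pos.
  splits.
  - apply x_le_MM; lia.
  - etransitivity; [|apply (x_le_MM n (lg n)); lia]. lia.
  - etransitivity; [|apply (x_le_MM n (lg n)); lia]. lia.
  - etransitivity; [exact HD|apply x_le_MM; lia].
  - apply (Nat.le_trans _ (2 ^ hh n * (2 ^ (3 + 2 * lg n)) ^ 4)).
    + apply Nat.mul_le_mono_l, Nat.pow_le_mono_l, HD.
    + rewrite <- Nat.pow_mul_r, <- Nat.pow_add_r. apply x_le_MM. lia.
  - etransitivity; [exact T1|apply x_le_MM; lia].
  - apply x_le_MM; lia.
  - unfold DD. nia.
  - unfold DD. nia.
  - unfold DD. nia.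
  - unfold DD. nia.
  - exact T1.
Qed.

Definition p_rank : cmd :=
  mapphase 1 gh ((kk 1 <<' gh) *' gh)
    (LET x := uV /' gh IN LET i := uV %' gh IN
     for_ (kk 0) (fun acc t => if_ (t <' (i +' kk 1)) (acc +' (kk 1 -' bitm x t)) acc)).

Ltac szs HI := let Z3 := fresh "Z3" in let Z2 := fresh "Z2" in let Z1 := fresh "Z1" in let Z0 := fresh "Z0" in
  pose proof (sizes _ _ _ HI) as (Z3 & Z2 & Z1 & Z0).

Ltac world n w r Hr d HU u :=
  let W := fresh "W" in
  assert (W : Wd n w r d) by (split; [exact Hr|unfold G; lia]);
  match goal with |- evb ?w ?m ?lim ?bnd _ _ _ _ =>
    assert (evb w m lim bnd r d uV u) by (apply ev_varG; [exact HU|unfold G; lia]) end.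

Lemma b2n_le1 b : Nat.b2n b <= 1.
Proof. destruct b; simpl; lia. Qed.

Lemma divmod_idx x h i : i < h -> (x * h + i) / h = x /\ (x * h + i) mod h = i.
Proof.
  intros H. split.
  - rewrite Nat.div_add_l by lia. rewrite Nat.div_small by lia. lia.
  - rewrite Nat.add_comm, Nat.Div0.mod_add, Nat.mod_small; auto.
Qed.

Lemma tri_rank : Tri (Inv spec 1) p_rank (Inv spec 2).
Proof.
  apply map_tri with (bndf := hh) (cntf := fun n => 2 ^ hh n * hh n); try lia; try reflexivity.
  - destruct (table_cost 3) as [C HC]. exists (2 * C). intros n Hn. specialize (HC n Hn).
    pose proof (hh_bounds n). 
    assert (A : hh n * (hh n + 1) * lg n <= lg n * (2 * lg n) * lg n) by (repeat apply Nat.mul_le_mono; lia).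
    replace (lg n ^ 3) with (lg n * lg n * lg n) in HC by (simpl; ring). nia.
  - exists 2. intros n Hn. pose proof (hh_bounds n). lia.
  - intros n T w HI. szs HI. pose proof (small_facts n) as (S1 & S2 & S3 & S4 & S5 & _ & _ & _ & S9 & _).
    split; [|lia]. etransitivity; [|exact S5]. apply Nat.mul_le_mono_l.
    apply (Nat.le_trans _ (DD n ^ 1)); [rewrite Nat.pow_1_r; lia|apply Nat.pow_le_mono_r; lia].
  - intros n T w m l b tau r HI [HL _]. szs HI.
    pose proof (small_facts n) as (S1 & S2 & S3 & S4 & S5 & _).
    assert (W : Wd n w r G) by (split; auto). split; [apply ev_gh with (1 := W)|].
    eapply ev_eq; [repeat (ev1)|]. all: try lia; try nia.
  - intros n T w m a HI HK Ha. szs HI. pose proof (inst_w _ _ _ HI) as Hw.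
    pose proof (small_facts n) as (S1 & S2 & S3 & S4 & S5 & _).
    intros x i Hx Hi. apply Ha; [nia|]. intros r Hr HU. world n w r Hr (G + 4) HU (x * hh n + i).
    pose proof (divmod_idx x (hh n) i Hi) as [D1 D2].
    assert (HB : x * hh n + i < 2 ^ w) by nia.
    eapply ev_let; [eapply ev_eq; [repeat ev1|exact D1]; auto|].
    intros r1 d1 X E1 HX. lift E1.
    eapply ev_let; [eapply ev_eq; [repeat ev1|exact D2]; auto|].
    intros r2 d2 I E2 HI2. lift E2.
    set (F := fun t acc => if t <? i + 1 then acc + (1 - Nat.b2n (Nat.testbit x t)) else acc).
    assert (FI : forall k, iter_up k F 0 = Nat.min k (i + 1) - cntb (Nat.testbit x) (Nat.min k (i + 1))).
    { induction k; auto. simpl iter_up. rewrite IHk. unfold F at 1.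
      destruct (Nat.ltb_spec k (i + 1)).
      - rewrite !Nat.min_l by lia. rewrite cntb_S. pose proof (cntb_le (Nat.testbit x) k).
        destruct (Nat.testbit x k); cbn [Nat.b2n]; lia.
      - now rewrite !Nat.min_r by lia. }
    eapply ev_eq; [eapply (ev_for w m _ _ r2 d2 (kk 0) _ 0 F)|].
    + apply ev_k. lia.
    + intros r3 d3 acc t vt E3 Ht HA HT. lift E3. rewrite FI in *. unfold F.
      pose proof (cntb_le (Nat.testbit x) (Nat.min vt (i + 1))).
      repeat ev1; auto; try lia. apply b2n_le1.
    + rewrite FI. now rewrite Nat.min_r by lia.
Qed.

(** One accumulator encodes two states: values up to [W] count the occurrences still to be passed,
    larger values are [W + 1] plus the position found. *)
Definition selm (W : bld) (c : bool) (x s : bld) : bld :=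
  LET r := for_ s (fun acc t =>
     if_ (W <' acc) acc
       (if_ (bitm x t =' kk (Nat.b2n c)) (if_ (acc =' kk 1) (W +' kk 1 +' t) (acc -' kk 1)) acc)) IN
  r -' (W +' kk 1).

Lemma sel_iter (c : bool) (x W s k : nat) : 1 <= s <= W -> k <= W ->
  let f := fun t => eqb (Nat.testbit x t) c in
  iter_up k (fun t acc => if W <? acc then acc else
      if Nat.b2n (Nat.testbit x t) =? Nat.b2n c then (if acc =? 1 then W + 1 + t else acc - 1) else acc) s =
  if s <=? cntb f k then W + 1 + fsel f k s else s - cntb f k.
Proof.
  intros Hs Hk f. induction k.
  - simpl iter_up. unfold cntb at 1. simpl psum. rewrite (proj2 (Nat.leb_gt s 0)) by lia. unfold cntb; simpl; lia.
  - simpl iter_up. rewrite IHk by lia. rewrite !cntb_S. cbn [fsel].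
    assert (E : (Nat.b2n (Nat.testbit x k) =? Nat.b2n c) = f k).
    { unfold f. destruct (Nat.testbit x k), c; reflexivity. }
    rewrite E. destruct (Nat.leb_spec s (cntb f k)).
    + rewrite (proj2 (Nat.ltb_lt W _)) by lia.
      rewrite (proj2 (Nat.leb_le s _)) by lia.
      rewrite (proj2 (Nat.eqb_neq s (S (cntb f k)))) by lia. now rewrite andb_false_r.
    + rewrite (proj2 (Nat.ltb_ge W _)) by lia. destruct (f k); cbn [Nat.b2n andb].
      * destruct (Nat.eqb_spec (s - cntb f k) 1).
        -- rewrite (proj2 (Nat.leb_le s _)) by lia. rewrite (proj2 (Nat.eqb_eq s _)) by lia. lia.
        -- rewrite (proj2 (Nat.leb_gt s _)) by lia. lia.
      * rewrite (proj2 (Nat.leb_gt s _)) by lia. lia.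
Qed.

Lemma ev_selm n T w m lim W Wv c x xv s sv r d : inst n T w ->
  (forall r' d', ext r d r' d' -> evb w m lim Wv r' d' W Wv) -> Wv <= MM n ->
  evb w m lim Wv r d x xv -> evb w m lim Wv r d s sv -> xv < 2 ^ w ->
  1 <= sv <= cntb (fun t => eqb (Nat.testbit xv t) c) Wv ->
  evb w m lim Wv r d (selm W c x s) (fsel (fun t => eqb (Nat.testbit xv t) c) Wv sv).
Proof.
  intros HI HW HM Hx Hs Hxw Hsv. szs HI. pose proof (inst_w _ _ _ HI) as Hw.
  set (f := fun t => eqb (Nat.testbit xv t) c) in *.
  assert (HsW : 1 <= sv <= Wv) by (pose proof (cntb_le f Wv); lia).
  pose proof (fsel_spec f Wv sv Hsv) as (F1 & F2 & F3).
  eapply ev_let.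
  - set (F := fun t acc => if Wv <? acc then acc else
        if Nat.b2n (Nat.testbit xv t) =? Nat.b2n c then (if acc =? 1 then Wv + 1 + t else acc - 1) else acc).
    eapply ev_eq; [eapply (ev_for w m lim Wv r d s _ sv F)|].
    + exact Hs.
    + intros r1 d1 acc t vt E1 Ht HA HT. specialize (HW r1 d1 E1). lift E1.
      unfold F in HA |- *. rewrite sel_iter in HA |- * by lia. fold f in HA |- *.
      assert (HB : 1 <= (if sv <=? cntb f vt then Wv + 1 + fsel f vt sv else sv - cntb f vt) < 2 ^ w).
      { destruct (Nat.leb_spec sv (cntb f vt)); [|lia]. pose proof (fsel_spec f vt sv ltac:(lia)). lia. }
      set (av := if sv <=? cntb f vt then _ else _) in *. clearbody av.
      repeat ev1; auto; try lia.
      all: try (destruct c; simpl; lia).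
    + unfold F. rewrite sel_iter by lia. fold f. rewrite (proj2 (Nat.leb_le _ _)) by lia. reflexivity.
  - intros r1 d1 rr E1 HR. specialize (HW r1 d1 E1). lift E1.
    eapply ev_eq; [repeat ev1|]; auto; try lia.
Qed.

Definition p_sel : cmd :=
  mapphase 2 gh ((kk 1 <<' gh) *' gh)
    (LET x := uV /' gh IN LET i := uV %' gh +' kk 1 IN selm gh true x i).

Lemma fsel_ext f g b s : (forall i, i < b -> f i = g i) -> fsel f b s = fsel g b s.
Proof.
  induction b; intros H; auto. cbn [fsel]. rewrite H, (cntb_ext f g) by auto. now rewrite IHb by auto.
Qed.

Lemma eqb_true_r b : eqb b true = b.
Proof. now destruct b. Qed.

Lemma tri_sel : Tri (Inv spec 2) p_sel (Inv spec 3).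
Proof.
  apply map_tri with (bndf := hh) (cntf := fun n => 2 ^ hh n * hh n); try lia; try reflexivity.
  - destruct (table_cost 3) as [C HC]. exists (2 * C). intros n Hn. specialize (HC n Hn).
    pose proof (hh_bounds n). 
    assert (A : hh n * (hh n + 1) * lg n <= lg n * (2 * lg n) * lg n) by (repeat apply Nat.mul_le_mono; lia).
    replace (lg n ^ 3) with (lg n * lg n * lg n) in HC by (simpl; ring). nia.
  - exists 2. intros n Hn. pose proof (hh_bounds n). lia.
  - intros n T w HI. szs HI. pose proof (small_facts n) as (S1 & S2 & S3 & S4 & S5 & _ & _ & _ & S9 & _).
    split; [|lia]. etransitivity; [|exact S5]. apply Nat.mul_le_mono_l.
    apply (Nat.le_trans _ (DD n ^ 1)); [rewrite Nat.pow_1_r; lia|apply Nat.pow_le_mono_r; lia].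
  - intros n T w m l b tau r HI [HL _]. szs HI.
    pose proof (small_facts n) as (S1 & S2 & S3 & S4 & S5 & _).
    assert (W : Wd n w r G) by (split; auto). split; [apply ev_gh with (1 := W)|].
    eapply ev_eq; [repeat (ev1)|]. all: try lia; try nia.
  - intros n T w m a HI HK Ha. szs HI. pose proof (inst_w _ _ _ HI) as Hw.
    pose proof (small_facts n) as (S1 & S2 & S3 & S4 & S5 & _).
    intros x s Hx Hs. pose proof (cntb_le (Nat.testbit x) (hh n)).
    apply Ha; [nia|]. intros r Hr HU. world n w r Hr (G + 4) HU (x * hh n + (s - 1)).
    pose proof (divmod_idx x (hh n) (s - 1) ltac:(lia)) as [D1 D2].
    assert (HB : x * hh n + (s - 1) < 2 ^ w) by nia.
    eapply ev_let; [eapply ev_eq; [repeat ev1|exact D1]; auto|].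
    intros r1 d1 X E1 HX. lift E1.
    eapply ev_let; [eapply (ev_eq _ _ _ _ _ _ _ s); [repeat ev1|]; auto; try lia|].
    intros r2 d2 I E2 HI2. lift E2.
    eapply ev_eq; [eapply (ev_selm n T w m _ gh (hh n) true X x I s); eauto; try lia|].
    + intros r3 d3 E3. lift E3. ev1.
    + erewrite cntb_ext; [exact Hs|]. intros; apply eqb_true_r.
    + apply fsel_ext. intros; apply eqb_true_r.
Qed.

Definition Ctx (n : nat) (T : list bool) (w : nat) (m : mem) (lim t : nat) : Prop :=
  inst n T w /\ known spec t n T m /\ t * MM n <= lim /\ t <= 64.

Lemma ev_arrC n T w m lim b t0 r d t a i : Ctx n T w m lim t0 -> t < t0 -> Wd n w r d ->
  evb w m lim b r d a i -> i < MM n ->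
  evb w m lim b r d (arr t a) (rg n m t i).
Proof. intros (HI & _ & A & B) H W Ha Hi. eapply ev_arr; eauto; nia. Qed.

Definition msel (x s : bld) : bld := arr 2 (x *' gh +' (s -' kk 1)).

Lemma ev_msel n T w m lim b t0 r d x s xv sv : Ctx n T w m lim t0 -> 2 < t0 -> Wd n w r d ->
  evb w m lim b r d x xv -> evb w m lim b r d s sv -> xv < 2 ^ hh n ->
  1 <= sv <= cntb (Nat.testbit xv) (hh n) ->
  evb w m lim b r d (msel x s) (fsel (Nat.testbit xv) (hh n) sv).
Proof.
  intros HC Ht W Hx Hs Hxl Hsv. pose proof HC as (HI & HK & _). szs HI.
  pose proof (small_facts n) as (S1 & S2 & S3 & S4 & S5 & _ & _ & _ & S9 & _).
  pose proof (cntb_le (Nat.testbit xv) (hh n)).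
  assert ((xv + 1) * hh n <= 2 ^ hh n * hh n) by (apply Nat.mul_le_mono_r; lia).
  assert (2 ^ hh n * hh n <= MM n).
  { etransitivity; [|exact S5]. apply Nat.mul_le_mono_l.
    apply (Nat.le_trans _ (DD n ^ 1)); [rewrite Nat.pow_1_r; lia|apply Nat.pow_le_mono_r; lia]. }
  eapply ev_eq.
  - eapply ev_arrC; [exact HC|lia|exact W| |].
    + repeat ev1; auto; try lia.
    + lia.
  - apply (HK 2 Ht); auto.
Qed.

Definition mlg (r : bld) : bld := arr 4 r.
Lemma ev_mlg n T w m lim b t0 r d x xv : Ctx n T w m lim t0 -> 4 < t0 -> Wd n w r d ->
  evb w m lim b r d x xv -> xv < thr n -> evb w m lim b r d (mlg x) (lg xv).
Proof.
  intros HC Ht W Hx Hlt. pose proof HC as (HI & HK & _).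
  pose proof (small_facts n) as (_ & _ & _ & _ & _ & S6 & _).
  eapply ev_eq; [eapply ev_arrC; [exact HC|lia|exact W|exact Hx|lia]|]. apply (HK 4 Ht); auto.
Qed.

(* The loop has as many rounds as the phase allows: correct only up to [2 ^ bnd]. *)
Definition lgm (x : bld) : bld :=
  LET r := for_ (kk 0) (fun acc t => if_ ((kk 1 <<' t) <' x) (t +' kk 1) acc) IN r.

(** The last [t] with [2 ^ t < x] is [Nat.log2_up x - 1]. *)
Lemma lg_iter x k : iter_up k (fun t acc => if 2 ^ t <? x then t + 1 else acc) 0 = Nat.min k (Nat.log2_up x).
Proof.
  induction k; auto. simpl iter_up. rewrite IHk.
  destruct (Nat.ltb_spec (2 ^ k) x) as [H|H].
  - assert (0 < x) by lia. apply Nat.log2_up_lt_pow2 in H; [|assumption]. lia.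
  - destruct (Nat.eq_dec x 0) as [->|N]; [change (Nat.log2_up 0) with 0; lia|].
    apply Nat.log2_up_le_pow2 in H; lia.
Qed.

Lemma ev_lgm w m lim b r d x xv : 1 <= w -> evb w m lim b r d x xv -> 2 ^ b < 2 ^ w -> xv <= 2 ^ b ->
  evb w m lim b r d (lgm x) (Nat.log2_up xv).
Proof.
  intros Hw Hx Hb Hxb. pose proof (pow2_ge2 w Hw). eapply ev_let; [|intros; eassumption].
  set (F := fun t acc => if 2 ^ t <? xv then t + 1 else acc).
  eapply ev_eq; [eapply (ev_for w m lim b r d (kk 0) _ 0 F)|].
  - apply ev_k. lia.
  - intros r1 d1 acc t vt E Ht HA HT. lift E.
    unfold F in HA |- *. rewrite lg_iter in *.
    assert (2 ^ vt <= 2 ^ b) by (apply Nat.pow_le_mono_r; lia). pose proof (le_pow2 vt).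
    eapply ev_eq; [repeat ev1; auto; lia|]. rewrite Nat.mul_1_l. reflexivity.
  - unfold F. rewrite lg_iter. destruct (Nat.eq_dec xv 0) as [->|N]; [change (Nat.log2_up 0) with 0; lia|].
    apply Nat.log2_up_le_pow2 in Hxb; lia.
Qed.

Definition max1 (x : bld) : bld := LET y := x IN if_ (y =' kk 0) (kk 1) y.
Lemma ev_max1 w m lim b r d x xv : 1 <= w -> evb w m lim b r d x xv ->
  evb w m lim b r d (max1 x) (Nat.max 1 xv).
Proof.
  intros Hw Hx. pose proof (pow2_ge2 w Hw). eapply ev_let; [exact Hx|].
  intros r1 d1 y E Hy. lift E. eapply ev_eq; [repeat ev1; auto; lia|].
  destruct (Nat.eqb_spec xv 0); lia.
Qed.

(** All arguments are below [thr n <= 2 ^ (4 * LL n)], so [4 * LL n] rounds suffice. *)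
Definition p_lg : cmd := mapphase 4 (kk 4 *' gLL) gthr (max1 (lgm uV)).

Lemma poly_le_n a : exists C, forall n, 1 <= n -> lg n ^ a <= C * n.
Proof.
  destruct (poly_exp a 1 ltac:(lia)) as [C HC]. exists (2 * C). intros n Hn.
  specialize (HC (lg n)). rewrite Nat.div_1_r in HC. pose proof (pow_L_le n Hn). nia.
Qed.

Lemma tri_lg : Tri (Inv spec 4) p_lg (Inv spec 5).
Proof.
  apply map_tri with (bndf := fun n => 4 * LL n) (cntf := thr); try lia; try reflexivity.
  - destruct (poly_le_n 6) as [C HC]. exists (5 * C). intros n Hn. specialize (HC n Hn).
    pose proof (LL_le_L n). pose proof (LL_pos n).
    assert (A : thr n * (4 * LL n + 1) * lg n <= (lg n ^ 2 * lg n ^ 2) * (5 * lg n) * lg n).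
    { unfold thr. repeat apply Nat.mul_le_mono; try lia. }
    replace (lg n ^ 2 * lg n ^ 2 * (5 * lg n) * lg n) with (5 * lg n ^ 6) in A by (simpl; ring). nia.
  - exists 5. intros n Hn. pose proof (LL_le_L n). pose proof (lg_pos n). lia.
  - intros n T w HI. szs HI. pose proof (small_facts n) as (S1 & S2 & S3 & S4 & S5 & S6 & _ & _ & _ & S10 & _). lia.
  - intros n T w m l b tau r HI [HL _]. szs HI.
    pose proof (small_facts n) as (S1 & S2 & S3 & S4 & S5 & S6 & _ & _ & _ & S10 & _).
    assert (W : Wd n w r G) by (split; auto). split; repeat ev1; lia.
  - intros n T w m a HI HK Ha. szs HI. pose proof (inst_w _ _ _ HI) as Hw.
    pose proof (small_facts n) as (S1 & S2 & S3 & S4 & S5 & S6 & _ & _ & _ & _ & _ & S12).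
    intros x Hx. apply Ha; auto. intros r Hr HU. world n w r Hr (G + 4) HU x.
    unfold lg. apply ev_max1; auto. apply ev_lgm; auto; [|lia].
    assert (2 ^ (4 * LL n) <= MM n); [|lia]. apply x_le_MM. pose proof (LL_le_L n). lia.
Qed.

Definition unpack (f : bld -> bld -> bld -> bld -> bld -> bld) : bld :=
  LET e := uV %' gD IN LET u1 := uV /' gD IN
  LET d := u1 %' gD IN LET u2 := u1 /' gD IN
  LET c := u2 %' gD IN LET u3 := u2 /' gD IN
  LET b := u3 %' gD IN LET a := u3 /' gD IN f a b c d e.

Lemma pack_idx_lt n x s d mm b : x < 2 ^ hh n -> s < DD n -> d < DD n -> mm < DD n -> b < DD n ->
  pack_idx (DD n) x s d mm b < 2 ^ hh n * DD n ^ 4.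
Proof.
  intros. unfold pack_idx. set (D := DD n) in *.
  assert (x * D + s < 2 ^ hh n * D) by nia.
  assert ((x * D + s) * D + d < 2 ^ hh n * D * D) by nia.
  assert (((x * D + s) * D + d) * D + mm < 2 ^ hh n * D * D * D) by nia.
  replace (2 ^ hh n * D ^ 4) with (2 ^ hh n * D * D * D * D) by (simpl; ring). nia.
Qed.

Definition pack_ld (t : nat) (x s d mm b : bld) : bld :=
  arr t ((((x *' gD +' s) *' gD +' d) *' gD +' mm) *' gD +' b).

Lemma ev_pack_ld n T w m lim bb t0 r e t x s d mm b xv sv dv mv bv : Ctx n T w m lim t0 -> t < t0 -> Wd n w r e ->
  evb w m lim bb r e x xv -> evb w m lim bb r e s sv -> evb w m lim bb r e d dv -> evb w m lim bb r e mm mv ->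
  evb w m lim bb r e b bv -> xv < 2 ^ hh n -> sv < DD n -> dv < DD n -> mv < DD n -> bv < DD n ->
  evb w m lim bb r e (pack_ld t x s d mm b) (rg n m t (pack_idx (DD n) xv sv dv mv bv)).
Proof.
  intros HC Ht W Ex Es Ed Em Eb Hx Hs Hd Hm Hb. pose proof HC as (HI & _). szs HI.
  pose proof (small_facts n) as (S1 & S2 & S3 & S4 & S5 & _).
  pose proof (pack_idx_lt n xv sv dv mv bv Hx Hs Hd Hm Hb) as PL.
  assert (LI : forall a b, a <= a * DD n + b).
  { intros a b0. assert (a * 1 <= a * DD n) by (apply Nat.mul_le_mono_l; lia). lia. }
  eapply ev_arrC; [exact HC|exact Ht|exact W| |lia]. unfold pack_idx in *.
  pose proof (LI (((xv * DD n + sv) * DD n + dv) * DD n + mv) bv).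
  pose proof (LI ((xv * DD n + sv) * DD n + dv) mv).
  pose proof (LI (xv * DD n + sv) dv). repeat ev1; lia.
Qed.

Lemma ev_unpack n T w m lim bb r d x1 x2 x3 x4 x5 f z : inst n T w -> Wd n w r d ->
  evb w m lim bb r d uV (pack_idx (DD n) x1 x2 x3 x4 x5) ->
  x1 < 2 ^ hh n -> x2 < DD n -> x3 < DD n -> x4 < DD n -> x5 < DD n ->
  (forall r' d' a b c e g, ext r d r' d' -> Wd n w r' d' ->
     evb w m lim bb r' d' a x1 -> evb w m lim bb r' d' b x2 -> evb w m lim bb r' d' c x3 ->
     evb w m lim bb r' d' e x4 -> evb w m lim bb r' d' g x5 -> evb w m lim bb r' d' (f a b c e g) z) ->
  evb w m lim bb r d (unpack f) z.
Proof.
  intros HI W HU H1 H2 H3 H4 H5 Hf. szs HI.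
  pose proof (small_facts n) as (S1 & S2 & S3 & S4 & S5 & _).
  pose proof (pack_idx_lt n x1 x2 x3 x4 x5 H1 H2 H3 H4 H5) as B5.
  set (i5 := pack_idx (DD n) x1 x2 x3 x4 x5) in *.
  set (i4 := ((x1 * DD n + x2) * DD n + x3) * DD n + x4).
  set (i3 := (x1 * DD n + x2) * DD n + x3). set (i2 := x1 * DD n + x2).
  assert (A5 : i5 / DD n = i4 /\ i5 mod DD n = x5) by exact (divmod_idx i4 (DD n) x5 H5).
  destruct A5 as [A5 A5'].
  assert (A4 : i4 / DD n = i3 /\ i4 mod DD n = x4) by exact (divmod_idx i3 (DD n) x4 H4).
  destruct A4 as [A4 A4'].
  assert (A3 : i3 / DD n = i2 /\ i3 mod DD n = x3) by exact (divmod_idx i2 (DD n) x3 H3).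
  destruct A3 as [A3 A3'].
  assert (A2 : i2 / DD n = x1 /\ i2 mod DD n = x2) by exact (divmod_idx x1 (DD n) x2 H2).
  destruct A2 as [A2 A2'].
  assert (LI : forall a b, a <= a * DD n + b).
  { intros a b. assert (a * 1 <= a * DD n) by (apply Nat.mul_le_mono_l; lia). lia. }
  assert (B4 : i4 <= i5) by exact (LI i4 x5).
  assert (B3 : i3 <= i4) by exact (LI i3 x4).
  assert (B2 : i2 <= i3) by exact (LI i2 x3).
  clearbody i5 i4 i3 i2.
  assert (X0 : ext r d r d) by apply ext_refl.
  pose proof (fun r1 d1 r2 d2 => ext_trans r d r1 d1 r2 d2) as XT.
  unfold unpack.
  eapply ev_let; [eapply ev_eq; [repeat ev1|exact A5']; auto; lia|]. intros r1 d1 e1 E1 HE1. pose proof (XT _ _ _ _ X0 E1) as X1. lift E1.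
  eapply ev_let; [eapply ev_eq; [repeat ev1|exact A5]; auto; lia|]. intros r2 d2 e2 E2 HE2. pose proof (XT _ _ _ _ X1 E2) as X2. lift E2.
  eapply ev_let; [eapply ev_eq; [repeat ev1|exact A4']; auto; lia|]. intros r3 d3 e3 E3 HE3. pose proof (XT _ _ _ _ X2 E3) as X3. lift E3.
  eapply ev_let; [eapply ev_eq; [repeat ev1|exact A4]; auto; lia|]. intros r4 d4 e4 E4 HE4. pose proof (XT _ _ _ _ X3 E4) as X4. lift E4.
  eapply ev_let; [eapply ev_eq; [repeat ev1|exact A3']; auto; lia|]. intros r5 d5 e5 E5 HE5. pose proof (XT _ _ _ _ X4 E5) as X5. lift E5.
  eapply ev_let; [eapply ev_eq; [repeat ev1|exact A3]; auto; lia|]. intros r6 d6 e6 E6 HE6. pose proof (XT _ _ _ _ X5 E6) as X6. lift E6.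
  eapply ev_let; [eapply ev_eq; [repeat ev1|exact A2']; auto; lia|]. intros r7 d7 e7 E7 HE7. pose proof (XT _ _ _ _ X6 E7) as X7. lift E7.
  eapply ev_let; [eapply ev_eq; [repeat ev1|exact A2]; auto; lia|]. intros r8 d8 e8 E8 HE8. pose proof (XT _ _ _ _ X7 E8) as X8. lift E8.
  apply Hf; auto.
Qed.

Lemma pack_map_tri (t : nat) (val : bld) :
  phase_wf (kk t *' gM) gh ((kk 1 <<' gh) *' (gD *' gD *' gD *' gD)) (kk 1) (kk t *' gM +' uV) val = true ->
  1 <= t -> t < 64 ->
  (forall n T w m a, inst n T w -> known spec t n T m ->
     (forall u z, u < 2 ^ hh n * DD n ^ 4 ->
        (forall r, globs n w r -> r G = u ->
           evb w m (t * MM n) (hh n) r (G + 4) val z) -> a u = z) -> spec n T t a) ->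
  Tri (Inv spec t) (mapphase t gh ((kk 1 <<' gh) *' (gD *' gD *' gD *' gD)) val) (Inv spec (S t)).
Proof.
  intros HWF H1 H2 Hm.
  apply map_tri with (bndf := hh) (cntf := fun n => 2 ^ hh n * DD n ^ 4); auto.
  (* Exponent 10: [DD n ^ 4] contributes 8, the rounds and the factor [lg n] of the bound one
     each. *)
  - destruct (table_cost 10) as [C HC]. exists (2 * 8 ^ 4 * C). intros n Hn. specialize (HC n Hn).
    pose proof (hh_bounds n).
    assert (A : 2 ^ hh n * DD n ^ 4 * (hh n + 1) * lg n <= 2 ^ hh n * (8 * lg n * lg n) ^ 4 * (2 * lg n) * lg n).
    { repeat apply Nat.mul_le_mono; try lia. }
    replace (2 ^ hh n * (8 * lg n * lg n) ^ 4 * (2 * lg n) * lg n) with (2 * 8 ^ 4 * (2 ^ hh n * lg n ^ 10)) in A.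
    2: { rewrite !Nat.pow_mul_l. replace (lg n ^ 10) with (lg n ^ 4 * lg n ^ 4 * lg n * lg n) by (simpl; ring). ring. }
    rewrite <- (Nat.mul_assoc (2 * 8 ^ 4)). etransitivity; [exact A|]. now apply Nat.mul_le_mono_l.
  - exists 2. intros n Hn. pose proof (hh_bounds n). lia.
  - intros n T w HI. szs HI. pose proof (small_facts n) as (S1 & S2 & S3 & S4 & S5 & _). lia.
  - intros n T w m l b tau r HI [HL _]. szs HI.
    pose proof (small_facts n) as (S1 & S2 & S3 & S4 & S5 & _ & _ & _ & S9 & _).
    assert (W : Wd n w r G) by (split; auto). split; [apply ev_gh with (1 := W)|].
    assert (P : forall k, k <= 4 -> DD n ^ k <= 2 ^ hh n * DD n ^ 4).
    { intros k Hk. rewrite <- (Nat.mul_1_l (DD n ^ k)). apply Nat.mul_le_mono; [apply pow2_pos|].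
      apply Nat.pow_le_mono_r; lia. }
    pose proof (P 2 ltac:(lia)) as D2. pose proof (P 3 ltac:(lia)) as D3. pose proof (P 4 ltac:(lia)) as D4.
    replace (DD n ^ 2) with (DD n * DD n) in D2 by (simpl; ring).
    replace (DD n ^ 3) with (DD n * DD n * DD n) in D3 by (simpl; ring).
    replace (DD n ^ 4) with (DD n * DD n * DD n * DD n) in * by (simpl; ring).
    eapply ev_eq; [repeat ev1|].
    all: try lia. 
Qed.

(** The number of rounds is fixed for the whole phase, so a shorter sum ignores the rounds from [mm]
    on. *)
Definition sumloop (mm : bld) (g : bld -> bld) : bld :=
  for_ (kk 0) (fun acc t => if_ (t <' mm) (acc +' g t) acc).

Lemma ev_sumloop w m lim b r d mm g mv (gv : nat -> nat) : 1 <= w ->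
  evb w m lim b r d mm mv -> mv <= b -> psum gv mv < 2 ^ w ->
  (forall r' d' t tv, ext r d r' d' -> tv < mv -> evb w m lim b r' d' t tv -> evb w m lim b r' d' (g t) (gv tv)) ->
  evb w m lim b r d (sumloop mm g) (psum gv mv).
Proof.
  intros Hw Hm Hb Hs Hg. pose proof (pow2_ge2 w Hw).
  set (F := fun t acc => if t <? mv then acc + gv t else acc).
  eapply ev_eq; [eapply (ev_for w m lim b r d (kk 0) _ 0 F)|].
  - apply ev_k. lia.
  - intros r1 d1 acc t vt E Ht HA HT. pose proof E as E'. lift E.
    assert (Q : forall j, iter_up j F 0 = psum gv (Nat.min j mv)).
    { induction j; auto. simpl iter_up. rewrite IHj. unfold F. destruct (Nat.ltb_spec j mv).
      - rewrite !Nat.min_l by lia. reflexivity.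
      - now rewrite !Nat.min_r by lia. }
    rewrite Q in *. unfold F. repeat ev1; auto.
    + rewrite Nat.min_l by lia. assert (psum gv (S vt) <= psum gv mv).
      { replace mv with (S vt + (mv - S vt)) by lia. rewrite (psum_split gv (S vt)). lia. }
      simpl in *. lia.
  - unfold F. now apply iter_psum.
Qed.

Definition p_pack : cmd :=
  mapphase 3 gh ((kk 1 <<' gh) *' (gD *' gD *' gD *' gD))
    (unpack (fun x s d mm b => sumloop mm (fun t => msel x (s +' t *' d) <<' (t *' b)))).

Lemma tri_pack : Tri (Inv spec 3) p_pack (Inv spec 4).
Proof.
  apply pack_map_tri; try lia; try reflexivity.
  intros n T w m a HI HK Ha. szs HI. pose proof (inst_w _ _ _ HI) as Hw.
  pose proof (small_facts n) as (S1 & S2 & S3 & S4 & S5 & S6 & S7 & S8 & S9 & _).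
  intros x s d mm b Hx Hs Hd Hm Hb Hs1 Hm1 Hc Hp.
  pose proof (cntb_le (Nat.testbit x) (hh n)) as HCn.
  pose proof (pack_idx_lt n x s d mm b Hx Hs Hd Hm Hb) as HL.
  apply Ha; auto. intros r Hr HU. world n w r Hr (G + 4) HU (pack_idx (DD n) x s d mm b).
  assert (HC : Ctx n T w m (3 * MM n) 3) by (unfold Ctx; splits; auto; lia).
  eapply ev_unpack; eauto.
  intros r' d' X S' D' M' B' E W1 HX HS HD HM HB. clear E W H.
  assert (TB : forall t, t < mm -> 2 ^ (t * b) <= MM n).
  { intros t Ht. etransitivity; [|exact Hp]. apply Nat.pow_le_mono_r; [lia|]. apply Nat.mul_le_mono_r. lia. }
  assert (SB : forall t, t < mm -> s + t * d <= cntb (Nat.testbit x) (hh n)) by (intros t Ht; assert (t * d <= (mm - 1) * d) by (apply Nat.mul_le_mono_r; lia); lia).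
  apply ev_sumloop; auto; try lia.
  - apply (Nat.le_lt_trans _ (mm * (MM n * MM n))).
    + rewrite <- (psum_const (MM n * MM n)). apply psum_le. intros t Ht. specialize (TB t Ht). specialize (SB t Ht).
      pose proof (fsel_spec (Nat.testbit x) (hh n) (s + t * d) ltac:(lia)).
      apply Nat.mul_le_mono; lia.
    + rewrite Nat.mul_assoc. assert (mm * MM n * MM n <= MM n * MM n * MM n); [|lia].
      repeat apply Nat.mul_le_mono; lia.
  - intros r1 d1 t tv E Ht HT. lift E.
    specialize (TB tv Ht). specialize (SB tv Ht).
    pose proof (fsel_spec (Nat.testbit x) (hh n) (s + tv * d) ltac:(lia)) as [F1 _].
    apply ev_shl.
    + eapply ev_msel; eauto; try lia. repeat ev1; lia.
    + repeat ev1. assert (tv * b <= MM n * MM n) by (apply Nat.mul_le_mono; lia). lia.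
    + assert (fsel (Nat.testbit x) (hh n) (s + tv * d) * 2 ^ (tv * b) <= MM n * MM n) by (apply Nat.mul_le_mono; lia). lia.
Qed.

Definition mceil (x y : bld) : bld := (x +' y -' kk 1) /' y.

Lemma ev_mceil w m lim b r d x y xv yv : evb w m lim b r d x xv -> evb w m lim b r d y yv ->
  1 <= yv -> xv + yv < 2 ^ w -> evb w m lim b r d (mceil x y) (ceil_div xv yv).
Proof. intros X Y Hy H. unfold ceil_div, mceil. repeat ev1; auto; lia. Qed.

Definition p_sub : cmd :=
  mapphase 5 gh ((kk 1 <<' gh) *' (gD *' gD *' gD *' gD))
    (unpack (fun x s mj br cc =>
      LET g := br *' gLL IN
      sumloop (mj *' g) (fun e =>
        LET p0 := msel x (s +' e /' g *' g) IN
        LET df := msel x (s +' (e /' g +' kk 1) *' g) -' p0 IN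
        LET b := mlg df IN
        if_ (df <' b *' br *' (gLL *' gLL)) (kk 0)
          ((msel x (s +' e) -' p0) <<' (mceil (cc +' p0) gLL %' gL +' e %' g *' b))))).

Lemma tri_sub : Tri (Inv spec 5) p_sub (Inv spec 6).
Proof.
  apply pack_map_tri; try lia; try reflexivity.
  intros n T w m a HI HK Ha. szs HI. pose proof (inst_w _ _ _ HI) as Hw.
  pose proof (small_facts n) as (S1 & S2 & S3 & S4 & S5 & S6 & S7 & S8 & S9 & S10 & S11 & S12).
  pose proof (LL_pos n) as LP. pose proof (LL_le_L n) as LLL. pose proof (hh_bounds n) as HB.
  intros x s mj br cc Hx Hs Hm Hb Hcc Hs1 Hb1 Hc.
  set (g := br * LL n) in *. assert (Hg : 1 <= g) by (unfold g; nia).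
  set (f := Nat.testbit x) in *.
  pose proof (cntb_le f (hh n)) as HCn.
  pose proof (pack_idx_lt n x s mj br cc Hx Hs Hm Hb Hcc) as HL.
  apply Ha; auto. intros r Hr HU. world n w r Hr (G + 4) HU (pack_idx (DD n) x s mj br cc).
  assert (HC : Ctx n T w m (5 * MM n) 5) by (unfold Ctx; splits; auto; lia).
  eapply ev_unpack; eauto.
  intros r' d' X S' MJ BR CC E W1 HX HS HM HBR HCC. clear E W H.
  assert (HgM : g <= MM n * MM n) by (apply Nat.mul_le_mono; lia).
  eapply ev_let; [repeat ev1; fold g; lia|]. fold g. intros r1 d1 gb E HG. lift E.
  assert (TT : forall e, e < mj * g ->
     let p0 := fsel f (hh n) (s + e / g * g) in
     let p1 := fsel f (hh n) (s + (e / g + 1) * g) in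
     p0 <= fsel f (hh n) (s + e) < hh n /\ p0 < p1 /\ p1 < hh n /\
     1 <= s + e / g * g <= cntb f (hh n) /\ s + (e / g + 1) * g <= cntb f (hh n) /\ s + e <= cntb f (hh n)).
  { intros e He p0 p1. pose proof (Nat.div_mod_eq e g). pose proof (Nat.mod_upper_bound e g ltac:(lia)).
    assert (e / g < mj) by (apply Nat.Div0.div_lt_upper_bound; lia).
    assert ((e / g + 1) * g <= mj * g) by (apply Nat.mul_le_mono_r; lia).
    assert (e / g * g <= e) by lia. assert (e < (e / g + 1) * g) by lia.
    splits; try lia.
    - destruct (Nat.eq_dec (e / g * g) e) as [Q|Q]; [unfold p0; rewrite Q; lia|].
      apply Nat.lt_le_incl, fsel_lt; lia.
    - apply fsel_spec; lia.
    - apply fsel_lt; lia.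
    - apply fsel_spec; lia. }
  (* A long sub-range has at least as many positions as its answers have bits. Lying inside a chunk,
     it has fewer than [hh n] positions, and its offset in the word adds less than [lg n]. *)
  assert (TB : forall e, e < mj * g ->
     let p0 := fsel f (hh n) (s + e / g * g) in
     let p1 := fsel f (hh n) (s + (e / g + 1) * g) in
     lg (p1 - p0) * br * LL n ^ 2 <= p1 - p0 ->
     2 ^ (ceil_div (cc + p0) (LL n) mod lg n + e mod g * lg (p1 - p0)) <= MM n).
  { intros e He p0 p1 Hact. destruct (TT e He) as (A1 & A2 & A3 & A4). fold p0 in A1, A2. fold p1 in A2, A3.
    pose proof (Nat.mod_upper_bound (ceil_div (cc + p0) (LL n)) (lg n) ltac:(pose proof (lg_pos n); lia)).
    pose proof (Nat.mod_upper_bound e g ltac:(lia)).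
    assert (e mod g * lg (p1 - p0) <= g * lg (p1 - p0)) by (apply Nat.mul_le_mono_r; lia).
    assert (g * lg (p1 - p0) <= lg (p1 - p0) * br * LL n ^ 2).
    { replace (lg (p1 - p0) * br * LL n ^ 2) with (g * lg (p1 - p0) * LL n) by (unfold g; simpl; ring).
      rewrite <- (Nat.mul_1_r (g * lg (p1 - p0))) at 1. apply Nat.mul_le_mono_l; lia. }
    apply x_le_MM. lia. }
  apply ev_sumloop; auto.
  - repeat ev1. lia.
  - lia.
  - apply (Nat.le_lt_trans _ ((mj * g) * (MM n * MM n))).
    + rewrite <- (psum_const (MM n * MM n)). apply psum_le. intros e He. unfold sub_term. fold g f.
      destruct (TT e He) as (A1 & A2 & A3 & A4). specialize (TB e He). cbv zeta in TB.
      destruct (Nat.leb_spec (lg (fsel f (hh n) (s + (e / g + 1) * g) - fsel f (hh n) (s + e / g * g)) * br * LL n ^ 2)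
         (fsel f (hh n) (s + (e / g + 1) * g) - fsel f (hh n) (s + e / g * g))) as [Q|Q]; [|lia].
      specialize (TB Q). apply Nat.mul_le_mono; lia.
    + rewrite Nat.mul_assoc. assert (mj * g * MM n * MM n <= MM n * MM n * MM n); [|lia].
      repeat apply Nat.mul_le_mono; lia.
  - intros r2 d2 e ev E He HE. lift E. specialize (TT ev He). specialize (TB ev He). cbv zeta in TT, TB.
    unfold sub_term. fold g f. set (p0 := fsel f (hh n) (s + ev / g * g)) in *.
    set (p1 := fsel f (hh n) (s + (ev / g + 1) * g)) in *. destruct TT as (A1 & A2 & A3 & A4 & A5 & A6).
    assert (mj * g <= hh n) by lia.
    assert (Hev : ev / g * g <= ev /\ (ev / g + 1) * g <= ev + g).
    { pose proof (Nat.div_mod_eq ev g) as Q. clear - Q. lia. }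
    assert (g <= mj * g). { destruct mj; [lia|]. simpl. lia. }
    assert (ev / g <= ev) by (apply Nat.Div0.div_le_upper_bound; clear - Hg; nia).
    eapply ev_let; [eapply ev_msel; eauto; try lia; repeat ev1; try lia|].
    intros r3 d3 P0 E HP0. lift E. fold f p0 in HP0.
    assert (HP1 : evb w m (5 * MM n) (hh n) r3 d3 (msel X (S' +' (e /' gb +' kk 1) *' gb)) p1).
    { eapply ev_msel; eauto; fold f; try lia. repeat ev1; try lia. }
    eapply ev_let; [eapply ev_sub; [exact HP1|exact HP0|lia|lia]|].
    intros r4 d4 DF E HDF. lift E.
    (* Distances inside a chunk are below [lg n <= thr n], so the table of logarithms covers
       them. *)
    assert (HT : p1 - p0 < thr n).
    { assert (lg n ^ 2 * 1 <= thr n). { unfold thr. apply Nat.mul_le_mono_l. simpl; clear - LP; nia. }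
      assert (lg n * 1 <= lg n ^ 2) by (simpl; clear; nia). lia. }
    eapply ev_let; [eapply ev_mlg; eauto; lia|]. intros r5 d5 b E Hbb. lift E.
    set (bv := lg (p1 - p0)) in *.
    assert (Hbv : bv <= lg n).
    { apply lg_le_pow; [apply lg_pos|]. pose proof (le_pow2 (lg n)). lia. }
    pose proof (pow2_pos w).
    assert (bv * br * (LL n * LL n) <= MM n * MM n * MM n).
    { assert (LL n * LL n <= MM n) by (clear - S8 S4; lia). repeat apply Nat.mul_le_mono; lia. }
    assert (HPe : evb w m (5 * MM n) (hh n) r5 d5 (msel X (S' +' e)) (fsel f (hh n) (s + ev))).
    { eapply ev_msel; eauto; fold f; try lia. repeat ev1; lia. }
    assert (HCe : evb w m (5 * MM n) (hh n) r5 d5 (mceil (CC +' P0) gLL) (ceil_div (cc + p0) (LL n))).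
    { apply ev_mceil; try lia; repeat ev1; lia. }
    assert (ceil_div (cc + p0) (LL n) <= cc + p0 + LL n).
    { unfold ceil_div. apply Nat.Div0.div_le_upper_bound. clear - LP. nia. }
    assert (bv * br <= MM n * MM n) by (apply Nat.mul_le_mono; lia).
    pose proof (Nat.mod_upper_bound ev g ltac:(lia)).
    pose proof (Nat.mod_upper_bound (ceil_div (cc + p0) (LL n)) (lg n) ltac:(pose proof (lg_pos n); lia)).
    assert (ev mod g * bv <= MM n * MM n) by (apply Nat.mul_le_mono; lia).
    eapply ev_eq; [repeat ev1; auto; try lia|].
    + assert (Q : lg (p1 - p0) * br * LL n ^ 2 <= p1 - p0). { fold bv. simpl. nia. }
      specialize (TB Q). fold bv in TB.
      apply (Nat.le_lt_trans _ (MM n * MM n)); [|lia]. apply Nat.mul_le_mono; lia.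
    + replace (LL n ^ 2) with (LL n * LL n) by (simpl; ring).
      destruct (Nat.ltb_spec (p1 - p0) (bv * br * (LL n * LL n))) as [Q|Q].
      * now rewrite (proj2 (Nat.leb_gt _ _)) by lia.
      * now rewrite (proj2 (Nat.leb_le _ _)) by lia.
Qed.

(** * Prefix sums *)

Definition rounds (c : cmd) : cmd :=
  Seq (Assign rT (Const 0))
    (While (Bin Lt (Reg rT) (Reg 7)) (Seq c (Assign rT (Bin Add (Reg rT) (Const 1))))).

Lemma like_next n w t rho v : like n w t rho -> like n w v (upd rho rT v).
Proof.
  intros [[] E]. split; [|apply upd_same].
  constructor; rewrite upd_other; auto; unfold rT, rBND in *; lia.
Qed.

Lemma rounds_ok n T w c (Q : nat -> mem -> Prop) (wkf : nat -> nat) d :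
  inst n T w ->
  (forall t rho m, t < HH n -> like n w t rho -> Q t m ->
     exists rho' m' wk dp, runs w c rho m rho' m' wk dp /\ like n w t rho' /\ Q (S t) m' /\
       wk <= wkf t /\ dp <= d) ->
  forall rho m, globs n w rho -> Q 0 m ->
  exists rho' m' wk dp, runs w (rounds c) rho m rho' m' wk dp /\ globs n w rho' /\ Q (HH n) m' /\
    wk <= 6 + psum (fun t => wkf t + 8) (HH n) /\ dp <= 6 + HH n * (d + 8).
Proof.
  intros HI Hc rho m HG HQ. pose proof (inst_w _ _ _ HI) as Hw. pose proof (pow2_ge2 w Hw) as P2.
  szs HI. pose proof (HH_le n) as HHle. pose proof (small_facts n) as (_ & S2 & _).
  assert (LP : forall j t r m0, t + j = HH n -> like n w t r -> Q t m0 ->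
    exists rho' m' wk dp, runs w (While (Bin Lt (Reg rT) (Reg 7)) (Seq c (Assign rT (Bin Add (Reg rT) (Const 1))))) r m0 rho' m' wk dp /\
      globs n w rho' /\ Q (HH n) m' /\ wk + psum (fun t => wkf t + 8) t <= 4 + psum (fun t => wkf t + 8) (HH n) /\ dp <= 4 + j * (d + 8)).
  { induction j; intros t r m0 Ht HL HQt.
    - rewrite Nat.add_0_r in Ht. subst t. exists r, m0, 4, 4. destruct HL as [HL E].
      splits; auto; try lia. do 2 eexists. apply (exec_while_false w (Bin Lt (Reg rT) (Reg 7))). cbn [eval]; unfold eval_binop.
      rewrite E, (g_H _ _ _ HL), Nat.ltb_irrefl. apply Nat.mod_small; simpl; lia.
    - destruct (Hc t r m0) as (r1 & m1 & wk1 & dp1 & (R1 & W1 & E1) & HL1 & HQ1 & B1 & D1); auto; [lia|].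
      assert (EV : eval w r1 (Bin Add (Reg rT) (Const 1)) = S t).
      { cbn [eval]; unfold eval_binop. destruct HL1 as [_ ->]. rewrite (Nat.mod_small 1), Nat.mod_small; lia. }
      destruct (IHj (S t) (upd r1 rT (S t)) m1) as (r2 & m2 & wk2 & dp2 & (R2 & W2 & E2) & HL2 & HQ2 & B2 & D2); auto; [lia|eapply like_next; eauto|].
      do 4 eexists. split; [|split; [exact HL2|split; [exact HQ2|]]].
      + do 2 eexists. eapply exec_while_true; [|eapply exec_seq; [exact E1|apply exec_assign]|rewrite EV; exact E2].
        cbn [eval]; unfold eval_binop. destruct HL as [HL ->]. rewrite (g_H _ _ _ HL).
        rewrite (proj2 (Nat.ltb_lt t (HH n))) by lia. cbn [Nat.b2n]. rewrite Nat.mod_small; lia.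
      + simpl in *. lia. }
  destruct (LP (HH n) 0 (upd rho rT 0) m) as (r2 & m2 & wk2 & dp2 & (R2 & W2 & E2) & HL2 & HQ2 & B2 & D2); auto.
  { eapply like_next. apply globs_like, HG. }
  exists r2, m2, (2 + wk2), (2 + dp2). splits; auto; [|simpl in B2; lia|lia].
  do 2 eexists. eapply exec_seq; [|exact E2].
  assert (Z : eval w rho (Const 0) = 0) by (apply Nat.mod_small; lia).
  rewrite <- Z at 2. apply exec_assign.
Qed.

(** Level [s] of the summation tree begins at offset [s * NC n] of the region. Each round moves the
    read limit to the start of the next level and fills that level from the previous one. *)
Definition scan_up (t : nat) : cmd :=
  rounds (phase (kk t *' gM +' (gT +' kk 1) *' gNC) (kk 0) (kk 1 <<' (gH -' gT -' kk 1)) (kk 1)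
    (kk t *' gM +' (gT +' kk 1) *' gNC +' uV)
    (ld (kk t *' gM +' (gT *' gNC +' kk 2 *' uV)) +' ld (kk t *' gM +' (gT *' gNC +' (kk 2 *' uV +' kk 1))))).

(** A node receives the sum of all leaves to its left: the value of its parent, plus, for a right
    child, the total of its left sibling. That total is found in the upward tree, whose levels are
    counted from the leaves, hence the index [gH -' gT -' kk 1]. *)
Definition scan_down (t : nat) : cmd :=
  rounds (phase (kk (S t) *' gM +' (gT +' kk 1) *' gNC) (kk 0) (kk 1 <<' (gT +' kk 1)) (kk 1)
    (kk (S t) *' gM +' (gT +' kk 1) *' gNC +' uV)
    (ld (kk (S t) *' gM +' (gT *' gNC +' uV /' kk 2)) +'
     if_ (uV %' kk 2 =' kk 1) (ld (kk t *' gM +' ((gH -' gT -' kk 1) *' gNC +' (uV -' kk 1)))) (kk 0))).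

(** Leaves in region [t], upward tree in [t + 1], downward tree with root 0 in [t + 2], resulting
    prefix sums in [t + 3]. *)
Definition scan (t : nat) : cmd :=
  Seq (mapphase (t + 1) (kk 0) gNC (arr t uV))
    (Seq (scan_up (t + 1))
       (Seq (mapphase (t + 2) (kk 0) (kk 1) (kk 0))
          (Seq (scan_down (t + 1))
             (mapphase (t + 3) (kk 0) gNC (arr (t + 2) (gH *' gNC +' uV)))))).

Lemma scan_space n : (HH n + 1) * NC n <= MM n /\ NC n <= MM n /\ 1 <= NC n /\ HH n + 1 <= MM n.
Proof.
  pose proof (HH_le n) as H. pose proof (lg_pos n).
  assert (A : NC n <= 2 ^ (lg n + 1)) by (apply Nat.pow_le_mono_r; lia).
  assert (B : HH n + 1 <= 2 ^ (lg n + 2)). { pose proof (le_pow2 (lg n + 2)). lia. }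
  assert (C : 2 ^ (lg n + 2) * 2 ^ (lg n + 1) <= MM n). { rewrite <- Nat.pow_add_r. apply x_le_MM. lia. }
  assert (1 <= NC n) by apply pow2_pos. splits; auto.
  - etransitivity; [|exact C]. apply Nat.mul_le_mono; auto.
  - etransitivity; [exact A|]. apply x_le_MM. lia.
  - nia.
Qed.

Lemma NC_cost : exists C, forall n, 1 <= n -> NC n * lg n <= C * n.
Proof.
  exists 8. intros n Hn. pose proof (NC_up n). pose proof (hh_bounds n) as (A & B & E & F).
  assert (n / hh n * hh n <= n) by (pose proof (Nat.div_mod_eq n (hh n)); lia).
  pose proof (pow_L_le n Hn). pose proof (le_pow2 (lg n)).
  assert (NC n * lg n <= 2 * (n / hh n + 1) * lg n) by (apply Nat.mul_le_mono_r; lia).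
  assert (n / hh n * lg n <= n / hh n * (2 * hh n)) by (apply Nat.mul_le_mono_l; lia). lia.
Qed.

(** * One round of the upward and of the downward pass *)

Section Scan.
Context (t n w : nat) (T : list bool) (A : nat -> nat).
Hypothesis HI : inst n T w.
Hypothesis Ht : t < 60.
Hypothesis HA : psum A (NC n) < 2 ^ w.

Let P (i : nat) := psum A i.

Definition upQ (m0 : mem) (s : nat) (m : mem) : Prop :=
  (forall a, a < t * MM n -> m a = m0 a) /\
  (forall s', s' <= s -> forall i, i < 2 ^ (HH n - s') ->
     m (t * MM n + (s' * NC n + i)) = psum A (S i * 2 ^ s') - psum A (i * 2 ^ s')).

Lemma P_mono i j : i <= j -> psum A i <= psum A j.
Proof. intros H. replace j with (i + (j - i)) by lia. rewrite psum_split. lia. Qed.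

Lemma ev_base m lim b r d k x xv : Wd n w r d -> k <= 64 -> evb w m lim b r d x xv -> xv <= MM n ->
  evb w m lim b r d (kk k *' gM +' x) (k * MM n + xv).
Proof. intros W Hk X Hx. szs HI. repeat ev1; auto; nia. Qed.

Lemma up_step m0 s rho m : s < HH n -> like n w s rho -> upQ m0 s m ->
  exists rho' m' wk dp,
    runs w (phase (kk t *' gM +' (gT +' kk 1) *' gNC) (kk 0) (kk 1 <<' (gH -' gT -' kk 1)) (kk 1)
    (kk t *' gM +' (gT +' kk 1) *' gNC +' uV)
    (ld (kk t *' gM +' (gT *' gNC +' kk 2 *' uV)) +' ld (kk t *' gM +' (gT *' gNC +' (kk 2 *' uV +' kk 1)))))
     rho m rho' m' wk dp /\ like n w s rho' /\ upQ m0 (S s) m' /\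
    wk <= phase_k (kk t *' gM +' (gT +' kk 1) *' gNC) (kk 0) (kk 1 <<' (gH -' gT -' kk 1)) (kk 1)
    (kk t *' gM +' (gT +' kk 1) *' gNC +' uV)
    (ld (kk t *' gM +' (gT *' gNC +' kk 2 *' uV)) +' ld (kk t *' gM +' (gT *' gNC +' (kk 2 *' uV +' kk 1)))) * (2 * 2 ^ (HH n - S s) + 1) /\
    dp <= phase_k (kk t *' gM +' (gT +' kk 1) *' gNC) (kk 0) (kk 1 <<' (gH -' gT -' kk 1)) (kk 1)
    (kk t *' gM +' (gT +' kk 1) *' gNC +' uV)
    (ld (kk t *' gM +' (gT *' gNC +' kk 2 *' uV)) +' ld (kk t *' gM +' (gT *' gNC +' (kk 2 *' uV +' kk 1)))).
Proof.
  intros Hs HL [Q1 Q2]. szs HI. pose proof (inst_w _ _ _ HI) as Hw. pose proof (scan_space n) as (B1 & B2 & B3 & B4).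
  assert (EN : 2 ^ (HH n - s) = 2 * 2 ^ (HH n - S s)).
  { replace (HH n - s) with (S (HH n - S s)) by lia. apply Nat.pow_succ_r'. }
  assert (EC : 2 ^ (HH n - s) <= NC n) by (apply Nat.pow_le_mono_r; lia).
  assert (S s * NC n + NC n <= MM n).
  { etransitivity; [|exact B1]. replace (S s * NC n + NC n) with ((S s + 1) * NC n) by lia. apply Nat.mul_le_mono_r. lia. }
  assert (EG : forall l b r d, like n w s r -> G <= d -> evb w m l b r d gT s).
  { intros l b r d [_ Hr] Hd. rewrite <- Hr. apply ev_v. unfold G, rT in *; lia. }
  assert (HLb : forall r l b d, like n w s r -> G <= d ->
     evb w m l b r d (kk t *' gM +' (gT +' kk 1) *' gNC) (t * MM n + S s * NC n)).
  { intros r l b d Hr Hd. assert (W : Wd n w r d) by (split; [apply Hr|auto]).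
    pose proof (EG l b r d Hr Hd). apply ev_base; auto; try lia.
    eapply ev_eq; [repeat ev1|]; try lia. }
  destruct (phase_ok n w s (kk t *' gM +' (gT +' kk 1) *' gNC) (kk 0) (kk 1 <<' (gH -' gT -' kk 1)) (kk 1)
    (kk t *' gM +' (gT +' kk 1) *' gNC +' uV)
    (ld (kk t *' gM +' (gT *' gNC +' kk 2 *' uV)) +' ld (kk t *' gM +' (gT *' gNC +' (kk 2 *' uV +' kk 1))))
    (t * MM n + S s * NC n) 0 (2 ^ (HH n - S s)) (fun _ => 1) (fun u _ => t * MM n + S s * NC n + u)
    (t * MM n + S s * NC n) (2 ^ (HH n - S s)) rho m)
    as (rho' & m' & wk & dp & E & HL' & V & F & B & D); auto; try lia.
  - intros. apply ev_k. lia.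
  - intros r Hr. assert (W : Wd n w r G) by (split; [apply Hr|auto]). pose proof (EG (t * MM n + S s * NC n) 0 r G Hr (le_n _)).
    eapply ev_eq; [repeat ev1|]; try lia.
    + replace (HH n - s - 1) with (HH n - S s) by lia. lia.
    + rewrite Nat.mul_1_l. f_equal. lia.
  - intros. apply ev_k. lia.
  - intros u v r Hu Hv Hr Hru Hrv. apply ev_add; [apply HLb; auto; lia|apply ev_varG; auto; unfold G; lia|nia].
  - exists rho', m', wk, dp. split; [exact E|]. split; [exact HL'|]. split; [|split; lia]. split.
    + intros a Ha. transitivity (m a); [|apply Q1, Ha]. apply F. intros; lia.
    + intros s' Hs' i Hi. destruct (Nat.eq_dec s' (S s)) as [->|N].
      * replace (t * MM n + (S s * NC n + i)) with (t * MM n + S s * NC n + i) by lia.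
        apply (V i 0); [auto|auto|]. intros r Hr Hru _.
        assert (W : Wd n w r (G + 4)) by (split; [apply Hr|lia]).
        pose proof (EG (t * MM n + S s * NC n) 0 r (G + 4) Hr ltac:(lia)).
        assert (HU : evb w m (t * MM n + S s * NC n) 0 r (G + 4) uV i) by (apply ev_varG; auto; lia).
        assert (I1 : i * 2 ^ S s <= NC n /\ S i * 2 ^ S s <= NC n).
        { assert (2 ^ (HH n - S s) * 2 ^ S s = NC n).
          { rewrite <- Nat.pow_add_r. unfold NC. f_equal. lia. }
          split; [assert (i * 2 ^ S s <= 2 ^ (HH n - S s) * 2 ^ S s) by (apply Nat.mul_le_mono_r; lia)
            |assert (S i * 2 ^ S s <= 2 ^ (HH n - S s) * 2 ^ S s) by (apply Nat.mul_le_mono_r; lia)]; lia. }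
        assert (VA : m (t * MM n + (s * NC n + 2 * i)) = psum A (S (2 * i) * 2 ^ s) - psum A (2 * i * 2 ^ s)) by (apply Q2; lia).
        assert (VB : m (t * MM n + (s * NC n + (2 * i + 1))) = psum A (S (2 * i + 1) * 2 ^ s) - psum A ((2 * i + 1) * 2 ^ s)) by (apply Q2; lia).
        assert (X1 : 2 * i * 2 ^ s = i * 2 ^ S s) by (rewrite Nat.pow_succ_r'; lia).
        assert (X2 : S (2 * i + 1) * 2 ^ s = S i * 2 ^ S s) by (rewrite Nat.pow_succ_r'; lia).
        rewrite X1 in VA. rewrite X2 in VB. replace (S (2 * i)) with (2 * i + 1) in VA by lia.
        pose proof (P_mono (i * 2 ^ S s) ((2 * i + 1) * 2 ^ s) ltac:(lia)).
        pose proof (P_mono ((2 * i + 1) * 2 ^ s) (S i * 2 ^ S s) ltac:(lia)).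
        pose proof (P_mono (S i * 2 ^ S s) (NC n) ltac:(lia)).
        assert (s * NC n + NC n <= MM n) by lia.
        assert (HLd : forall x xv, evb w m (t * MM n + S s * NC n) 0 r (G + 4) x xv -> xv < S s * NC n ->
          evb w m (t * MM n + S s * NC n) 0 r (G + 4) (ld (kk t *' gM +' x)) (m (t * MM n + xv))).
        { intros x xv Hx Hxv. apply ev_ld; [apply ev_base; auto; lia|lia]. }
        eapply ev_eq.
        -- apply ev_add.
           ++ apply HLd; [|shelve]. repeat ev1; auto; lia.
           ++ apply HLd; [|shelve]. repeat ev1; auto; lia.
           ++ rewrite VA, VB. lia.
        -- rewrite VA, VB. lia.
        Unshelve. all: simpl; lia.
      * transitivity (m (t * MM n + (s' * NC n + i))); [|apply Q2; lia]. apply F. intros u v Hu Hv.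
        assert (i < NC n). { apply (Nat.lt_le_trans _ (2 ^ (HH n - s'))); auto. apply Nat.pow_le_mono_r; lia. }
        assert (s' * NC n <= s * NC n) by (apply Nat.mul_le_mono_r; lia). simpl. lia.
Qed.

Definition downQ (m0 : mem) (s : nat) (m : mem) : Prop :=
  (forall a, a < S t * MM n -> m a = m0 a) /\
  (forall s', s' <= s -> forall i, i < 2 ^ s' ->
     m (S t * MM n + (s' * NC n + i)) = psum A (i * 2 ^ (HH n - s'))).

Lemma down_step m0 s rho m : s < HH n -> like n w s rho -> upQ m0 (HH n) m0 -> downQ m0 s m ->
  exists rho' m' wk dp,
    runs w (phase (kk (S t) *' gM +' (gT +' kk 1) *' gNC) (kk 0) (kk 1 <<' (gT +' kk 1)) (kk 1)
    (kk (S t) *' gM +' (gT +' kk 1) *' gNC +' uV)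
    (ld (kk (S t) *' gM +' (gT *' gNC +' uV /' kk 2)) +'
     if_ (uV %' kk 2 =' kk 1) (ld (kk t *' gM +' ((gH -' gT -' kk 1) *' gNC +' (uV -' kk 1)))) (kk 0)))
     rho m rho' m' wk dp /\ like n w s rho' /\ downQ m0 (S s) m' /\
    wk <= phase_k (kk (S t) *' gM +' (gT +' kk 1) *' gNC) (kk 0) (kk 1 <<' (gT +' kk 1)) (kk 1)
    (kk (S t) *' gM +' (gT +' kk 1) *' gNC +' uV)
    (ld (kk (S t) *' gM +' (gT *' gNC +' uV /' kk 2)) +'
     if_ (uV %' kk 2 =' kk 1) (ld (kk t *' gM +' ((gH -' gT -' kk 1) *' gNC +' (uV -' kk 1)))) (kk 0)) * (2 * 2 ^ S s + 1) /\
    dp <= phase_k (kk (S t) *' gM +' (gT +' kk 1) *' gNC) (kk 0) (kk 1 <<' (gT +' kk 1)) (kk 1)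
    (kk (S t) *' gM +' (gT +' kk 1) *' gNC +' uV)
    (ld (kk (S t) *' gM +' (gT *' gNC +' uV /' kk 2)) +'
     if_ (uV %' kk 2 =' kk 1) (ld (kk t *' gM +' ((gH -' gT -' kk 1) *' gNC +' (uV -' kk 1)))) (kk 0)).
Proof.
  intros Hs HL [_ HUp] [Q1 Q2]. szs HI. pose proof (inst_w _ _ _ HI) as Hw. pose proof (scan_space n) as (B1 & B2 & B3 & B4).
  assert (EC : 2 ^ S s <= NC n) by (apply Nat.pow_le_mono_r; lia).
  assert (EC' : 2 * 2 ^ s = 2 ^ S s) by (rewrite Nat.pow_succ_r'; lia).
  assert (S s * NC n + NC n <= MM n).
  { etransitivity; [|exact B1]. replace (S s * NC n + NC n) with ((S s + 1) * NC n) by lia. apply Nat.mul_le_mono_r. lia. }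
  assert (EG : forall l b r d, like n w s r -> G <= d -> evb w m l b r d gT s).
  { intros l b r d [_ Hr] Hd. rewrite <- Hr. apply ev_v. unfold G, rT in *; lia. }
  assert (HLb : forall r l b d, like n w s r -> G <= d ->
     evb w m l b r d (kk (S t) *' gM +' (gT +' kk 1) *' gNC) (S t * MM n + S s * NC n)).
  { intros r l b d Hr Hd. assert (W : Wd n w r d) by (split; [apply Hr|auto]).
    pose proof (EG l b r d Hr Hd). apply ev_base; auto; try lia.
    eapply ev_eq; [repeat ev1|]; try lia. }
  destruct (phase_ok n w s (kk (S t) *' gM +' (gT +' kk 1) *' gNC) (kk 0) (kk 1 <<' (gT +' kk 1)) (kk 1)
    (kk (S t) *' gM +' (gT +' kk 1) *' gNC +' uV)
    (ld (kk (S t) *' gM +' (gT *' gNC +' uV /' kk 2)) +'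
     if_ (uV %' kk 2 =' kk 1) (ld (kk t *' gM +' ((gH -' gT -' kk 1) *' gNC +' (uV -' kk 1)))) (kk 0))
    (S t * MM n + S s * NC n) 0 (2 ^ S s) (fun _ => 1) (fun u _ => S t * MM n + S s * NC n + u)
    (S t * MM n + S s * NC n) (2 ^ S s) rho m)
    as (rho' & m' & wk & dp & E & HL' & V & F & B & D); auto; try lia.
  - intros. apply ev_k. lia.
  - intros r Hr. assert (W : Wd n w r G) by (split; [apply Hr|auto]). pose proof (EG (S t * MM n + S s * NC n) 0 r G Hr (le_n _)).
    assert (s + 1 = S s) as E1 by lia.
    eapply ev_eq; [repeat ev1|]; rewrite ?E1; try lia.
  - intros. apply ev_k. lia.
  - intros u v r Hu Hv Hr Hru Hrv. apply ev_add; [apply HLb; auto; lia|apply ev_varG; auto; unfold G; lia|nia].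
  - exists rho', m', wk, dp. split; [exact E|]. split; [exact HL'|]. split; [|split; lia]. split.
    + intros a Ha. transitivity (m a); [|apply Q1, Ha]. apply F. intros; lia.
    + intros s' Hs' i Hi. destruct (Nat.eq_dec s' (S s)) as [->|N].
      * replace (S t * MM n + (S s * NC n + i)) with (S t * MM n + S s * NC n + i) by lia.
        apply (V i 0); [auto|auto|]. intros r Hr Hru _.
        assert (W : Wd n w r (G + 4)) by (split; [apply Hr|lia]).
        pose proof (EG (S t * MM n + S s * NC n) 0 r (G + 4) Hr ltac:(lia)).
        assert (HU : evb w m (S t * MM n + S s * NC n) 0 r (G + 4) uV i) by (apply ev_varG; auto; lia).
        set (e := HH n - S s) in *.
        assert (Ee : 2 ^ (HH n - s) = 2 * 2 ^ e).
        { unfold e. replace (HH n - s) with (S (HH n - S s)) by lia. apply Nat.pow_succ_r'. }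
        assert (Hi2 : i / 2 < 2 ^ s) by (apply Nat.Div0.div_lt_upper_bound; lia).
        assert (VA : m (S t * MM n + (s * NC n + i / 2)) = psum A (i / 2 * (2 * 2 ^ e))).
        { rewrite <- Ee. apply Q2; lia. }
        pose proof (Nat.div_mod_eq i 2) as Dm. pose proof (Nat.mod_upper_bound i 2 ltac:(lia)).
        assert (Be : 2 ^ e * 2 ^ S s = NC n).
        { rewrite <- Nat.pow_add_r. unfold NC, e. f_equal. lia. }
        assert (e * NC n + NC n <= HH n * NC n).
        { replace (e * NC n + NC n) with ((e + 1) * NC n) by lia. apply Nat.mul_le_mono_r. unfold e; lia. }
        assert (HJ : forall j, j <= NC n -> psum A j < 2 ^ w).
        { intros j Hj. pose proof (P_mono j (NC n) Hj). lia. }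
        assert (i * 2 ^ e <= NC n). { rewrite <- Be. rewrite Nat.mul_comm. apply Nat.mul_le_mono_l. lia. }
        (* The parent of an odd node starts where its left sibling starts; the parent of an even
           node starts where the node itself does. *)
        assert (DV : i mod 2 = 1 -> i / 2 * (2 * 2 ^ e) = (i - 1) * 2 ^ e).
        { intros Hodd. replace (i - 1) with (2 * (i / 2)) by lia. ring. }
        assert (DV0 : i mod 2 <> 1 -> i / 2 * (2 * 2 ^ e) = i * 2 ^ e).
        { intros Hev. replace (i * 2 ^ e) with (2 * (i / 2) * 2 ^ e) by (f_equal; lia). ring. }
        assert (Pm : psum A ((i - 1) * 2 ^ e) <= psum A (i * 2 ^ e)).
        { apply P_mono, Nat.mul_le_mono_r. lia. }
        assert (Si : S s * NC n = s * NC n + NC n) by lia.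
        assert (i / 2 < NC n) by lia.
        assert (HLd : forall k x xv, k <= S t -> evb w m (S t * MM n + S s * NC n) 0 r (G + 4) x xv -> xv < MM n -> (k = S t -> xv < S s * NC n) ->
          evb w m (S t * MM n + S s * NC n) 0 r (G + 4) (ld (kk k *' gM +' x)) (m (k * MM n + xv))).
        { intros k x xv Hk Hx Hxm Hxv. apply ev_ld; [apply ev_base; auto; lia|].
          destruct (Nat.eq_dec k (S t)) as [->|Nk]; [specialize (Hxv eq_refl); lia|].
          assert (k <= t) by lia. assert (k * MM n <= t * MM n) by (apply Nat.mul_le_mono_r; lia). simpl. lia. }
        assert (VB : i mod 2 = 1 -> m (t * MM n + (e * NC n + (i - 1))) = psum A (i * 2 ^ e) - psum A ((i - 1) * 2 ^ e)).
        { intros Hodd. rewrite Q1 by (simpl; lia). rewrite HUp.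
          - replace (S (i - 1)) with i by lia. reflexivity.
          - unfold e; lia.
          - unfold e. replace (HH n - (HH n - S s)) with (S s) by lia. lia. }
        eapply (ev_eq _ _ _ _ _ _ _ _ (psum A (i / 2 * (2 * 2 ^ e)) + if i mod 2 =? 1 then psum A (i * 2 ^ e) - psum A ((i - 1) * 2 ^ e) else 0)).
        -- rewrite <- VA at 1. apply ev_add.
           ++ apply HLd; auto; try (intros; lia). repeat ev1; auto; lia.
           ++ apply ev_if_eq; auto; [repeat ev1; auto; lia|repeat ev1; lia| |intros; apply ev_k; lia].
              intros Hodd. rewrite <- VB by auto.
              apply HLd; auto; try (intros; lia).
              replace e with (HH n - s - 1) by (unfold e; lia). repeat ev1; auto; try lia.
           ++ rewrite VA. pose proof (HJ (i * 2 ^ e) ltac:(lia)). destruct (Nat.eqb_spec (i mod 2) 1) as [O|O].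
              ** rewrite DV by exact O. lia.
              ** rewrite DV0 by exact O. lia.
        -- destruct (Nat.eqb_spec (i mod 2) 1) as [O|O].
           ++ rewrite DV by exact O. lia.
           ++ rewrite DV0 by exact O. lia.
      * transitivity (m (S t * MM n + (s' * NC n + i))); [|apply Q2; lia]. apply F. intros u v Hu Hv.
        assert (i < NC n). { apply (Nat.lt_le_trans _ (2 ^ s')); auto. apply Nat.pow_le_mono_r; lia. }
        assert (s' * NC n <= s * NC n) by (apply Nat.mul_le_mono_r; lia). simpl. lia.
Qed.
End Scan.

(** While a scan is running, its scratch regions satisfy more than the final specification says. The
    specification is replaced there for the time of the scan and restored by [Inv_weaken]. *)
Definition override (spec : specs) (t : nat) (P : nat -> list bool -> (nat -> nat) -> Prop) : specs :=
  fun n T t' => if t' =? t then P n T else spec n T t'.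

Lemma override_same spec t P n T : override spec t P n T t = P n T.
Proof. unfold override. now rewrite Nat.eqb_refl. Qed.

Lemma override_other spec t P n T t' : t' <> t -> override spec t P n T t' = spec n T t'.
Proof. intros H. unfold override. now rewrite (proj2 (Nat.eqb_neq _ _) H). Qed.

Lemma psum_pow2 k : psum (fun t => 2 ^ t) k + 1 = 2 ^ k.
Proof. induction k; [reflexivity|]. cbn [psum]. rewrite Nat.pow_succ_r'. lia. Qed.

Lemma psum_rev f k : psum (fun t => f (k - S t)) k = psum f k.
Proof.
  induction k; auto. rewrite psum_shift. cbn [psum].
  rewrite (psum_ext (fun i => f (S k - S (S i))) (fun i => f (k - S i))) by (intros; f_equal; lia).
  rewrite IHk. replace (S k - 1) with k by lia. lia.
Qed.

Lemma level_index n s i : s <= HH n -> i < NC n -> s * NC n + i < MM n.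
Proof.
  intros H1 H2. pose proof (scan_space n) as (B1 & B2 & B3 & B4).
  assert (s * NC n <= HH n * NC n) by (apply Nat.mul_le_mono_r; lia). lia.
Qed.

Lemma pow_le_NC n s : s <= HH n -> 2 ^ (HH n - s) <= NC n /\ 2 ^ s <= NC n.
Proof. intros H. split; apply Nat.pow_le_mono_r; lia. Qed.

Lemma Inv_weaken (s s' : specs) k : 
  (forall n T t' a, t' < k -> s n T t' a -> s' n T t' a) ->
  forall n T w rho m, Inv s k n T w rho m -> Inv s' k n T w rho m.
Proof. intros H n T w rho m (A1 & A2 & A3). split; [auto|split; [auto|]]. intros t' Ht'. apply H; auto. Qed.

Lemma Inv_step (s : specs) k n T w rho m : inst n T w -> globs n w rho ->
  known s k n T m -> s n T k (rg n m k) -> Inv s (S k) n T w rho m.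
Proof.
  intros H1 H2 H3 H4. split; [auto|split; [auto|]]. intros t' Ht'. destruct (Nat.eq_dec t' k) as [->|N]; auto.
  apply H3. lia.
Qed.

Lemma flat_cost (f : nat -> nat) : (exists C, forall n, 1 <= n -> f n * lg n <= C * n) ->
  exists C, forall n, 1 <= n -> f n * (0 + 1) * lg n <= C * n.
Proof. intros [C H]. exists C. intros n Hn. rewrite Nat.mul_1_r. auto. Qed.

Lemma flat_depth : exists C, forall n, 1 <= n -> 0 + 1 <= C * lg n.
Proof. exists 1. intros n _. pose proof (lg_pos n). lia. Qed.

(** * The whole scan as a triple *)

Section ScanTri.
Context (sp : specs) (t : nat) (A : nat -> list bool -> nat -> nat).
Hypothesis Ht : t + 3 < 60.
Hypothesis HA : forall n T w, inst n T w -> psum (A n T) (NC n) < 2 ^ w.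

Definition leaf_s n T (a : nat -> nat) := forall i, i < NC n -> a i = A n T i.
Definition up_s n T (a : nat -> nat) := forall s i, s <= HH n -> i < 2 ^ (HH n - s) ->
  a (s * NC n + i) = psum (A n T) (S i * 2 ^ s) - psum (A n T) (i * 2 ^ s).
Definition root_s (n : nat) (T : list bool) (a : nat -> nat) := a 0 = 0.
Definition down_s n T (a : nat -> nat) := forall i, i < NC n -> a (HH n * NC n + i) = psum (A n T) i.

Let sp1 := override sp (t + 1) leaf_s.
Let sp2 := override (override sp (t + 1) up_s) (t + 2) root_s.
Let sp3 := override (override sp (t + 1) up_s) (t + 2) down_s.

Lemma up_tri : Tri (Inv sp1 (S (t + 1))) (scan_up (t + 1)) (Inv sp2 (S (t + 1))).
Proof.
  destruct NC_cost as [C1 HC1]. 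
  match goal with |- Tri _ (scan_up (t + 1)) _ => unfold scan_up end.
  match goal with |- Tri _ (rounds (phase ?a ?b ?c ?d ?e ?f)) _ => set (K := phase_k a b c d e f) end.
  match goal with |- Tri _ (rounds ?c) _ => set (bd := c) end.
  exists ((3 * K + 8 + 6) * C1 + (6 + 2 * (K + 8)) * 8). intros n T w rho m (HI & HG & HK).
  assert (L0 : leaf_s n T (rg n m (t + 1))).
  { specialize (HK (t + 1) ltac:(lia)). unfold sp1 in HK. now rewrite override_same in HK. }
  pose proof (scan_space n) as (B1 & B2 & B3 & B4).
  destruct (rounds_ok n T w bd (upQ (t + 1) n (A n T) m) (fun s => K * (2 * 2 ^ (HH n - S s) + 1)) K HI) with (rho := rho) (m := m)
    as (rho' & m' & wk & dp & E & HG' & [Q1 Q2] & B & D); auto.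
  - intros s r m0 Hs HL HQ. apply (up_step (t + 1) n w T (A n T) HI ltac:(lia) (HA n T w HI) m s r m0 Hs HL HQ).
  - split; auto. intros s' Hs' i Hi. replace s' with 0 in * by lia. rewrite Nat.sub_0_r in Hi.
    replace (0 * NC n + i) with i by lia. replace (S i * 2 ^ 0) with (S i) by (simpl; lia).
    replace (i * 2 ^ 0) with i by (simpl; lia). fold (NC n) in Hi.
    rewrite <- rg_at by lia. rewrite L0 by auto. cbn [psum]. lia.
  - exists rho', m', wk, dp. split; [exact E|]. split; [|split].
    + replace (S (t + 1)) with (S (t + 1)) by lia. apply Inv_step; auto.
      * intros t' Ht'. rewrite (rg_ext n m m' t' (t + 1)) by auto. specialize (HK t' ltac:(lia)).
        unfold sp1 in HK. rewrite override_other in HK by lia. unfold sp2.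
        rewrite !override_other by lia. exact HK.
      * unfold sp2. rewrite override_other, override_same by lia. intros s i Hs Hi.
        rewrite rg_at.
        -- now apply (Q2 s).
        -- apply level_index; auto. pose proof (pow_le_NC n s Hs). lia.
    + destruct HI as (Hn & _). specialize (HC1 n Hn). pose proof (HH_le n).
      (* A geometric series over the levels, at most [2 * NC n], plus a constant for each of the
         [HH n] rounds. *)
      assert (X : psum (fun s => K * (2 * 2 ^ (HH n - S s) + 1) + 8) (HH n) <= 2 * K * NC n + HH n * (K + 8)).
      { rewrite (psum_ext _ (fun s => 2 * K * 2 ^ (HH n - S s) + (K + 8))) by (intros; lia).
        rewrite (psum_add (fun s => 2 * K * 2 ^ (HH n - S s)) (fun _ => K + 8)), psum_const, psum_mul.
        rewrite (psum_rev (fun t => 2 ^ t)). pose proof (psum_pow2 (HH n)). fold (NC n) in *. nia. }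
      assert (HL : lg n * lg n <= 8 * n) by now apply lg_lin. pose proof (lg_pos n).
      assert (HH n * (K + 8) * lg n <= (2 * (K + 8)) * (8 * n)).
      { apply (Nat.le_trans _ ((2 * lg n) * (K + 8) * lg n)).
        - repeat apply Nat.mul_le_mono_r. lia.
        - replace (2 * lg n * (K + 8) * lg n) with (2 * (K + 8) * (lg n * lg n)) by ring. now apply Nat.mul_le_mono_l. }
      assert (2 * K * NC n * lg n <= 2 * K * (C1 * n)).
      { rewrite <- Nat.mul_assoc. apply Nat.mul_le_mono_l. exact HC1. }
      assert (lg n <= 8 * n) by nia.
      assert (wk * lg n <= (6 + (2 * K * NC n + HH n * (K + 8))) * lg n) by (apply Nat.mul_le_mono_r; lia).
      nia.
    + pose proof (HH_le n). pose proof (lg_pos n).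
      assert (HH n * (K + 8) <= 2 * lg n * (K + 8)) by (apply Nat.mul_le_mono_r; lia). nia.
Qed.

Lemma down_tri : Tri (Inv sp2 (S (t + 2))) (scan_down (t + 1)) (Inv sp3 (S (t + 2))).
Proof.
  destruct NC_cost as [C1 HC1].
  match goal with |- Tri _ (scan_down (t + 1)) _ => unfold scan_down end.
  match goal with |- Tri _ (rounds (phase ?a ?b ?c ?d ?e ?f)) _ => set (K := phase_k a b c d e f) end.
  match goal with |- Tri _ (rounds ?c) _ => set (bd := c) end.
  exists ((4 * K + 8 + 6) * C1 + (6 + 2 * (K + 8)) * 8). intros n T w rho m (HI & HG & HK).
  assert (L0 : up_s n T (rg n m (t + 1))).
  { specialize (HK (t + 1) ltac:(lia)). unfold sp2 in HK. rewrite override_other, override_same in HK by lia. exact HK. }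
  assert (L1 : root_s n T (rg n m (t + 2))).
  { specialize (HK (t + 2) ltac:(lia)). unfold sp2 in HK. now rewrite override_same in HK. }
  pose proof (scan_space n) as (B1 & B2 & B3 & B4).
  assert (HU : upQ (t + 1) n (A n T) m (HH n) m).
  { split; auto. intros s Hs i Hi. rewrite <- rg_at.
    - now apply L0.
    - apply level_index; auto. pose proof (pow_le_NC n s Hs). lia. }
  destruct (rounds_ok n T w bd (downQ (t + 1) n (A n T) m) (fun s => K * (2 * 2 ^ S s + 1)) K HI) with (rho := rho) (m := m)
    as (rho' & m' & wk & dp & E & HG' & [Q1 Q2] & B & D); auto.
  - intros s r m0 Hs HL HQ. apply (down_step (t + 1) n w T (A n T) HI ltac:(lia) (HA n T w HI) m s r m0 Hs HL HU HQ).
  - split; auto. intros s' Hs' i Hi. replace s' with 0 in * by lia. change (2 ^ 0) with 1 in Hi.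
    replace i with 0 by lia. replace (0 * NC n + 0) with 0 by lia. rewrite Nat.mul_0_l.
    replace (S (t + 1)) with (t + 2) by lia. rewrite <- rg_at by lia. exact L1.
  - exists rho', m', wk, dp. split; [exact E|]. replace (S (t + 1)) with (t + 2) in * by lia. split; [|split].
    + apply Inv_step; auto.
      * intros t' Ht'. rewrite (rg_ext n m m' t' (t + 2)) by auto. specialize (HK t' ltac:(lia)).
        unfold sp2 in HK. rewrite override_other in HK by lia. unfold sp3.
        rewrite (override_other _ (t + 2)) by lia. exact HK.
      * unfold sp3. rewrite override_same by lia. intros i Hi.
        rewrite rg_at by (apply level_index; auto). rewrite (Q2 (HH n)) by auto. rewrite Nat.sub_diag. f_equal. simpl. lia.
    + destruct HI as (Hn & _). specialize (HC1 n Hn). pose proof (HH_le n).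
      assert (X : psum (fun s => K * (2 * 2 ^ S s + 1) + 8) (HH n) <= 4 * K * NC n + HH n * (K + 8)).
      { rewrite (psum_ext _ (fun s => 4 * K * 2 ^ s + (K + 8))) by (intros; rewrite Nat.pow_succ_r'; lia).
        rewrite (psum_add (fun s => 4 * K * 2 ^ s) (fun _ => K + 8)), psum_const, (psum_mul (4 * K) (fun s => 2 ^ s)).
        pose proof (psum_pow2 (HH n)). fold (NC n) in *. apply Nat.add_le_mono_r, Nat.mul_le_mono_l. lia. }
      assert (HL : lg n * lg n <= 8 * n) by now apply lg_lin. pose proof (lg_pos n).
      assert (HH n * (K + 8) * lg n <= (2 * (K + 8)) * (8 * n)).
      { apply (Nat.le_trans _ ((2 * lg n) * (K + 8) * lg n)).
        - repeat apply Nat.mul_le_mono_r. lia.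
        - replace (2 * lg n * (K + 8) * lg n) with (2 * (K + 8) * (lg n * lg n)) by ring. now apply Nat.mul_le_mono_l. }
      assert (4 * K * NC n * lg n <= 4 * K * (C1 * n)).
      { rewrite <- Nat.mul_assoc. apply Nat.mul_le_mono_l. exact HC1. }
      assert (lg n <= 8 * n) by nia.
      assert (wk * lg n <= (6 + (4 * K * NC n + HH n * (K + 8))) * lg n) by (apply Nat.mul_le_mono_r; lia).
      nia.
    + pose proof (HH_le n). pose proof (lg_pos n).
      assert (HH n * (K + 8) <= 2 * lg n * (K + 8)) by (apply Nat.mul_le_mono_r; lia). nia.
Qed.

Lemma scan_tri :
  (forall n T a, sp n T t a -> leaf_s n T a) ->
  (forall n T a, sp n T (t + 1) a) -> (forall n T a, sp n T (t + 2) a) ->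
  (forall n T a, (forall i, i < NC n -> a i = psum (A n T) i) -> sp n T (t + 3) a) ->
  Tri (Inv sp (t + 1)) (scan t) (Inv sp (t + 4)).
Proof.
  intros H0 H1 H2 H3. unfold scan.
  assert (T1 : Tri (Inv sp1 (t + 1)) (mapphase (t + 1) (kk 0) gNC (arr t uV)) (Inv sp1 (S (t + 1)))).
  { apply map_tri with (bndf := fun _ => 0) (cntf := NC); try lia; try reflexivity.
    - apply flat_cost, NC_cost.
    - apply flat_depth.
    - intros n T w HI. pose proof (inst_w _ _ _ HI) as Hw. pose proof (pow2_pos w). pose proof (scan_space n). lia.
    - intros n T w m l b tau r HI [HL _]. pose proof (pow2_pos w).
      assert (W : Wd n w r G) by (split; auto). split; repeat ev1; lia.
    - intros n T w m a HI HK Ha. unfold sp1. rewrite override_same. intros i Hi. apply Ha; auto.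
      intros r Hr HU. world n w r Hr (G + 4) HU i. pose proof (scan_space n).
      eapply ev_eq; [eapply ev_arr; eauto; lia|].
      apply H0; auto. specialize (HK t ltac:(lia)). unfold sp1 in HK. rewrite override_other in HK by lia. exact HK. }
  assert (T3 : Tri (Inv sp2 (t + 2)) (mapphase (t + 2) (kk 0) (kk 1) (kk 0)) (Inv sp2 (S (t + 2)))).
  { apply map_tri with (bndf := fun _ => 0) (cntf := fun _ => 1); try lia; try reflexivity.
    - exists 8. intros n Hn. pose proof (lg_lin n Hn). pose proof (lg_pos n). nia.
    - apply flat_depth.
    - intros n T w HI. pose proof (pow2_pos w). pose proof (scan_space n). lia.
    - intros n T w m l b tau r HI [HL _]. pose proof (inst_w _ _ _ HI) as Hw. pose proof (pow2_ge2 w Hw). split; repeat ev1; lia.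
    - intros n T w m a HI HK Ha. unfold sp2. rewrite override_same. apply Ha; auto.
      intros r Hr HU. pose proof (pow2_pos w). apply ev_k. lia. }
  assert (T5 : Tri (Inv sp3 (t + 3)) (mapphase (t + 3) (kk 0) gNC (arr (t + 2) (gH *' gNC +' uV))) (Inv sp3 (S (t + 3)))).
  { apply map_tri with (bndf := fun _ => 0) (cntf := NC); try lia; try reflexivity.
    - apply flat_cost, NC_cost.
    - apply flat_depth.
    - intros n T w HI. pose proof (pow2_pos w). pose proof (scan_space n). lia.
    - intros n T w m l b tau r HI [HL _]. pose proof (pow2_pos w).
      assert (W : Wd n w r G) by (split; auto). split; repeat ev1; lia.
    - intros n T w m a HI HK Ha. unfold sp3. rewrite !override_other by lia. apply H3. intros i Hi. apply Ha; auto.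
      intros r Hr HU. world n w r Hr (G + 4) HU i. pose proof (scan_space n) as (B1 & B2 & B3 & B4). szs HI.
      pose proof (level_index n (HH n) i (le_n _) Hi).
      eapply ev_eq; [eapply ev_arr; eauto|].
      + repeat ev1; lia.
      + replace (t + 3) with (S (t + 2)) by lia. lia.
      + lia.
      + specialize (HK (t + 2) ltac:(lia)). unfold sp3 in HK. rewrite override_same in HK by lia. now apply HK. }
  eapply Tri_seq; [eapply Tri_conseq; [exact T1| |intros; eassumption]|].
  { apply Inv_weaken. intros n T t' a Ht'. unfold sp1. rewrite override_other by lia. auto. }
  eapply Tri_seq; [exact up_tri|]. replace (S (t + 1)) with (t + 2) by lia.
  eapply Tri_seq; [exact T3|]. eapply Tri_seq; [exact down_tri|].
  replace (S (t + 2)) with (t + 3) by lia. eapply Tri_conseq; [exact T5|intros; eassumption|].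
  replace (S (t + 3)) with (t + 4) by lia. apply Inv_weaken. intros n T t' a Ht'. unfold sp3.
  destruct (Nat.eq_dec t' (t + 2)) as [->|N2]; [intros; apply H2|].
  destruct (Nat.eq_dec t' (t + 1)) as [->|N1]; [intros; apply H1|].
  rewrite !override_other by lia. auto.
Qed.
End ScanTri.

(** * Ranges and sub-ranges *)

Section Index.
Context (c : bool) (T : list bool).
Notation N := (count c T).
Notation rk_ := (rk c T).
Notation bnd_ := (bnd c T).

Lemma N_rk : N = rk_ (length T).
Proof. apply count_cntb. Qed.

Lemma rk_le p : rk_ p <= p.
Proof. apply cntb_le. Qed.

Lemma rk_mono p q : p <= q -> rk_ p <= rk_ q.
Proof. apply cntb_mono. Qed.

Lemma rk_le_N p : rk_ p <= N.
Proof. rewrite N_rk. unfold rk. rewrite (cntb_min c T p). apply cntb_mono. lia. Qed.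

Lemma N_le : N <= length T.
Proof. rewrite N_rk. apply rk_le. Qed.

Lemma rk_add p d : rk_ (p + d) <= rk_ p + d.
Proof. unfold rk. rewrite cntb_split. pose proof (cntb_le (fun i => Bf c T (p + i)) d). lia. Qed.

Lemma sel_spec i : 1 <= i <= N -> select c T i < length T /\ Bf c T (select c T i) = true /\ rk_ (select c T i) = i - 1.
Proof. intros H. rewrite select_fsel by auto. rewrite N_rk in H. now apply fsel_spec. Qed.

Lemma bnd_sel i : 1 <= i -> bnd_ i = select c T i.
Proof. intros H. unfold bnd. now rewrite (proj2 (Nat.eqb_neq i 0)) by lia. Qed.

Lemma bnd_out i : N < i -> bnd_ i = length T.
Proof. intros H. rewrite bnd_sel by lia. now apply select_out. Qed.

Lemma bnd_le i : bnd_ i <= length T.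
Proof.
  destruct (Nat.eq_dec i 0) as [->|H]; [unfold bnd; simpl; lia|].
  destruct (Nat.le_gt_cases i N); [|rewrite bnd_out; lia].
  rewrite bnd_sel by lia. pose proof (sel_spec i). lia.
Qed.

(** Truncated subtraction and minimum express the two conventions: boundary 0 is position 0, and
    boundaries past the last occurrence are at the end of [T]. *)
Lemma rk_bnd i : rk_ (bnd_ i) = Nat.min (i - 1) N.
Proof.
  destruct (Nat.eq_dec i 0) as [->|H]; [reflexivity|].
  destruct (Nat.le_gt_cases i N).
  - rewrite bnd_sel by lia. destruct (sel_spec i) as (_ & _ & ->); lia.
  - rewrite bnd_out by lia. rewrite <- N_rk. lia.
Qed.

(** The Galois connection between rank and select, extended to missing occurrences, which are placed
    at [length T]. *)
Lemma bnd_lt_iff i p : 1 <= i -> p <= length T -> bnd_ i < p <-> i <= rk_ p.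
Proof.
  intros Hi Hp. destruct (Nat.le_gt_cases i N) as [H|H].
  - rewrite bnd_sel by lia. destruct (sel_spec i) as (A & B & C); [lia|]. split; intros X.
    + pose proof (cntb_lt (Bf c T) _ p B X). unfold rk in *. lia.
    + destruct (Nat.lt_ge_cases (select c T i) p) as [|Y]; auto. apply rk_mono in Y. lia.
  - rewrite bnd_out by lia. pose proof (rk_le_N p). lia.
Qed.

Lemma bnd_mono i j : i <= j -> bnd_ i <= bnd_ j.
Proof.
  intros H. destruct (Nat.eq_dec i 0) as [->|Hi]; [unfold bnd; simpl; lia|].
  destruct (Nat.lt_ge_cases (bnd_ j) (bnd_ i)) as [X|]; auto.
  apply bnd_lt_iff in X; [|lia|apply bnd_le]. rewrite rk_bnd in X. lia.
Qed.

Lemma bnd_lt i j : 1 <= i -> i < j -> i <= N -> bnd_ i < bnd_ j.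
Proof. intros A B C. apply bnd_lt_iff; auto; [apply bnd_le|]. rewrite rk_bnd. lia. Qed.

Definition is_chunk (h v x : nat) : Prop :=
  x < 2 ^ h /\ forall t, t < h -> Nat.testbit x t = Bf c T (v * h + t).

Lemma chunk_cnt h v x t : is_chunk h v x -> t <= h -> rk_ (v * h + t) = rk_ (v * h) + cntb (Nat.testbit x) t.
Proof.
  intros [_ H] Ht. unfold rk. rewrite cntb_split. f_equal. apply cntb_ext. intros i Hi. symmetry. apply H. lia.
Qed.

Lemma chunk_sel h v x i : is_chunk h v x -> rk_ (v * h) < i -> i <= rk_ (S v * h) ->
  select c T i = v * h + fsel (Nat.testbit x) h (i - rk_ (v * h)) /\
  1 <= i - rk_ (v * h) <= cntb (Nat.testbit x) h.
Proof.
  intros HC H1 H2. assert (E : S v * h = v * h + h) by lia.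
  rewrite E, (chunk_cnt h v x h HC) in H2 by lia. split; [|lia].
  assert (HN : i <= N). { pose proof (rk_le_N (v * h + h)). rewrite (chunk_cnt h v x h HC) in H by lia. lia. }
  destruct (fsel_spec (Nat.testbit x) h (i - rk_ (v * h))) as (A & B & C); [lia|].
  destruct (sel_spec i) as (A' & B' & C'); [lia|].
  apply (cntb_inj (Bf c T)); auto.
  - rewrite <- (proj2 HC) by auto. exact B.
  - change (rk_ (select c T i) = rk_ (v * h + fsel (Nat.testbit x) h (i - rk_ (v * h)))).
    rewrite (chunk_cnt h v x) by (auto; lia). lia.
Qed.
End Index.

Lemma psum_tele (P : nat -> nat) k : (forall i, P i <= P (S i)) -> psum (fun v => P (S v) - P v) k = P k - P 0.
Proof.
  intros H. assert (M : forall i, P 0 <= P i) by (induction i; auto; etransitivity; eauto).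
  induction k; [simpl; lia|]. cbn [psum]. rewrite IHk. specialize (H k). specialize (M k). lia.
Qed.

Lemma psum_isum f (P : nat -> nat) k : (forall i, P i <= P (S i)) ->
  psum (fun v => isum f (P v) (P (S v))) k = isum f (P 0) (P k).
Proof.
  intros H. assert (M : forall i, P 0 <= P i) by (induction i; auto; etransitivity; eauto).
  induction k; [rewrite isum_nil; auto|]. cbn [psum]. rewrite IHk. symmetry. apply isum_split; auto.
Qed.

Lemma div_mul_le a b : a / b * b <= a.
Proof. destruct b; [lia|]. pose proof (Nat.div_mod_eq a (S b)). lia. Qed.

Lemma div_ub a b : 1 <= b -> a < (a / b + 1) * b.
Proof. intros H. pose proof (Nat.div_mod_eq a b). pose proof (Nat.mod_upper_bound a b). lia. Qed.

Lemma div_between a b k : 1 <= b -> k * b <= a -> a < (k + 1) * b -> a / b = k.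
Proof. intros H A B. symmetry. apply (Nat.div_unique a b k (a - k * b)); lia. Qed.

Lemma ceil_le a b c : 1 <= b -> a <= c * b -> ceil_div a b <= c.
Proof. intros H A. unfold ceil_div. apply Nat.lt_succ_r. apply Nat.Div0.div_lt_upper_bound. nia. Qed.

Lemma ceil_mul a b : 1 <= b -> a <= ceil_div a b * b.
Proof. intros H. unfold ceil_div. pose proof (div_ub (a + b - 1) b H). lia. Qed.

Lemma ceil_lt a b : 1 <= b -> ceil_div a b * b < a + b.
Proof. intros H. unfold ceil_div. pose proof (div_mul_le (a + b - 1) b). lia. Qed.

Lemma ceil_mono a b c : a <= b -> ceil_div a c <= ceil_div b c.
Proof. intros H. unfold ceil_div. apply Nat.Div0.div_le_mono. lia. Qed.

(** * Short ranges, their sub-ranges, and bounds on the numbers of bits *)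

Section Ranges.
Context (c : bool) (T : list bool).
Notation n := (length T).
Notation N := (count c T).
Notation rk_ := (rk c T).
Notation bnd_ := (bnd c T).
Notation short_ := (short c T).
Notation rlen_ := (rlen c T).
Notation lgr_ := (lgr c T).
Notation gp_ := (gp c T).
Notation sidx_ := (sidx c T).
Notation nidx_ := (nidx c T).
Notation slen_ := (slen c T).

Lemma gg_pos : 1 <= gg n.
Proof. unfold gg. pose proof (lg_pos n). pose proof (LL_pos n). nia. Qed.

Lemma lgr_pos k : 1 <= lgr_ k. Proof. apply lg_pos. Qed.
Lemma gp_pos k : 1 <= gp_ k.
Proof. unfold gp. pose proof (lgr_pos k). pose proof (LL_pos n). nia. Qed.

(** Both [lg n] and [LL n] are at most [2 ^ LL n], and the threshold is the product of their
    squares. *)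
Lemma short_lgr k : short_ k = true -> lgr_ k <= 4 * LL n /\ rlen_ k < thr n.
Proof.
  intros H. apply Nat.ltb_lt in H. split; auto. pose proof (LL_pos n). apply lg_le_pow; [lia|].
  pose proof (lg_up (lg n)). fold (LL n) in *. pose proof (le_pow2 (LL n)).
  assert (thr n <= 2 ^ (4 * LL n)); [|lia]. unfold thr. replace (4 * LL n) with (LL n * 2 + LL n * 2) by lia.
  rewrite Nat.pow_add_r, !Nat.pow_mul_r. apply Nat.mul_le_mono; apply Nat.pow_le_mono_l; lia.
Qed.

Lemma lgr_le k : 1 <= n -> lgr_ k <= lg n.
Proof.
  intros Hn. unfold lgr. apply lg_mono. unfold rlen. pose proof (bnd_le c T (S k * gg n)). lia.
Qed.

Lemma range_of i : i / gg n * gg n <= i < S (i / gg n) * gg n.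
Proof. pose proof gg_pos. pose proof (div_mul_le i (gg n)). pose proof (div_ub i (gg n)). lia. Qed.

Lemma sidx_bounds i : i / gg n * gg n <= sidx_ i <= i /\ i < nidx_ i <= S (i / gg n) * gg n.
Proof.
  pose proof (range_of i). unfold nidx, sidx. destruct (short_ (i / gg n)); [|lia].
  set (k := i / gg n) in *. pose proof (gp_pos k).
  pose proof (div_mul_le (i - k * gg n) (gp_ k)). pose proof (div_ub (i - k * gg n) (gp_ k)). lia.
Qed.

(** Sub-ranges, and long ranges taken as a whole, partition the occurrence numbers into intervals;
    [sidx_lt] gives the order of the classes. *)
Lemma sidx_same i i' : sidx_ i <= i' < nidx_ i -> sidx_ i' = sidx_ i /\ nidx_ i' = nidx_ i /\ i' / gg n = i / gg n.
Proof.
  intros H. pose proof (sidx_bounds i) as B. pose proof gg_pos as Gp.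
  assert (E : i' / gg n = i / gg n) by (apply div_between; lia).
  assert (S1 : sidx_ i' = sidx_ i).
  { unfold nidx, sidx in *. rewrite E in *. destruct (short_ (i / gg n)); auto.
    set (k := i / gg n) in *. pose proof (gp_pos k). f_equal. f_equal.
    apply div_between; lia. }
  splits; auto. unfold nidx. now rewrite E, S1.
Qed.

Lemma sidx_lt i i' : i < i' -> ~ (sidx_ i <= i' < nidx_ i) -> nidx_ i <= sidx_ i'.
Proof.
  intros H Hn. pose proof (sidx_bounds i) as B. pose proof (sidx_bounds i') as B'.
  destruct (Nat.le_gt_cases (nidx_ i) (sidx_ i')) as [|X]; auto. exfalso.
  destruct (Nat.le_gt_cases (sidx_ i) (sidx_ i')) as [Y|Y].
  - destruct (sidx_same i (sidx_ i')) as (S1 & S2 & S3); [lia|].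
    destruct (sidx_same i' (sidx_ i')) as (S1' & S2' & S3'); [lia|]. lia.
  - destruct (sidx_same i' i) as (S1 & S2 & S3); [lia|]. lia.
Qed.

Lemma slen_le i : slen_ i <= rlen_ (i / gg n).
Proof.
  pose proof (sidx_bounds i) as (A & B). unfold slen, rlen.
  pose proof (bnd_mono c T (i / gg n * gg n) (sidx_ i)). pose proof (bnd_mono c T (nidx_ i) (S (i / gg n) * gg n)). lia.
Qed.

Lemma val_lt i : 1 <= i <= N -> bnd_ i - bnd_ (sidx_ i) < slen_ i.
Proof.
  intros H. pose proof (sidx_bounds i) as (A & B). unfold slen.
  pose proof (bnd_lt c T i (nidx_ i)). pose proof (bnd_mono c T (sidx_ i) i). lia.
Qed.

Lemma act4_facts i : act4 c T i = true ->
  short_ (i / gg n) = true /\ lg (slen_ i) * lgr_ (i / gg n) * LL n ^ 2 <= slen_ i /\ lg (slen_ i) <= 4 * LL n.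
Proof.
  unfold act4. rewrite andb_true_iff. intros [A B]. apply Nat.leb_le in B. splits; auto.
  etransitivity; [apply lg_mono, slen_le|]. apply (short_lgr _ A).
Qed.

(** The first bound is polynomial in [LL n] and makes a group of answers fit into a word of the
    machine. The second one says that the answers need at most a fraction [1 / LL n] of the length
    of the sub-range, which is why placing them at [ceil (p / loglog n)] causes no overlap. *)
Lemma gp_bits i : act4 c T i = true -> gp_ (i / gg n) * lg (slen_ i) <= 16 * LL n ^ 3 /\
  gp_ (i / gg n) * lg (slen_ i) * LL n <= slen_ i.
Proof.
  intros H. destruct (act4_facts i H) as (A & B & C). destruct (short_lgr _ A) as [D _]. split.
  - unfold gp. replace (16 * LL n ^ 3) with (4 * LL n * LL n * (4 * LL n)) by (simpl; ring).
    repeat apply Nat.mul_le_mono; lia.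
  - replace (gp_ (i / gg n) * lg (slen_ i) * LL n) with (lg (slen_ i) * lgr_ (i / gg n) * LL n ^ 2); [auto|].
    unfold gp. simpl. ring.
Qed.

Lemma sidx_gp i : short_ (i / gg n) = true -> i - sidx_ i < gp_ (i / gg n) /\ nidx_ i - sidx_ i <= gp_ (i / gg n).
Proof.
  intros H. unfold nidx, sidx. rewrite H. set (k := i / gg n).
  pose proof (gp_pos k). pose proof (div_ub (i - k * gg n) (gp_ k)). lia.
Qed.

Lemma off4_lt i : act4 c T i = true -> off4 c T i + lg (slen_ i) <= lg n + 16 * LL n ^ 3.
Proof.
  intros H. destruct (act4_facts i H) as (A & _). destruct (gp_bits i H) as [B _]. destruct (sidx_gp i A) as [C _].
  unfold off4. pose proof (lg_pos n). pose proof (Nat.mod_upper_bound (ceil_div (bnd_ (sidx_ i)) (LL n)) (lg n)).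
  assert ((i - sidx_ i + 1) * lg (slen_ i) <= gp_ (i / gg n) * lg (slen_ i)) by (apply Nat.mul_le_mono_r; lia). lia.
Qed.

Lemma wt4_bound i : 1 <= i <= N -> wt4 c T i <= MM n.
Proof.
  intros Hi. unfold wt4. destruct (act4 c T i) eqn:E; [|lia].
  pose proof (off4_lt i E). pose proof (val_lt i Hi). pose proof (lg_up (slen_ i)).
  apply (Nat.le_trans _ (2 ^ lg (slen_ i) * 2 ^ off4 c T i)); [apply Nat.mul_le_mono_r; lia|].
  rewrite <- Nat.pow_add_r. apply pow_le_M. pose proof (K0_ok (lg n) (lg_pos n)). fold (LL n) in *.
  assert (LL n ^ 3 <= LL n ^ 4) by (apply Nat.pow_le_mono_r; pose proof (LL_pos n); lia). lia.
Qed.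

(** Multiplied by [LL n], this compares the index of an occurrence within its range with the range
    size [lg n * LL n]. A field thus begins in the first word of the record of its range. *)
Lemma wt1_bits i : (i - i / gg n * gg n) / gp_ (i / gg n) * lgr_ (i / gg n) < lg n.
Proof.
  pose proof (range_of i). set (k := i / gg n) in *. pose proof (LL_pos n).
  pose proof (div_mul_le (i - k * gg n) (gp_ k)) as D. set (j := (i - k * gg n) / gp_ k) in *.
  unfold gp in D. assert (X : j * lgr_ k * LL n < lg n * LL n); [|nia].
  replace (j * lgr_ k * LL n) with (j * (lgr_ k * LL n)) by ring.
  assert (i - k * gg n < gg n) by lia. unfold gg in *. lia.
Qed.

Lemma wt1_bound i : 1 <= n -> 1 <= i <= N -> wt1 c T i <= MM n.
Proof.
  intros Hn Hi. unfold wt1. destruct (_ && _) eqn:E; [|lia].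
  pose proof (wt1_bits i). pose proof (lgr_le (i / gg n) Hn).
  assert (bnd_ i - bnd_ (i / gg n * gg n) <= 2 ^ lgr_ (i / gg n)).
  { etransitivity; [|apply lg_up]. unfold rlen. pose proof (range_of i). pose proof (bnd_mono c T i (S (i / gg n) * gg n)). lia. }
  apply (Nat.le_trans _ (2 ^ lgr_ (i / gg n) * 2 ^ lg n)).
  - apply Nat.mul_le_mono; auto. apply Nat.pow_le_mono_r; lia.
  - rewrite <- Nat.pow_add_r. apply x_le_MM. lia.
Qed.
End Ranges.

(** * Chunks and ranks *)

Lemma off_bounds c : 6 <= off c <= 29.
Proof. destruct c; unfold off; lia. Qed.

Lemma known_off c j n T m t : known spec t n T m -> off c + j < t -> j < 23 ->
  nth j (per_bit c n T) s_any (rg n m (off c + j)).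
Proof. intros HK Ht Hj. rewrite <- (spec_off c n T j Hj). now apply HK. Qed.

Lemma NC_h n : NC n * hh n <= MM n.
Proof.
  pose proof (HH_le n) as H. pose proof (hh_bounds n). pose proof (le_pow2 (lg n)).
  assert (A : NC n <= 2 ^ (lg n + 1)) by (apply Nat.pow_le_mono_r; lia).
  apply (Nat.le_trans _ (2 ^ (lg n + 1) * 2 ^ lg n)); [apply Nat.mul_le_mono; lia|].
  rewrite <- Nat.pow_add_r. apply x_le_MM. lia.
Qed.

Lemma chunk_in n p : p <= n -> p / hh n < NC n.
Proof.
  intros H. pose proof (NC_low n). pose proof (hh_bounds n).
  assert (p / hh n <= n / hh n) by (apply Nat.Div0.div_le_mono; auto). lia.
Qed.

Definition word (n : nat) (T : list bool) (k : nat) : nat :=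
  if k * lg n <? n then bits_val (firstn (lg n) (skipn (k * lg n) T)) else 0.

Lemma word_lt n T k : word n T k < 2 ^ lg n.
Proof.
  unfold word. destruct (_ <? _); [|apply pow2_pos].
  eapply Nat.lt_le_trans; [apply bits_lt|]. apply Nat.pow_le_mono_r; [lia|].
  rewrite length_firstn. lia.
Qed.

Lemma word_bit n T k t : length T = n -> t < lg n ->
  Nat.testbit (word n T k) t = nth (k * lg n + t) T false.
Proof.
  intros HT Ht. unfold word. destruct (Nat.ltb_spec (k * lg n) n).
  - rewrite testbit_bits, nth_firstn, (proj2 (Nat.ltb_lt _ _)), nth_skipn by lia. reflexivity.
  - rewrite Nat.bits_0, nth_overflow; auto. lia.
Qed.

Definition mword (k : bld) : bld := if_ (k *' gL <' gN) (arr 0 k) (kk 0).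

Lemma ev_mword n T w m lim b t0 r d k kv : Ctx n T w m lim t0 -> 0 < t0 -> Wd n w r d ->
  evb w m lim b r d k kv -> kv <= MM n -> evb w m lim b r d (mword k) (word n T kv).
Proof.
  intros HC Ht W Hk Hkv. pose proof HC as (HI & HK & _). szs HI. pose proof (inst_w _ _ _ HI) as Hw.
  pose proof (small_facts n) as (_ & S2 & _ & _ & _ & _ & S7 & _). pose proof (n_le n).
  assert (kv * lg n <= MM n * MM n) by (apply Nat.mul_le_mono; lia).
  unfold word. pose proof (lg_pos n).
  eapply ev_if_lt; auto; [repeat ev1; lia|repeat ev1| |intros; apply ev_k; lia].
  intros Hlt. eapply ev_eq; [eapply ev_arrC; [exact HC|lia|exact W|exact Hk|]|].
  - assert (kv * 1 <= kv * lg n) by (apply Nat.mul_le_mono_l; lia). lia.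
  - apply (HK 0 Ht). exact Hlt.
Qed.

(** A chunk may straddle two input words, so both are joined before shifting. *)
Definition mraw (v : bld) : bld :=
  LET p := v *' gh IN LET k := p /' gL IN
  LET x := mword k +' (mword (k +' kk 1) <<' gL) IN
  (x >>' (p %' gL)) %' (kk 1 <<' gh).

Definition raw (n : nat) (T : list bool) (v : nat) : nat :=
  let p := v * hh n in let k := p / lg n in
  (word n T k + word n T (k + 1) * 2 ^ lg n) / 2 ^ (p mod lg n) mod 2 ^ hh n.

Lemma raw_bit n T v t : length T = n -> t < hh n -> Nat.testbit (raw n T v) t = nth (v * hh n + t) T false.
Proof.
  intros HT Ht. unfold raw. set (p := v * hh n). set (k := p / lg n).
  pose proof (lg_pos n) as LP. pose proof (hh_bounds n) as HB.
  assert (E : p = k * lg n + p mod lg n) by (pose proof (Nat.div_mod_eq p (lg n)); unfold k; lia).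
  pose proof (Nat.mod_upper_bound p (lg n) ltac:(lia)) as O. set (o := p mod lg n) in *.
  rewrite Nat.mod_pow2_bits_low, Nat.div_pow2_bits, testbit_glue by (auto; apply word_lt).
  destruct (Nat.ltb_spec (t + o) (lg n)).
  - rewrite word_bit by auto. f_equal. lia.
  - rewrite word_bit by (auto; lia). f_equal. lia.
Qed.

Lemma raw_lt n T v : raw n T v < 2 ^ hh n.
Proof. apply Nat.mod_upper_bound, Nat.pow_nonzero. lia. Qed.

Lemma ev_mraw n T w m lim b t0 r d v vv : Ctx n T w m lim t0 -> 0 < t0 -> Wd n w r d ->
  evb w m lim b r d v vv -> vv < NC n -> evb w m lim b r d (mraw v) (raw n T vv).
Proof.
  intros HC Ht W Hv Hlt. pose proof HC as (HI & HK & _). szs HI. pose proof (inst_w _ _ _ HI) as Hw.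
  pose proof (small_facts n) as (S1 & S2 & S3 & _ & _ & _ & S7 & _). pose proof (NC_h n) as HN.
  pose proof (lg_pos n).
  assert (HP : vv * hh n < MM n).
  { pose proof (hh_bounds n). assert ((vv + 1) * hh n <= NC n * hh n) by (apply Nat.mul_le_mono_r; lia). lia. }
  assert (HKL : vv * hh n / lg n <= vv * hh n) by (apply Nat.Div0.div_le_upper_bound; nia).
  unfold raw. eapply ev_let; [repeat ev1; lia|]. intros r1 d1 p E Hp. lift E.
  eapply ev_let; [repeat ev1; lia|]. intros r2 d2 k E Hk. lift E.
  set (kv := vv * hh n / lg n) in *. clearbody kv.
  pose proof (word_lt n T kv). pose proof (word_lt n T (kv + 1)).
  assert (word n T (kv + 1) * 2 ^ lg n <= MM n * MM n) by (apply Nat.mul_le_mono; lia).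
  assert (HW0 : evb w m lim b r2 d2 (mword k) (word n T kv)) by (eapply ev_mword; eauto; lia).
  assert (HW1 : evb w m lim b r2 d2 (mword (k +' kk 1)) (word n T (kv + 1))).
  { eapply ev_mword with (t0 := t0); eauto; [repeat ev1; lia|lia]. }
  eapply ev_let.
  - apply ev_add; [exact HW0|apply ev_shl; [exact HW1|repeat ev1|lia]|lia].
  - intros r3 d3 x E Hx. lift E. eapply ev_eq; [repeat ev1; try lia|].
    + pose proof (Nat.Div0.div_le_upper_bound (word n T kv + word n T (kv + 1) * 2 ^ lg n) (2 ^ ((vv * hh n) mod lg n)) (word n T kv + word n T (kv + 1) * 2 ^ lg n)) as D.
      pose proof (pow2_pos ((vv * hh n) mod lg n)) as PP.
      eapply Nat.le_lt_trans; [apply D|lia]. rewrite <- (Nat.mul_1_l (word n T kv + _)) at 1. apply Nat.mul_le_mono_r. exact PP.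
    + now rewrite Nat.mul_1_l.
Qed.

Lemma compl_bits k x t : x < 2 ^ k -> Nat.testbit (2 ^ k - 1 - x) t = (t <? k) && negb (Nat.testbit x t).
Proof.
  intros H. destruct (Nat.ltb_spec t k) as [L|L].
  - assert (LG : Nat.log2 x < k).
    { destruct (Nat.eq_dec x 0) as [->|N]; [change (Nat.log2 0) with 0; lia|].
      apply (proj1 (Nat.log2_lt_pow2 x k ltac:(lia))). exact H. }
    rewrite <- (Nat.lnot_spec_low x k t), Nat.lnot_sub_low, Nat.ones_equiv by auto.
    rewrite andb_true_l. f_equal. lia.
  - apply (testbit_high _ k); auto. pose proof (pow2_pos k). lia.
Qed.

(** For the bit 0 only the first [nb] bits are complemented: positions past the end of [T] must be
    occurrences of neither bit. *)
Definition v_chunk (c : bool) : bld :=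
  if c then mraw uV else
    LET p := uV *' gh IN
    LET nb := if_ (p <' gN) (if_ (gN -' p <' gh) (gN -' p) gh) (kk 0) IN
    ((kk 1 <<' nb) -' kk 1) -' mraw uV.

Lemma Bf_true T p : Bf true T p = nth p T false.
Proof. unfold Bf. simpl. now destruct (nth p T false). Qed.

Lemma tri_chunk c : Tri (Inv spec (off c + 0)) (mapphase (off c + 0) (kk 0) gNC (v_chunk c)) (Inv spec (S (off c + 0))).
Proof.
  pose proof (off_bounds c) as OB.
  apply map_tri with (bndf := fun _ => 0) (cntf := NC); try lia.
  - destruct c; reflexivity.
  - apply flat_cost, NC_cost.
  - apply flat_depth.
  - intros n T w HI. pose proof (pow2_pos w). pose proof (scan_space n). lia.
  - intros n T w m l b tau r HI [HL _]. pose proof (pow2_pos w).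
    assert (W : Wd n w r G) by (split; auto). split; repeat ev1; lia.
  - intros n T w m a HI HK Ha. rewrite spec_off by lia. szs HI. pose proof (inst_w _ _ _ HI) as Hw.
    pose proof (small_facts n) as (S1 & S2 & S3 & _ & _ & _ & S7 & _). pose proof (n_le n) as NL.
    assert (HC : Ctx n T w m ((off c + 0) * MM n) (off c + 0)) by (unfold Ctx; splits; auto; lia).
    pose proof HI as (Hn & HT & _). pose proof (hh_bounds n) as HB.
    cbn [nth per_bit]. intros v Hv.
    assert (HP : v * hh n < MM n).
    { pose proof (NC_h n). assert ((v + 1) * hh n <= NC n * hh n) by (apply Nat.mul_le_mono_r; lia). lia. }
    pose proof (raw_lt n T v) as RL.
    destruct c.
    + assert (E : a v = raw n T v).
      { apply Ha; auto. intros r Hr HU. world n w r Hr (G + 4) HU v. eapply ev_mraw; eauto; lia. }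
      rewrite E. split; auto. intros t Ht. rewrite raw_bit by auto. symmetry. apply Bf_true.
    + set (nb := if v * hh n <? n then if n - v * hh n <? hh n then n - v * hh n else hh n else 0).
      assert (NB : nb = Nat.min (n - v * hh n) (hh n)).
      { unfold nb. destruct (Nat.ltb_spec (v * hh n) n); [|lia]. destruct (Nat.ltb_spec (n - v * hh n) (hh n)); lia. }
      (* Positions past the end read as 0, so the contents fit into [nb] bits and the subtraction
         that complements them does not borrow. *)
      assert (RN : raw n T v < 2 ^ nb).
      { rewrite <- (Nat.mod_small (raw n T v) (2 ^ hh n)) by auto.
        replace (raw n T v mod 2 ^ hh n) with (raw n T v mod 2 ^ nb); [apply Nat.mod_upper_bound, Nat.pow_nonzero; lia|].
        rewrite (Nat.mod_small (raw n T v) (2 ^ hh n)) by auto.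
        apply Nat.bits_inj. intros t. destruct (Nat.lt_ge_cases t nb).
        - now apply Nat.mod_pow2_bits_low.
        - rewrite Nat.mod_pow2_bits_high by auto. destruct (Nat.lt_ge_cases t (hh n)).
          + rewrite raw_bit by auto. rewrite nth_overflow; auto. lia.
          + symmetry. apply (testbit_high _ (hh n)); auto. }
      assert (E : a v = 2 ^ nb - 1 - raw n T v).
      { apply Ha; auto. intros r Hr HU. world n w r Hr (G + 4) HU v.
        assert (2 ^ nb <= MM n). { etransitivity; [|exact S1]. apply Nat.pow_le_mono_r; lia. }
        pose proof (pow2_pos nb).
        eapply ev_let; [repeat ev1; lia|]. intros r1 d1 p E Hp. lift E.
        eapply ev_let; [repeat ev1; try lia; auto|]. fold nb. intros r2 d2 q E Hq. lift E.
        assert (HR : evb w m ((off false + 0) * MM n) 0 r2 d2 (mraw uV) (raw n T v)) by (eapply ev_mraw; eauto; lia).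
        eapply ev_eq; [repeat ev1; try lia|]. lia. }
      rewrite E. split.
      { assert (2 ^ nb <= 2 ^ hh n) by (apply Nat.pow_le_mono_r; lia). pose proof (pow2_pos nb). lia. }
      intros t Ht. rewrite compl_bits, raw_bit by auto.
      destruct (Nat.ltb_spec t nb).
      * simpl. rewrite Bf_neg by lia. simpl negb. now rewrite Bf_true.
      * simpl. symmetry. apply Bf_out. lia.
Qed.

Definition aX (c : bool) (v : bld) : bld := arr (off c + 0) v.
Definition aCNT (c : bool) (v : bld) : bld := arr (off c + 4) v.
Definition aLOC (c : bool) (k : bld) : bld := arr (off c + 6) k.

(** The number of ones among the first [t] bits, as the complement of a rank of 0 in region 1. *)
Definition mpc (x t : bld) : bld :=
  if_ (t =' kk 0) (kk 0) (t -' arr 1 (x *' gh +' (t -' kk 1))).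

Lemma ev_mpc n T w m lim b t0 r d x t xv tv : Ctx n T w m lim t0 -> 1 < t0 -> Wd n w r d ->
  evb w m lim b r d x xv -> evb w m lim b r d t tv -> xv < 2 ^ hh n -> tv <= hh n ->
  evb w m lim b r d (mpc x t) (cntb (Nat.testbit xv) tv).
Proof.
  intros HC Ht W Hx Htv Hxl Htl. pose proof HC as (HI & HK & _). szs HI. pose proof (inst_w _ _ _ HI) as Hw.
  pose proof (small_facts n) as (S1 & S2 & S3 & S4 & S5 & _ & _ & _ & S9 & _).
  pose proof (cntb_le (Nat.testbit xv) tv) as CL.
  assert (SZ : xv * hh n + hh n <= 2 ^ hh n * hh n).
  { replace (xv * hh n + hh n) with ((xv + 1) * hh n) by lia. apply Nat.mul_le_mono_r. lia. }
  assert (2 ^ hh n * hh n <= MM n).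
  { etransitivity; [|exact S5]. apply Nat.mul_le_mono_l.
    apply (Nat.le_trans _ (DD n ^ 1)); [rewrite Nat.pow_1_r; lia|apply Nat.pow_le_mono_r; lia]. }
  assert (HR : 1 <= tv -> rg n m 1 (xv * hh n + (tv - 1)) = tv - cntb (Nat.testbit xv) tv).
  { intros H1. pose proof (HK 1 Ht xv (tv - 1) Hxl ltac:(lia)) as E. rewrite E. now replace (tv - 1 + 1) with tv by lia. }
  eapply ev_eq.
  - apply ev_if_eq; auto.
    + exact Htv.
    + apply ev_k; lia.
    + intros; apply ev_k; lia.
    + intros Hne. apply ev_sub; [exact Htv| | |lia].
      * eapply ev_arrC; [exact HC|lia|exact W|repeat ev1; auto; lia|lia].
      * rewrite HR by lia. lia.
  - destruct (Nat.eqb_spec tv 0) as [->|Hne]; [reflexivity|]. rewrite HR by lia. lia.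
Qed.

Section BitMacros.
Context (c : bool) (n : nat) (T : list bool) (w : nat) (m : mem) (lim b t0 : nat).
Hypothesis HC : Ctx n T w m lim t0.

Definition xchunk (v : nat) : nat := rg n m (off c + 0) v.

Lemma ev_aX r d v vv : off c + 0 < t0 -> Wd n w r d -> evb w m lim b r d v vv -> vv < NC n ->
  evb w m lim b r d (aX c v) (xchunk vv) /\ is_chunk c T (hh n) vv (xchunk vv).
Proof.
  intros Ht W Hv Hlt. pose proof HC as (HI & HK & _). pose proof (scan_space n). split.
  - unfold xchunk. eapply ev_arrC; eauto; lia.
  - apply (known_off c 0 n T m t0 HK Ht ltac:(lia)). exact Hlt.
Qed.

Lemma ev_aCNT r d v vv : off c + 4 < t0 -> Wd n w r d -> evb w m lim b r d v vv -> vv < NC n ->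
  evb w m lim b r d (aCNT c v) (rk c T (vv * hh n)).
Proof.
  intros Ht W Hv Hlt. pose proof HC as (HI & HK & _). pose proof (scan_space n).
  eapply ev_eq; [eapply ev_arrC; eauto; lia|].
  apply (known_off c 4 n T m t0 HK Ht ltac:(lia)). exact Hlt.
Qed.

Definition mrk (p : bld) : bld :=
  LET v := p /' gh IN aCNT c v +' mpc (aX c v) (p %' gh).

Lemma ev_mrk r d p pv : off c + 4 < t0 -> Wd n w r d -> evb w m lim b r d p pv -> pv <= n ->
  evb w m lim b r d (mrk p) (rk c T pv).
Proof.
  intros Ht W Hp Hpn. pose proof HC as (HI & HK & _). szs HI. pose proof (n_le n).
  pose proof (off_bounds c).
  pose proof (small_facts n) as (_ & _ & _ & _ & _ & _ & S7 & _). pose proof (hh_bounds n) as HB.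
  eapply ev_let; [repeat ev1; eauto; lia|]. intros r1 d1 v E Hv. lift E.
  pose proof (chunk_in n pv Hpn) as HV.
  destruct (ev_aX r1 d1 v _ ltac:(lia) W Hv HV) as [HX HCk].
  pose proof (Nat.mod_upper_bound pv (hh n) ltac:(lia)).
  pose proof (chunk_cnt c T (hh n) _ _ (pv mod hh n) HCk ltac:(lia)) as E.
  replace (pv / hh n * hh n + pv mod hh n) with pv in E by (pose proof (Nat.div_mod_eq pv (hh n)); lia).
  rewrite E. apply ev_add.
  - eapply ev_aCNT; eauto.
  - eapply ev_mpc; eauto; try lia; [repeat ev1; eauto; lia|apply HCk].
  - rewrite <- E. pose proof (rk_le c T pv). lia.
Qed.
End BitMacros.

Lemma tri_leaf0 c : Tri (Inv spec (off c + 1)) (mapphase (off c + 1) (kk 0) gNC (mpc (aX c uV) gh)) (Inv spec (S (off c + 1))).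
Proof.
  pose proof (off_bounds c) as OB.
  apply map_tri with (bndf := fun _ => 0) (cntf := NC); try lia.
  - destruct c; reflexivity.
  - apply flat_cost, NC_cost.
  - apply flat_depth.
  - intros n T w HI. pose proof (pow2_pos w). pose proof (scan_space n). lia.
  - intros n T w m l b tau r HI [HL _]. pose proof (pow2_pos w).
    assert (W : Wd n w r G) by (split; auto). split; repeat ev1; lia.
  - intros n T w m a HI HK Ha. rewrite spec_off by lia.
    assert (HC : Ctx n T w m ((off c + 1) * MM n) (off c + 1)) by (unfold Ctx; splits; auto; lia).
    cbn [nth per_bit]. intros v Hv. apply Ha; auto. intros r Hr HU. world n w r Hr (G + 4) HU v.
    destruct (ev_aX c n T w m _ 0 _ HC r (G + 4) uV v ltac:(lia) W H Hv) as [HX HCk].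
    eapply ev_eq; [eapply ev_mpc; eauto; try lia; [repeat ev1|apply HCk]|].
    replace (S v * hh n) with (v * hh n + hh n) by lia. rewrite (chunk_cnt c T (hh n) v _ (hh n) HCk) by lia. lia.
Qed.

Lemma tri_scan0 c : Tri (Inv spec (off c + 2)) (scan (off c + 1)) (Inv spec (off c + 5)).
Proof.
  replace (off c + 2) with (off c + 1 + 1) by lia. replace (off c + 5) with (off c + 1 + 4) by lia.
  pose proof (off_bounds c) as OB.
  assert (Q : forall n T i, psum (fun v => rk c T (S v * hh n) - rk c T (v * hh n)) i = rk c T (i * hh n)).
  { intros n T i. rewrite (psum_tele (fun v => rk c T (v * hh n))); [replace (rk c T (0 * hh n)) with 0 by reflexivity; lia|].
    intros j. apply rk_mono. lia. }
  apply scan_tri with (A := fun n T v => rk c T (S v * hh n) - rk c T (v * hh n)); try lia.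
  - intros n T w HI. rewrite Q. pose proof (rk_le c T (NC n * hh n)). pose proof (NC_h n). szs HI. lia.
  - intros n T a H. rewrite spec_off in H by lia. exact H.
  - intros. rewrite <- Nat.add_assoc, spec_off by lia. exact I.
  - intros. rewrite <- Nat.add_assoc, spec_off by lia. exact I.
  - intros n T a H. rewrite <- Nat.add_assoc, spec_off by lia. cbn [nth per_bit].
    intros v Hv. rewrite H by auto. apply Q.
Qed.

(** * Locations and answers of the ranges *)

Lemma gg_facts n : 1 <= gg n /\ lg n <= gg n /\ gg n <= lg n * lg n /\ thr n = gg n * gg n.
Proof.
  unfold gg, thr. pose proof (lg_pos n). pose proof (LL_pos n). pose proof (LL_le_L n).
  splits; try nia. simpl. ring.
Qed.

Lemma nk_facts n : nk n + gg n + 6 <= MM n /\ n <= MM n /\ nom n = nk n.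
Proof.
  pose proof (n_le n). pose proof (gg_facts n) as (A & B & C & _). unfold nk, nom.
  assert (n / gg n <= n) by (apply Nat.Div0.div_le_upper_bound; nia).
  assert (D : 2 ^ (2 * lg n + 6) <= MM n) by (apply x_le_MM; pose proof (lg_pos n); lia).
  pose proof (le_pow2 (lg n)).
  replace (2 * lg n + 6) with (lg n + lg n + 6) in D by lia. rewrite !Nat.pow_add_r in D.
  change (2 ^ 6) with 64 in D. assert (lg n * lg n <= 2 ^ lg n * 2 ^ lg n) by (apply Nat.mul_le_mono; lia).
  assert (2 ^ lg n * 1 <= 2 ^ lg n * 2 ^ lg n) by (apply Nat.mul_le_mono_l; lia). splits; lia.
Qed.

Lemma nk_cost : exists C, forall n, 1 <= n -> nk n * lg n <= C * n.
Proof.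
  exists 25. intros n Hn. pose proof (gg_facts n) as (A & B & _). unfold nk.
  pose proof (lg_lin n Hn). pose proof (lg_pos n). pose proof (div_mul_le n (gg n)).
  assert (n / gg n * lg n <= n / gg n * gg n) by (apply Nat.mul_le_mono_l; lia). nia.
Qed.

Lemma hh_le_gg n : hh n <= gg n.
Proof. pose proof (hh_bounds n). pose proof (gg_facts n). lia. Qed.

Lemma chunk_of c T i : let n := length T in 1 <= i <= count c T ->
  let v := select c T i / hh n in v < NC n /\ rk c T (v * hh n) < i <= rk c T (S v * hh n).
Proof.
  intros n Hi v. destruct (sel_spec c T i Hi) as (A & B & C). pose proof (hh_bounds n).
  split; [apply chunk_in; fold n in A; lia|].
  pose proof (div_mul_le (select c T i) (hh n)) as D. pose proof (div_ub (select c T i) (hh n) ltac:(lia)) as U.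
  fold v in D, U. split.
  - apply (rk_mono c T) in D. lia.
  - assert (rk c T (S (select c T i)) <= rk c T (S v * hh n)) by (apply rk_mono; lia).
    assert (X : rk c T (S (select c T i)) = rk c T (select c T i) + 1) by (unfold rk; rewrite cntb_S, B; reflexivity). lia.
Qed.

Lemma chunk_unique c T h u v i : rk c T (u * h) < i <= rk c T (S u * h) -> rk c T (v * h) < i <= rk c T (S v * h) -> u = v.
Proof.
  intros A B. destruct (Nat.lt_trichotomy u v) as [L|[L|L]]; auto.
  - assert (rk c T (S u * h) <= rk c T (v * h)) by (apply rk_mono, Nat.mul_le_mono_r; lia). lia.
  - assert (rk c T (S v * h) <= rk c T (u * h)) by (apply rk_mono, Nat.mul_le_mono_r; lia). lia.
Qed.

Lemma rk_chunk_step c T h v : rk c T (S v * h) <= rk c T (v * h) + h.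
Proof. replace (S v * h) with (v * h + h) by lia. apply rk_add. Qed.

Definition mone (c : bool) (v a i : bld) : bld := v *' gh +' msel (aX c v) (i -' a).

Section Macros2.
Context (c : bool) (n : nat) (T : list bool) (w : nat) (m : mem) (lim b t0 : nat).
Hypothesis HC : Ctx n T w m lim t0.

Lemma ev_mone r d v a i vv iv : off c + 4 < t0 -> Wd n w r d -> evb w m lim b r d v vv -> vv < NC n ->
  evb w m lim b r d a (rk c T (vv * hh n)) -> evb w m lim b r d i iv ->
  rk c T (vv * hh n) < iv <= rk c T (S vv * hh n) ->
  evb w m lim b r d (mone c v a i) (select c T iv).
Proof.
  intros Ht W Hv Hlt Ha Hi Hr. pose proof HC as (HI & HK & _). szs HI. pose proof (off_bounds c).
  pose proof HI as (Hn & HT & _). pose proof (NC_h n).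
  destruct (ev_aX c n T w m lim b t0 HC r d v vv ltac:(lia) W Hv Hlt) as [HX HCk].
  destruct (chunk_sel c T (hh n) vv _ iv HCk ltac:(lia) ltac:(lia)) as [E1 E2]. rewrite E1.
  assert (vv * hh n <= MM n). { assert (vv * hh n <= NC n * hh n) by (apply Nat.mul_le_mono_r; lia). lia. }
  pose proof (rk_le_N c T (S vv * hh n)). pose proof (N_le c T). pose proof (nk_facts n).
  destruct (fsel_spec _ _ _ E2) as [F _]. pose proof (hh_bounds n). pose proof (small_facts n).
  apply ev_add; [repeat ev1; lia| |lia].
  eapply ev_msel; eauto; try lia; [repeat ev1; lia|apply HCk].
Qed.

Lemma ev_aLOC r d k kv : off c + 6 < t0 -> Wd n w r d -> evb w m lim b r d k kv -> kv < nk n ->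
  evb w m lim b r d (aLOC c k) (bnd c T (kv * gg n)).
Proof.
  intros Ht W Hv Hlt. pose proof HC as (HI & HK & _). pose proof (nk_facts n).
  eapply ev_eq; [eapply ev_arrC; eauto; lia|].
  apply (known_off c 6 n T m t0 HK Ht ltac:(lia)). exact Hlt.
Qed.
End Macros2.

(** A chunk has at most [hh n <= gg n] occurrences, so their numbers contain at most one multiple of
    [gg n], which must be the first one above [a]. *)
Definition l_raw (c : bool) : bld :=
  LET a := aCNT c uV IN LET b := a +' mpc (aX c uV) gh IN
  if_ (b <' (a /' gg_ +' kk 1) *' gg_) (kk 0) (kk 1).
Definition o_raw (c : bool) : bld := aCNT c uV /' gg_ +' kk 1.
Definition v_raw (c : bool) : bld :=
  LET a := aCNT c uV IN mone c uV a ((a /' gg_ +' kk 1) *' gg_).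
Definition p_raw (c : bool) : cmd :=
  phase (kk (off c + 5) *' gM) (kk 0) gNC (l_raw c) (kk (off c + 5) *' gM +' o_raw c) (v_raw c).

Lemma tri_raw c : Tri (Inv spec (off c + 5)) (p_raw c) (Inv spec (S (off c + 5))).
Proof.
  pose proof (off_bounds c) as OB.
  apply scat_tri with (bndf := fun _ => 0) (cntf := NC) (sizef := nk); try lia.
  - destruct c; reflexivity.
  - destruct NC_cost as [C1 H1]. destruct nk_cost as [C2 H2]. exists (C1 + C2). intros n Hn.
    specialize (H1 n Hn). specialize (H2 n Hn). lia.
  - apply flat_depth.
  - intros n T w HI. pose proof (pow2_pos w). pose proof (nk_facts n). lia.
  - intros n T w m l b tau r HI [HL _]. pose proof (pow2_pos w).
    assert (W : Wd n w r G) by (split; auto). split; repeat ev1; lia.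
  - intros n T w m HI HK. rewrite spec_off by lia.
    assert (HC : Ctx n T w m ((off c + 5) * MM n) (off c + 5)) by (unfold Ctx; splits; auto; lia).
    pose proof HI as (Hn & HT & _). pose proof (gg_facts n) as (G1 & G2 & G3 & G4). pose proof (nk_facts n) as (K1 & K2 & _).
    pose proof (N_le c T) as NL. rewrite HT in NL. szs HI. pose proof (inst_w _ _ _ HI) as Hw.
    assert (RL : forall p, rk c T p <= n) by (intros p; pose proof (rk_le_N c T p); lia).
    assert (DL : forall p, (rk c T p / gg n + 1) * gg n <= n + gg n).
    { intros p. pose proof (div_mul_le (rk c T p) (gg n)). pose proof (RL p). lia. }
    assert (QL : forall p, rk c T p / gg n <= rk c T p) by (intros p; apply Nat.Div0.div_le_upper_bound; nia).
    assert (EA : forall r d u, Wd n w r d -> u < NC n -> evb w m ((off c + 5) * MM n) 0 r d uV u ->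
      evb w m ((off c + 5) * MM n) 0 r d (aCNT c uV) (rk c T (u * hh n))).
    { intros r d u W Hu HU. eapply ev_aCNT; eauto; lia. }
    exists (fun u => if rk c T (S u * hh n) <? (rk c T (u * hh n) / gg n + 1) * gg n then 0 else 1),
      (fun u _ => rk c T (u * hh n) / gg n + 1). splits.
    + intros u r Hu Hr HU. world n w r Hr (G + 1) HU u.
      eapply ev_let; [eapply EA; eauto|]. intros r1 d1 a E Ha. lift E.
      destruct (ev_aX c n T w m _ 0 _ HC r1 d1 uV u ltac:(lia) W H Hu) as [HX HCk].
      pose proof (chunk_cnt c T (hh n) u _ (hh n) HCk (le_n _)) as EC. replace (u * hh n + hh n) with (S u * hh n) in EC by lia.
      pose proof (RL (S u * hh n)). pose proof (RL (u * hh n)). pose proof (DL (u * hh n)). pose proof (QL (u * hh n)).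
      eapply ev_let.
      { apply ev_add; [exact Ha|eapply ev_mpc; eauto; try lia; [repeat ev1|apply HCk]|lia]. }
      intros r2 d2 b E Hb. lift E. rewrite <- EC in Hb. repeat ev1; lia.
    + intros u t r Hu Ht Hr HU Hrt. world n w r Hr (G + 3) HU u.
      pose proof (RL (u * hh n)). pose proof (QL (u * hh n)).
      apply ev_add; [apply ev_div; [eapply EA; eauto|repeat ev1|lia]|apply ev_k; lia|lia].
    + intros u t Hu Ht. unfold nk. assert (rk c T (u * hh n) / gg n <= n / gg n) by (apply Nat.Div0.div_le_mono, RL). lia.
    + intros u t u' t' Hu Ht Hu' Ht' E.
      destruct (Nat.ltb_spec (rk c T (S u * hh n)) ((rk c T (u * hh n) / gg n + 1) * gg n)); [lia|].
      destruct (Nat.ltb_spec (rk c T (S u' * hh n)) ((rk c T (u' * hh n) / gg n + 1) * gg n)); [lia|].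
      split; [|lia]. rewrite <- E in H0.
      pose proof (div_ub (rk c T (u * hh n)) (gg n) ltac:(lia)). pose proof (div_ub (rk c T (u' * hh n)) (gg n) ltac:(lia)). rewrite <- E in H2.
      (* Both chunks contain the occurrence with the same number, a multiple of [gg n]. *)
      eapply (chunk_unique c T (hh n) u u'); split; eassumption.
    + intros a Ha. cbn [nth per_bit]. intros k Hk HkN.
      destruct (chunk_of c T (k * gg n) ltac:(nia)) as [U1 U2]. rewrite HT in U1, U2.
      set (u := select c T (k * gg n) / hh n) in *.
      pose proof (rk_chunk_step c T (hh n) u). pose proof (hh_le_gg n).
      assert (Ek : (k - 1) * gg n = k * gg n - gg n) by (rewrite Nat.mul_sub_distr_r; lia).
      assert (QK : rk c T (u * hh n) / gg n = k - 1).
      { apply div_between; [lia|lia|]. replace (k - 1 + 1) with k by lia. lia. }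
      assert (QK' : rk c T (u * hh n) / gg n + 1 = k) by (rewrite QK; lia).
      rewrite <- QK' at 1. apply (Ha u 0); auto.
      * rewrite QK'. rewrite (proj2 (Nat.ltb_ge _ _)); lia.
      * intros r Hr HU _. world n w r Hr (G + 4) HU u.
        eapply ev_let; [eapply EA; eauto|]. intros r1 d1 x E Hx. lift E.
        pose proof (RL (u * hh n)). pose proof (QL (u * hh n)). pose proof (DL (u * hh n)).
        assert (k * gg n <= n) by lia. assert (k <= k * gg n) by nia.
        eapply ev_mone; eauto; try lia.
        eapply ev_eq; [repeat ev1; lia|]. now rewrite QK'.
Qed.

Definition v_loc (c : bool) : bld :=
  if_ (uV =' kk 0) (kk 0) (if_ (mrk c gN <' uV *' gg_) gN (arr (off c + 5) uV)).

Lemma tri_loc c : Tri (Inv spec (off c + 6)) (mapphase (off c + 6) (kk 0) (gN /' gg_ +' kk 3) (v_loc c)) (Inv spec (S (off c + 6))).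
Proof.
  pose proof (off_bounds c) as OB.
  apply map_tri with (bndf := fun _ => 0) (cntf := nk); try lia.
  - destruct c; reflexivity.
  - apply flat_cost, nk_cost.
  - apply flat_depth.
  - intros n T w HI. pose proof (pow2_pos w). pose proof (nk_facts n). lia.
  - intros n T w m l b tau r HI [HL _]. szs HI. pose proof (nk_facts n) as (K1 & K2 & _).
    assert (W : Wd n w r G) by (split; auto). unfold nk in *. split; repeat ev1; lia.
  - intros n T w m a HI HK Ha. rewrite spec_off by lia.
    assert (HC : Ctx n T w m ((off c + 6) * MM n) (off c + 6)) by (unfold Ctx; splits; auto; lia).
    pose proof HI as (Hn & HT & _). pose proof (gg_facts n) as (G1 & G2 & G3 & G4). pose proof (nk_facts n) as (K1 & K2 & _).
    szs HI. pose proof (inst_w _ _ _ HI) as Hw.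
    cbn [nth per_bit]. intros k Hk. apply Ha; auto. intros r Hr HU. world n w r Hr (G + 4) HU k.
    assert (HN : evb w m ((off c + 6) * MM n) 0 r (G + 4) (mrk c gN) (rk c T n)) by (eapply ev_mrk; eauto; [lia|repeat ev1]).
    assert (k * gg n <= MM n * MM n) by (apply Nat.mul_le_mono; lia).
    unfold v_loc. assert (EN : rk c T n = count c T) by (rewrite N_rk, HT; auto).
    eapply ev_eq; [repeat ev1; auto; try lia|].
    + destruct (Nat.eqb_spec k 0) as [->|Hk0]; [reflexivity|].
      rewrite EN. destruct (Nat.ltb_spec (count c T) (k * gg n)).
      * rewrite bnd_out; auto.
      * rewrite bnd_sel by nia. apply (known_off c 5 n T m _ HK ltac:(lia) ltac:(lia)); lia.
Qed.

Definition maxb (x y : bld) : bld := if_ (x <' y) y x.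
Definition minb (x y : bld) : bld := if_ (x <' y) x y.

Lemma ev_maxb w m lim b r d x y xv yv : 1 <= w -> evb w m lim b r d x xv -> evb w m lim b r d y yv ->
  evb w m lim b r d (maxb x y) (Nat.max xv yv).
Proof.
  intros Hw X Y. eapply ev_eq; [apply ev_if_lt; eauto|].
  destruct (Nat.ltb_spec xv yv); lia.
Qed.

Lemma ev_minb w m lim b r d x y xv yv : 1 <= w -> evb w m lim b r d x xv -> evb w m lim b r d y yv ->
  evb w m lim b r d (minb x y) (Nat.min xv yv).
Proof.
  intros Hw X Y. eapply ev_eq; [apply ev_if_lt; eauto|].
  destruct (Nat.ltb_spec xv yv); lia.
Qed.

(* The occurrences [lo <= i < hi] of chunk [u] that belong to the long range
   number [k]; [k] is one of the two ranges that the chunk can meet. *)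
Definition ans_item (c : bool) (f : bld -> bld -> bld -> bld -> bld -> bld -> bld -> bld) : bld :=
  LET u := uV /' kk 2 IN
  LET a := aCNT c u IN
  LET k := a /' gg_ +' uV %' kk 2 IN
  LET p := aLOC c k IN
  LET r := aLOC c (k +' kk 1) -' p IN
  LET lo := maxb (a +' kk 1) (k *' gg_) IN
  LET hi := minb (a +' mpc (aX c u) gh +' kk 1) (k *' gg_ +' gg_) IN
  f u a k p r lo hi.

Definition p_ans (c : bool) : cmd :=
  phase (kk (off c + 7) *' gM) (kk 0) (kk 2 *' gNC)
    (ans_item c (fun u a k p r lo hi => if_ (r <' gthr) (kk 0) (if_ (lo <' hi) (hi -' lo) (kk 0))))
    (kk (off c + 7) *' gM +' ans_item c (fun u a k p r lo hi => mceil p gg_ +' (lo +' tV -' k *' gg_)))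
    (ans_item c (fun u a k p r lo hi => mone c u a (lo +' tV))).

Section Ans.
Context (c : bool) (n : nat) (T : list bool) (w : nat) (m : mem).
Hypothesis HC : Ctx n T w m ((off c + 7) * MM n) (off c + 7).

(** Item [v] is a pair: chunk [v / 2] and one of the two ranges it can meet, selected by [v mod 2].
    The functions give the registers bound in [ans_item] as numbers. *)
Definition iu (v : nat) := v / 2.
Definition ia (v : nat) := rk c T (iu v * hh n).
Definition ik (v : nat) := ia v / gg n + v mod 2.
Definition ilo (v : nat) := Nat.max (ia v + 1) (ik v * gg n).
Definition ihi (v : nat) := Nat.min (rk c T (S (iu v) * hh n) + 1) (ik v * gg n + gg n).

Lemma ev_ans_item r d v f z : Wd n w r d -> v < 2 * NC n ->
  evb w m ((off c + 7) * MM n) 0 r d uV v ->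
  (forall r' d' u a k p rr lo hi, ext r d r' d' -> Wd n w r' d' ->
     let E := evb w m ((off c + 7) * MM n) 0 r' d' in
     E u (iu v) -> E a (ia v) -> E k (ik v) -> E p (bnd c T (ik v * gg n)) -> E rr (rlen c T (ik v)) ->
     E lo (ilo v) -> E hi (ihi v) -> E (f u a k p rr lo hi) z) ->
  evb w m ((off c + 7) * MM n) 0 r d (ans_item c f) z.
Proof.
  intros W Hv HU Hf. pose proof HC as (HI & HK & _). szs HI. pose proof (inst_w _ _ _ HI) as Hw.
  pose proof HI as (Hn & HT & _). pose proof (gg_facts n) as (G1 & G2 & G3 & G4). pose proof (nk_facts n) as (K1 & K2 & _).
  pose proof (N_le c T) as NL. rewrite HT in NL. pose proof (scan_space n) as (_ & B2 & _).
  assert (RL : forall p, rk c T p <= n) by (intros p; pose proof (rk_le_N c T p); lia).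
  assert (Hu : iu v < NC n) by (apply Nat.Div0.div_lt_upper_bound; lia).
  pose proof (Nat.mod_upper_bound v 2 ltac:(lia)) as V2.
  assert (Hk : ik v + 1 < nk n).
  { unfold ik, nk. assert (ia v / gg n <= n / gg n) by (apply Nat.Div0.div_le_mono, RL). lia. }
  assert (KG : ik v * gg n <= MM n * MM n) by (apply Nat.mul_le_mono; lia).
  pose proof (RL (iu v * hh n)) as R1. fold (ia v) in R1.
  pose proof (fun r1 d1 r2 d2 => ext_trans r d r1 d1 r2 d2) as XT.
  pose proof (ext_refl r d) as X0. unfold ans_item.
  eapply ev_let; [repeat ev1; lia|]. fold (iu v). intros r1 d1 u E Hu'. pose proof (XT _ _ _ _ X0 E) as X1. lift E.
  eapply ev_let; [eapply ev_aCNT; eauto; lia|]. fold (ia v). intros r2 d2 a E Ha. pose proof (XT _ _ _ _ X1 E) as X2. lift E.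
  assert (ia v / gg n <= ia v) by (apply Nat.Div0.div_le_upper_bound; clear - G1; nia).
  eapply ev_let; [repeat ev1; lia|]. fold (ik v). intros r3 d3 k E Hk'. pose proof (XT _ _ _ _ X2 E) as X3. lift E.
  eapply ev_let; [eapply ev_aLOC; eauto; lia|]. intros r4 d4 p E Hp. pose proof (XT _ _ _ _ X3 E) as X4. lift E.
  assert (HL1 : evb w m ((off c + 7) * MM n) 0 r4 d4 (aLOC c (k +' kk 1)) (bnd c T (S (ik v) * gg n))).
  { replace (S (ik v)) with (ik v + 1) by lia. eapply ev_aLOC; eauto; [lia|repeat ev1; lia]. }
  pose proof (bnd_mono c T (ik v * gg n) (S (ik v) * gg n) ltac:(lia)). pose proof (bnd_le c T (S (ik v) * gg n)) as BL. rewrite HT in BL.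
  assert (gg n <= MM n) by lia.
  eapply ev_let; [apply ev_sub; [exact HL1|exact Hp|lia|lia]|]. fold (rlen c T (ik v)).
  replace (bnd c T (S (ik v) * gg n) - bnd c T (ik v * gg n)) with (rlen c T (ik v)) by (unfold rlen; now rewrite HT).
  intros r5 d5 rr E Hrr. pose proof (XT _ _ _ _ X4 E) as X5. lift E.
  eapply ev_let; [apply ev_maxb; auto; repeat ev1; lia|]. fold (ilo v). intros r6 d6 lo E Hlo. pose proof (XT _ _ _ _ X5 E) as X6. lift E.
  destruct (ev_aX c n T w m _ 0 _ HC r6 d6 u (iu v) ltac:(lia) W Hu' Hu) as [HX HCk].
  pose proof (chunk_cnt c T (hh n) (iu v) _ (hh n) HCk (le_n _)) as EC.
  replace (iu v * hh n + hh n) with (S (iu v) * hh n) in EC by lia. pose proof (RL (S (iu v) * hh n)). fold (ia v) in EC.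
  assert (HP : evb w m ((off c + 7) * MM n) 0 r6 d6 (mpc (aX c u) gh) (cntb (Nat.testbit (xchunk c n m (iu v))) (hh n))).
  { eapply ev_mpc; eauto; try lia; [repeat ev1|apply HCk]. }
  eapply ev_let; [apply ev_minb; auto; repeat ev1; lia|]. rewrite <- EC. fold (ihi v).
  intros r7 d7 hi E Hhi. pose proof (XT _ _ _ _ X6 E) as X7. lift E.
  apply Hf; auto.
Qed.
End Ans.

(** A long range has at least [gg n * gg n] positions, and division by [gg n] leaves [gg n] slots,
    one for each of its answers. *)
Lemma long_gap c T k k' : let n := length T in thr n <= rlen c T k -> k < k' ->
  ceil_div (bnd c T (k * gg n)) (gg n) + gg n <= ceil_div (bnd c T (k' * gg n)) (gg n).
Proof.
  intros n HL Hk. pose proof (gg_facts n) as (G1 & G2 & G3 & G4). unfold rlen in HL. fold n in HL.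
  pose proof (bnd_mono c T (S k * gg n) (k' * gg n) ltac:(apply Nat.mul_le_mono_r; lia)).
  assert (bnd c T (k * gg n) + gg n * gg n <= bnd c T (k' * gg n)) by lia.
  unfold ceil_div. rewrite <- Nat.div_add by lia. apply Nat.Div0.div_le_mono. lia.
Qed.

Lemma tri_ans c : Tri (Inv spec (off c + 7)) (p_ans c) (Inv spec (S (off c + 7))).
Proof.
  pose proof (off_bounds c) as OB.
  (* Starting indices are at most [n / gg n + 1], and up to [gg n] answers follow the last of
     them. *)
  apply scat_tri with (bndf := fun _ => 0) (cntf := fun n => 2 * NC n) (sizef := fun n => nk n + gg n); try lia.
  - destruct c; reflexivity.
  - destruct NC_cost as [C1 H1]. destruct nk_cost as [C2 H2]. destruct (poly_le_n 3) as [C3 H3].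
    exists (2 * C1 + C2 + C3). intros n Hn.
    specialize (H1 n Hn). specialize (H2 n Hn). specialize (H3 n Hn). pose proof (gg_facts n) as (_ & _ & G3 & _).
    assert (gg n * lg n <= lg n ^ 3). { replace (lg n ^ 3) with (lg n * lg n * lg n) by (simpl; ring). now apply Nat.mul_le_mono_r. }
    lia.
  - apply flat_depth.
  - intros n T w HI. pose proof (pow2_pos w). pose proof (nk_facts n). lia.
  - intros n T w m l b tau r HI [HL _]. szs HI. pose proof (scan_space n).
    assert (W : Wd n w r G) by (split; auto). split; repeat ev1; lia.
  - intros n T w m HI HK. rewrite spec_off by lia.
    assert (HC : Ctx n T w m ((off c + 7) * MM n) (off c + 7)) by (unfold Ctx; splits; auto; lia).
    pose proof HI as (Hn & HT & _). pose proof (gg_facts n) as (G1 & G2 & G3 & G4). pose proof (nk_facts n) as (K1 & K2 & _).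
    pose proof (N_le c T) as NL. rewrite HT in NL. szs HI. pose proof (inst_w _ _ _ HI) as Hw.
    pose proof (small_facts n) as (_ & _ & _ & _ & _ & S6 & _).
    assert (RL : forall p, rk c T p <= count c T) by (intros p; apply rk_le_N).
    assert (HB : forall v, ihi c n T v <= n + 1 /\ ik c n T v * gg n <= ilo c n T v /\ ihi c n T v <= ik c n T v * gg n + gg n /\ ia c n T v < ilo c n T v /\ ihi c n T v <= rk c T (S (iu v) * hh n) + 1).
    { intros v. pose proof (RL (S (iu v) * hh n)). unfold ihi, ilo. set (X := rk c T (S (iu v) * hh n)) in *. clearbody X. set (Y := ik c n T v * gg n). splits; try lia. }
    set (lenv := fun v => if rlen c T (ik c n T v) <? thr n then 0 else
       if ilo c n T v <? ihi c n T v then ihi c n T v - ilo c n T v else 0).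
    assert (LF : forall v t, t < lenv v -> thr n <= rlen c T (ik c n T v) /\ ilo c n T v + t < ihi c n T v).
    { intros v t. unfold lenv. destruct (Nat.ltb_spec (rlen c T (ik c n T v)) (thr n)); [lia|].
      destruct (Nat.ltb_spec (ilo c n T v) (ihi c n T v)); lia. }
    exists lenv, (fun v t => ceil_div (bnd c T (ik c n T v * gg n)) (gg n) + (ilo c n T v + t - ik c n T v * gg n)). splits.
    + intros v r Hv Hr HU. world n w r Hr (G + 1) HU v. eapply ev_ans_item; eauto.
      intros r' d' u a k p rr lo hi X W' E Eu Ea Ek Ep Er Elo Ehi. destruct (HB v) as (B1 & B2 & B3 & _).
      unfold E in *. unfold lenv. repeat ev1; auto; lia.
    + intros v t r Hv Ht Hr HU HUt. world n w r Hr (G + 3) HU v.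
      assert (HTt : evb w m ((off c + 7) * MM n) 0 r (G + 3) tV t) by (apply ev_varG; [exact HUt|lia]).
      eapply ev_ans_item; eauto. destruct (HB v) as (B1 & B2 & B3 & _). destruct (LF v t Ht) as [L1 L2].
      intros r' d' u a k p rr lo hi X W' E Eu Ea Ek Ep Er Elo Ehi. lift X. unfold E in *.
      pose proof (bnd_le c T (ik c n T v * gg n)) as BL. rewrite HT in BL.
      assert (ceil_div (bnd c T (ik c n T v * gg n)) (gg n) <= n) by (apply ceil_le; [lia|]; clear - BL G1; nia).
      apply ev_add; [apply ev_mceil; auto; repeat ev1; lia|repeat ev1; lia|lia].
    + intros v t Hv Ht. destruct (HB v) as (B1 & B2 & B3 & _). destruct (LF v t Ht) as [L1 L2].
      pose proof (bnd_le c T (ik c n T v * gg n)) as BL. rewrite HT in BL.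
      assert (ceil_div (bnd c T (ik c n T v * gg n)) (gg n) <= n / gg n + 1).
      { apply ceil_le; [lia|]. pose proof (div_ub n (gg n) ltac:(lia)). lia. }
      unfold nk. lia.
    + intros v t v' t' Hv Ht Hv' Ht' E.
      destruct (HB v) as (B1 & B2 & B3 & B4 & B5). destruct (LF v t Ht) as [L1 L2].
      destruct (HB v') as (B1' & B2' & B3' & B4' & B5'). destruct (LF v' t' Ht') as [L1' L2'].
      (* Equal addresses force equal ranges by [long_gap], then equal occurrences, then equal
         chunks. *)
      subst n. assert (Ekk : ik c (length T) T v = ik c (length T) T v').
      { destruct (Nat.lt_trichotomy (ik c (length T) T v) (ik c (length T) T v')) as [L|[L|L]]; auto.
        - pose proof (long_gap c T _ _ L1 L). lia.
        - pose proof (long_gap c T _ _ L1' L). lia. }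
      assert (Ei : ilo c (length T) T v + t = ilo c (length T) T v' + t') by (rewrite Ekk in *; lia).
      assert (Eu : iu v = iu v').
      { apply (chunk_unique c T (hh (length T)) _ _ (ilo c (length T) T v + t)); [unfold ia in *; lia|].
        rewrite Ei. unfold ia in *. lia. }
      assert (Ev : v = v').
      { unfold ik, ia in Ekk. rewrite Eu in Ekk. unfold iu in *.
        pose proof (Nat.div_mod_eq v 2). pose proof (Nat.div_mod_eq v' 2). lia. }
      subst v'. split; auto. lia.
    + intros a Ha. cbn [nth per_bit]. intros k i Hk HL Hik Hi.
      subst n. set (n := length T) in *.
      destruct (chunk_of c T i Hi) as [U1 U2]. fold n in U1, U2. set (u := select c T i / hh n) in *.
      pose proof (rk_chunk_step c T (hh n) u). pose proof (hh_le_gg n).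
      (* Tells which of the two ranges that chunk [u] can meet is range [k]. *)
      set (s := k - rk c T (u * hh n) / gg n).
      pose proof (div_mul_le (rk c T (u * hh n)) (gg n)) as D1. pose proof (div_ub (rk c T (u * hh n)) (gg n) ltac:(lia)) as D2.
      assert (K1' : rk c T (u * hh n) / gg n <= k).
      { apply Nat.lt_succ_r. apply Nat.Div0.div_lt_upper_bound. lia. }
      assert (K2' : k <= rk c T (u * hh n) / gg n + 1).
      { destruct (Nat.le_gt_cases k (rk c T (u * hh n) / gg n + 1)); auto. exfalso.
        assert ((rk c T (u * hh n) / gg n + 1 + 1) * gg n <= k * gg n) by (apply Nat.mul_le_mono_r; lia). lia. }
      assert (Hs : s <= 1 /\ rk c T (u * hh n) / gg n + s = k) by (unfold s; lia). destruct Hs as [Hs1 Hs2].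
      set (v := u * 2 + s). assert (Vd : v / 2 = u /\ v mod 2 = s) by (apply divmod_idx; lia). destruct Vd as [Vd Vm].
      assert (Iu : iu v = u) by exact Vd. assert (Ia : ia c n T v = rk c T (u * hh n)) by (unfold ia; now rewrite Iu).
      assert (Ik : ik c n T v = k) by (unfold ik; rewrite Ia, Vm; exact Hs2).
      assert (Ilo : ilo c n T v <= i) by (unfold ilo; rewrite Ia, Ik; lia).
      assert (Ihi : i < ihi c n T v) by (unfold ihi; rewrite Iu, Ik; lia).
      assert (Hlen : i - ilo c n T v < lenv v).
      { unfold lenv. rewrite Ik. rewrite (proj2 (Nat.ltb_ge _ _)) by auto. rewrite (proj2 (Nat.ltb_lt _ _)) by lia. lia. }
      replace (i - k * gg n) with (ilo c n T v + (i - ilo c n T v) - ik c n T v * gg n) by (rewrite Ik; lia).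
      rewrite <- Ik. apply Ha; [lia|exact Hlen|].
      intros r Hr HU HUt. world n w r Hr (G + 4) HU v.
      assert (HTt : evb w m ((off c + 7) * MM n) 0 r (G + 4) tV (i - ilo c n T v)) by (apply ev_varG; [exact HUt|lia]).
      eapply ev_ans_item; eauto; [lia|].
      intros r' d' u' a' k' p rr lo hi X W' E Eu Ea Ek Ep Er Elo Ehi. lift X. unfold E in *.
      pose proof (HB v) as (B1 & _). rewrite Iu in Eu. rewrite Ia in Ea.
      eapply ev_mone; eauto; try lia. eapply ev_eq; [repeat ev1; lia|]. lia.
Qed.

(** * Prefix sums of weights *)

Lemma le_mul_l a b : 1 <= a -> b <= a * b.
Proof. nia. Qed.

Lemma le_mul_r a b : 1 <= b -> a <= a * b.
Proof. nia. Qed.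

(* Arguments [v a k p br lo hi]: the chunk, the number of occurrences before it, a
   short range, its start, [lg] of its length, and the occurrences [lo], ...,
   [hi - 1], which lie in both. *)
Definition piece_f := bld -> bld -> bld -> bld -> bld -> bld -> bld -> bld.

Definition piece (c : bool) (f : piece_f) (v a k lo hi : bld) : bld :=
  LET k := k IN LET lo := lo IN LET hi := hi IN
  if_ (lo <' hi)
    (LET p := aLOC c k IN LET r := aLOC c (k +' kk 1) -' p IN
     if_ (r <' gthr) (LET br := mlg r IN f v a k p br lo hi) (kk 0))
    (kk 0).

(* The sum of the weights of the occurrences of chunk [v] before number [e]. *)
Definition partial (c : bool) (f : piece_f) (v e : bld) : bld :=
  LET e := e IN
  LET a := aCNT c v IN LET k := a /' gg_ IN LET s := k *' gg_ +' gg_ IN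
  piece c f v a k (a +' kk 1) (minb e s) +' piece c f v a (k +' kk 1) s e.

(** The total weight of the occurrences before position [p]: the scanned value at the chunk boundary
    plus a part of one chunk. *)
Definition query (c : bool) (j : nat) (f : piece_f) (p : bld) : bld :=
  LET p := p IN LET v := p /' gh IN arr (off c + j) v +' partial c f v (mrk c p +' kk 1).

Section Partial.
Context (c : bool) (n : nat) (T : list bool) (w : nat) (m : mem) (lim b t0 : nat).
Hypothesis HC : Ctx n T w m lim t0.
Context (wt : nat -> nat) (f : piece_f).
Hypothesis wt_max : forall i, 1 <= i <= count c T -> wt i <= MM n.

Lemma isum_max lo hi : 1 <= lo -> hi <= count c T + 1 -> isum wt lo hi <= MM n * MM n.
Proof.
  intros H1 H2. pose proof HC as (HI & _). pose proof HI as (Hn & HT & _). pose proof (nk_facts n).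
  pose proof (N_le c T) as NL. rewrite HT in NL.
  etransitivity; [apply (isum_bound wt lo hi (MM n)); intros; apply wt_max; lia|].
  apply Nat.mul_le_mono_r. lia.
Qed.

Hypothesis wt_long : forall i, short c T (i / gg n) = false -> wt i = 0.
Hypothesis Ht0 : off c + 6 < t0.

(** The contract for evaluating a weight on the common part of a chunk and a short range. Long
    ranges have weight 0 and are handled outside. *)
Definition piece_ok : Prop := forall r d v a k p br lo hi vv kv lov hiv,
  let E := evb w m lim b r d in
  Wd n w r d -> vv < NC n -> E v vv -> E a (rk c T (vv * hh n)) -> E k kv -> S kv < nk n ->
  E p (bnd c T (kv * gg n)) -> E br (lgr c T kv) -> E lo lov -> E hi hiv ->
  short c T kv = true -> kv * gg n <= lov -> lov < hiv -> hiv <= S kv * gg n ->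
  rk c T (vv * hh n) < lov -> hiv <= rk c T (S vv * hh n) + 1 ->
  E (f v a k p br lo hi) (isum wt lov hiv).
Hypothesis Hf : piece_ok.

Lemma ev_piece r d v a k lo hi vv kv lov hiv :
  let E := evb w m lim b r d in
  Wd n w r d -> vv < NC n -> E v vv -> E a (rk c T (vv * hh n)) -> E k kv -> S kv < nk n ->
  E lo lov -> E hi hiv -> 1 <= lov -> hiv <= count c T + 1 ->
  (lov < hiv -> kv * gg n <= lov /\ hiv <= S kv * gg n /\
     rk c T (vv * hh n) < lov /\ hiv <= rk c T (S vv * hh n) + 1) ->
  E (piece c f v a k lo hi) (isum wt lov hiv).
Proof.
  intros E0 W Hv Ev Ea Ek Hk Elo Ehi H1 H2 Hin. unfold E0 in *. clear E0.
  pose proof HC as (HI & HK & _). szs HI. pose proof (inst_w _ _ _ HI) as Hw. pose proof (nk_facts n) as (K1 & K2 & _).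
  pose proof HI as (Hn & HT & _). pose proof (small_facts n) as (_ & _ & _ & _ & _ & S6 & _).
  unfold piece. eapply ev_let; [exact Ek|]. clear Ek. intros r1 d1 k1 E Ek. lift E.
  eapply ev_let; [exact Elo|]. clear Elo. intros r2 d2 lo1 E Elo. lift E.
  eapply ev_let; [exact Ehi|]. clear Ehi. intros r3 d3 hi1 E Ehi. lift E.
  eapply ev_eq; [apply ev_if_lt; [exact Hw|exact Elo|exact Ehi| |intros; apply ev_k; lia]|].
  - intros Hlt. destruct (Hin Hlt) as (A1 & A2 & A3 & A4).
    eapply ev_let; [eapply ev_aLOC; eauto; lia|]. intros r4 d4 p E Hp. lift E.
    assert (HL1 : evb w m lim b r4 d4 (aLOC c (k1 +' kk 1)) (bnd c T (S kv * gg n))).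
    { replace (S kv) with (kv + 1) by lia. eapply ev_aLOC; eauto; [repeat ev1; lia|lia]. }
    pose proof (bnd_mono c T (kv * gg n) (S kv * gg n) ltac:(lia)). pose proof (bnd_le c T (S kv * gg n)) as BL. rewrite HT in BL.
    eapply ev_let; [apply ev_sub; [exact HL1|exact Hp|lia|lia]|].
    replace (bnd c T (S kv * gg n) - bnd c T (kv * gg n)) with (rlen c T kv) by (unfold rlen; now rewrite HT).
    intros r5 d5 rr E Hrr. lift E.
    apply ev_if_lt; [exact Hw|exact Hrr|repeat ev1| |intros; apply ev_k; lia].
    intros Hsh. eapply ev_let; [eapply ev_mlg; eauto; pose proof (off_bounds c); lia|].
    fold (lgr c T kv). intros r6 d6 br E Hbr. lift E.
    apply (Hf r6 d6 v a k1 p br lo1 hi1 vv kv lov hiv); auto.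
    unfold short. rewrite HT. now apply Nat.ltb_lt.
  - destruct (Nat.ltb_spec lov hiv) as [Hlt|Hge]; [|now rewrite isum_nil].
    destruct (Nat.ltb_spec (rlen c T kv) (thr n)) as [Hs|Hs]; [reflexivity|].
    destruct (Hin Hlt) as (A1 & A2 & A3 & A4). pose proof (gg_facts n).
    symmetry. apply isum_zero. intros i Hi. apply wt_long.
    replace (i / gg n) with kv by (symmetry; apply div_between; lia).
    unfold short. rewrite HT. apply Nat.ltb_ge. lia.
Qed.

(** By [hh n <= gg n] the occurrences of a chunk fall into range [k0] and its successor, and the sum
    is split at the first occurrence of the successor. *)
Lemma ev_partial r d v e vv ev : Wd n w r d -> vv < NC n ->
  evb w m lim b r d v vv -> evb w m lim b r d e ev ->
  rk c T (vv * hh n) + 1 <= ev <= rk c T (S vv * hh n) + 1 ->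
  evb w m lim b r d (partial c f v e) (isum wt (rk c T (vv * hh n) + 1) ev).
Proof.
  intros W Hv Ev Ee He. pose proof HC as (HI & HK & _). szs HI. pose proof (nk_facts n) as (K1 & K2 & _).
  pose proof HI as (Hn & HT & _). pose proof (gg_facts n) as (G1 & _). pose proof (inst_w _ _ _ HI) as Hw.
  pose proof (N_le c T) as NL. rewrite HT in NL. pose proof (rk_le_N c T (S vv * hh n)) as RN.
  unfold partial. eapply ev_let; [exact Ee|]. clear Ee. intros r0 d0 e1 E Ee. lift E.
  eapply ev_let; [eapply ev_aCNT; eauto; lia|]. set (a := rk c T (vv * hh n)) in *. intros r1 d1 a1 E Ea. lift E.
  eapply ev_let; [repeat ev1; lia|]. intros r2 d2 k E Ek. lift E.
  pose proof (div_mul_le a (gg n)) as D1. pose proof (div_ub a (gg n) G1) as D2. set (k0 := a / gg n) in *.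
  assert (KN : k0 <= n / gg n) by (apply Nat.Div0.div_le_mono; lia).
  assert (K3 : S k0 < nk n - 1) by (unfold nk; lia). assert (Hst : rk c T (S vv * hh n) <= a + hh n) by apply rk_chunk_step.
  pose proof (hh_le_gg n). clearbody k0.
  eapply ev_let; [repeat ev1; lia|]. intros r3 d3 s E Es. lift E.
  set (sv := k0 * gg n + gg n) in *.
  assert (Esv : S k0 * gg n = sv) by (unfold sv; lia). assert (Esv2 : S (k0 + 1) * gg n = sv + gg n) by (unfold sv; lia).
  eapply ev_eq.
  - apply ev_add.
    + eapply ev_piece with (vv := vv) (kv := k0) (lov := a + 1) (hiv := Nat.min ev sv); eauto; try lia;
        try (apply ev_minb; eauto); try (repeat ev1; lia).
    + eapply ev_piece with (vv := vv) (kv := k0 + 1) (lov := sv) (hiv := ev); eauto; try lia; try (repeat ev1; lia).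
    + pose proof (isum_max (a + 1) (Nat.min ev sv) ltac:(lia) ltac:(lia)).
      pose proof (isum_max sv ev ltac:(lia) ltac:(lia)). lia.
  - destruct (Nat.le_gt_cases ev sv).
    + rewrite Nat.min_l by lia. rewrite (isum_nil _ sv ev) by lia. lia.
    + rewrite Nat.min_r by lia. symmetry. apply isum_split; lia.
Qed.

Lemma ev_query j r d p pv : j < 23 -> off c + j < t0 -> nth j (per_bit c n T) s_any = s_scan c n T wt ->
  Wd n w r d -> evb w m lim b r d p pv -> pv <= n ->
  evb w m lim b r d (query c j f p) (isum wt 1 (rk c T pv + 1)).
Proof.
  intros Hj Hjt Hs W Ep Hp. pose proof HC as (HI & HK & _). szs HI. pose proof (nk_facts n) as (K1 & K2 & _).
  pose proof HI as (Hn & HT & _). pose proof (hh_bounds n) as HB. pose proof (scan_space n) as (_ & B2 & _).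
  pose proof (rk_le_N c T pv) as RN. pose proof (N_le c T) as NL. rewrite HT in NL.
  unfold query. eapply ev_let; [exact Ep|]. clear Ep. intros r0 d0 p1 E Ep. lift E.
  eapply ev_let; [repeat ev1; lia|]. intros r1 d1 v E Ev. lift E.
  pose proof (chunk_in n pv Hp) as Hv. pose proof (div_mul_le pv (hh n)) as D1. pose proof (div_ub pv (hh n) ltac:(lia)) as D2.
  set (vv := pv / hh n) in *.
  assert (R1 : rk c T (vv * hh n) <= rk c T pv) by (apply rk_mono; lia).
  assert (R2 : rk c T pv <= rk c T (S vv * hh n)) by (apply rk_mono; lia).
  assert (HS : rg n m (off c + j) vv = isum wt 1 (rk c T (vv * hh n) + 1)).
  { pose proof (known_off c j n T m t0 HK Hjt Hj) as Q. rewrite Hs in Q. now apply Q. }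
  rewrite (isum_split wt 1 (rk c T (vv * hh n) + 1)) by lia. rewrite <- HS.
  pose proof (isum_max 1 (rk c T (vv * hh n) + 1) ltac:(lia) ltac:(lia)).
  pose proof (isum_max (rk c T (vv * hh n) + 1) (rk c T pv + 1) ltac:(lia) ltac:(lia)).
  apply ev_add; [eapply ev_arrC; eauto; lia| |lia].
  apply ev_partial; auto; [|lia]. repeat ev1; try lia. eapply ev_mrk; eauto; lia.
Qed.
End Partial.

(* [sum_t (select (i0 + t d) - o) 2 ^ (t b)] for [t < mm]: the table gives the
   positions inside the chunk, and [u = sum_t 2 ^ (t b)] shifts them all at once. *)
Definition mpack (c : bool) (v a o i0 d mm b : bld) : bld :=
  LET i0 := i0 IN LET mm := mm IN
  LET u := ((kk 1 <<' (mm *' b)) -' kk 1) /' ((kk 1 <<' b) -' kk 1) IN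
  (pack_ld 3 (aX c v) (i0 -' a) d mm b +' v *' gh *' u) -' o *' u.

Lemma geom b k : 1 <= b -> psum (fun t => 2 ^ (t * b)) k = (2 ^ (k * b) - 1) / (2 ^ b - 1).
Proof.
  intros Hb. pose proof (pow2_ge2 b Hb). apply Nat.div_unique_exact; [lia|].
  induction k; [simpl; lia|]. cbn [psum]. rewrite Nat.mul_add_distr_l, <- IHk.
  replace (2 ^ (S k * b)) with (2 ^ b * 2 ^ (k * b)) by (rewrite <- Nat.pow_add_r; f_equal; lia).
  pose proof (pow2_pos (k * b)). nia.
Qed.

Section Pack.
Context (c : bool) (n : nat) (T : list bool) (w : nat) (m : mem) (lim b t0 : nat).
Hypothesis HC : Ctx n T w m lim t0.
Hypothesis Ht0 : off c + 4 < t0.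

Lemma ev_mpack r d v a o i0 dd mm bb vv ov iv dv mv bv :
  let E := evb w m lim b r d in
  Wd n w r d -> vv < NC n -> E v vv -> E a (rk c T (vv * hh n)) -> E o ov -> E i0 iv -> E dd dv -> E mm mv -> E bb bv ->
  1 <= dv < DD n -> 1 <= mv -> 1 <= bv < DD n -> 2 ^ (mv * bv) <= MM n ->
  rk c T (vv * hh n) < iv -> iv + (mv - 1) * dv <= rk c T (S vv * hh n) -> ov <= select c T iv ->
  E (mpack c v a o i0 dd mm bb) (psum (fun t => (select c T (iv + t * dv) - ov) * 2 ^ (t * bv)) mv).
Proof.
  intros E0 W Hv Ev Ea Eo Ei Ed Em Eb Hd Hm Hb Hp H1 H2 Ho. unfold E0 in *. clear E0.
  pose proof HC as (HI & HK & _). szs HI. pose proof (inst_w _ _ _ HI) as Hw. pose proof (nk_facts n) as (K1 & K2 & _).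
  pose proof HI as (Hn & HT & _). pose proof (small_facts n) as (S1 & S2 & S3 & S4 & S5 & S6 & S7 & S8 & S9 & _).
  pose proof (off_bounds c) as OB. pose proof (NC_h n) as NH.
  pose proof (N_le c T) as NL. rewrite HT in NL. pose proof (rk_le_N c T (S vv * hh n)) as RN.
  set (av := rk c T (vv * hh n)) in *. set (ev := rk c T (S vv * hh n)) in *.
  assert (Hst : ev <= av + hh n) by apply rk_chunk_step.
  assert (Hmd : mv - 1 <= (mv - 1) * dv) by (apply le_mul_r; lia).
  unfold mpack. eapply ev_let; [exact Ei|]. clear Ei. intros r0 d0 i1 E Ei. lift E.
  eapply ev_let; [exact Em|]. clear Em. intros r1 d1 m1 E Em. lift E.
  assert (Hbm : bv <= mv * bv) by (apply le_mul_l; lia).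
  assert (PB : 2 ^ bv <= MM n). { etransitivity; [|exact Hp]. apply Nat.pow_le_mono_r; lia. }
  pose proof (pow2_ge2 bv ltac:(lia)). pose proof (pow2_pos (mv * bv)).
  assert (HmM : mv * bv <= MM n) by (pose proof (le_pow2 (mv * bv)); lia).
  set (U := (2 ^ (mv * bv) - 1) / (2 ^ bv - 1)).
  assert (HU : U <= MM n).
  { unfold U. apply Nat.Div0.div_le_upper_bound. assert (1 * MM n <= (2 ^ bv - 1) * MM n) by (apply Nat.mul_le_mono_r; lia). lia. }
  eapply ev_let; [eapply (ev_eq _ _ _ _ _ _ _ U); [repeat ev1; rewrite ?Nat.mul_1_l; lia|unfold U; now rewrite !Nat.mul_1_l]|].
  intros r2 d2 u E Eu. lift E.
  destruct (ev_aX c n T w m lim b t0 HC r2 d2 v vv ltac:(lia) W Ev Hv) as [HX HCk].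
  set (x := xchunk c n m vv) in *.
  assert (SEL : forall t, t < mv -> select c T (iv + t * dv) = vv * hh n + fsel (Nat.testbit x) (hh n) (iv - av + t * dv)
     /\ 1 <= iv - av + t * dv <= cntb (Nat.testbit x) (hh n)).
  { intros t Ht. assert (t * dv <= (mv - 1) * dv) by (apply Nat.mul_le_mono_r; lia).
    destruct (chunk_sel c T (hh n) vv x (iv + t * dv) HCk) as [Q1 Q2]; [fold av; lia|fold ev; lia|].
    fold av in Q1, Q2. replace (iv - av + t * dv) with (iv + t * dv - av) by lia. auto. }
  assert (PT : rg n m 3 (pack_idx (DD n) x (iv - av) dv mv bv) =
     psum (fun t => fsel (Nat.testbit x) (hh n) (iv - av + t * dv) * 2 ^ (t * bv)) mv).
  { apply (HK 3 ltac:(lia)); try lia; [apply HCk|]. destruct (SEL (mv - 1) ltac:(lia)). lia. }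
  assert (EP : evb w m lim b r2 d2 (pack_ld 3 (aX c v) (i1 -' a) dd m1 bb) (rg n m 3 (pack_idx (DD n) x (iv - av) dv mv bv))).
  { eapply ev_pack_ld; eauto; try lia; [repeat ev1; lia|apply HCk]. }
  rewrite PT in EP.
  set (P0 := psum (fun t => fsel (Nat.testbit x) (hh n) (iv - av + t * dv) * 2 ^ (t * bv)) mv) in *.
  assert (P0le : P0 <= mv * (MM n * MM n)).
  { unfold P0. rewrite <- (psum_const (MM n * MM n)). apply psum_le. intros t Ht. destruct (SEL t Ht) as [_ Q].
    pose proof (fsel_spec _ _ _ Q). apply Nat.mul_le_mono; [lia|]. etransitivity; [|exact Hp]. apply Nat.pow_le_mono_r; [lia|].
    apply Nat.mul_le_mono_r; lia. }
  assert (P0le' : P0 <= MM n * MM n * MM n).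
  { etransitivity; [exact P0le|]. rewrite Nat.mul_assoc. repeat apply Nat.mul_le_mono; lia. }
  assert (VU : vv * hh n * U <= MM n * MM n).
  { apply Nat.mul_le_mono; auto. assert (vv * hh n <= NC n * hh n) by (apply Nat.mul_le_mono_r; lia). lia. }
  (* Moving [ov * U] to the left turns the termwise truncated subtractions into one identity of
     sums, which holds because every selected position is at least [ov]. *)
  assert (EQ : psum (fun t => (select c T (iv + t * dv) - ov) * 2 ^ (t * bv)) mv + ov * U = P0 + vv * hh n * U).
  { unfold U. rewrite <- geom by lia. rewrite <- !psum_mul. unfold P0. rewrite <- !psum_add. apply psum_ext. intros t Ht.
    destruct (SEL t Ht) as [Q _]. rewrite Q.
    assert (select c T iv <= select c T (iv + t * dv)).
    { rewrite <- !bnd_sel by lia. apply bnd_mono. lia. }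
    rewrite Q in H3. rewrite <- !Nat.mul_add_distr_r. f_equal. lia. }
  assert (VH : vv * hh n <= MM n).
  { assert (vv * hh n <= NC n * hh n) by (apply Nat.mul_le_mono_r; lia). lia. }
  assert (OV : ov <= MM n).
  { destruct (sel_spec c T iv ltac:(lia)) as (Q & _). rewrite HT in Q. lia. }
  assert (OU : ov * U <= MM n * MM n) by (apply Nat.mul_le_mono; lia).
  eapply ev_eq; [apply ev_sub; [apply ev_add; [exact EP|repeat ev1; lia|lia]|repeat ev1; lia|lia|lia]|]. lia.
Qed.
End Pack.

(** * Locations of the sub-ranges *)

(** Re-indexes a sum over a residue class; [i0] is the first member of the class from [lo] on. *)
Lemma ap_sum d base lo hi F : 1 <= d -> base <= lo -> lo <= hi ->
  let i0 := base + ceil_div (lo - base) d * d in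
  isum (fun i => if (i - base) mod d =? 0 then F i else 0) lo hi =
  psum (fun t => F (i0 + t * d)) (if i0 <? hi then (hi - 1 - i0) / d + 1 else 0).
Proof.
  intros Hd Hb Hl i0. pose proof (ceil_mul (lo - base) d Hd) as C1. pose proof (ceil_lt (lo - base) d Hd) as C2.
  set (j0 := ceil_div (lo - base) d) in *.
  induction Hl as [|hi Hl IH].
  - rewrite isum_nil, (proj2 (Nat.ltb_ge _ _)) by (unfold i0; lia). reflexivity.
  - rewrite isum_S, IH by auto. clear IH.
    destruct (Nat.lt_ge_cases hi i0) as [L|L].
    + rewrite !(proj2 (Nat.ltb_ge _ _)) by lia.
      destruct (Nat.eqb_spec ((hi - base) mod d) 0) as [Z|Z]; [exfalso|lia].
      pose proof (Nat.div_mod_eq (hi - base) d) as D. rewrite Z in D.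
      set (q := (hi - base) / d) in *. assert (q * d < j0 * d) by (unfold i0 in L; lia).
      assert (q < j0) by (apply Nat.mul_lt_mono_pos_r in H; lia).
      assert ((q + 1) * d <= j0 * d) by (apply Nat.mul_le_mono_r; lia). lia.
    + rewrite (proj2 (Nat.ltb_lt i0 (S hi))) by lia. replace (S hi - 1 - i0) with (hi - i0) by lia.
      pose proof (Nat.div_mod_eq (hi - i0) d) as D. pose proof (Nat.mod_upper_bound (hi - i0) d ltac:(lia)) as U.
      set (q := (hi - i0) / d) in *.
      assert (M : (hi - base) mod d = (hi - i0) mod d).
      { replace (hi - base) with ((hi - i0) + j0 * d) by (unfold i0 in *; lia). apply Nat.Div0.mod_add. }
      rewrite M. destruct (Nat.eqb_spec ((hi - i0) mod d) 0) as [Z|Z].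
      * assert (E : (if i0 <? hi then (hi - 1 - i0) / d + 1 else 0) = q).
        { destruct (Nat.ltb_spec i0 hi).
          - assert (q <> 0) by (intros ->; lia).
            assert ((hi - 1 - i0) / d = q - 1); [|lia]. apply div_between; [lia| |].
            + rewrite Nat.mul_sub_distr_r. lia.
            + replace (q - 1 + 1) with q by lia. lia.
          - destruct q; auto. simpl in D. lia. }
        rewrite E. rewrite Nat.add_1_r. cbn [psum]. f_equal. f_equal. lia.
      * rewrite (proj2 (Nat.ltb_lt i0 hi)) by lia. rewrite Nat.add_0_r. f_equal. f_equal.
        apply div_between; lia.
Qed.

(** Within a short range the occurrences that carry weight form an arithmetic progression with step
    [g], and their fields are adjacent and of equal width. One use of [mpack] sums them; the shift
    by [j0 *' br] puts the first field in place. *)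
Definition g1 (c : bool) : piece_f := fun v a k p br lo hi =>
  LET g := br *' gLL IN
  LET j0 := mceil (lo -' k *' gg_) g IN
  LET i0 := k *' gg_ +' j0 *' g IN
  if_ (i0 <' hi)
    (mpack c v a p i0 g ((hi -' kk 1 -' i0) /' g +' kk 1) br <<' (j0 *' br))
    (kk 0).

Lemma wt1_long c T i : short c T (i / gg (length T)) = false -> wt1 c T i = 0.
Proof. intros H. unfold wt1. now rewrite H. Qed.

Lemma wt4_long c T i : short c T (i / gg (length T)) = false -> wt4 c T i = 0.
Proof. intros H. unfold wt4, act4. now rewrite H. Qed.

Lemma piece1 c n T w m lim b t0 : Ctx n T w m lim t0 -> off c + 6 < t0 ->
  piece_ok c n T w m lim b (wt1 c T) (g1 c).
Proof.
  intros HC Ht r d v a k p br lo hi vv kv lov hiv E0 W Hv Ev Ea Ek Hk Ep Eb Elo Ehi Hs H1 H2 H3 H4 H5.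
  unfold E0 in *. clear E0. pose proof HC as (HI & HK & _). szs HI. pose proof (inst_w _ _ _ HI) as Hw. pose proof (nk_facts n) as (K1 & K2 & _).
  pose proof HI as (Hn & HT & _). pose proof (small_facts n) as (S1 & S2 & S3 & S4 & S5 & S6 & S7 & S8 & S9 & S10 & _).
  pose proof (gg_facts n) as (G1 & G2 & G3 & G4).
  pose proof (short_lgr c T kv Hs) as [B1 B2]. pose proof (lgr_pos c T kv) as B3. pose proof (gp_pos c T kv) as B4.
  pose proof (lgr_le c T kv) as B5. rewrite HT in B1, B5. specialize (B5 Hn).
  assert (Eg : gp c T kv = lgr c T kv * LL n) by (unfold gp; now rewrite HT).
  pose proof (LL_pos n) as LP. pose proof (LL_le_L n) as LLe.
  set (bv := lgr c T kv) in *. set (g := gp c T kv) in *.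
  assert (Hg : g < DD n). { assert (bv * LL n <= 4 * LL n * LL n) by (apply Nat.mul_le_mono_r; lia). lia. }
  pose proof (rk_le_N c T (S vv * hh n)) as RN. pose proof (N_le c T) as NL. rewrite HT in NL.
  assert (KG : S kv * gg n = kv * gg n + gg n) by lia.
  assert (VAL : isum (wt1 c T) lov hiv =
    let j0 := ceil_div (lov - kv * gg n) g in let i0 := kv * gg n + j0 * g in
    if i0 <? hiv then psum (fun t => (select c T (i0 + t * g) - bnd c T (kv * gg n)) * 2 ^ (t * bv)) ((hiv - 1 - i0) / g + 1) * 2 ^ (j0 * bv)
    else 0).
  { rewrite (isum_ext _ (fun i => if (i - kv * gg n) mod g =? 0 then
       (bnd c T i - bnd c T (kv * gg n)) * 2 ^ ((i - kv * gg n) / g * bv) else 0)).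
    2: { intros i Hi. unfold wt1. rewrite HT. replace (i / gg n) with kv by (symmetry; apply div_between; lia).
         rewrite Hs. reflexivity. }
    rewrite ap_sum by lia. cbv zeta. set (j0 := ceil_div (lov - kv * gg n) g). set (i0 := kv * gg n + j0 * g).
    destruct (Nat.ltb_spec i0 hiv) as [L|L]; [|reflexivity].
    rewrite (Nat.mul_comm (psum _ _) (2 ^ (j0 * bv))), <- psum_mul. apply psum_ext. intros t Ht'.
    rewrite bnd_sel by (pose proof (ceil_mul (lov - kv * gg n) g ltac:(lia)) as C; fold j0 in C; unfold i0; lia).
    replace ((i0 + t * g - kv * gg n) / g) with (j0 + t).
    2: { symmetry. apply div_between; unfold i0; lia. }
    rewrite Nat.mul_add_distr_r, Nat.pow_add_r. ring. }
  rewrite VAL. cbv zeta.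
  pose proof (ceil_mul (lov - kv * gg n) g ltac:(lia)) as C1. pose proof (ceil_lt (lov - kv * gg n) g ltac:(lia)) as C2.
  set (j0 := ceil_div (lov - kv * gg n) g) in *. 
  assert (J0 : j0 <= j0 * g) by (apply le_mul_r; lia).
  unfold g1. eapply ev_let; [repeat ev1; unfold bv in *; rewrite <- ?Eg; lia|]. rewrite <- Eg. intros r1 d1 gb E Eg'. lift E.
  eapply ev_let; [apply ev_mceil; [repeat ev1; lia|exact Eg'|lia|lia]|]. fold j0. intros r2 d2 jb E Ej. lift E.
  eapply ev_let; [repeat ev1; lia|]. set (i0 := kv * gg n + j0 * g) in *. intros r3 d3 ib E Ei. lift E.
  apply ev_if_lt; auto; [|intros; apply ev_k; lia]. intros Hlt.
  set (mv := (hiv - 1 - i0) / g + 1) in *.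
  assert (Hmv : (mv - 1) * g <= hiv - 1 - i0).
  { unfold mv. rewrite Nat.add_sub. apply div_mul_le. }
  assert (Mg : mv - 1 <= (mv - 1) * g) by (apply le_mul_r; lia).
  assert (MB : (mv - 1) * bv < lg n).
  { assert ((mv - 1) * bv * LL n < lg n * LL n).
    { replace ((mv - 1) * bv * LL n) with ((mv - 1) * g) by (rewrite Eg; unfold bv; ring). unfold gg in *. lia. }
    apply Nat.mul_lt_mono_pos_r in H; lia. }
  assert (JB : j0 * bv < lg n).
  { assert (j0 * bv * LL n < lg n * LL n).
    { replace (j0 * bv * LL n) with (j0 * g) by (rewrite Eg; unfold bv; ring). unfold gg in *. lia. }
    apply Nat.mul_lt_mono_pos_r in H; lia. }
  (* All fields but one have fewer than [lg n] bits together, and the remaining one has at most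
     [lg n]. *)
  assert (PM : 2 ^ (mv * bv) <= MM n).
  { apply x_le_MM. replace (mv * bv) with ((mv - 1) * bv + bv).
    - lia.
    - replace mv with (mv - 1 + 1) at 2 by (unfold mv; lia). ring. }
  pose proof (isum_max c n T w m lim t0 HC (wt1 c T) ltac:(intros; rewrite <- HT; apply wt1_bound; lia) lov hiv ltac:(lia) ltac:(lia)) as IM.
  rewrite VAL in IM. cbv zeta in IM. fold j0 i0 mv in IM. rewrite (proj2 (Nat.ltb_lt _ _) Hlt) in IM.
  apply ev_shl; [|repeat ev1; lia|lia].
  eapply ev_mpack; eauto; try lia; try (unfold mv; lia).
  - unfold mv. repeat ev1; lia.
  - rewrite <- bnd_sel by lia. apply bnd_mono. unfold i0. lia.
Qed.

Definition v_leaf (c : bool) (f : piece_f) : bld :=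
  partial c f uV (aCNT c uV +' mpc (aX c uV) gh +' kk 1).

(** * Leaves and prefix sums for an arbitrary weight *)

Section LeafTri.
Context (c : bool) (j : nat) (wt : list bool -> nat -> nat) (f : piece_f).
Hypothesis Hj : 7 <= j /\ j + 3 < 23.
Hypothesis Hwf : phase_wf (kk (off c + j) *' gM) (kk 0) gNC (kk 1) (kk (off c + j) *' gM +' uV) (v_leaf c f) = true.
Hypothesis Hpiece : forall n T w m lim b t0, Ctx n T w m lim t0 -> off c + j <= t0 ->
  piece_ok c n T w m lim b (wt T) f.
Hypothesis Hlong : forall T i, short c T (i / gg (length T)) = false -> wt T i = 0.
Hypothesis Hmax : forall T i, 1 <= length T -> 1 <= i <= count c T -> wt T i <= MM (length T).
Hypothesis Hs0 : forall n T, nth j (per_bit c n T) s_any = s_leaf c n T (wt T).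
Hypothesis Hs1 : forall n T, nth (j + 1) (per_bit c n T) s_any = s_any.
Hypothesis Hs2 : forall n T, nth (j + 2) (per_bit c n T) s_any = s_any.
Hypothesis Hs3 : forall n T, nth (j + 3) (per_bit c n T) s_any = s_scan c n T (wt T).

Lemma tri_leaf : Tri (Inv spec (off c + j)) (mapphase (off c + j) (kk 0) gNC (v_leaf c f)) (Inv spec (S (off c + j))).
Proof.
  pose proof (off_bounds c) as OB.
  apply map_tri with (bndf := fun _ => 0) (cntf := NC); try lia; auto.
  - apply flat_cost, NC_cost.
  - apply flat_depth.
  - intros n T w HI. pose proof (pow2_pos w). pose proof (scan_space n). lia.
  - intros n T w m l b tau r HI [HL _]. pose proof (pow2_pos w).
    assert (W : Wd n w r G) by (split; auto). split; repeat ev1; lia.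
  - intros n T w m a HI HK Ha. rewrite spec_off, Hs0 by lia.
    assert (HC : Ctx n T w m ((off c + j) * MM n) (off c + j)) by (unfold Ctx; splits; auto; lia).
    pose proof HI as (Hn & HT & _). pose proof (N_le c T) as NL. rewrite HT in NL. szs HI. pose proof (nk_facts n).
    intros v Hv. apply Ha; auto. intros r Hr HU. world n w r Hr (G + 4) HU v.
    pose proof (rk_le_N c T (S v * hh n)) as RN.
    assert (rk c T (v * hh n) <= rk c T (S v * hh n)) by (apply rk_mono, Nat.mul_le_mono_r; lia).
    assert (HLg : forall i, short c T (i / gg n) = false -> wt T i = 0).
    { intros i Hi. apply Hlong. rewrite HT. exact Hi. }
    assert (HMx : forall i, 1 <= i <= count c T -> wt T i <= MM n).
    { intros i Hi. rewrite <- HT. apply Hmax; auto. lia. }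
    unfold v_leaf. eapply ev_partial; eauto; try lia.
    + destruct (ev_aX c n T w m _ 0 _ HC r (G + 4) uV v ltac:(lia) W H0 Hv) as [HX HCk].
      pose proof (chunk_cnt c T (hh n) v _ (hh n) HCk (le_n _)) as EC.
      replace (v * hh n + hh n) with (S v * hh n) in EC by lia. rewrite EC in *.
      assert (HCN : evb w m ((off c + j) * MM n) 0 r (G + 4) (aCNT c uV) (rk c T (v * hh n))) by (eapply ev_aCNT; eauto; lia).
      assert (HP : evb w m ((off c + j) * MM n) 0 r (G + 4) (mpc (aX c uV) gh) (cntb (Nat.testbit (xchunk c n m v)) (hh n))).
      { eapply ev_mpc; eauto; try lia; [repeat ev1|apply HCk]. }
      repeat ev1; lia.
Qed.

Lemma tri_leaf_scan : Tri (Inv spec (S (off c + j))) (scan (off c + j)) (Inv spec (off c + (j + 4))).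
Proof.
  replace (S (off c + j)) with (off c + j + 1) by lia. replace (off c + (j + 4)) with (off c + j + 4) by lia.
  pose proof (off_bounds c) as OB.
  assert (Q : forall n T i, psum (fun v => isum (wt T) (rk c T (v * hh n) + 1) (rk c T (S v * hh n) + 1)) i = isum (wt T) 1 (rk c T (i * hh n) + 1)).
  { intros n T i. rewrite (psum_isum (wt T) (fun v => rk c T (v * hh n) + 1)); [reflexivity|].
    intros x. apply Nat.add_le_mono_r, rk_mono, Nat.mul_le_mono_r. lia. }
  apply scan_tri with (A := fun n T v => isum (wt T) (rk c T (v * hh n) + 1) (rk c T (S v * hh n) + 1)); try lia.
  - intros n T w HI. rewrite Q. szs HI. pose proof HI as (Hn & HT & _).
    pose proof (N_le c T) as NL. rewrite HT in NL. pose proof (nk_facts n). pose proof (rk_le_N c T (NC n * hh n)).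
    assert (isum (wt T) 1 (rk c T (NC n * hh n) + 1) <= n * MM n).
    { etransitivity; [apply (isum_bound _ _ _ (MM n)); intros i Hi; rewrite <- HT; apply Hmax; lia|].
      apply Nat.mul_le_mono_r. lia. }
    assert (n * MM n <= MM n * MM n) by (apply Nat.mul_le_mono_r; lia). lia.
  - intros n T a H. rewrite spec_off, Hs0 in H by lia. exact H.
  - intros. rewrite <- Nat.add_assoc, spec_off, Hs1 by lia. exact I.
  - intros. rewrite <- Nat.add_assoc, spec_off, Hs2 by lia. exact I.
  - intros n T a H. rewrite <- Nat.add_assoc, spec_off, Hs3 by lia.
    intros v Hv. rewrite H by auto. apply Q.
Qed.
End LeafTri.

Lemma wt1_max c T i : 1 <= length T -> 1 <= i <= count c T -> wt1 c T i <= MM (length T).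
Proof. apply wt1_bound. Qed.

Lemma wt4_max c T i : 1 <= length T -> 1 <= i <= count c T -> wt4 c T i <= MM (length T).
Proof. intros _. apply wt4_bound. Qed.

Lemma tri_leaf1 c : Tri (Inv spec (off c + 8)) (mapphase (off c + 8) (kk 0) gNC (v_leaf c (g1 c))) (Inv spec (S (off c + 8))).
Proof.
  apply tri_leaf with (wt := wt1 c); try lia; try reflexivity.
  - intros. eapply piece1; eauto. lia.
  - apply wt1_long.
  - apply wt1_max.
Qed.

Lemma tri_scan1 c : Tri (Inv spec (S (off c + 8))) (scan (off c + 8)) (Inv spec (off c + 12)).
Proof.
  apply (tri_leaf_scan c 8 (wt1 c)); try lia; try reflexivity. apply wt1_max.
Qed.

Definition v_rec (c : bool) : bld :=
  query c 11 (g1 c) (aLOC c (uV +' kk 1)) -' query c 11 (g1 c) (aLOC c uV).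

Lemma tri_rec c : Tri (Inv spec (off c + 12)) (mapphase (off c + 12) (kk 0) (gN /' gg_ +' kk 2) (v_rec c)) (Inv spec (S (off c + 12))).
Proof.
  pose proof (off_bounds c) as OB.
  apply map_tri with (bndf := fun _ => 0) (cntf := fun n => n / gg n + 2); try lia.
  - destruct c; reflexivity.
  - apply flat_cost. destruct nk_cost as [C H]. exists C. intros n Hn. specialize (H n Hn). unfold nk in H. lia.
  - apply flat_depth.
  - intros n T w HI. pose proof (pow2_pos w). pose proof (nk_facts n). unfold nk in *. lia.
  - intros n T w m l b tau r HI [HL _]. szs HI. pose proof (nk_facts n) as (K1 & K2 & _).
    assert (W : Wd n w r G) by (split; auto). unfold nk in *. split; repeat ev1; lia.
  - intros n T w m a HI HK Ha. rewrite spec_off by lia. cbn [nth per_bit].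
    assert (HC : Ctx n T w m ((off c + 12) * MM n) (off c + 12)) by (unfold Ctx; splits; auto; lia).
    pose proof HI as (Hn & HT & _). szs HI. pose proof (nk_facts n) as (K1 & K2 & _).
    intros k Hk. apply Ha; [unfold nk in Hk; lia|]. intros r Hr HU. world n w r Hr (G + 4) HU k.
    assert (BL : forall i, bnd c T i <= n) by (intros i; rewrite <- HT; apply bnd_le).
    assert (Q : forall x kv, evb w m ((off c + 12) * MM n) 0 r (G + 4) x kv -> kv < nk n ->
      evb w m ((off c + 12) * MM n) 0 r (G + 4) (query c 11 (g1 c) (aLOC c x)) (isum (wt1 c T) 1 (rk c T (bnd c T (kv * gg n)) + 1))).
    { intros x kv Hx Hkv. pose proof (piece1 c n T w m ((off c + 12) * MM n) 0 _ HC ltac:(lia)).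
      assert (HLg : forall i, short c T (i / gg n) = false -> wt1 c T i = 0).
      { intros i Hi. apply wt1_long. rewrite HT. exact Hi. }
      assert (HMx : forall i, 1 <= i <= count c T -> wt1 c T i <= MM n).
      { intros i Hi. rewrite <- HT. apply wt1_bound; lia. }
      eapply ev_query; eauto; try lia. eapply ev_aLOC; eauto. lia. }
    assert (Q1 : evb w m ((off c + 12) * MM n) 0 r (G + 4) (query c 11 (g1 c) (aLOC c (uV +' kk 1))) (isum (wt1 c T) 1 (rk c T (bnd c T (S k * gg n)) + 1))).
    { replace (S k) with (k + 1) in * by lia. apply Q; [repeat ev1; lia|lia]. }
    unfold rec1. rewrite HT.
    assert (M1 : rk c T (bnd c T (k * gg n)) <= rk c T (bnd c T (S k * gg n))) by (apply rk_mono, bnd_mono, Nat.mul_le_mono_r; lia).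
    pose proof (isum_split (wt1 c T) 1 (rk c T (bnd c T (k * gg n)) + 1) (rk c T (bnd c T (S k * gg n)) + 1) ltac:(lia) ltac:(lia)) as SP.
    pose proof (isum_max c n T w m _ _ HC (wt1 c T) ltac:(intros; rewrite <- HT; apply wt1_bound; lia) 1 (rk c T (bnd c T (S k * gg n)) + 1) ltac:(lia)
      ltac:(pose proof (rk_le_N c T (bnd c T (S k * gg n))); lia)) as IM.
    eapply ev_eq; [unfold v_rec; apply ev_sub; [exact Q1|apply Q; [eauto|lia]|lia|lia]|]. lia.
Qed.

Definition aREC (c : bool) (k : bld) : bld := arr (off c + 12) k.

Lemma rec1_le n T w m lim t0 c k : Ctx n T w m lim t0 -> rec1 c T k <= MM n * MM n.
Proof.
  intros HC. pose proof HC as (HI & _). pose proof HI as (Hn & HT & _).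
  apply (isum_max c n T w m _ _ HC (wt1 c T) ltac:(intros; rewrite <- HT; apply wt1_bound; lia)); [lia|].
  pose proof (rk_le_N c T (bnd c T (S k * gg (length T)))). lia.
Qed.

(** A record covers two words of the stream. The high bits of the first word need not be cleared,
    because [field] reads only the low [lg n] bits of each word. *)
Lemma tri_subloc c : Tri (Inv spec (off c + 13))
  (mapphase (off c + 13) (kk 0) (kk 2 *' (gN /' gg_ +' kk 2))
    (LET k := aREC c (uV /' kk 2) IN if_ (uV %' kk 2 =' kk 0) k (k >>' gL))) (Inv spec (S (off c + 13))).
Proof.
  pose proof (off_bounds c) as OB.
  apply map_tri with (bndf := fun _ => 0) (cntf := fun n => 2 * (n / gg n + 2)); try lia.
  - destruct c; reflexivity.
  - apply flat_cost. destruct nk_cost as [C H]. exists (2 * C). intros n Hn. specialize (H n Hn). unfold nk in H. lia.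
  - apply flat_depth.
  - intros n T w HI. pose proof (pow2_pos w). pose proof (nk_facts n). unfold nk in *.
    assert (2 * (n / gg n + 2) <= MM n); [|lia].
    pose proof (small_facts n) as (_ & _ & _ & _ & _ & _ & S7 & _). pose proof HI as (Hn & _). pose proof (n_le n).
    assert (n / gg n <= n) by (apply Nat.Div0.div_le_upper_bound; rewrite Nat.mul_comm; apply le_mul_r; apply gg_facts).
    pose proof (x_le_MM n (lg n + 5) ltac:(pose proof (lg_pos n); lia)) as Q. rewrite Nat.pow_add_r in Q. change (2 ^ 5) with 32 in Q. pose proof (pow2_pos (lg n)). lia.
  - intros n T w m l b tau r HI [HL _]. szs HI. pose proof (nk_facts n) as (K1 & K2 & _).
    assert (W : Wd n w r G) by (split; auto). unfold nk in *. split; repeat ev1; lia.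
  - intros n T w m a HI HK Ha. rewrite spec_off by lia. cbn [nth per_bit].
    assert (HC : Ctx n T w m ((off c + 13) * MM n) (off c + 13)) by (unfold Ctx; splits; auto; lia).
    pose proof HI as (Hn & HT & _). szs HI. pose proof (inst_w _ _ _ HI) as Hw. pose proof (nk_facts n) as (K1 & K2 & _).
    assert (MAIN : forall k s, S k < nk n -> s < 2 -> a (k * 2 + s) = if s =? 0 then rec1 c T k else rec1 c T k / 2 ^ lg n).
    { intros k s Hk Hs. pose proof (rec1_le n T w m _ _ c k HC) as RM.
      assert (k * 2 + s < 2 * (n / gg n + 2)) by (unfold nk in Hk; lia).
      apply Ha; auto. intros r Hr HU. world n w r Hr (G + 4) HU (k * 2 + s).
      destruct (divmod_idx k 2 s Hs) as [D1 D2].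
      eapply ev_let.
      { eapply (ev_eq _ _ _ _ _ _ _ (rec1 c T k)).
        - eapply ev_arrC; [exact HC|lia|exact W|repeat ev1; lia|lia].
        - rewrite D1. apply (known_off c 12 n T m _ HK ltac:(lia) ltac:(lia)). exact Hk. }
      intros r1 d1 x E Hx. lift E.
      eapply ev_eq; [repeat ev1; lia|]. now rewrite D2. }
    intros k Hk. split.
    + replace (2 * k) with (k * 2 + 0) by lia. now rewrite MAIN by lia.
    + replace (2 * k + 1) with (k * 2 + 1) by lia. now rewrite MAIN by lia.
Qed.

(** * Answers of the sub-ranges *)

(** Field [j] has offset [j * lgr], and fields of different sub-ranges are disjoint, so [fields_sum]
    reads it back from the sum. *)
Lemma rec1_field c T k j t : let n := length T in short c T k = true ->
  k * gg n + j * gp c T k <= count c T -> j * gp c T k < gg n -> t < lgr c T k ->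
  Nat.testbit (rec1 c T k) (j * lgr c T k + t) =
  Nat.testbit (bnd c T (k * gg n + j * gp c T k) - bnd c T (k * gg n)) t.
Proof.
  intros n Hs HN Hj Ht. pose proof (gp_pos c T k) as GP. pose proof (gg_pos T) as GG. fold n in GG.
  set (g := gp c T k) in *. set (b := lgr c T k) in *.
  unfold rec1. fold n. rewrite !rk_bnd.
  set (lo := Nat.min (k * gg n - 1) (count c T) + 1). set (hi := Nat.min (S k * gg n - 1) (count c T) + 1).
  set (o := fun i => (i - k * gg n) / g * b).
  destruct (fields_sum (fun i => (i - k * gg n) mod g =? 0) o (fun _ => b) (fun i => bnd c T i - bnd c T (k * gg n)) lo hi) as (F1 & F2 & _).
  - intros i Hi _. assert (bnd c T i < bnd c T (S k * gg n)) by (apply bnd_lt; unfold lo, hi in *; lia).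
    pose proof (lg_up (rlen c T k)) as U. fold (lgr c T k) in U. fold b in U. unfold rlen in U. fold n in U.
    assert (bnd c T (k * gg n) <= bnd c T i) by (apply bnd_mono; unfold lo in Hi; lia). lia.
  - intros i i' H1 H2 H3 A1 A2. apply Nat.eqb_eq in A1, A2. unfold o.
    pose proof (Nat.div_mod_eq (i - k * gg n) g). pose proof (Nat.div_mod_eq (i' - k * gg n) g).
    set (q := (i - k * gg n) / g) in *. set (q' := (i' - k * gg n) / g) in *.
    assert (q < q'). { apply (Nat.mul_lt_mono_pos_l g); [lia|]. unfold lo in H1. lia. }
    assert ((q + 1) * b <= q' * b) by (apply Nat.mul_le_mono_r; lia). lia.
  - set (W := fun i => if (i - k * gg n) mod g =? 0 then (bnd c T i - bnd c T (k * gg n)) * 2 ^ o i else 0) in *.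
    assert (EW : isum (wt1 c T) lo hi = isum W lo hi).
    { apply isum_ext. intros i Hi. unfold wt1, W, o. fold n.
      replace (i / gg n) with k by (symmetry; apply div_between; unfold lo, hi in *; lia).
      rewrite Hs. reflexivity. }
    (* Occurrences are numbered from 1, so the first sub-range of the first range contributes no
       term. Its field has to be 0, and it is, because no other field reaches it. *)
    rewrite EW. destruct (Nat.eq_dec (k * gg n + j * g) 0) as [Z|NZ].
    + rewrite Z. assert (k * gg n = 0) by lia. rewrite H, Nat.sub_diag, Nat.bits_0.
      assert (j = 0) by (destruct j; [auto|exfalso; lia]). subst j. rewrite Nat.mul_0_l, Nat.add_0_l.
      apply not_true_iff_false. intros B. destruct (F2 t B) as (i & Hi & A & Hy). apply Nat.eqb_eq in A. unfold o in Hy.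
      pose proof (Nat.div_mod_eq (i - k * gg n) g). destruct ((i - k * gg n) / g); [unfold lo in Hi; lia|]. simpl in Hy. lia.
    + assert (Q : (k * gg n + j * g - k * gg n) / g = j) by (apply div_between; lia).
      rewrite <- (F1 (k * gg n + j * g) t); auto.
      * unfold o. now rewrite Q.
      * unfold lo, hi. lia.
      * apply Nat.eqb_eq. replace (k * gg n + j * g - k * gg n) with (j * g) by lia. apply Nat.Div0.mod_mul.
Qed.

Lemma rec1_val c T k j : let n := length T in short c T k = true ->
  k * gg n + j * gp c T k <= count c T -> j * gp c T k < gg n ->
  rec1 c T k / 2 ^ (j * lgr c T k) mod 2 ^ lgr c T k = bnd c T (k * gg n + j * gp c T k) - bnd c T (k * gg n).
Proof.
  intros n Hs HN Hj. apply (bits_eq _ _ (lgr c T k)).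
  - apply Nat.mod_upper_bound, Nat.pow_nonzero. lia.
  - pose proof (lg_up (rlen c T k)) as U. fold (lgr c T k) in U. unfold rlen in U. fold n in U.
    destruct (Nat.eq_dec (k * gg n + j * gp c T k) 0) as [Z|NZ].
    + rewrite Z. assert (k * gg n = 0) by lia. rewrite H. pose proof (pow2_pos (lgr c T k)). lia.
    + assert (bnd c T (k * gg n + j * gp c T k) < bnd c T (S k * gg n)) by (apply bnd_lt; lia).
      assert (bnd c T (k * gg n) <= bnd c T (k * gg n + j * gp c T k)) by (apply bnd_mono; lia). lia.
  - intros t Ht. rewrite Nat.mod_pow2_bits_low, Nat.div_pow2_bits, Nat.add_comm by auto. now apply rec1_field.
Qed.

(* the boundary between sub-ranges [j - 1] and [j] of the short range [k] *)
Definition bsub (c : bool) (k p br g j : bld) : bld :=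
  LET j := j IN LET i := k *' gg_ +' j *' g IN
  if_ (i <' k *' gg_ +' gg_)
    (if_ (mrk c gN <' i) (aLOC c (k +' kk 1)) (p +' (aREC c k >>' (j *' br)) %' (kk 1 <<' br)))
    (aLOC c (k +' kk 1)).

(** For occurrences [i0], ..., [i1 - 1] of one sub-range [j]: their fields are adjacent and of equal
    width, so [mpack] with step 1 applies. *)
Definition sub4 (c : bool) (v a k p br g j i0 i1 : bld) : bld :=
  LET p' := bsub c k p br g j IN
  LET r' := bsub c k p br g (j +' kk 1) -' p' IN
  LET b' := mlg r' IN
  if_ (r' <' b' *' br *' (gLL *' gLL)) (kk 0)
    (mpack c v a p' i0 (kk 1) (i1 -' i0) b' <<'
      (mceil p' gLL %' gL +' (i0 -' (k *' gg_ +' j *' g)) *' b')).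

(** Sub-range [j] may begin before the chunk and [jo] may end after it, so their boundaries are
    taken from the records of sub-range locations. Those strictly between are one lookup in region
    5, keyed by the residue of the chunk position. *)
Definition g4 (c : bool) : piece_f := fun v a k p br lo hi =>
  LET g := br *' gLL IN LET q := k *' gg_ IN LET j := (lo -' q) /' g IN
  LET e := minb hi (q +' (j +' kk 1) *' g) IN
  sub4 c v a k p br g j lo e +'
  if_ (e <' hi)
    (LET jo := (hi -' kk 1 -' q) /' g IN LET fo := q +' jo *' g IN
     pack_ld 5 (aX c v) (e -' a) (jo -' j -' kk 1) br (v *' gh %' (gL *' gLL))
     +' sub4 c v a k p br g jo fo hi)
    (kk 0).

(** * Answers of the sub-ranges that a chunk meets in one short range *)

Section Piece4.
Context (c : bool) (n : nat) (T : list bool) (w : nat) (m : mem) (lim b t0 : nat).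
Hypothesis HC : Ctx n T w m lim t0.
Hypothesis Ht0 : off c + 12 < t0.
Context (kv : nat).
Hypothesis Hk : S kv < nk n.
Hypothesis Hs : short c T kv = true.

Definition bs (j : nat) : nat := bnd c T (Nat.min (kv * gg n + j * gp c T kv) (S kv * gg n)).

Lemma ev_bsub r d k p br g j jv : Wd n w r d -> evb w m lim b r d k kv ->
  evb w m lim b r d p (bnd c T (kv * gg n)) -> evb w m lim b r d br (lgr c T kv) ->
  evb w m lim b r d g (gp c T kv) -> evb w m lim b r d j jv -> jv <= MM n ->
  evb w m lim b r d (bsub c k p br g j) (bs jv).
Proof.
  intros W Ek Ep Eb Eg Ej Hj. pose proof HC as (HI & HK & _). szs HI. pose proof (inst_w _ _ _ HI) as Hw.
  pose proof (nk_facts n) as (K1 & K2 & _). pose proof HI as (Hn & HT & _). pose proof (gg_facts n) as (G1 & G2 & G3 & G4).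
  pose proof (small_facts n) as (S1 & S2 & S3 & S4 & S5 & S6 & S7 & S8 & S9 & S10 & _).
  pose proof (short_lgr c T kv Hs) as [B1 B2]. rewrite HT in B1, B2.
  assert (Eg' : gp c T kv = lgr c T kv * LL n) by (unfold gp; now rewrite HT).
  pose proof (gp_pos c T kv) as GP.
  assert (GM : gp c T kv <= MM n). { assert (gp c T kv <= 4 * LL n * LL n) by (rewrite Eg'; apply Nat.mul_le_mono_r; lia). lia. }
  assert (KM : kv * gg n <= MM n * MM n) by (apply Nat.mul_le_mono; lia).
  assert (JM : jv * gp c T kv <= MM n * MM n) by (apply Nat.mul_le_mono; lia).
  unfold bsub. eapply ev_let; [exact Ej|]. clear Ej. intros r0 d0 j1 E Ej. lift E.
  eapply ev_let; [repeat ev1; lia|]. intros r1 d1 i E Ei. lift E.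
  assert (HL1 : evb w m lim b r1 d1 (aLOC c (k +' kk 1)) (bnd c T (S kv * gg n))).
  { replace (S kv) with (kv + 1) by lia. eapply ev_aLOC; eauto; [lia|repeat ev1; lia|lia]. }
  assert (HN : evb w m lim b r1 d1 (mrk c gN) (count c T)).
  { rewrite N_rk, HT. eapply ev_mrk; eauto; [lia|repeat ev1]. }
  pose proof (N_le c T) as NL. rewrite HT in NL.
  assert (BL : forall i, bnd c T i <= n) by (intros x; rewrite <- HT; apply bnd_le).
  assert (HR : evb w m lim b r1 d1 (aREC c k) (rec1 c T kv)).
  { eapply ev_eq; [eapply ev_arrC; eauto; lia|]. apply (known_off c 12 n T m t0 HK Ht0 ltac:(lia)). exact Hk. }
  pose proof (rec1_le n T w m lim t0 c kv HC) as RL.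
  assert (BM : 2 ^ lgr c T kv <= MM n) by (apply x_le_MM; pose proof (LL_le_L n); lia).
  pose proof (pow2_pos (lgr c T kv)).
  assert (KG : S kv * gg n = kv * gg n + gg n) by lia.
  assert (QL : rec1 c T kv / 2 ^ (jv * lgr c T kv) <= rec1 c T kv).
  { pose proof (pow2_pos (jv * lgr c T kv)). apply Nat.Div0.div_le_upper_bound. apply le_mul_l. lia. }
  assert (LJ : jv * lgr c T kv <= MM n * MM n).
  { apply Nat.mul_le_mono; [lia|]. rewrite Eg' in GM. pose proof (le_mul_r (lgr c T kv) (LL n) (LL_pos n)). lia. }
  assert (QM : rec1 c T kv / 2 ^ (jv * lgr c T kv) mod 2 ^ lgr c T kv < 2 ^ lgr c T kv) by (apply Nat.mod_upper_bound; lia).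
  eapply ev_eq.
  - apply ev_if_lt; [exact Hw|exact Ei|repeat ev1; lia| |intros; exact HL1].
    intros. apply ev_if_lt; [exact Hw|exact HN|exact Ei|intros; exact HL1|].
    intros. repeat ev1; rewrite ?Nat.mul_1_l; try lia. pose proof (BL (kv * gg n)). lia.
  - unfold bs. rewrite KG. destruct (Nat.ltb_spec (kv * gg n + jv * gp c T kv) (kv * gg n + gg n)) as [L|L].
    + rewrite Nat.min_l by lia. destruct (Nat.ltb_spec (count c T) (kv * gg n + jv * gp c T kv)) as [L'|L'].
      * rewrite !bnd_out; auto; lia.
      * rewrite Nat.mul_1_l, <- HT in *. rewrite rec1_val by (auto; lia).
        pose proof (bnd_mono c T (kv * gg (length T)) (kv * gg (length T) + jv * gp c T kv) ltac:(lia)). lia.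
    + now rewrite Nat.min_r by lia.
Qed.

Lemma subrange_of j i : kv * gg n + j * gp c T kv <= i -> i < kv * gg n + (j + 1) * gp c T kv -> i < S kv * gg n ->
  length T = n ->
  i / gg n = kv /\ sidx c T i = kv * gg n + j * gp c T kv /\ bnd c T (sidx c T i) = bs j /\ slen c T i = bs (j + 1) - bs j.
Proof using Hs.
  clear - Hs.
  intros H1 H2 H3 HT. pose proof (gg_facts n) as (G1 & _). pose proof (gp_pos c T kv).
  assert (E : i / gg n = kv) by (apply div_between; lia).
  assert (S1 : sidx c T i = kv * gg n + j * gp c T kv).
  { unfold sidx. rewrite HT, E, Hs. f_equal. f_equal. apply div_between; lia. }
  splits; auto.
  - rewrite S1. unfold bs. f_equal. lia.
  - unfold slen, nidx. rewrite HT, E, Hs, S1. unfold bs. f_equal; f_equal; lia.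
Qed.

Lemma ev_sub4 r d v a k p br g j i0 i1 vv jv iv0 iv1 :
  let E := evb w m lim b r d in
  Wd n w r d -> vv < NC n -> E v vv -> E a (rk c T (vv * hh n)) -> E k kv ->
  E p (bnd c T (kv * gg n)) -> E br (lgr c T kv) -> E g (gp c T kv) -> E j jv -> E i0 iv0 -> E i1 iv1 ->
  jv < MM n -> kv * gg n + jv * gp c T kv <= iv0 -> iv0 < iv1 -> iv1 <= kv * gg n + (jv + 1) * gp c T kv ->
  iv1 <= S kv * gg n -> rk c T (vv * hh n) < iv0 -> iv1 <= rk c T (S vv * hh n) + 1 ->
  E (sub4 c v a k p br g j i0 i1) (isum (wt4 c T) iv0 iv1).
Proof.
  intros E0 W Hv Ev Ea Ek Ep Eb Eg Ej Ei0 Ei1 J1 H1 H2 H3 H4 H5 H6. unfold E0 in *. clear E0.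
  pose proof HC as (HI & HK & _). szs HI. pose proof (inst_w _ _ _ HI) as Hw.
  pose proof (nk_facts n) as (K1 & K2 & _). pose proof HI as (Hn & HT & _). pose proof (gg_facts n) as (G1 & G2 & G3 & G4).
  pose proof (small_facts n) as (S1 & S2 & S3 & S4 & S5 & S6 & S7 & S8 & S9 & S10 & _).
  pose proof (short_lgr c T kv Hs) as [B1 B2]. rewrite HT in B1, B2.
  pose proof (gp_pos c T kv) as GP. pose proof (LL_pos n) as LP. pose proof (LL_le_L n) as LLe. pose proof (lg_pos n).
  pose proof (rk_le_N c T (S vv * hh n)) as RN. pose proof (N_le c T) as NL. rewrite HT in NL.
  assert (SUB : forall i, iv0 <= i < iv1 -> i / gg n = kv /\ sidx c T i = kv * gg n + jv * gp c T kv /\ bnd c T (sidx c T i) = bs jv /\ slen c T i = bs (jv + 1) - bs jv).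
  { intros i Hi. apply subrange_of; auto; lia. }
  assert (Hb0 : bs jv <= bs (jv + 1)).
  { apply bnd_mono. assert (jv * gp c T kv <= (jv + 1) * gp c T kv) by (apply Nat.mul_le_mono_r; lia). lia. }
  assert (BL : forall i, bnd c T i <= n) by (intros x; rewrite <- HT; apply bnd_le).
  assert (Hb1 : bs jv <= n /\ bs (jv + 1) <= n) by (split; apply BL).
  unfold sub4. eapply ev_let; [eapply ev_bsub; eauto; lia|]. intros r1 d1 p' E Ep'. lift E.
  assert (HJ : evb w m lim b r1 d1 (bsub c k p br g (j +' kk 1)) (bs (jv + 1))).
  { eapply ev_bsub; eauto; [repeat ev1; lia|lia]. }
  eapply ev_let; [apply ev_sub; [exact HJ|exact Ep'|lia|lia]|]. set (rv := bs (jv + 1) - bs jv) in *.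
  assert (Hrv : rv < thr n).
  { destruct (SUB iv0 ltac:(lia)) as (A1 & _ & _ & A4). rewrite <- A4.
    pose proof (slen_le c T iv0) as Q. rewrite HT, A1 in Q. lia. }
  intros r2 d2 r' E Er'. lift E.
  eapply ev_let; [eapply ev_mlg; eauto; pose proof (off_bounds c); lia|]. intros r3 d3 b' E Eb'. lift E.
  set (bv := lg rv) in *.
  assert (LB : bv <= lgr c T kv).
  { apply lg_mono. destruct (SUB iv0 ltac:(lia)) as (A1 & _ & _ & A4). rewrite <- A4.
    pose proof (slen_le c T iv0) as Q. rewrite HT, A1 in Q. lia. }
  assert (X2 : LL n ^ 2 = LL n * LL n) by (simpl; ring).
  assert (LM : bv * lgr c T kv <= MM n).
  { assert (bv * lgr c T kv <= 4 * LL n * (4 * LL n)) by (apply Nat.mul_le_mono; lia).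
    assert (4 * LL n * (4 * LL n) <= 4 * (4 * LL n * LL n)) by lia.
    pose proof (x_le_MM n 10 ltac:(lia)) as Q. pose proof (le_pow2 10). unfold thr in S6.
    assert (4 * (4 * LL n * LL n) <= 2 ^ 4 * (2 ^ lg n * 2 ^ lg n)).
    { change (2 ^ 4) with 16. replace (4 * (4 * LL n * LL n)) with (16 * (LL n * LL n)) by ring. apply Nat.mul_le_mono_l.
      pose proof (le_pow2 (lg n)). apply Nat.mul_le_mono; lia. }
    rewrite <- !Nat.pow_add_r in *. pose proof (x_le_MM n (4 + (lg n + lg n)) ltac:(lia)). lia. }
  assert (L2M : LL n * LL n <= MM n).
  { assert (LL n * LL n <= 4 * LL n * LL n) by (apply Nat.mul_le_mono_r; lia). lia. }
  assert (PM : bv * lgr c T kv * (LL n * LL n) <= MM n * MM n) by (apply Nat.mul_le_mono; lia).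
  set (TH := bv * lgr c T kv * (LL n * LL n)) in *.
  assert (VAL : isum (wt4 c T) iv0 iv1 = if rv <? TH then 0 else
    psum (fun t => (select c T (iv0 + t * 1) - bs jv) * 2 ^ (t * bv)) (iv1 - iv0) *
    2 ^ (ceil_div (bs jv) (LL n) mod lg n + (iv0 - (kv * gg n + jv * gp c T kv)) * bv)).
  { unfold isum. destruct (Nat.ltb_spec rv TH) as [L|L].
    - rewrite (psum_ext _ (fun _ => 0)); [now rewrite psum_const, Nat.mul_0_r|]. intros t Ht.
      destruct (SUB (iv0 + t) ltac:(lia)) as (A1 & A2 & A3 & A4).
      unfold wt4, act4. rewrite HT, A1, A4, Hs. fold bv. rewrite X2. fold TH.
      rewrite (proj2 (Nat.leb_gt TH rv)) by lia. reflexivity.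
    - rewrite Nat.mul_comm, <- psum_mul. apply psum_ext. intros t Ht.
      destruct (SUB (iv0 + t) ltac:(lia)) as (A1 & A2 & A3 & A4).
      unfold wt4, act4, off4. rewrite HT, A1, A3, A4, Hs. fold bv. rewrite X2. fold TH.
      rewrite (proj2 (Nat.leb_le TH rv)) by lia. cbn [andb]. rewrite A2, bnd_sel, Nat.mul_1_r by lia.
      replace (iv0 + t - (kv * gg n + jv * gp c T kv)) with (iv0 - (kv * gg n + jv * gp c T kv) + t) by lia.
      rewrite Nat.mul_add_distr_r, !Nat.pow_add_r. ring. }
  rewrite VAL. apply ev_if_lt; auto; [apply ev_mul; [repeat ev1; lia|repeat ev1; lia|unfold TH in PM; lia]|intros; apply ev_k; lia|].
  intros HL. assert (ACT : act4 c T iv0 = true).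
  { destruct (SUB iv0 ltac:(lia)) as (A1 & A2 & A3 & A4).
    unfold act4. rewrite HT, A1, A4, Hs. fold bv. rewrite X2. fold TH. now rewrite (proj2 (Nat.leb_le TH rv)) by lia. }
  destruct (gp_bits c T iv0 ACT) as [GB _]. destruct (SUB iv0 ltac:(lia)) as (A1 & A2 & A3 & A4).
  rewrite HT, A1, A4 in GB. fold bv in GB.
  (* The packed answers have at most [16 * LL n ^ 3] bits, which the term [300 * lg L ^ 4]
     accommodates. *)
  pose proof (K0_ok (lg n) (lg_pos n)) as KO. fold (LL n) in KO.
  assert (L34 : LL n ^ 3 <= LL n ^ 4) by (apply Nat.pow_le_mono_r; lia).
  set (sv := kv * gg n + jv * gp c T kv) in *.
  assert (IB : (iv1 - sv) * bv <= 16 * LL n ^ 3).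
  { etransitivity; [|exact GB]. apply Nat.mul_le_mono_r. lia. }
  assert (SPL : (iv1 - iv0) * bv + (iv0 - sv) * bv = (iv1 - sv) * bv) by (rewrite <- Nat.mul_add_distr_r; f_equal; lia).
  assert (KB : (iv1 - sv) * bv <= K0 * lg n).
  { etransitivity; [exact IB|]. clear - KO L34. set (y := LL n ^ 3) in *. set (z := LL n ^ 4) in *. clearbody y z. lia. }
  assert (KB0 : (iv1 - iv0) * bv <= K0 * lg n) by (etransitivity; [|exact KB]; apply Nat.mul_le_mono_r; lia).
  assert (LB1 : 1 <= bv) by apply lg_pos.
  pose proof (isum_max c n T w m lim t0 HC (wt4 c T) ltac:(intros; rewrite <- HT; apply wt4_bound; lia) iv0 iv1 ltac:(lia) ltac:(lia)) as IM.
  rewrite VAL in IM. rewrite (proj2 (Nat.ltb_ge _ _) HL) in IM.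
  assert (BVM : bv < DD n) by lia.
  assert (JM : jv * gp c T kv <= sv) by (unfold sv; lia).
  assert (BN : bs jv <= select c T iv0).
  { rewrite <- bnd_sel by lia. rewrite <- A3. apply bnd_mono. rewrite A2. lia. }
  apply ev_shl.
  - eapply ev_mpack with (dv := 1); eauto; try lia.
    + repeat ev1; lia.
    + repeat ev1; lia.
    + apply pow_le_M. exact KB0.
  - assert (ceil_div (bs jv) (LL n) <= n).
    { apply ceil_le; auto. etransitivity; [apply Hb1|]. apply le_mul_r. lia. }
    pose proof (Nat.Div0.mod_le (ceil_div (bs jv) (LL n)) (lg n)).
    assert ((iv0 - sv) * bv <= MM n).
    { assert (2 ^ ((iv1 - sv) * bv) <= MM n) by (apply pow_le_M; exact KB). pose proof (le_pow2 ((iv1 - sv) * bv)).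
      assert ((iv0 - sv) * bv <= (iv1 - sv) * bv) by (apply Nat.mul_le_mono_r; lia). lia. }
    apply ev_add; [apply ev_mod; [apply ev_mceil; auto; [repeat ev1|lia]|repeat ev1|lia]|unfold sv in *; repeat ev1; lia|lia].
  - lia.
Qed.
End Piece4.

(** The reason why the table of sub-range answers may be keyed by a residue: a shift by a multiple
    of [k * L] changes the quotient by a multiple of [k]. *)
Lemma ceil_shift q L k x : 1 <= L -> 1 <= k -> ceil_div (q * (k * L) + x) L mod k = ceil_div x L mod k.
Proof.
  intros HL Hk. unfold ceil_div. replace (q * (k * L) + x + L - 1) with (x + L - 1 + q * k * L) by lia.
  rewrite Nat.div_add by lia. apply Nat.Div0.mod_add.
Qed.

(** All boundaries of these sub-ranges are occurrences of the chunk, so differences of positions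
    follow from its contents. Only the offset in the word depends on the position of the chunk, and
    there [ceil_shift] applies. *)
Lemma sub_table c n T kv vv x jv mj : length T = n -> short c T kv = true -> is_chunk c T (hh n) vv x ->
  let g := gp c T kv in let e := kv * gg n + jv * g in let a := rk c T (vv * hh n) in
  a < e -> e + mj * g <= rk c T (S vv * hh n) -> e + mj * g < S kv * gg n ->
  isum (wt4 c T) e (e + mj * g) =
  psum (sub_term n x (e - a) (lgr c T kv) ((vv * hh n) mod (lg n * LL n))) (mj * g).
Proof.
  intros HT Hs HCk g e a H1 H2 H3. pose proof (gp_pos c T kv) as GP. fold g in GP.
  pose proof (LL_pos n) as LP. pose proof (lg_pos n) as LgP.
  assert (Eg : g = lgr c T kv * LL n) by (unfold g, gp; now rewrite HT).
  unfold isum. rewrite Nat.add_comm, Nat.add_sub. apply psum_ext. intros t Ht.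
  pose proof (div_mul_le t g) as D1. pose proof (div_ub t g GP) as D2. pose proof (Nat.div_mod_eq t g) as D3.
  set (q := t / g) in *.
  assert (Q1 : q < mj) by (apply (Nat.mul_lt_mono_pos_r g); lia).
  assert (Q2 : (q + 1) * g <= mj * g) by (apply Nat.mul_le_mono_r; lia).
  assert (EJ : kv * gg n + (jv + q) * g = e + q * g) by (unfold e; lia).
  assert (EJ1 : kv * gg n + (jv + q + 1) * g = e + (q + 1) * g) by (unfold e; lia).
  destruct (subrange_of c n T kv Hs (jv + q) (e + t)) as (A1 & A2 & A3 & A4); auto; try (fold g; lia).
  assert (SEL : forall y, 1 <= e + y -> e + y <= rk c T (S vv * hh n) ->
     bnd c T (e + y) = vv * hh n + fsel (Nat.testbit x) (hh n) (e - a + y)).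
  { intros y Y1 Y2. rewrite bnd_sel by lia.
    destruct (chunk_sel c T (hh n) vv x (e + y) HCk) as [Q _]; [fold a; lia|lia|].
    rewrite Q. fold a. f_equal. f_equal. lia. }
  assert (B0 : bs c n T kv (jv + q) = vv * hh n + fsel (Nat.testbit x) (hh n) (e - a + q * g)).
  { unfold bs. fold g. rewrite EJ, Nat.min_l by lia. apply SEL; lia. }
  assert (B1 : bs c n T kv (jv + q + 1) = vv * hh n + fsel (Nat.testbit x) (hh n) (e - a + (q + 1) * g)).
  { unfold bs. fold g. rewrite EJ1, Nat.min_l by lia. apply SEL; lia. }
  unfold wt4, act4, off4, sub_term. rewrite HT, A1, A3, A4, Hs, A2. fold g. rewrite EJ, B0, B1, SEL by lia.
  rewrite <- Eg. fold q.
  set (p0 := fsel (Nat.testbit x) (hh n) (e - a + q * g)). set (p1 := fsel (Nat.testbit x) (hh n) (e - a + (q + 1) * g)).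
  replace (vv * hh n + p1 - (vv * hh n + p0)) with (p1 - p0) by lia. cbn [andb].
  destruct (_ <=? _); auto.
  replace (vv * hh n + fsel (Nat.testbit x) (hh n) (e - a + t) - (vv * hh n + p0))
    with (fsel (Nat.testbit x) (hh n) (e - a + t) - p0) by lia.
  replace (e + t - (e + q * g)) with (t mod g) by lia.
  assert (EC : ceil_div (vv * hh n + p0) (LL n) mod lg n = ceil_div ((vv * hh n) mod (lg n * LL n) + p0) (LL n) mod lg n).
  { rewrite (Nat.div_mod_eq (vv * hh n) (lg n * LL n)) at 1.
    rewrite (Nat.mul_comm (lg n * LL n)), <- Nat.add_assoc. apply ceil_shift; auto. }
  now rewrite EC.
Qed.

Lemma piece4 c n T w m lim b t0 : Ctx n T w m lim t0 -> off c + 12 < t0 ->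
  piece_ok c n T w m lim b (wt4 c T) (g4 c).
Proof.
  intros HC Ht r d v a k p br lo hi vv kv lov hiv E0 W Hv Ev Ea Ek Hk Ep Eb Elo Ehi Hs H1 H2 H3 H4 H5.
  unfold E0 in *. clear E0. pose proof HC as (HI & HK & _). szs HI. pose proof (inst_w _ _ _ HI) as Hw. pose proof (nk_facts n) as (K1 & K2 & _).
  pose proof HI as (Hn & HT & _). pose proof (small_facts n) as (S1 & S2 & S3 & S4 & S5 & S6 & S7 & S8 & S9 & S10 & S11 & _).
  pose proof (gg_facts n) as (G1 & G2 & G3 & G4). pose proof (off_bounds c) as OB.
  pose proof (short_lgr c T kv Hs) as [B1 B2]. pose proof (lgr_pos c T kv) as B3. pose proof (gp_pos c T kv) as B4.
  rewrite HT in B1.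
  assert (Eg : gp c T kv = lgr c T kv * LL n) by (unfold gp; now rewrite HT).
  pose proof (LL_pos n) as LP. pose proof (LL_le_L n) as LLe. pose proof (lg_pos n) as LgP.
  assert (Hg : gp c T kv < DD n). { rewrite Eg. assert (lgr c T kv * LL n <= 4 * LL n * LL n) by (apply Nat.mul_le_mono_r; lia). lia. }
  pose proof (rk_le_N c T (S vv * hh n)) as RN. pose proof (N_le c T) as NL. rewrite HT in NL.
  pose proof (rk_chunk_step c T (hh n) vv) as RS. pose proof (NC_h n) as NH.
  set (av := rk c T (vv * hh n)) in *. set (g := gp c T kv) in *.
  set (q := kv * gg n) in *. assert (KG : S kv * gg n = q + gg n) by (unfold q; lia).
  set (jv := (lov - q) / g) in *. set (ev := Nat.min hiv (q + (jv + 1) * g)) in *.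
  pose proof (div_mul_le (lov - q) g) as D1. pose proof (div_ub (lov - q) g B4) as D2. fold jv in D1, D2.
  assert (JM : jv <= jv * g) by (apply le_mul_r; lia).
  unfold g4. eapply ev_let; [repeat ev1; rewrite <- ?Eg; lia|]. rewrite <- Eg. fold g. intros r1 d1 gb E Egb. lift E.
  eapply ev_let; [repeat ev1; lia|]. fold q. intros r2 d2 qb E Eq. lift E.
  eapply ev_let; [repeat ev1; lia|]. fold jv. intros r3 d3 jb E Ej. lift E.
  assert (J1g : (jv + 1) * g = jv * g + g) by lia.
  eapply ev_let; [apply ev_minb; [exact Hw|exact Ehi|repeat ev1; lia]|]. fold ev. intros r4 d4 eb E Ee. lift E.
  assert (Hev : lov < ev <= hiv /\ ev <= q + (jv + 1) * g) by (unfold ev; lia).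
  assert (IM : forall x y, 1 <= x -> y <= count c T + 1 -> isum (wt4 c T) x y <= MM n * MM n).
  { apply (isum_max c n T w m lim t0 HC (wt4 c T)). intros; rewrite <- HT; apply wt4_bound; lia. }
  rewrite (isum_split _ lov ev hiv) by lia.
  assert (P1 : evb w m lim b r4 d4 (sub4 c v a k p br gb jb lo eb) (isum (wt4 c T) lov ev)).
  { eapply ev_sub4 with (jv := jv); eauto; fold g q; lia. }
  pose proof (IM lov ev ltac:(lia) ltac:(lia)). pose proof (IM ev hiv ltac:(lia) ltac:(lia)).
  apply ev_add; [exact P1| |lia].
  eapply ev_eq; [apply ev_if_lt; [exact Hw|exact Ee|exact Ehi| |intros; apply ev_k; lia]|].
  2: { destruct (Nat.ltb_spec ev hiv); [reflexivity|]. symmetry. apply isum_nil. lia. }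
  (* More than one sub-range is met, so [ev] is the end of sub-range [jv]. *)
  intros Hlt. assert (EV : ev = q + (jv + 1) * g) by (unfold ev in *; lia).
  set (jo := (hiv - 1 - q) / g). set (fo := q + jo * g).
  pose proof (div_mul_le (hiv - 1 - q) g) as D3. pose proof (div_ub (hiv - 1 - q) g B4) as D4. fold jo in D3, D4.
  assert (JJ : jv + 1 <= jo).
  { apply Nat.div_le_lower_bound; [lia|]. lia. }
  assert (JOM : jo <= jo * g) by (apply le_mul_r; lia).
  assert (FO : fo = ev + (jo - jv - 1) * g).
  { unfold fo. rewrite EV. replace jo with (jv + 1 + (jo - jv - 1)) at 1 by lia. ring. }
  assert (EF : ev <= fo <= hiv - 1) by (split; [rewrite FO; apply Nat.le_add_r|unfold fo; lia]).
  rewrite (isum_split _ ev fo hiv) by lia.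
  pose proof (IM ev fo ltac:(lia) ltac:(lia)). pose proof (IM fo hiv ltac:(lia) ltac:(lia)).
  eapply ev_let; [repeat ev1; lia|]. fold jo. intros r5 d5 job E Ejo. lift E.
  eapply ev_let; [repeat ev1; lia|]. fold fo. intros r6 d6 fob E Efo. lift E.
  apply ev_add; [| |lia].
  - destruct (ev_aX c n T w m lim b t0 HC r6 d6 v vv ltac:(lia) W Ev Hv) as [HX HCk].
    set (x := xchunk c n m vv) in *.
    pose proof (chunk_cnt c T (hh n) vv x (hh n) HCk (le_n _)) as EC. replace (vv * hh n + hh n) with (S vv * hh n) in EC by lia. fold av in EC.
    set (mj := jo - jv - 1) in *. set (cc := (vv * hh n) mod (lg n * LL n)).
    assert (CC : cc < DD n). { assert (cc < lg n * LL n) by (apply Nat.mod_upper_bound; lia). lia. }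
    assert (MJ : mj <= mj * g) by (apply le_mul_r; lia).
    assert (BD : ev - av < DD n /\ mj < DD n /\ lgr c T kv < DD n /\ cc < DD n /\ 1 <= ev - av /\ ev - av + mj * g <= cntb (Nat.testbit x) (hh n)).
    { clear - H4 H5 Hev EF FO RS S9 S10 EC MJ B1 CC. splits; lia. }
    assert (VH : vv * hh n <= MM n).
    { assert (vv * hh n <= NC n * hh n) by (apply Nat.mul_le_mono_r; lia). lia. }
    eapply (ev_eq _ _ _ _ _ _ _ _ (rg n m 5 (pack_idx (DD n) x (ev - av) mj (lgr c T kv) cc))).
    + assert (HCC : evb w m lim b r6 d6 (v *' gh %' (gL *' gLL)) cc).
      { clear - Z0 Z1 W VH S11 S4 Ev. unfold cc. repeat ev1; lia. }
      assert (HMJ : evb w m lim b r6 d6 (job -' jb -' kk 1) mj).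
      { assert (JN : jo <= n) by lia. clear - Z0 Z1 K2 JJ JN Ejo Ej. unfold mj. repeat ev1; lia. }
      assert (HEA : evb w m lim b r6 d6 (eb -' a) (ev - av)).
      { apply ev_sub; [exact Ee|exact Ea|clear - BD; lia|clear - Z0 Z1 K2 NL Hev H5 RN; lia]. }
      apply (ev_pack_ld n T w m lim b t0 r6 d6 5); [exact HC|clear - Ht OB; lia|exact W|exact HX|exact HEA|exact HMJ|exact Eb|exact HCC|apply HCk|apply BD..].
    + rewrite (HK 5 ltac:(clear - Ht OB; lia)).
      * rewrite FO, EV. unfold mj. subst x cc. rewrite <- Eg. symmetry.
        apply (sub_table c n T kv vv _ (jv + 1) (jo - jv - 1)); auto; fold g q av; unfold fo, mj in *; lia.
      * apply HCk.
      * apply BD.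
      * apply BD.
      * apply BD.
      * exact CC.
      * clear - BD. lia.
      * exact B3.
      * rewrite <- Eg. apply BD.
  - eapply ev_sub4 with (jv := jo); eauto; fold g q; unfold fo in *; lia.
Qed.

Lemma tri_leaf4 c : Tri (Inv spec (off c + 14)) (mapphase (off c + 14) (kk 0) gNC (v_leaf c (g4 c))) (Inv spec (S (off c + 14))).
Proof.
  apply tri_leaf with (wt := wt4 c); try lia; try reflexivity.
  - intros. eapply piece4; eauto. lia.
  - apply wt4_long.
  - apply wt4_max.
Qed.

Lemma tri_scan4 c : Tri (Inv spec (S (off c + 14))) (scan (off c + 14)) (Inv spec (off c + 18)).
Proof.
  apply (tri_leaf_scan c 14 (wt4 c)); try lia; try reflexivity. apply wt4_max.
Qed.

(** The argument of [mrk] is the first position from which answers would begin in word [uV] or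
    later. The last occurrence before it has number [i], and the boundary wanted is the end of the
    sub-range of [i]. *)
Definition v_pb (c : bool) : bld :=
  if_ (uV =' kk 0) (kk 0)
    (LET i := mrk c (minb gN (gLL *' (uV *' gL -' kk 1) +' kk 1)) IN
     LET k := i /' gg_ IN LET p := aLOC c k IN LET r := aLOC c (k +' kk 1) -' p IN
     if_ (r <' gthr)
       (LET br := mlg r IN LET g := br *' gLL IN
        bsub c k p br g ((i -' k *' gg_) /' g +' kk 1))
       (aLOC c (k +' kk 1))).

Lemma nidx_mono c T i i' : i <= i' -> nidx c T i <= nidx c T i'.
Proof.
  intros H. pose proof (sidx_bounds c T i) as (_ & B). pose proof (sidx_bounds c T i) as (A & _).
  pose proof (sidx_bounds c T i') as (A' & B').
  destruct (Nat.lt_ge_cases i' (nidx c T i)).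
  - destruct (sidx_same c T i i') as (_ & -> & _); lia.
  - lia.
Qed.

Lemma pbw_le c T o : pbw c T o <= length T.
Proof. unfold pbw. destruct (_ =? _); [lia|apply bnd_le]. Qed.

Lemma pbw_mono c T o o' : o <= o' -> pbw c T o <= pbw c T o'.
Proof.
  intros H. unfold pbw. destruct (Nat.eqb_spec o 0); [lia|]. rewrite (proj2 (Nat.eqb_neq o' 0)) by lia.
  apply bnd_mono, nidx_mono, rk_mono. apply Nat.min_le_compat_l, Nat.add_le_mono_r, Nat.mul_le_mono_l.
  apply Nat.sub_le_mono_r, Nat.mul_le_mono_r. exact H.
Qed.

Lemma nom_cost a : exists C, forall n, 1 <= n -> (nom n + a) * lg n <= C * n.
Proof.
  destruct nk_cost as [C H]. exists (C + 2 * a). intros n Hn. specialize (H n Hn). pose proof (nk_facts n) as (_ & _ & ->).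
  pose proof (pow_L_le n Hn). pose proof (le_pow2 (lg n)).
  assert (a * lg n <= a * (2 * n)) by (apply Nat.mul_le_mono_l; lia). lia.
Qed.

Lemma nom_MM n : nom n + 3 <= MM n.
Proof. pose proof (nk_facts n) as (K1 & K2 & K3). lia. Qed.

Lemma tri_pb c : Tri (Inv spec (off c + 18)) (mapphase (off c + 18) (kk 0) (gN /' gg_ +' kk 4) (v_pb c)) (Inv spec (S (off c + 18))).
Proof.
  pose proof (off_bounds c) as OB.
  apply map_tri with (bndf := fun _ => 0) (cntf := fun n => nom n + 1); try lia.
  - destruct c; reflexivity.
  - apply flat_cost, nom_cost.
  - apply flat_depth.
  - intros n T w HI. pose proof (pow2_pos w). pose proof (nom_MM n). lia.
  - intros n T w m l b tau r HI [HL _]. szs HI. pose proof (nk_facts n) as (K1 & K2 & _).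
    assert (W : Wd n w r G) by (split; auto). unfold nk, nom in *. split; [repeat ev1; lia|].
    eapply ev_eq; [repeat ev1; lia|]. lia.
  - intros n T w m a HI HK Ha. rewrite spec_off by lia. cbn [nth per_bit].
    assert (HC : Ctx n T w m ((off c + 18) * MM n) (off c + 18)) by (unfold Ctx; splits; auto; lia).
    pose proof HI as (Hn & HT & _). szs HI. pose proof (inst_w _ _ _ HI) as Hw. pose proof (nk_facts n) as (K1 & K2 & _).
    pose proof (gg_facts n) as (G1 & G2 & G3 & G4). pose proof (small_facts n) as (S1 & S2 & S3 & S4 & S5 & S6 & S7 & S8 & S9 & S10 & _).
    pose proof (LL_le_L n) as LLe. pose proof (LL_pos n) as LP.
    pose proof (N_le c T) as NL. rewrite HT in NL.
    assert (BL : forall i, bnd c T i <= n) by (intros x; rewrite <- HT; apply bnd_le).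
    intros o Ho. pose proof (nom_MM n). apply Ha; [lia|]. intros r Hr HU. world n w r Hr (G + 4) HU o.
    assert (OM : o * lg n <= MM n * MM n) by (apply Nat.mul_le_mono; lia).
    assert (OM3 : LL n * (o * lg n - 1) <= MM n * MM n * MM n).
    { rewrite <- (Nat.mul_assoc (MM n)). apply Nat.mul_le_mono; lia. }
    unfold v_pb, pbw. rewrite HT.
    apply ev_if_eq; auto; [apply ev_k; lia|intros; apply ev_k; lia|]. intros Hne.
    assert (1 <= o * lg n) by (pose proof (lg_pos n); pose proof (le_mul_r o (lg n)); lia).
    set (zp := Nat.min n (LL n * (o * lg n - 1) + 1)).
    assert (HZ : evb w m ((off c + 18) * MM n) 0 r (G + 4) (minb gN (gLL *' (uV *' gL -' kk 1) +' kk 1)) zp).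
    { apply ev_minb; auto; repeat ev1; lia. }
    eapply ev_let; [eapply ev_mrk; eauto; unfold zp; lia|]. set (i := rk c T zp). intros r1 d1 ib E Hi. lift E.
    pose proof (rk_le_N c T zp) as RN. fold i in RN.
    eapply ev_let; [repeat ev1; lia|]. set (k := i / gg n). intros r2 d2 kb E Hkb. lift E.
    assert (Hk : S k < nk n). { unfold k, nk. assert (i / gg n <= n / gg n) by (apply Nat.Div0.div_le_mono; lia). lia. }
    pose proof (div_mul_le i (gg n)) as D1. fold k in D1.
    eapply ev_let; [eapply ev_aLOC; eauto; lia|]. intros r3 d3 p E Hp. lift E.
    assert (HL1 : evb w m ((off c + 18) * MM n) 0 r3 d3 (aLOC c (kb +' kk 1)) (bnd c T (S k * gg n))).
    { replace (S k) with (k + 1) by lia. eapply ev_aLOC; eauto; [lia|repeat ev1; lia|lia]. }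
    pose proof (bnd_mono c T (k * gg n) (S k * gg n) ltac:(lia)).
    pose proof (BL (S k * gg n)) as BL1.
    eapply ev_let; [apply ev_sub; [exact HL1|exact Hp|lia|lia]|].
    replace (bnd c T (S k * gg n) - bnd c T (k * gg n)) with (rlen c T k) by (unfold rlen; now rewrite HT).
    intros r4 d4 rr E Hrr. lift E.
    eapply ev_eq.
    + apply ev_if_lt; [exact Hw|exact Hrr|repeat ev1| |intros; exact HL1].
      intros Hlt. assert (Hs : short c T k = true) by (apply Nat.ltb_lt; now rewrite HT).
      pose proof (short_lgr c T k Hs) as [B1 B2]. rewrite HT in B1.
      assert (Eg : gp c T k = lgr c T k * LL n) by (unfold gp; now rewrite HT).
      assert (GM : gp c T k <= MM n). { assert (gp c T k <= 4 * LL n * LL n) by (rewrite Eg; apply Nat.mul_le_mono_r; lia). lia. }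
      pose proof (gp_pos c T k) as GP.
      eapply ev_let; [eapply ev_mlg; eauto; lia|]. fold (lgr c T k). intros r5 d5 br E Hbr. lift E.
      eapply ev_let; [repeat ev1; lia|]. rewrite <- Eg. intros r6 d6 g E Hg. lift E.
      pose proof (div_ub i (gg n) G1) as D2. fold k in D2.
      assert (QM : (i - k * gg n) / gp c T k <= gg n).
      { apply Nat.Div0.div_le_upper_bound. pose proof (le_mul_l (gp c T k) (gg n) ltac:(lia)). lia. }
      eapply ev_bsub with (n := n) (jv := (i - k * gg n) / gp c T k + 1); eauto; try lia.
      repeat ev1; lia.
    + unfold nidx, sidx. rewrite HT. fold k. unfold short. rewrite HT.
      destruct (Nat.ltb_spec (rlen c T k) (thr n)); [|reflexivity].
      unfold bs. f_equal. f_equal. lia.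
Qed.

Lemma tri_w4p c : Tri (Inv spec (off c + 19)) (mapphase (off c + 19) (kk 0) (gN /' gg_ +' kk 4)
  (query c 17 (g4 c) (arr (off c + 18) uV))) (Inv spec (S (off c + 19))).
Proof.
  pose proof (off_bounds c) as OB.
  apply map_tri with (bndf := fun _ => 0) (cntf := fun n => nom n + 1); try lia.
  - destruct c; reflexivity.
  - apply flat_cost, nom_cost.
  - apply flat_depth.
  - intros n T w HI. pose proof (pow2_pos w). pose proof (nom_MM n). lia.
  - intros n T w m l b tau r HI [HL _]. szs HI. pose proof (nk_facts n) as (K1 & K2 & _).
    assert (W : Wd n w r G) by (split; auto). unfold nk, nom in *. split; [repeat ev1; lia|].
    eapply ev_eq; [repeat ev1; lia|]. lia.
  - intros n T w m a HI HK Ha. rewrite spec_off by lia. cbn [nth per_bit].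
    assert (HC : Ctx n T w m ((off c + 19) * MM n) (off c + 19)) by (unfold Ctx; splits; auto; lia).
    pose proof HI as (Hn & HT & _). pose proof (nom_MM n).
    intros o Ho. apply Ha; [lia|]. intros r Hr HU. world n w r Hr (G + 4) HU o.
    assert (HLg : forall i, short c T (i / gg n) = false -> wt4 c T i = 0).
    { intros i Hi. apply wt4_long. rewrite HT. exact Hi. }
    assert (HMx : forall i, 1 <= i <= count c T -> wt4 c T i <= MM n).
    { intros i Hi. rewrite <- HT. apply wt4_bound; lia. }
    pose proof (piece4 c n T w m ((off c + 19) * MM n) 0 _ HC ltac:(lia)).
    pose proof (pbw_le c T o) as PL. rewrite HT in PL.
    eapply ev_query; eauto; try lia.
    eapply ev_eq; [eapply ev_arrC; eauto; lia|]. apply (known_off c 18 n T m _ HK ltac:(lia) ltac:(lia)). exact Ho.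
Qed.

Lemma rec4_le n T w m lim t0 c o : Ctx n T w m lim t0 -> rec4 c T o <= MM n * MM n.
Proof.
  intros HC. pose proof HC as (HI & _). pose proof HI as (Hn & HT & _).
  apply (isum_max c n T w m _ _ HC (wt4 c T) ltac:(intros; rewrite <- HT; apply wt4_bound; lia)); [lia|].
  pose proof (rk_le_N c T (pbw c T (S o))). lia.
Qed.

Lemma tri_rec4 c : Tri (Inv spec (off c + 20)) (mapphase (off c + 20) (kk 0) (gN /' gg_ +' kk 3)
  (arr (off c + 19) (uV +' kk 1) -' arr (off c + 19) uV)) (Inv spec (S (off c + 20))).
Proof.
  pose proof (off_bounds c) as OB.
  apply map_tri with (bndf := fun _ => 0) (cntf := nom); try lia.
  - destruct c; reflexivity.
  - apply flat_cost. destruct (nom_cost 0) as [C H]. exists C. intros n Hn. specialize (H n Hn). now rewrite Nat.add_0_r in H.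
  - apply flat_depth.
  - intros n T w HI. pose proof (pow2_pos w). pose proof (nom_MM n). lia.
  - intros n T w m l b tau r HI [HL _]. szs HI. pose proof (nk_facts n) as (K1 & K2 & _).
    assert (W : Wd n w r G) by (split; auto). unfold nk, nom in *. split; repeat ev1; lia.
  - intros n T w m a HI HK Ha. rewrite spec_off by lia. cbn [nth per_bit].
    assert (HC : Ctx n T w m ((off c + 20) * MM n) (off c + 20)) by (unfold Ctx; splits; auto; lia).
    pose proof HI as (Hn & HT & _). pose proof (nom_MM n). szs HI.
    intros o Ho. apply Ha; [lia|]. intros r Hr HU. world n w r Hr (G + 4) HU o.
    pose proof (known_off c 19 n T m _ HK ltac:(lia) ltac:(lia)) as K19. cbn [nth per_bit] in K19.
    pose proof (K19 o ltac:(lia)) as Q0. pose proof (K19 (S o) ltac:(lia)) as Q1.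
    assert (M1 : rk c T (pbw c T o) <= rk c T (pbw c T (S o))) by (apply rk_mono, pbw_mono; lia).
    pose proof (isum_split (wt4 c T) 1 (rk c T (pbw c T o) + 1) (rk c T (pbw c T (S o)) + 1) ltac:(lia) ltac:(lia)) as SP.
    pose proof (isum_max c n T w m _ _ HC (wt4 c T) ltac:(intros; rewrite <- HT; apply wt4_bound; lia) 1 (rk c T (pbw c T (S o)) + 1) ltac:(lia)
      ltac:(pose proof (rk_le_N c T (pbw c T (S o))); lia)) as IM.
    replace (S o) with (o + 1) in * by lia. unfold rec4. replace (S o) with (o + 1) by lia.
    eapply ev_eq.
    + apply ev_sub; [eapply ev_arrC with (t0 := off c + 20) (i := o + 1); eauto; [lia|repeat ev1; lia|lia]|eapply ev_arrC; eauto; lia| |]; rewrite Q1, ?Q0; lia.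
    + rewrite Q1, Q0. lia.
Qed.

(** [1024 = 16 * 64], with 64 from [lg_pow4]. A group of answers thus reaches a constant number of
    words, and each word of the stream takes constant work. *)
Lemma spill_le n : spill n <= 1026.
Proof.
  unfold spill. pose proof (lg_pow4 (lg n) (lg_pos n)) as P. fold (LL n) in P. pose proof (LL_pos n). pose proof (lg_pos n).
  assert (LL n ^ 3 <= LL n ^ 4) by (apply Nat.pow_le_mono_r; lia).
  assert (16 * LL n ^ 3 / lg n <= 1024); [|lia]. apply Nat.Div0.div_le_upper_bound.
  set (y := LL n ^ 3) in *. set (z := LL n ^ 4) in *. clearbody y z. lia.
Qed.

Lemma lor_iter (f : nat -> nat) b k : (forall i, f i < 2 ^ b) ->
  iter_up k (fun z acc => Nat.lor acc (f z)) 0 < 2 ^ b.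
Proof.
  intros H. apply (iter_inv k _ 0 (fun _ v => v < 2 ^ b)); [pose proof (pow2_pos b); lia|].
  intros. now apply lor_lt.
Qed.

Lemma tri_subans c : Tri (Inv spec (off c + 21)) (mapphase (off c + 21) (kk 16 *' (gLL *' gLL *' gLL) /' gL +' kk 2) (gN /' gg_ +' kk 3)
  (for_ (kk 0) (fun acc z => bop Or acc (if_ (uV <' z) (kk 0) (arr (off c + 20) (uV -' z) >>' (z *' gL))))))
  (Inv spec (S (off c + 21))).
Proof.
  pose proof (off_bounds c) as OB.
  apply map_tri with (bndf := spill) (cntf := nom); try lia.
  - destruct c; reflexivity.
  - destruct (nom_cost 0) as [C H]. exists (1027 * C). intros n Hn. specialize (H n Hn). rewrite Nat.add_0_r in H.
    pose proof (spill_le n). assert (nom n * (spill n + 1) * lg n <= nom n * 1027 * lg n) by (apply Nat.mul_le_mono_r, Nat.mul_le_mono_l; lia).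
    lia.
  - exists 1027. intros n _. pose proof (spill_le n). pose proof (lg_pos n). lia.
  - intros n T w HI. szs HI. pose proof (nom_MM n). pose proof (spill_le n). pose proof (x_le_MM n 11 ltac:(pose proof (lg_pos n); lia)) as Q.
    change (2 ^ 11) with 2048 in Q. lia.
  - intros n T w m l b tau r HI [HL _]. szs HI. pose proof (nk_facts n) as (K1 & K2 & _).
    assert (W : Wd n w r G) by (split; auto). unfold nk, nom in *.
    pose proof (spill_le n) as SL. pose proof (small_facts n) as (S1 & S2 & _).
    assert (LL n <= lg n) by apply LL_le_L.
    assert (16 * (LL n * LL n * LL n) < 2 ^ w).
    { assert (LL n * LL n * LL n <= MM n * MM n * MM n) by (repeat apply Nat.mul_le_mono; lia). lia. }
    split; [|repeat ev1; lia].
    assert (SE : spill n = 16 * (LL n * LL n * LL n) / lg n + 2).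
    { unfold spill. f_equal. f_equal. simpl. ring. }
    assert (LL n * LL n <= MM n * MM n) by (apply Nat.mul_le_mono; lia).
    rewrite SE in *.
    pose proof (x_le_MM n 11 ltac:(pose proof (lg_pos n); lia)) as Q. change (2 ^ 11) with 2048 in Q. repeat ev1; lia.
  - intros n T w m a HI HK Ha. rewrite spec_off by lia. cbn [nth per_bit].
    assert (HC : Ctx n T w m ((off c + 21) * MM n) (off c + 21)) by (unfold Ctx; splits; auto; lia).
    pose proof HI as (Hn & HT & _). pose proof (nom_MM n). szs HI. pose proof (inst_w _ _ _ HI) as Hw.
    intros o Ho. apply Ha; [lia|]. intros r Hr HU. world n w r Hr (G + 4) HU o.
    set (f := fun z => if o <? z then 0 else rec4 c T (o - z) / 2 ^ (z * lg n)).
    assert (FL : forall z, f z < 2 ^ w).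
    { intros z. unfold f. destruct (o <? z); [lia|]. pose proof (rec4_le n T w m _ _ c (o - z) HC).
      pose proof (pow2_pos (z * lg n)). pose proof (le_mul_l (2 ^ (z * lg n)) (rec4 c T (o - z)) ltac:(lia)).
      pose proof (Nat.Div0.div_le_upper_bound (rec4 c T (o - z)) (2 ^ (z * lg n)) (rec4 c T (o - z)) ltac:(lia)). lia. }
    unfold sword. rewrite HT. fold f.
    apply (ev_for w m ((off c + 21) * MM n) (spill n) r (G + 4) (kk 0) _ 0 (fun z acc => Nat.lor acc (f z))).
    + apply ev_k. lia.
    + intros r1 d1 acc z zv E Hz HA HZ. lift E.
      assert (zv * lg n <= MM n * MM n).
      { pose proof (spill_le n). pose proof (x_le_MM n 11 ltac:(pose proof (lg_pos n); lia)) as Q. change (2 ^ 11) with 2048 in Q.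
        pose proof (small_facts n) as (S1 & S2 & _). apply Nat.mul_le_mono; lia. }
      apply ev_or; [exact HA| |apply lor_iter, FL|apply FL].
      apply ev_if_lt; auto; [intros; apply ev_k; lia|]. intros Hle.
      pose proof (rec4_le n T w m _ _ c (o - zv) HC).
      assert (HR : evb w m ((off c + 21) * MM n) (spill n) r1 d1 (arr (off c + 20) (uV -' z)) (rec4 c T (o - zv))).
      { eapply ev_eq; [eapply ev_arrC with (t0 := off c + 21) (i := o - zv); eauto; [lia|repeat ev1; lia|lia]|].
        apply (known_off c 20 n T m _ HK ltac:(lia) ltac:(lia)). lia. }
      apply ev_shr; [exact HR|repeat ev1; lia|lia].
Qed.

(** [LL n ^ 4] is at most a constant times [y = 2 ^ (LL n / 2)], where [y * y <= 2 * lg n], and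
    [2 * (D * y) <= D * D + y * y]. The coefficient is [49 = 3 * 16 + 1]: in [ll_cost] the exponent
    [ll n] occurs three times and [LL n] once. *)
Lemma ll_small : exists K, forall n, 49 * LL n ^ 4 <= lg n + K.
Proof.
  destruct (poly_exp 4 2 ltac:(lia)) as [C HC]. exists (49 * C * (49 * C)). intros n.
  specialize (HC (LL n)). pose proof (lg_low (lg n) (lg_pos n)) as L2. fold (LL n) in L2.
  set (y := 2 ^ (LL n / 2)) in *.
  assert (Y : y * y <= 2 ^ LL n).
  { unfold y. rewrite <- Nat.pow_add_r. apply Nat.pow_le_mono_r; [lia|]. pose proof (Nat.div_mod_eq (LL n) 2). lia. }
  set (z := LL n ^ 4) in *. set (D := 49 * C). assert (Q : 49 * z <= D * y) by (unfold D; lia).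
  assert (AM : forall a b, 2 * (a * b) <= a * a + b * b).
  { clear. intros a b. destruct (Nat.le_ge_cases a b) as [H|H].
    - replace b with (a + (b - a)) by lia. generalize (b - a). intros. ring_simplify. nia.
    - replace a with (b + (a - b)) by lia. generalize (a - b). intros. ring_simplify. nia. }
  specialize (AM D y). fold D. clearbody D y z. lia.
Qed.

Lemma ll_cost : exists C, forall n, 1 <= n -> 2 ^ ll n * ll n * (ll n + 1) * lg n <= C * n.
Proof.
  destruct ll_small as [K HK]. exists (2 ^ K * 2). intros n Hn. specialize (HK n).
  pose proof (pow_L_le n Hn) as PL. pose proof (le_pow2 (ll n)) as P. pose proof (lg_up (lg n)) as U. fold (LL n) in U.
  assert (LL n <= LL n ^ 4). { pose proof (LL_pos n). rewrite <- (Nat.pow_1_r (LL n)) at 1. apply Nat.pow_le_mono_r; lia. }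
  apply (Nat.le_trans _ (2 ^ ll n * 2 ^ ll n * 2 ^ ll n * 2 ^ LL n)).
  - repeat apply Nat.mul_le_mono; lia.
  - rewrite <- !Nat.pow_add_r. apply (Nat.le_trans _ (2 ^ (K + lg n))).
    + apply Nat.pow_le_mono_r; [lia|]. unfold ll. set (z := LL n ^ 4) in *. clearbody z. lia.
    + rewrite Nat.pow_add_r, <- Nat.mul_assoc. now apply Nat.mul_le_mono_l.
Qed.

Lemma ll_MM n : 2 ^ ll n * ll n <= MM n /\ 2 ^ ll n <= MM n /\ ll n < 2 ^ ll n.
Proof.
  pose proof (ll_M n) as H. pose proof (le_pow2 (ll n)). pose proof (pow2_pos (ll n)).
  assert (A : 2 ^ ll n * 2 ^ ll n <= 2 ^ (18 * ll n)) by (rewrite <- Nat.pow_add_r; apply Nat.pow_le_mono_r; lia).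
  assert (2 ^ ll n * ll n <= 2 ^ ll n * 2 ^ ll n) by (apply Nat.mul_le_mono_l; lia).
  assert (2 ^ ll n * 1 <= 2 ^ ll n * 2 ^ ll n) by (apply Nat.mul_le_mono_l; lia). lia.
Qed.

(** The exponent [ll n] is polynomial in [LL n], so the table is so small that each entry can afford
    to inspect all [ll n] bits. *)
Lemma tri_seltab c : Tri (Inv spec (off c + 22)) (mapphase (off c + 22) gl ((kk 1 <<' gl) *' gl)
  (LET x := uV /' gl IN LET i := uV %' gl +' kk 1 IN selm gl c x i)) (Inv spec (S (off c + 22))).
Proof.
  pose proof (off_bounds c) as OB.
  apply map_tri with (bndf := ll) (cntf := fun n => 2 ^ ll n * ll n); try lia.
  - destruct c; reflexivity.
  - exact ll_cost.
  - exists 1025. intros n _. pose proof (lg_pow4 (lg n) (lg_pos n)) as P. fold (LL n) in P. pose proof (lg_pos n).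
    unfold ll. set (z := LL n ^ 4) in *. clearbody z. lia.
  - intros n T w HI. szs HI. pose proof (ll_MM n). lia.
  - intros n T w m l b tau r HI [HL _]. szs HI. pose proof (ll_MM n).
    assert (W : Wd n w r G) by (split; auto). split; [repeat ev1|].
    eapply ev_eq; [repeat ev1; rewrite ?Nat.mul_1_l; lia|]. now rewrite Nat.mul_1_l.
  - intros n T w m a HI HK Ha. rewrite spec_off by lia. cbn [nth per_bit].
    szs HI. pose proof (ll_MM n) as (M1 & M2 & M3).
    intros s i Hl Hi. pose proof (bits_lt s) as BL.
    assert (BL' : bits_val s < 2 ^ ll n).
    { eapply Nat.lt_le_trans; [exact BL|]. apply Nat.pow_le_mono_r; lia. }
    pose proof Hi as Hi'. rewrite count_cntb in Hi'. pose proof (cntb_le (Bf c s) (length s)).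
    (* The index [bits_val s] does not record the length of [s]. For [c = false] the padding creates
       further occurrences, but only behind those of [s]. *)
    set (f := fun t => eqb (Nat.testbit (bits_val s) t) c).
    assert (FE : forall t, t < length s -> f t = Bf c s t).
    { intros t Ht. unfold f, Bf. rewrite testbit_bits. f_equal. now apply nth_indep. }
    assert (CE : cntb f (length s) = cntb (Bf c s) (length s)) by now apply cntb_ext.
    pose proof (cntb_mono f _ _ Hl).
    assert (FS : fsel f (ll n) i = select c s i).
    { rewrite select_fsel by lia. destruct (fsel_spec (Bf c s) (length s) i Hi') as (F1 & F2 & F3).
      apply fsel_unique; try lia.
      - now rewrite FE.
      - rewrite <- F3. apply cntb_ext. intros t Ht. apply FE. lia. }
    rewrite <- FS.
    assert (IDX : bits_val s * ll n + (i - 1) < 2 ^ ll n * ll n).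
    { assert ((bits_val s + 1) * ll n <= 2 ^ ll n * ll n) by (apply Nat.mul_le_mono_r; lia). lia. }
    apply Ha; [exact IDX|]. intros r Hr HU. world n w r Hr (G + 4) HU (bits_val s * ll n + (i - 1)).
    destruct (divmod_idx (bits_val s) (ll n) (i - 1) ltac:(lia)) as [D1 D2].
    eapply ev_let; [eapply ev_eq; [repeat ev1|exact D1]; auto; lia|]. intros r1 d1 x E Hx. lift E.
    eapply ev_let.
    { eapply (ev_eq _ _ _ _ _ _ _ i); [repeat ev1; rewrite ?D2; lia|rewrite D2; lia]. }
    intros r2 d2 ib E Hib. lift E.
    apply (ev_selm n T w m _ gl (ll n) c x (bits_val s)); auto; try lia.
    + intros r' d' E. lift E. repeat ev1.
    + fold f. lia.
Qed.

(** * Rank structure *)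

Lemma rank_pred c T p : 1 <= p -> rank c T (p - 1) = rk c T p.
Proof. intros H. rewrite rank_rk. f_equal. lia. Qed.

Lemma tri_ranges : Tri (Inv spec 52) (mapphase 52 (kk 0) (gN /' (gL *' gL) +' kk 1)
  (mrk false (minb ((uV +' kk 1) *' (gL *' gL)) gN))) (Inv spec 53).
Proof.
  assert (LE : forall n, n / (lg n * lg n) <= n).
  { intros n. apply Nat.Div0.div_le_upper_bound, le_mul_l. pose proof (lg_pos n). apply (Nat.mul_le_mono 1 _ 1); auto. }
  assert (NM : forall n, n + 1 <= MM n).
  { intros n. pose proof (n_le n). pose proof (x_le_MM n (lg n + 1) ltac:(pose proof (lg_pos n); lia)) as Q.
    rewrite Nat.pow_add_r in Q. pose proof (pow2_pos (lg n)). change (2 ^ 1) with 2 in Q. lia. }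
  apply map_tri with (bndf := fun _ => 0) (cntf := fun n => n / (lg n * lg n) + 1); try lia; try reflexivity.
  - apply flat_cost. exists 3. intros n Hn. pose proof (pow_L_le n Hn). pose proof (le_pow2 (lg n)). pose proof (lg_pos n).
    pose proof (div_mul_le n (lg n * lg n)). pose proof (le_mul_r (n / (lg n * lg n) * lg n) (lg n) ltac:(lia)). lia.
  - apply flat_depth.
  - intros n T w HI. pose proof (pow2_pos w). specialize (NM n). specialize (LE n). lia.
  - intros n T w m l b tau r HI [HL _]. szs HI. pose proof (small_facts n) as (S1 & S2 & _). specialize (NM n). specialize (LE n).
    assert (W : Wd n w r G) by (split; auto). assert (lg n * lg n <= MM n * MM n) by (apply Nat.mul_le_mono; lia).
    split; repeat ev1; lia.
  - intros n T w m a HI HK Ha.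
    assert (HC : Ctx n T w m (52 * MM n) 52) by (unfold Ctx; splits; auto; lia).
    pose proof HI as (Hn & HT & _). szs HI. pose proof (inst_w _ _ _ HI) as Hw. specialize (NM n). specialize (LE n).
    pose proof (small_facts n) as (S1 & S2 & _).
    intros k Hk. assert (X : lg n ^ 2 = lg n * lg n) by (simpl; ring). rewrite X in *.
    assert (LM : lg n * lg n <= MM n * MM n) by (apply Nat.mul_le_mono; lia).
    assert (1 <= lg n * lg n) by (pose proof (lg_pos n); apply (Nat.mul_le_mono 1 _ 1); auto).
    assert (KL : k <= n) by (pose proof (le_mul_r k (lg n * lg n) ltac:(lia)); lia).
    assert (Hk' : k <= n / (lg n * lg n)).
    { apply Nat.div_le_lower_bound; [lia|]. rewrite Nat.mul_comm. lia. }
    rewrite rank_pred by lia. apply Ha; [lia|]. intros r Hr HU. world n w r Hr (G + 4) HU k.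
    assert (KM : (k + 1) * (lg n * lg n) <= MM n * (MM n * MM n)) by (apply Nat.mul_le_mono; lia).
    eapply ev_mrk; eauto; [unfold off; lia| |lia]. replace (S k) with (k + 1) by lia.
    apply ev_minb; auto; repeat ev1; lia.
Qed.

Lemma lor_iter_bit (f : nat -> nat) k y :
  Nat.testbit (iter_up k (fun z acc => Nat.lor acc (f z)) 0) y = true <-> exists z, z < k /\ Nat.testbit (f z) y = true.
Proof.
  induction k; cbn [iter_up].
  - rewrite Nat.bits_0. split; [discriminate|]. intros (z & Hz & _). lia.
  - rewrite Nat.lor_spec, orb_true_iff, IHk. split.
    + intros [(z & Hz & B)|B]; [exists z|exists k]; split; auto.
    + intros (z & Hz & B). destruct (Nat.eq_dec z k) as [->|N]; [now right|]. left. exists z. split; auto. lia.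
Qed.

(** A shift by [j * b - o], which may be negative, is carried out as a left shift by [j * b + b - o]
    followed by a right shift by [b]. The result is the part of field [j] at or after bit [o] of the
    stream. *)
Lemma shift_bit x b o j y : x < 2 ^ b -> o <= j * b + b ->
  Nat.testbit (x * 2 ^ (j * b + b - o) / 2 ^ b) y = true <->
  j * b <= o + y /\ o + y < j * b + b /\ Nat.testbit x (o + y - j * b) = true.
Proof.
  intros Hx Ho. rewrite Nat.div_pow2_bits.
  replace (x * 2 ^ (j * b + b - o)) with (0 + x * 2 ^ (j * b + b - o)) by lia.
  rewrite testbit_glue by apply pow2_pos. destruct (Nat.ltb_spec (y + b) (j * b + b - o)) as [L|L].
  - rewrite Nat.bits_0. split; [discriminate|lia].
  - replace (y + b - (j * b + b - o)) with (o + y - j * b) by lia. split.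
    + intros B. splits; auto; [lia|]. destruct (Nat.lt_ge_cases (o + y) (j * b + b)); auto.
      rewrite (testbit_high _ b) in B; auto; [discriminate|lia].
    + intros (_ & _ & B). exact B.
Qed.

Lemma rb_facts n : 3 <= rb n <= 3 * lg n.
Proof. unfold rb. pose proof (LL_pos n). pose proof (LL_le_L n). lia. Qed.

(** A range has [lg n * lg n <= 2 ^ (2 * LL n)] positions; the additional bit leaves room for a
    count equal to that power. *)
Lemma rfield_lt n T j : length T = n -> rfield n T j < 2 ^ rb n.
Proof.
  intros HT. unfold rfield. set (s := j / lg n * lg n ^ 2).
  pose proof (div_ub j (lg n) (lg_pos n)) as D. pose proof (lg_up (lg n)) as U. fold (LL n) in U.
  assert (E : S j * lg n <= s + lg n * lg n).
  { unfold s. replace (j / lg n * lg n ^ 2 + lg n * lg n) with ((j / lg n + 1) * lg n * lg n) by (simpl; ring).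
    apply Nat.mul_le_mono_r. lia. }
  assert (R : rk false T (Nat.min (S j * lg n) n) <= rk false T s + lg n * lg n).
  { etransitivity; [apply rk_mono|apply rk_add]. lia. }
  assert (lg n * lg n <= 2 ^ LL n * 2 ^ LL n) by (apply Nat.mul_le_mono; lia).
  unfold rb. replace (2 * LL n + 1) with (S (LL n + LL n)) by lia. rewrite Nat.pow_succ_r', Nat.pow_add_r.
  pose proof (lg_pos n). pose proof (le_mul_l (lg n) (lg n) ltac:(lia)). lia.
Qed.

(** A word of the stream meets at most [lg n / rb n + 2] fields of [rb n] bits. *)
Definition sbnd (n : nat) : nat := lg n / rb n + 2.
Definition scnt (n : nat) : nat := (n / lg n + 1) * rb n / lg n + 1.

Lemma scnt_MM n : scnt n <= MM n /\ sbnd n <= lg n + 2 /\ (n / lg n + 1) * rb n <= MM n.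
Proof.
  pose proof (rb_facts n). pose proof (lg_pos n). pose proof (n_le n). pose proof (le_pow2 (lg n)).
  assert (A : (n / lg n + 1) * rb n <= (n + lg n) * 3).
  { etransitivity; [apply Nat.mul_le_mono_l; apply H|]. pose proof (div_mul_le n (lg n)). lia. }
  assert (B : scnt n <= (n / lg n + 1) * rb n + 1).
  { unfold scnt. apply Nat.add_le_mono_r. apply Nat.Div0.div_le_upper_bound, le_mul_l. lia. }
  pose proof (x_le_MM n (lg n + 4) ltac:(lia)) as Q. rewrite Nat.pow_add_r in Q. change (2 ^ 4) with 16 in Q.
  splits; try lia. unfold sbnd. apply Nat.add_le_mono_r. apply Nat.Div0.div_le_upper_bound, le_mul_l. lia.
Qed.

(** Each word computes all fields that it meets, so no two instances share a word. There are about
    [n * rb n / (lg n) ^ 2] words with about [lg n / rb n] fields each, hence [O(n / lg n)]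
    evaluations of a field. *)
Definition v_subr : bld :=
  LET rbv := kk 2 *' gLL +' kk 1 IN LET o := uV *' gL IN LET j0 := o /' rbv IN
  for_ (kk 0) (fun acc t => bop Or acc
    (LET j := j0 +' t IN
     LET x := mrk false (minb ((j +' kk 1) *' gL) gN) -' mrk false (minb (j /' gL *' gL *' gL) gN) IN
     (x <<' (j *' rbv +' rbv -' o)) >>' rbv)).

Lemma tri_subranges : Tri (Inv spec 53) (mapphase 53 (gL /' (kk 2 *' gLL +' kk 1) +' kk 2)
  ((gN /' gL +' kk 1) *' (kk 2 *' gLL +' kk 1) /' gL +' kk 1) v_subr) (Inv spec 54).
Proof.
  apply map_tri with (bndf := sbnd) (cntf := scnt); try lia; try reflexivity.
  - exists 130. intros n Hn. pose proof (rb_facts n) as [R1 R2]. pose proof (lg_pos n) as LP. pose proof (lg_lin n Hn) as LL2.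
    pose proof (div_mul_le n (lg n)) as D1. unfold scnt, sbnd.
    set (X := n / lg n + 1) in *. pose proof (div_mul_le (X * rb n) (lg n)) as D2. pose proof (div_mul_le (lg n) (rb n)) as D3.
    set (A := X * rb n / lg n) in *. set (B := lg n / rb n) in *.
    assert (E1 : (A + 1) * (B + 2 + 1) * lg n <= (X * rb n + lg n) * (B + 3)).
    { replace ((A + 1) * (B + 2 + 1) * lg n) with ((A * lg n + lg n) * (B + 3)) by ring. apply Nat.mul_le_mono_r. lia. }
    assert (E2 : X * rb n * B <= X * lg n).
    { rewrite <- Nat.mul_assoc. apply Nat.mul_le_mono_l. lia. }
    assert (E3 : lg n * B <= lg n * lg n).
    { apply Nat.mul_le_mono_l. pose proof (le_mul_r B (rb n) ltac:(lia)). lia. }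
    assert (E4 : X * rb n <= X * (3 * lg n)) by (apply Nat.mul_le_mono_l; lia).
    assert (E5 : X * lg n <= n + lg n) by (unfold X; lia).
    assert (E6 : lg n <= lg n * lg n) by (apply le_mul_r; lia). 
    assert (E7 : (X * rb n + lg n) * (B + 3) = X * rb n * B + 3 * (X * rb n) + lg n * B + 3 * lg n) by ring. lia.
  - exists 4. intros n _. pose proof (scnt_MM n). pose proof (lg_pos n). lia.
  - intros n T w HI. szs HI. pose proof (scnt_MM n). pose proof (small_facts n) as (S1 & S2 & _). lia.
  - intros n T w m l b tau r HI [HL _]. szs HI. pose proof (scnt_MM n) as (C1 & C2 & C3). pose proof (rb_facts n).
    pose proof (small_facts n) as (S1 & S2 & _). pose proof (nk_facts n) as (_ & K2 & _).
    assert (W : Wd n w r G) by (split; auto).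
    assert (HR : evb w m l b r G (kk 2 *' gLL +' kk 1) (rb n)) by (unfold rb in *; repeat ev1; lia).
    assert (n / lg n <= n) by (apply Nat.Div0.div_le_upper_bound, le_mul_l, lg_pos).
    split.
    + unfold sbnd in *. apply ev_add; [apply ev_div; [repeat ev1|exact HR|lia]|apply ev_k; lia|lia].
    + unfold scnt in *. apply ev_add; [apply ev_div; [apply ev_mul; [repeat ev1; lia|exact HR|lia]|repeat ev1|lia]|apply ev_k; lia|lia].
  - intros n T w m a HI HK Ha.
    assert (HC : Ctx n T w m (53 * MM n) 53) by (unfold Ctx; splits; auto; lia).
    pose proof HI as (Hn & HT & _). szs HI. pose proof (inst_w _ _ _ HI) as Hw.
    pose proof (scnt_MM n) as (C1 & C2 & C3). pose proof (rb_facts n) as RB.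
    pose proof (small_facts n) as (S1 & S2 & _). pose proof (lg_pos n) as LP. pose proof (nk_facts n) as (_ & K2 & _).
    set (fj := fun o j => rfield n T j * 2 ^ (j * rb n + rb n - o) / 2 ^ rb n).
    assert (VAL : forall u, u < scnt n -> a u = iter_up (sbnd n) (fun t acc => Nat.lor acc (fj (u * lg n) (u * lg n / rb n + t))) 0).
    { intros u Hu. apply Ha; auto. intros r Hr HU. world n w r Hr (G + 4) HU u.
      assert (UL : u * lg n <= MM n * MM n) by (apply Nat.mul_le_mono; lia).
      unfold v_subr. eapply ev_let.
      { eapply (ev_eq _ _ _ _ _ _ _ (rb n)); [repeat ev1; unfold rb in *; lia|reflexivity]. }
      intros r1 d1 rbv E Hrb. lift E.
      eapply ev_let; [repeat ev1; lia|]. set (o := u * lg n) in *. intros r2 d2 ob E Ho. lift E.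
      eapply ev_let; [repeat ev1; lia|]. pose proof (div_mul_le o (rb n)) as D1. pose proof (div_ub o (rb n) ltac:(lia)) as D2.
      set (j0 := o / rb n) in *. intros r3 d3 j0b E Hj0. lift E.
      assert (FB : forall t, t < sbnd n -> (j0 + t) * rb n + rb n <= o + lg n + 2 * rb n).
      { intros t Ht. unfold sbnd in Ht. pose proof (div_mul_le (lg n) (rb n)).
        assert (t * rb n <= (lg n / rb n + 1) * rb n) by (apply Nat.mul_le_mono_r; lia). lia. }
      assert (FS : forall t, t < sbnd n -> rfield n T (j0 + t) * 2 ^ ((j0 + t) * rb n + rb n - o) < MM n).
      { intros t Ht. specialize (FB t Ht). pose proof (rfield_lt n T (j0 + t) HT).
        apply (Nat.lt_le_trans _ (2 ^ rb n * 2 ^ ((j0 + t) * rb n + rb n - o))).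
        - apply Nat.mul_lt_mono_pos_r; [pose proof (pow2_pos ((j0 + t) * rb n + rb n - o)); lia|auto].
        - rewrite <- Nat.pow_add_r. apply x_le_MM. lia. }
      assert (FM : forall t, t < sbnd n -> fj o (j0 + t) < MM n).
      { intros t Ht. eapply Nat.le_lt_trans; [|apply (FS t Ht)]. unfold fj.
        apply Nat.Div0.div_le_upper_bound, le_mul_l, pow2_pos. }
      apply (ev_for w m (53 * MM n) (sbnd n) r3 d3 (kk 0) _ 0 (fun t acc => Nat.lor acc (fj o (j0 + t)))).
      - apply ev_k. lia.
      - intros r4 d4 acc tb t E Ht HA HTb. lift E.
        assert (J0M : j0 <= MM n * MM n) by (pose proof (le_mul_r j0 (rb n) ltac:(lia)); lia).
        specialize (FB t Ht). specialize (FS t Ht). pose proof (FM t Ht).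
        apply ev_or; [exact HA| | |lia].
        2: { apply (iter_inv t _ 0 (fun _ v => v < 2 ^ w)); [lia|]. intros i v Hi Hv. apply lor_lt; auto.
             specialize (FM i ltac:(lia)). lia. }
        eapply ev_let; [repeat ev1; lia|]. set (j := j0 + t) in *. intros r5 d5 jb E Hj. lift E.
        assert (JM : j + 1 <= MM n * MM n + MM n + MM n) by (unfold j; lia).
        assert (JL : (j + 1) * lg n <= 3 * (MM n * MM n) * MM n).
        { apply Nat.mul_le_mono; [|lia]. assert (MM n * 1 <= MM n * MM n) by (apply Nat.mul_le_mono_l; lia). lia. }
        assert (JQ : j / lg n * lg n <= j) by apply div_mul_le.
        assert (JQ2 : j / lg n * lg n * lg n <= j * lg n) by (apply Nat.mul_le_mono_r; lia).
        assert (E1 : evb w m (53 * MM n) (sbnd n) r5 d5 (mrk false (minb ((jb +' kk 1) *' gL) gN)) (rk false T (Nat.min (S j * lg n) n))).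
        { eapply ev_mrk; eauto; [unfold off; lia| |lia]. replace (S j) with (j + 1) by lia. apply ev_minb; auto; repeat ev1; lia. }
        (* The loop also reaches fields beyond the last sub-range. Cutting the position at [n] keeps
           it admissible for [mrk] and does not change the rank. *)
        assert (E2 : evb w m (53 * MM n) (sbnd n) r5 d5 (mrk false (minb (jb /' gL *' gL *' gL) gN)) (rk false T (j / lg n * lg n ^ 2))).
        { replace (j / lg n * lg n ^ 2) with (j / lg n * lg n * lg n) by (simpl; ring).
          eapply ev_eq; [eapply ev_mrk with (pv := Nat.min (j / lg n * lg n * lg n) n); [exact HC|unfold off; lia|exact W|apply ev_minb; auto; repeat ev1; lia|apply Nat.le_min_r]|].
          unfold rk. rewrite <- HT. symmetry. apply cntb_min. }
        pose proof (rk_le false T (Nat.min (S j * lg n) n)).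
        assert (rk false T (j / lg n * lg n ^ 2) <= rk false T (Nat.min (S j * lg n) n)).
        { replace (j / lg n * lg n ^ 2) with (j / lg n * lg n * lg n) by (simpl; ring).
          unfold rk at 1. rewrite cntb_min, HT. apply rk_mono. lia. }
        eapply ev_let; [apply ev_sub; [exact E1|exact E2|lia|lia]|]. fold (rfield n T j).
        intros r6 d6 x E Hx. lift E. pose proof (le_mul_r j (rb n) ltac:(lia)).
        unfold fj. repeat ev1; try lia. }
    intros j i Hj Hi. set (p := j * rb n + i). set (u := p / lg n).
    pose proof (div_mul_le p (lg n)) as D1. pose proof (Nat.div_mod_eq p (lg n)) as D2. pose proof (Nat.mod_upper_bound p (lg n) ltac:(lia)) as D3.
    fold u in D1, D2. set (y := p mod lg n) in *.
    assert (Hjn : j <= n / lg n) by (apply Nat.div_le_lower_bound; [lia|]; rewrite Nat.mul_comm; lia).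
    assert (Hu : u < scnt n).
    { unfold scnt, u. assert (p / lg n <= (n / lg n + 1) * rb n / lg n); [|lia]. apply Nat.Div0.div_le_mono.
      unfold p. assert ((j + 1) * rb n <= (n / lg n + 1) * rb n) by (apply Nat.mul_le_mono_r; lia). lia. }
    rewrite VAL by auto. set (o := u * lg n) in *. set (j0 := o / rb n).
    assert (Ep : o + y = p) by lia.
    pose proof (div_mul_le o (rb n)) as E1. pose proof (div_ub o (rb n) ltac:(lia)) as E2. fold j0 in E1, E2.
    assert (HJ0 : forall z, o <= (j0 + z) * rb n + rb n) by (intros z; lia).
    apply eq_true_iff_eq. rewrite lor_iter_bit. split.
    + intros (z & Hz & B). unfold fj in B. apply shift_bit in B; [|apply rfield_lt, HT|apply HJ0].
      destruct B as (B1 & B2 & B3). rewrite Ep in *.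
      assert (J : j0 + z = j).
      { transitivity (p / rb n); [symmetry|]; apply div_between; unfold p in *; lia. }
      rewrite J in B3. replace (p - j * rb n) with i in B3 by (unfold p; lia). exact B3.
    + intros B. assert (J : j0 <= j).
      { apply Nat.lt_succ_r. apply Nat.Div0.div_lt_upper_bound. unfold p in *. lia. }
      exists (j - j0). split.
      * unfold sbnd. pose proof (div_ub (lg n) (rb n) ltac:(lia)).
        destruct (Nat.lt_ge_cases (j - j0) (lg n / rb n + 2)) as [|X]; auto. exfalso.
        assert ((lg n / rb n + 2 + j0) * rb n <= j * rb n) by (apply Nat.mul_le_mono_r; lia). unfold p in *. lia.
      * unfold fj. replace (j0 + (j - j0)) with j by lia. apply shift_bit; [apply rfield_lt, HT|unfold p in *; lia|].
        rewrite Ep. splits; unfold p; try lia. replace (j * rb n + i - j * rb n) with i by lia. exact B.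
Qed.

(** * Initialization *)

Definition holds (st : list (nat * nat)) (rho : env) : Prop := forall x v, In (x, v) st -> rho x = v.

(** Forward symbolic execution of sequential code: the association list collects the registers known
    so far. *)
Definition ini (w : nat) (st : list (nat * nat)) (c : cmd) (st' : list (nat * nat)) (K : nat) : Prop :=
  forall rho m, holds st rho -> exists rho' R W k, exec w c rho m rho' m R W k k /\ holds st' rho' /\ k <= K.

Lemma ini_seq w a c1 b c2 d K1 K2 : ini w a c1 b K1 -> ini w b c2 d K2 -> ini w a (Seq c1 c2) d (K1 + K2).
Proof.
  intros H1 H2 rho m Ha. destruct (H1 rho m Ha) as (r1 & R1 & W1 & k1 & E1 & Hb & B1).
  destruct (H2 r1 m Hb) as (r2 & R2 & W2 & k2 & E2 & Hd & B2).
  do 4 eexists. split; [eapply exec_seq; eauto|]. split; auto. lia.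
Qed.

Lemma holds_set st rho rho' x v : ~ In x (map fst st) -> holds st rho -> rho' x = v ->
  (forall y, In y (map fst st) -> y <> x -> rho' y = rho y) -> holds ((x, v) :: st) rho'.
Proof.
  intros Hx H E F y u [P|P]; [injection P as <- <-; exact E|].
  assert (In y (map fst st)) by (apply in_map_iff; exists (y, u); auto).
  rewrite F by congruence. now apply H.
Qed.

Lemma ini_set w st x e v : 1 <= w -> x < G -> wf G (e G) = true -> loop_free (e G) = true ->
  In (rBND, 0) st -> ~ In x (map fst st) -> (forall y, In y (map fst st) -> y < G) ->
  (forall rho m l b, holds st rho -> evb w m l b rho G e v) ->
  ini w st (setr x e) ((x, v) :: st) (pcost 0 (e G) + 2).
Proof.
  intros Hw Hx Hwf Hl HB Hf HG He rho m HS.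
  destruct (setr_ok w m rho x e v Hw Hx Hwf Hl) as (r & R & W & k & E & V & F & B); auto.
  { rewrite (HS rBND 0 HB). pose proof (pow2_pos w). lia. }
  exists r, R, W, k. splits; auto. eapply holds_set; eauto.
Qed.

(** Tries powers of two from exponent [s] on. The start 1 yields [lg], which is at least 1; the
    start 0 yields the plain logarithm for the tree height. *)
Definition plog (s x y : nat) : cmd :=
  Seq (Assign x (Const s))
    (While (Bin Lt (Bin Shl (Const 1) (Reg x)) (Reg y)) (Assign x (Bin Add (Reg x) (Const 1)))).

Lemma log2_up_max s v i : s <= i -> i < Nat.max s (Nat.log2_up v) <-> 2 ^ i < v.
Proof.
  intros H. destruct (Nat.eq_dec v 0) as [->|N]; [change (Nat.log2_up 0) with 0; lia|].
  rewrite (Nat.log2_up_lt_pow2 v i) by lia. lia.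
Qed.

Lemma ini_plog w st s x y v B : 1 <= w -> s <= 1 -> x <> y -> In (y, v) st -> ~ In x (map fst st) ->
  v < 2 ^ w -> 2 * 2 ^ Nat.max s (Nat.log2_up v) < 2 ^ w -> Nat.max s (Nat.log2_up v) <= B ->
  ini w st (plog s x y) ((x, Nat.max s (Nat.log2_up v)) :: st) (8 + B * 10).
Proof.
  intros Hw Hs Hxy Hy Hx Hv HM HB rho m HS. set (M := Nat.max s (Nat.log2_up v)) in *.
  pose proof (le_pow2 M) as MP. pose proof (pow2_ge2 w Hw) as P2.
  set (t := Bin Lt (Bin Shl (Const 1) (Reg x)) (Reg y)).
  assert (EV : forall r i, r x = i -> r y = v -> s <= i -> i <= M -> eval w r t = Nat.b2n (i <? M)).
  { intros r i E1 E2 L1 L2. cbn [t eval]. unfold t. cbn [eval]. rewrite E1, E2.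
    assert (2 ^ i <= 2 ^ M) by (apply Nat.pow_le_mono_r; lia).
    unfold eval_binop at 2. rewrite (Nat.mod_small 1) by lia. rewrite Nat.shiftl_mul_pow2, Nat.mul_1_l, (Nat.mod_small (2 ^ i)) by lia.
    unfold eval_binop. rewrite b2n_mod by auto. f_equal.
    apply eq_true_iff_eq. rewrite !Nat.ltb_lt. symmetry. now apply log2_up_max. }
  assert (LP : forall j i r, i + j = M -> s <= i -> r x = i -> r y = v ->
    exists r' R W k, exec w (While t (Assign x (Bin Add (Reg x) (Const 1)))) r m r' m R W k k /\
      r' x = M /\ (forall z, z <> x -> r' z = r z) /\ k <= 6 + j * 10).
  { induction j; intros i r Hij Hi Ex Ey.
    - assert (Hi' : i = M) by lia. subst i. do 4 eexists. split; [apply exec_while_false|].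
      + rewrite (EV r M) by (auto; lia). now rewrite Nat.ltb_irrefl.
      + splits; auto.
    - set (r1 := upd r x (eval w r (Bin Add (Reg x) (Const 1)))).
      assert (E1 : r1 x = S i).
      { unfold r1. rewrite upd_same. cbn [eval]. unfold eval_binop. rewrite Ex, (Nat.mod_small 1), Nat.mod_small; lia. }
      destruct (IHj (S i) r1) as (r' & R & W & k & E & V & F & Bk); try lia.
      { unfold r1. rewrite upd_other; auto. }
      do 4 eexists. split; [eapply exec_while_true; [|apply exec_assign|exact E]|].
      + rewrite (EV r i) by (auto; lia). rewrite (proj2 (Nat.ltb_lt _ _)) by lia. simpl. lia.
      + splits; auto.
        * intros z Hz. rewrite F by auto. unfold r1. now rewrite upd_other.
        * simpl. lia. }
  set (r0 := upd rho x (eval w rho (Const s))).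
  destruct (LP (M - s) s r0) as (r' & R & W & k & E & V & F & Bk); try lia.
  { unfold r0. rewrite upd_same. cbn [eval]. apply Nat.mod_small. lia. }
  { unfold r0. rewrite upd_other by auto. now apply HS. }
  do 4 eexists. split; [eapply exec_seq; [apply exec_assign|exact E]|]. split.
  - eapply holds_set; eauto. intros z _ Hz. rewrite F by auto. unfold r0. now rewrite upd_other.
  - simpl. assert ((M - s) * 10 <= B * 10) by lia. lia.
Qed.

Definition init : cmd :=
  Seq (plog 1 1 0) (Seq (plog 1 2 1)
  (Seq (setr 3 ((vv 1 +' kk 2 -' kk 1) /' kk 2)) (Seq (setr 4 (vv 1 *' vv 2)) (Seq (setr 5 (kk 8 *' vv 1 *' vv 1))
  (Seq (setr 6 (kk 1 <<' (kk K0 *' vv 1))) (Seq (setr 14 (vv 0 /' vv 3 +' kk 1)) (Seq (plog 0 7 14)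
  (Seq (setr 8 (kk 1 <<' vv 7)) (Seq (setr 12 (vv 1 *' vv 1 *' (vv 2 *' vv 2)))
  (setr 13 (kk 16 *' (vv 2 *' vv 2 *' (vv 2 *' vv 2))))))))))))).

Definition Start : asrt := fun n T w rho m =>
  inst n T w /\ rho 0 = n /\ rho rBND = 0 /\ packed_input m T.

Lemma ini_set' w st x e v : 1 <= w -> x < G -> wf G (e G) = true -> loop_free (e G) = true ->
  In (rBND, 0) st -> ~ In x (map fst st) -> pcost 0 (e G) + 2 <= 100 ->
  (forall y, In y (map fst st) -> y < G) ->
  (forall rho m l b, (forall y u, In (y, u) st -> evb w m l b rho G (vv y) u) -> evb w m l b rho G e v) ->
  ini w st (setr x e) ((x, v) :: st) 100.
Proof.
  intros H1 H2 H3 H4 H5 H6 H7 H8 H9 rho m HS.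
  destruct (ini_set w st x e v H1 H2 H3 H4 H5 H6 H8) with (rho := rho) (m := m) as (r & R & W & k & E & V & B); auto.
  - intros rho' m' l b HS'. apply H9. intros y u Hy. apply ev_varG; [now apply HS'|].
    apply H8, in_map_iff. exists (y, u). auto.
  - exists r, R, W, k. splits; auto. lia.
Qed.

Ltac inn := repeat first [left; reflexivity | right].
Ltac notin := cbn [map fst In]; unfold rBND, G; lia.
Ltac use H x := let K := fresh in pose proof (H x _ ltac:(inn)) as K.
Ltac setstep := apply ini_set'; [assumption|unfold G; lia|reflexivity|reflexivity|inn|notin|apply Nat.leb_le; reflexivity|notin|].

Lemma init_ok n T w : inst n T w ->
  exists st, ini w [(0, n); (rBND, 0)] init st (1000 * lg n) /\ forall rho, holds st rho -> globs n w rho.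
Proof.
  intros HI. pose proof HI as (Hn & HT & HwK). szs HI. pose proof (inst_w _ _ _ HI) as Hw.
  pose proof (small_facts n) as (S1 & S2 & S3 & S4 & S5 & S6 & S7 & S8 & S9 & S10 & S11 & _).
  pose proof (nk_facts n) as (_ & K2 & _). pose proof (lg_pos n) as LP. pose proof (LL_pos n) as LLP. pose proof (LL_le_L n) as LLe.
  pose proof (scan_space n) as (_ & N2 & N3 & N4). pose proof (HH_le n) as HHl. pose proof (hh_bounds n) as HB.
  pose proof (le_pow2 (lg n)) as LE. pose proof (lg_up n) as LU. pose proof (lg_up (lg n)) as LU2.
  assert (KM : K0 * lg n <= MM n) by (pose proof (le_pow2 (K0 * lg n)); unfold MM; lia).
  assert (KM1 : K0 <= MM n) by (pose proof (le_mul_r K0 (lg n)); lia).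
  assert (D1 : n / hh n <= n) by (apply Nat.Div0.div_le_upper_bound, le_mul_l; lia).
  assert (LLM : 2 ^ LL n <= MM n) by (apply x_le_MM; lia).
  assert (Q1 : LL n * LL n <= MM n) by lia.
  assert (Q2 : LL n * LL n * (LL n * LL n) <= MM n * MM n) by (apply Nat.mul_le_mono; lia).
  assert (Q3 : lg n * lg n <= MM n) by (unfold DD in S4; lia).
  assert (Q4 : lg n * lg n * (LL n * LL n) <= MM n * MM n) by (apply Nat.mul_le_mono; lia).
  assert (Q5 : lg n * LL n <= MM n) by (pose proof (Nat.mul_le_mono_l (LL n) (lg n) (lg n) LLe); lia).
  set (st := [(13, ll n); (12, thr n); (8, NC n); (7, HH n); (14, n / hh n + 1); (6, MM n); (5, DD n); (4, gg n); (3, hh n); (2, LL n); (1, lg n); (0, n); (rBND, 0)]).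
  exists st. split.
  2: { intros rho H. constructor; try (apply H; simpl; tauto). rewrite (H rBND 0); [lia|simpl; tauto]. }
  assert (HK : ini w [(0, n); (rBND, 0)] init st
    ((8 + lg n * 10) + ((8 + lg n * 10) + (100 + (100 + (100 + (100 + (100 + ((8 + (lg n + 1) * 10) + (100 + (100 + 100))))))))))).
  2: { intros rho m H. destruct (HK rho m H) as (r & R & W & k & E & V & B). exists r, R, W, k. splits; auto. lia. }
  unfold init, st.
  eapply ini_seq.
  { apply ini_plog; [exact Hw|lia|lia|inn|notin|lia| |]; fold (lg n); lia. }
  fold (lg n). eapply ini_seq.
  { apply ini_plog; [exact Hw|lia|lia|inn|notin|lia| |]; fold (lg (lg n)); fold (LL n); lia. }
  fold (lg (lg n)). fold (LL n).
  eapply (ini_seq w _ _ ((3, hh n) :: _)).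
  { setstep. intros rho m l b H. use H 1. unfold hh, ceil_div. repeat ev1; lia. }
  eapply (ini_seq w _ _ ((4, gg n) :: _)).
  { setstep. intros rho m l b H. use H 1. use H 2. unfold gg. repeat ev1; lia. }
  eapply (ini_seq w _ _ ((5, DD n) :: _)).
  { setstep. intros rho m l b H. use H 1. unfold DD in *. repeat ev1; lia. }
  eapply (ini_seq w _ _ ((6, MM n) :: _)).
  { setstep. intros rho m l b H. use H 1. eapply ev_eq; [repeat ev1; try lia|].
    - rewrite Nat.mul_1_l. fold (MM n). lia.
    - apply Nat.mul_1_l. }
  eapply (ini_seq w _ _ ((14, n / hh n + 1) :: _)).
  { setstep. intros rho m l b H. use H 0. use H 3. repeat ev1; lia. }
  eapply (ini_seq w _ _ ((7, HH n) :: _)).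
  { change (HH n) with (Nat.max 0 (HH n)). unfold HH. apply ini_plog; [exact Hw|lia|lia|inn|notin|lia| |]; rewrite Nat.max_0_l; fold (HH n); try lia.
    fold (NC n). lia. }
  eapply (ini_seq w _ _ ((8, NC n) :: _)).
  { setstep. intros rho m l b H. use H 7. eapply ev_eq; [repeat ev1; try lia|apply Nat.mul_1_l].
    rewrite Nat.mul_1_l. fold (NC n). lia. }
  eapply (ini_seq w _ _ ((12, thr n) :: _)).
  { setstep. intros rho m l b H. use H 1. use H 2. eapply ev_eq; [repeat ev1; lia|]. unfold thr. simpl. ring. }
  setstep. intros rho m l b H. use H 2. eapply ev_eq; [repeat ev1; lia|]. unfold ll. simpl. ring.
Qed.

Lemma tri_init : Tri Start init (Inv spec 1).
Proof.
  exists (8 * 1000). intros n T w rho m (HI & R0 & RB & HP). pose proof HI as (Hn & HT & _).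
  destruct (init_ok n T w HI) as (st & H & HG).
  destruct (H rho m) as (rho' & R & W & k & E & V & B).
  { intros x v [Q|[Q|[]]]; injection Q as <- <-; auto. }
  exists rho', m, k, k. splits.
  - exists R, W. exact E.
  - split; [exact HI|]. split; [now apply HG|]. intros t Ht. assert (t = 0) by lia. subst t. intros i Hi.
    unfold packed_input in HP. rewrite HT in HP. rewrite rg_at.
    + now apply HP.
    + pose proof (nk_facts n). pose proof (le_mul_r i (lg n) (lg_pos n)). lia.
  - pose proof (lg_lin n Hn). assert (k * lg n <= 1000 * lg n * lg n) by (apply Nat.mul_le_mono_r; exact B).
    rewrite <- Nat.mul_assoc in *. lia.
  - lia.
Qed.

(** * Reading the structures *)

Lemma ceil_add a b c : 1 <= b -> ceil_div (a + c * b) b = ceil_div a b + c.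
Proof. intros H. unfold ceil_div. replace (a + c * b + b - 1) with (a + b - 1 + c * b) by lia. apply Nat.div_add. lia. Qed.

(** The origin of the position [LL n * (o * lg n - 1) + 1] in [pbw]: it is the least one whose
    rounded quotient by [LL n] reaches [o * lg n]. *)
Lemma ceil_lt_iff a b c : 1 <= b -> 1 <= c -> ceil_div a b < c <-> a < b * (c - 1) + 1.
Proof.
  intros H H1. split; intros A.
  - pose proof (ceil_mul a b H) as U. assert (ceil_div a b * b <= (c - 1) * b) by (apply Nat.mul_le_mono_r; lia).
    rewrite (Nat.mul_comm b). lia.
  - assert (ceil_div a b <= c - 1); [|lia]. apply ceil_le; auto. rewrite Nat.mul_comm. lia.
Qed.

(** * Reading the answers of the sub-ranges from their bit stream *)

Section SubAnswers.
Context (c : bool) (T : list bool).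
Notation n := (length T).
Notation N := (count c T).

(** The place of the entry in the whole stream, as [select_structure] prescribes it; [off4] is the
    same place relative to word [grp i]. *)
Definition opos (i : nat) : nat := ceil_div (bnd c T (sidx c T i)) (LL n) + (i - sidx c T i) * lg (slen c T i).
Definition grp (i : nat) : nat := ceil_div (bnd c T (sidx c T i)) (LL n) / lg n.

Lemma opos_off4 i : opos i = grp i * lg n + off4 c T i.
Proof.
  unfold opos, grp, off4. pose proof (Nat.div_mod_eq (ceil_div (bnd c T (sidx c T i)) (LL n)) (lg n)). lia.
Qed.

(** By [gp_bits] the answers need at most [slen / LL n] bits, which is no more than the distance
    between the rounded quotients of the two ends of the sub-range. *)
Lemma opos_end i : act4 c T i = true -> opos i + lg (slen c T i) <= ceil_div (bnd c T (nidx c T i)) (LL n).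
Proof.
  intros H. destruct (act4_facts c T i H) as (A & _). destruct (gp_bits c T i H) as [_ B]. destruct (sidx_gp c T i A) as [C _].
  pose proof (LL_pos n) as LP. pose proof (sidx_bounds c T i) as [S1 S2].
  assert (M : bnd c T (sidx c T i) <= bnd c T (nidx c T i)) by (apply bnd_mono; lia).
  unfold opos. set (b := lg (slen c T i)) in *.
  assert ((i - sidx c T i) * b + b <= gp c T (i / gg n) * b).
  { replace ((i - sidx c T i) * b + b) with ((i - sidx c T i + 1) * b) by ring. apply Nat.mul_le_mono_r. lia. }
  assert (ceil_div (bnd c T (sidx c T i)) (LL n) + gp c T (i / gg n) * b <= ceil_div (bnd c T (nidx c T i)) (LL n)); [|lia].
  rewrite <- ceil_add by auto. apply ceil_mono. unfold slen in B. lia.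
Qed.

Lemma opos_disjoint i i' : i < i' -> act4 c T i = true -> opos i + lg (slen c T i) <= opos i'.
Proof.
  intros H A. destruct (Nat.lt_ge_cases i' (nidx c T i)) as [L|L].
  - pose proof (sidx_bounds c T i) as [S1 S2]. destruct (sidx_same c T i i') as (E1 & E2 & _); [lia|].
    assert (E3 : slen c T i' = slen c T i) by (unfold slen; now rewrite E1, E2).
    unfold opos. rewrite E1, E3. set (b := lg (slen c T i)).
    assert ((i - sidx c T i + 1) * b <= (i' - sidx c T i) * b) by (apply Nat.mul_le_mono_r; lia). lia.
  - etransitivity; [apply opos_end, A|]. unfold opos. etransitivity; [|apply Nat.le_add_r].
    apply ceil_mono, bnd_mono, (sidx_lt c T); [exact H|lia].
Qed.

(** Both sides say that the sub-range of [i] begins no later than the last occurrence before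
    position [q]. *)
Lemma sidx_rk i q : 1 <= i <= N -> 1 <= q -> i < nidx c T (rk c T (Nat.min n q)) <-> bnd c T (sidx c T i) < q.
Proof.
  intros Hi Hq. set (r := rk c T (Nat.min n q)). pose proof (sidx_bounds c T i) as [S1 S2]. pose proof (sidx_bounds c T r) as [R1 R2].
  transitivity (sidx c T i <= r).
  - split; intros H.
    + destruct (Nat.le_gt_cases i r); [lia|]. destruct (sidx_same c T r i) as (-> & _); lia.
    + destruct (Nat.lt_ge_cases i (nidx c T r)) as [|L]; auto. exfalso.
      pose proof (sidx_lt c T r i ltac:(lia) ltac:(lia)). lia.
  - destruct (Nat.eq_dec (sidx c T i) 0) as [Z|NZ].
    + rewrite Z. unfold bnd. simpl. lia.
    + unfold r. rewrite <- bnd_lt_iff by lia. pose proof (sel_spec c T (sidx c T i) ltac:(lia)) as (B & _).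
      rewrite bnd_sel by lia. lia.
Qed.

(** The purpose of [pbw]: the word in which the answers begin is monotone in the occurrence, so each
    group is an interval of occurrences and its record a difference of prefix sums. *)
Lemma grp_range i o : 1 <= i <= N -> i <= rk c T (pbw c T o) <-> grp i < o.
Proof.
  intros Hi. pose proof (LL_pos n) as LP. pose proof (lg_pos n) as LgP. unfold pbw. destruct (Nat.eqb_spec o 0) as [->|Ho].
  - change (rk c T 0) with 0. lia.
  - assert (OL : 1 <= o * lg n) by (pose proof (le_mul_r o (lg n) LgP); lia).
    rewrite rk_bnd. set (q := LL n * (o * lg n - 1) + 1).
    transitivity (i < nidx c T (rk c T (Nat.min n q))); [lia|].
    rewrite (sidx_rk i q Hi ltac:(apply Nat.le_add_l)). unfold q.
    rewrite <- (ceil_lt_iff _ (LL n) (o * lg n) LP OL). unfold grp. split; intros H1.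
    + apply Nat.Div0.div_lt_upper_bound. lia.
    + pose proof (div_ub (ceil_div (bnd c T (sidx c T i)) (LL n)) (lg n) LgP).
      assert ((ceil_div (bnd c T (sidx c T i)) (LL n) / lg n + 1) * lg n <= o * lg n) by (apply Nat.mul_le_mono_r; lia). lia.
Qed.

Lemma rec4_fields o :
  (forall i t, 1 <= i <= N -> act4 c T i = true -> grp i = o -> t < lg (slen c T i) ->
     Nat.testbit (rec4 c T o) (off4 c T i + t) = Nat.testbit (bnd c T i - bnd c T (sidx c T i)) t) /\
  (forall y, Nat.testbit (rec4 c T o) y = true ->
     exists i, 1 <= i <= N /\ act4 c T i = true /\ grp i = o /\ off4 c T i <= y < off4 c T i + lg (slen c T i)).
Proof.
  assert (G1 : forall i, 1 <= i <= N -> rk c T (pbw c T o) + 1 <= i < rk c T (pbw c T (S o)) + 1 <-> grp i = o).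
  { intros i Hi. pose proof (grp_range i o Hi). pose proof (grp_range i (S o) Hi). lia. }
  assert (G2 : forall i, rk c T (pbw c T o) + 1 <= i < rk c T (pbw c T (S o)) + 1 -> 1 <= i <= N).
  { intros i Hi. pose proof (rk_le_N c T (pbw c T (S o))). lia. }
  destruct (fields_sum (act4 c T) (off4 c T) (fun i => lg (slen c T i)) (fun i => bnd c T i - bnd c T (sidx c T i))
    (rk c T (pbw c T o) + 1) (rk c T (pbw c T (S o)) + 1)) as (F1 & F2 & _).
  - intros i Hi _. pose proof (val_lt c T i (G2 i Hi)). pose proof (lg_up (slen c T i)). lia.
  - intros i i' H1 H2 H3 A A'. pose proof (proj1 (G1 i (G2 i ltac:(lia))) ltac:(lia)) as E1.
    pose proof (proj1 (G1 i' (G2 i' ltac:(lia))) ltac:(lia)) as E2.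
    pose proof (opos_disjoint i i' H2 A) as D. rewrite !opos_off4, E1, E2 in D. lia.
  - split.
    + intros i t Hi A E Ht. apply (F1 i t); auto. now apply G1.
    + intros y B. destruct (F2 y B) as (i & Hi & A & Hy). exists i. splits; auto; try apply (G2 i Hi); try apply Hy.
      apply G1; [apply (G2 i Hi)|exact Hi].
Qed.

(** A set bit of a shifted record belongs to the field of some occurrence, and disjointness in the
    stream leaves only [i]. Conversely, [off4_lt] shows that the record of group [grp i] is among
    those that the word inspects. *)
Lemma subans_bit i t : 1 <= i <= N -> act4 c T i = true -> t < lg (slen c T i) ->
  Nat.testbit (sword c T ((opos i + t) / lg n)) ((opos i + t) mod lg n) =
  Nat.testbit (bnd c T i - bnd c T (sidx c T i)) t.
Proof.
  intros Hi A Ht. pose proof (lg_pos n) as LgP. set (x := opos i + t).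
  pose proof (Nat.div_mod_eq x (lg n)) as D. set (w := x / lg n) in *. set (y := x mod lg n) in *.
  pose proof (opos_off4 i) as E. pose proof (off4_lt c T i A) as OL.
  apply eq_true_iff_eq. unfold sword.
  rewrite (lor_iter_bit (fun z => if w <? z then 0 else rec4 c T (w - z) / 2 ^ (z * lg n))).
  split.
  - intros (z & Hz & B). destruct (Nat.ltb_spec w z) as [L|L]; [rewrite Nat.bits_0 in B; discriminate|].
    rewrite Nat.div_pow2_bits in B. destruct (rec4_fields (w - z)) as [F1 F2].
    destruct (F2 _ B) as (i' & Hi' & A' & E' & Hy).
    assert (EW : (w - z) * lg n + z * lg n = w * lg n) by (rewrite <- Nat.mul_add_distr_r; f_equal; lia).
    pose proof (opos_off4 i') as EO. rewrite E' in EO.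
    assert (Hx : opos i' <= x < opos i' + lg (slen c T i')) by lia.
    assert (i' = i).
    { destruct (Nat.lt_trichotomy i i') as [Q|[Q|Q]]; auto; exfalso.
      - pose proof (opos_disjoint i i' Q A). unfold x in *. lia.
      - pose proof (opos_disjoint i' i Q A'). unfold x in *. lia. }
    subst i'. rewrite <- (F1 i t) by auto. replace (off4 c T i + t) with (y + z * lg n); [exact B|].
    rewrite E' in E. unfold x in *. lia.
  - intros B. assert (GW : grp i <= w). { apply Nat.div_le_lower_bound; [lia|]. unfold x. lia. }
    assert (EW : (w - grp i) * lg n + grp i * lg n = w * lg n) by (rewrite <- Nat.mul_add_distr_r; f_equal; lia).
    exists (w - grp i). split.
    + unfold spill. pose proof (div_ub (16 * LL n ^ 3) (lg n) LgP).
      destruct (Nat.lt_ge_cases (w - grp i) (16 * LL n ^ 3 / lg n + 2)) as [|Q]; auto. exfalso.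
      assert ((16 * LL n ^ 3 / lg n + 2) * lg n <= (w - grp i) * lg n) by (apply Nat.mul_le_mono_r; exact Q).
      unfold x in *. set (K := 16 * LL n ^ 3) in *. clearbody K. lia.
    + rewrite (proj2 (Nat.ltb_ge _ _)) by lia. rewrite Nat.div_pow2_bits. replace (w - (w - grp i)) with (grp i) by lia.
      destruct (rec4_fields (grp i)) as [F1 _]. rewrite <- B, <- (F1 i t) by auto. f_equal. unfold x in *. lia.
Qed.

Lemma subans_word i t : act4 c T i = true -> t < lg (slen c T i) -> (opos i + t) / lg n < nom n.
Proof.
  intros A Ht. pose proof (opos_end i A) as E. pose proof (bnd_le c T (nidx c T i)) as BL. pose proof (LL_pos n) as LP. pose proof (lg_pos n) as LgP.
  pose proof (gg_pos T) as GP.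
  assert (E2 : opos i + t < ceil_div n (LL n)). { pose proof (ceil_mono _ _ (LL n) BL). lia. }
  set (x := opos i + t) in *. pose proof (ceil_lt n (LL n) LP) as CL.
  assert ((x + 1) * LL n <= ceil_div n (LL n) * LL n) by (apply Nat.mul_le_mono_r; lia).
  unfold nom. assert (x / lg n <= n / gg n); [|lia].
  apply Nat.div_le_lower_bound; [lia|]. unfold gg. pose proof (div_mul_le x (lg n)).
  replace (lg n * LL n * (x / lg n)) with (x / lg n * lg n * LL n) by ring.
  assert (x / lg n * lg n * LL n <= x * LL n) by (apply Nat.mul_le_mono_r; lia). lia.
Qed.
End SubAnswers.

(** * The input and the structures in the final memory *)

Section Outcome.
Context (n : nat) (T : list bool) (w : nat) (m : mem).
Hypothesis HI : inst n T w.
Hypothesis HK : known spec 54 n T m.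

Lemma outcome_input : packed_input m T.
Proof.
  pose proof HI as (Hn & HT & _). unfold packed_input. rewrite HT. intros k Hk.
  pose proof (nk_facts n) as (_ & K2 & _). pose proof (le_mul_r k (lg n) (lg_pos n)).
  rewrite <- (HK 0 ltac:(lia) k Hk). rewrite rg_at by lia. reflexivity.
Qed.

Lemma outcome_rank : rank_structure m T (52 * MM n) (53 * MM n) (1 * MM n).
Proof.
  pose proof HI as (Hn & HT & _). unfold rank_structure. rewrite HT. fold (LL n).
  pose proof (lg_pos n) as LP. pose proof (nk_facts n) as (_ & K2 & _). splits.
  - intros k Hk. rewrite <- (HK 52 ltac:(lia) k Hk). rewrite rg_at; auto.
    pose proof (Nat.pow_nonzero (lg n) 2 ltac:(lia)). pose proof (le_mul_r k (lg n ^ 2) ltac:(lia)). lia.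
  - intros j Hj. fold (rb n). set (start := j / lg n * lg n ^ 2).
    assert (ST : start <= j * lg n).
    { unfold start. replace (j / lg n * lg n ^ 2) with (j / lg n * lg n * lg n) by (simpl; ring). apply Nat.mul_le_mono_r, div_mul_le. }
    assert (E : rank false (skipn start T) (Nat.min (S j * lg n) n - 1 - start) = rfield n T j).
    { rewrite rank_skipn. unfold rfield. fold start. f_equal. f_equal. lia. }
    rewrite E. split; [now apply rfield_lt|]. intros i Hi.
    rewrite <- (HK 53 ltac:(lia) j i Hj Hi). rewrite rg_at; auto.
    pose proof (scnt_MM n) as (_ & _ & C3).
    assert (j <= n / lg n) by (apply Nat.div_le_lower_bound; [lia|]; rewrite Nat.mul_comm; lia).
    assert ((j + 1) * rb n <= (n / lg n + 1) * rb n) by (apply Nat.mul_le_mono_r; lia).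
    apply Nat.Div0.div_lt_upper_bound. pose proof (le_mul_l (lg n) (MM n) LP). lia.
  - fold (hh n). intros s i Hs Hi. pose proof (bits_lt s) as BL.
    assert (BL' : bits_val s < 2 ^ hh n) by (eapply Nat.lt_le_trans; [exact BL|apply Nat.pow_le_mono_r; lia]).
    pose proof (HK 1 ltac:(lia) (bits_val s) i BL' ltac:(lia)) as Q.
    pose proof (small_facts n) as (_ & _ & _ & _ & S5 & _ & _ & _ & S9 & _).
    assert ((bits_val s + 1) * hh n <= 2 ^ hh n * DD n ^ 4).
    { apply Nat.mul_le_mono; [lia|]. apply (Nat.le_trans _ (DD n ^ 1)); [simpl; lia|]. apply Nat.pow_le_mono_r; lia. }
    rewrite rg_at in Q by lia. rewrite <- Nat.add_assoc. rewrite Q, rank_rk. unfold rk. rewrite Nat.add_1_r.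
    (* The table counts ones of [bits_val s]; up to the length of [s] the zeros are exactly the
       complement, and the padding is not touched. *)
    assert (X : forall k, k <= length s -> cntb (Bf false s) k + cntb (Nat.testbit (bits_val s)) k = k).
    { induction k; intros Hk; auto. rewrite !cntb_S, testbit_bits. unfold Bf at 2. cbn [negb].
      rewrite (nth_indep s true false) by lia. specialize (IHk ltac:(lia)). destruct (nth k s false); cbn [Nat.b2n eqb]; lia. }
    specialize (X (S i) ltac:(lia)). lia.
Qed.

Lemma outcome_select c : select_structure c m T ((off c + 6) * MM n) ((off c + 7) * MM n)
  ((off c + 13) * MM n) ((off c + 21) * MM n) ((off c + 22) * MM n).
Proof.
  pose proof HI as (Hn & HT & _). pose proof (off_bounds c) as OB.
  pose proof (lg_pos n) as LP. pose proof (LL_pos n) as LLP. pose proof (nk_facts n) as (K1 & K2 & K3). pose proof (gg_facts n) as (G1 & G2 & G3 & G4).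
  pose proof (N_le c T) as NL. rewrite HT in NL.
  assert (NK : count c T / gg n <= n / gg n) by (apply Nat.Div0.div_le_mono; lia).
  assert (KN : forall j, j < 23 -> nth j (per_bit c n T) s_any (rg n m (off c + j))).
  { intros j Hj. apply (known_off c j n T m 54 HK); lia. }
  (* The local function of the definition is identified with the global [bnd] before the local
     definitions are expanded. *)
  cbv beta delta [select_structure]. intros n' L L2 N g b l. change b with (bnd c T). subst n' L L2 N g l. clear b. cbv zeta. rewrite HT.
  fold (LL n). change (lg n * LL n) with (gg n). fold (ll n). splits.
  - intros k Hk. rewrite <- (KN 6 ltac:(lia) k) by (unfold nk; lia). rewrite rg_at; auto. unfold nk in *. lia.
  - intros k Hk. change (lg n ^ 2 * LL n ^ 2) with (thr n).
    replace (bnd c T (S k * gg n) - bnd c T (k * gg n)) with (rlen c T k) by (unfold rlen; now rewrite HT).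
    split.
    + intros HL i Hik Hi. rewrite <- (KN 7 ltac:(lia) k i); auto. rewrite rg_at; [now rewrite Nat.add_assoc|].
      pose proof (bnd_le c T (k * gg n)) as BL. rewrite HT in BL.
      assert (ceil_div (bnd c T (k * gg n)) (gg n) <= n / gg n + 1).
      { apply ceil_le; [lia|]. pose proof (div_ub n (gg n) G1). lia. }
      unfold nk in *. lia.
    + intros HS j. fold (lgr c T k).
      assert (Hs : short c T k = true) by (apply Nat.ltb_lt; now rewrite HT).
      assert (EG : lgr c T k * LL n = gp c T k) by (unfold gp; now rewrite HT). rewrite EG.
      intros Hj HN. pose proof (gp_pos c T k) as GP.
      pose proof (lgr_le c T k ltac:(lia)) as LR. rewrite HT in LR. pose proof (lgr_pos c T k) as LR1.
      assert (JL : j * lgr c T k < lg n).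
      { apply (Nat.mul_lt_mono_pos_r (LL n)); [lia|]. rewrite <- Nat.mul_assoc, EG. exact Hj. }
      split.
      * pose proof (rec1_val c T k j) as RV. pose proof (rec1_field c T k j) as RF. cbv zeta in RV, RF. rewrite HT in RV, RF.
        split; [rewrite <- RV by auto; apply Nat.mod_upper_bound, Nat.pow_nonzero; lia|].
        intros i Hi. rewrite <- (RF i) by auto.
        assert (KK : S k < nk n) by (unfold nk; lia). destruct (KN 13 ltac:(lia) k KK) as [R0 R1].
        assert (2 * nk n <= MM n).
        { pose proof (x_le_MM n (lg n + 4) ltac:(lia)) as Q. rewrite Nat.pow_add_r in Q. change (2 ^ 4) with 16 in Q.
          pose proof (lg_up n). pose proof (pow2_pos (lg n)). assert (n / gg n <= n) by (apply Nat.Div0.div_le_upper_bound, le_mul_l; lia). unfold nk. lia. }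
        rewrite rg_at in R0, R1 by lia.
        set (x := j * lgr c T k + i). replace (2 * k * lg n + j * lgr c T k + i) with (2 * k * lg n + x) by (unfold x; lia).
        (* A field may cross into the second word of its record, which holds the bits from [lg n]
           on. *)
        destruct (Nat.lt_ge_cases x (lg n)) as [L|L].
        -- destruct (divmod_idx (2 * k) (lg n) x L) as [-> ->]. now rewrite R0.
        -- replace (2 * k * lg n + x) with ((2 * k + 1) * lg n + (x - lg n)) by lia.
           destruct (divmod_idx (2 * k + 1) (lg n) (x - lg n) ltac:(unfold x; lia)) as [-> ->].
           rewrite R1, Nat.div_pow2_bits. f_equal. lia.
      * set (first := k * gg n + j * gp c T k). fold first in HN. set (next := Nat.min (first + gp c T k) (S k * gg n)).
        intros HA i Hi HiN.
        destruct (subrange_of c n T k Hs j i) as (A1 & A2 & A3 & A4); auto; try (unfold first, next in *; lia).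
        fold first in A2.
        assert (B0 : bs c n T k j = bnd c T first) by (unfold bs; fold first; f_equal; lia).
        assert (B1 : bs c n T k (j + 1) = bnd c T next) by (unfold bs, next, first; f_equal; lia).
        rewrite B0, B1 in A4. rewrite <- A4 in *.
        assert (ACT : act4 c T i = true).
        { unfold act4. rewrite HT, A1, Hs. cbn [andb]. now apply Nat.leb_le. }
        rewrite <- (bnd_sel c T i) by lia. rewrite <- A2.
        assert (OP : ceil_div (bnd c T (sidx c T i)) (LL n) + (i - sidx c T i) * lg (slen c T i) = opos c T i) by (unfold opos; now rewrite HT).
        rewrite OP. split.
        -- pose proof (val_lt c T i HiN). pose proof (lg_up (slen c T i)). lia.
        -- intros t Ht. pose proof (subans_bit c T i t HiN ACT Ht) as SB. pose proof (subans_word c T i t ACT Ht) as SW. rewrite HT in SB, SW.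
           rewrite <- SB. rewrite <- (KN 21 ltac:(lia) _ SW). rewrite rg_at; auto. lia.
  - intros s i Hs Hi. rewrite <- (KN 22 ltac:(lia) s i Hs Hi). rewrite rg_at; [now rewrite Nat.add_assoc|].
    pose proof (ll_MM n) as (M1 & _). pose proof (bits_lt s) as BL.
    assert (BL' : bits_val s < 2 ^ ll n) by (eapply Nat.lt_le_trans; [exact BL|apply Nat.pow_le_mono_r; lia]).
    assert ((bits_val s + 1) * ll n <= 2 ^ ll n * ll n) by (apply Nat.mul_le_mono_r; lia).
    rewrite count_cntb in Hi. pose proof (cntb_le (Bf c s) (length s)). lia.
Qed.
End Outcome.

Definition p_bit (c : bool) : cmd :=
  Seq (mapphase (off c + 0) (kk 0) gNC (v_chunk c))
  (Seq (mapphase (off c + 1) (kk 0) gNC (mpc (aX c uV) gh))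
  (Seq (scan (off c + 1))
  (Seq (p_raw c)
  (Seq (mapphase (off c + 6) (kk 0) (gN /' gg_ +' kk 3) (v_loc c))
  (Seq (p_ans c)
  (Seq (mapphase (off c + 8) (kk 0) gNC (v_leaf c (g1 c)))
  (Seq (scan (off c + 8))
  (Seq (mapphase (off c + 12) (kk 0) (gN /' gg_ +' kk 2) (v_rec c))
  (Seq (mapphase (off c + 13) (kk 0) (kk 2 *' (gN /' gg_ +' kk 2))
    (LET k := aREC c (uV /' kk 2) IN if_ (uV %' kk 2 =' kk 0) k (k >>' gL)))
  (Seq (mapphase (off c + 14) (kk 0) gNC (v_leaf c (g4 c)))
  (Seq (scan (off c + 14))
  (Seq (mapphase (off c + 18) (kk 0) (gN /' gg_ +' kk 4) (v_pb c))
  (Seq (mapphase (off c + 19) (kk 0) (gN /' gg_ +' kk 4) (query c 17 (g4 c) (arr (off c + 18) uV)))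
  (Seq (mapphase (off c + 20) (kk 0) (gN /' gg_ +' kk 3) (arr (off c + 19) (uV +' kk 1) -' arr (off c + 19) uV))
  (Seq (mapphase (off c + 21) (kk 16 *' (gLL *' gLL *' gLL) /' gL +' kk 2) (gN /' gg_ +' kk 3)
    (for_ (kk 0) (fun acc z => bop Or acc (if_ (uV <' z) (kk 0) (arr (off c + 20) (uV -' z) >>' (z *' gL))))))
  (mapphase (off c + 22) gl ((kk 1 <<' gl) *' gl)
    (LET x := uV /' gl IN LET i := uV %' gl +' kk 1 IN selm gl c x i))))))))))))))))).

Lemma tri_bit c : Tri (Inv spec (off c)) (p_bit c) (Inv spec (off c + 23)).
Proof.
  assert (S1 : forall j, S (off c + j) = off c + S j) by (intros; lia).
  pose proof (tri_chunk c) as H0. pose proof (tri_leaf0 c) as H1. pose proof (tri_scan0 c) as H2. pose proof (tri_raw c) as H5.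
  pose proof (tri_loc c) as H6. pose proof (tri_ans c) as H7. pose proof (tri_leaf1 c) as H8. pose proof (tri_scan1 c) as H9.
  pose proof (tri_rec c) as H12. pose proof (tri_subloc c) as H13. pose proof (tri_leaf4 c) as H14. pose proof (tri_scan4 c) as H15.
  pose proof (tri_pb c) as H18. pose proof (tri_w4p c) as H19. pose proof (tri_rec4 c) as H20. pose proof (tri_subans c) as H21.
  pose proof (tri_seltab c) as H22.
  rewrite S1 in *. rewrite Nat.add_0_r in H0 at 1. unfold p_bit.
  repeat (eapply Tri_seq; [eassumption|]). exact H22.
Qed.

(** * The program *)

Definition build : cmd :=
  Seq init (Seq p_rank (Seq p_sel (Seq p_pack (Seq p_lg (Seq p_sub (Seq (p_bit true) (Seq (p_bit false)
  (Seq (mapphase 52 (kk 0) (gN /' (gL *' gL) +' kk 1) (mrk false (minb ((uV +' kk 1) *' (gL *' gL)) gN)))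
    (mapphase 53 (gL /' (kk 2 *' gLL +' kk 1) +' kk 2)
      ((gN /' gL +' kk 1) *' (kk 2 *' gLL +' kk 1) /' gL +' kk 1) v_subr))))))))).

Lemma tri_build : Tri Start build (Inv spec 54).
Proof.
  unfold build.
  eapply Tri_seq; [exact tri_init|]. eapply Tri_seq; [exact tri_rank|]. eapply Tri_seq; [exact tri_sel|].
  eapply Tri_seq; [exact tri_pack|]. eapply Tri_seq; [exact tri_lg|]. eapply Tri_seq; [exact tri_sub|].
  eapply Tri_seq; [exact (tri_bit true)|]. eapply Tri_seq; [exact (tri_bit false)|].
  eapply Tri_seq; [exact tri_ranges|exact tri_subranges].
Qed.

Definition outputs (l : list (nat * nat)) : cmd :=
  fold_right (fun p c => Seq (Assign (fst p) (Bin Mul (Const (snd p)) (Reg 14))) c) Skip l.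

Lemma outputs_ok w M m l : forall rho, rho 14 = M -> NoDup (map fst l) ->
  (forall x t, In (x, t) l -> x <> 14 /\ t < 2 ^ w /\ t * M < 2 ^ w) ->
  exists rho' R W k, exec w (outputs l) rho m rho' m R W k k /\ k <= 1 + 5 * length l /\
    (forall x t, In (x, t) l -> rho' x = t * M) /\ (forall x, ~ In x (map fst l) -> rho' x = rho x).
Proof.
  induction l as [|[x t] l IH]; intros rho HM ND H.
  - do 4 eexists. split; [apply exec_skip|]. splits; auto. intros x t [].
  - inversion ND as [|? ? N1 N2]; subst. destruct (H x t (or_introl eq_refl)) as (H1 & H2 & H3).
    set (v := eval w rho (Bin Mul (Const t) (Reg 14))).
    assert (EV : v = t * rho 14). { unfold v. cbn [eval]. unfold eval_binop. rewrite (Nat.mod_small t), Nat.mod_small; auto. }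
    destruct (IH (upd rho x v)) as (r & R & W & k & E & B & V & F); auto.
    { apply upd_other. auto. } { intros y u Hy. apply H. now right. }
    do 4 eexists. split; [eapply exec_seq; [apply exec_assign|exact E]|]. splits.
    + cbn [length ecost]. lia.
    + intros y u [Q|Q]; [injection Q as <- <-; rewrite F by auto; rewrite upd_same; exact EV|now apply V].
    + intros y Hy. cbn [map fst In] in Hy. rewrite F by tauto. apply upd_other. intros ->. tauto.
Qed.

(** Output registers and regions. For each bit these are the regions [off c + 6], [off c + 7],
    [off c + 13], [off c + 21] and [off c + 22]. *)
Definition places : list (nat * nat) :=
  [(0, 52); (1, 53); (2, 1); (3, 12); (4, 13); (5, 19); (6, 27); (7, 28);
   (8, 35); (9, 36); (10, 42); (11, 50); (12, 51)].

(* A word has Theta(log n) bits, with a lower constant c0 large enough for n and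
   the addresses in use to be words; 1 < c0 makes n a word in any case.
   The program starts with n in register 0 (and 0 in all other registers), T in
   the memory from address 0 on and arbitrary words in the rest of the memory; at
   the end, T is still there and registers 0 to 12 contain the addresses of the
   components of the three structures. *)
Theorem theorem5p1 :
  exists c0 : nat, 1 < c0 /\
  forall wordsize : nat -> nat,
    (forall n : nat, c0 * lg n <= wordsize n) ->
    (exists c1 : nat, forall n : nat, wordsize n <= c1 * lg n) ->
  exists (program : cmd) (C : nat),
  forall (n : nat) (T : list bool) (m : mem),
    1 <= n -> length T = n ->
    (forall a : nat, m a < 2 ^ wordsize n) ->
    packed_input m T ->
  exists (rho' : env) (m' : mem) (work depth : nat),
    runs (wordsize n) program (upd (fun _ => 0) 0 n) m rho' m' work depth /\
    packed_input m' T /\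
    rank_structure m' T (rho' 0) (rho' 1) (rho' 2) /\
    select_structure true m' T
      (rho' 3) (rho' 4) (rho' 5) (rho' 6) (rho' 7) /\
    select_structure false m' T
      (rho' 8) (rho' 9) (rho' 10) (rho' 11) (rho' 12) /\
    work * lg n <= C * n /\
    depth <= C * lg n.
Proof.
  exists (8 * K0). split; [pose proof K0_pos; lia|]. intros ws Hws _.
  (* Register 6 is itself an output register, so [MM n] is saved in register 14 before the addresses
     are written. *)
  destruct tri_build as [C HC]. exists (Seq build (Seq (Assign 14 (Reg 6)) (outputs places))), (C + 200).
  intros n T m Hn HT _ HP.
  assert (HI : inst n T (ws n)) by (split; [exact Hn|split; [exact HT|apply Hws]]).
  destruct (HC n T (ws n) (upd (fun _ => 0) 0 n) m) as (r1 & m1 & wk & dp & (R1 & W1 & E1) & (_ & HG & HK) & B1 & D1).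
  { split; [exact HI|]. splits; auto. }
  szs HI.
  destruct (outputs_ok (ws n) (MM n) m1 places (upd r1 14 (eval (ws n) r1 (Reg 6)))) as (r2 & R2 & W2 & k & E2 & B2 & V & _).
  { rewrite upd_same. apply HG. }
  { repeat constructor; cbn [map fst In]; lia. }
  { intros x t Hx. cbn [places In] in Hx.
    assert (t <= 53 /\ x <> 14) by (repeat (destruct Hx as [Q|Hx]; [injection Q as <- <-; lia|]); destruct Hx).
    pose proof (Nat.mul_le_mono_r t 53 (MM n)). lia. }
  exists r2, m1. do 2 eexists. split; [do 2 eexists; eapply exec_seq; [exact E1|eapply exec_seq; [apply exec_assign|exact E2]]|].
  assert (VP : forall x t, In (x, t) places -> r2 x = t * MM n) by exact V.
  assert (O : r2 0 = 52 * MM n /\ r2 1 = 53 * MM n /\ r2 2 = 1 * MM n) by (splits; apply VP; simpl; tauto).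
  destruct O as (-> & -> & ->).
  assert (O : r2 3 = (off true + 6) * MM n /\ r2 4 = (off true + 7) * MM n /\ r2 5 = (off true + 13) * MM n /\ r2 6 = (off true + 21) * MM n
    /\ r2 7 = (off true + 22) * MM n) by (splits; apply VP; simpl; tauto).
  destruct O as (-> & -> & -> & -> & ->).
  assert (O : r2 8 = (off false + 6) * MM n /\ r2 9 = (off false + 7) * MM n /\ r2 10 = (off false + 13) * MM n /\ r2 11 = (off false + 21) * MM n
    /\ r2 12 = (off false + 22) * MM n) by (splits; apply VP; simpl; tauto).
  destruct O as (-> & -> & -> & -> & ->).
  pose proof (lg_pos n). pose proof (lg_lin n Hn). cbn [ecost places length] in *. splits.
  - eapply outcome_input; eauto.
  - eapply outcome_rank; eauto.
  - eapply outcome_select; eauto.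
  - eapply outcome_select; eauto.
  - pose proof (pow_L_le n Hn). pose proof (le_pow2 (lg n)).
    assert (k * lg n <= 66 * lg n) by (apply Nat.mul_le_mono_r; lia). lia.
  - lia.
Qed.
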